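(* Let $p>3$ be a prime and let $n\geq 1$. There is an isomorphism of graded $\mathbb{F}_p$-algebras $$H^*(B_p(\mathbb{R}^n);\mathbb{F}_p)\;\cong\; I\times_{\mathbb{F}_p}\frac{H^*(\Sigma_p;\mathbb{F}_p)}{H^{>(n-1)(p-1)}(\Sigma_p;\mathbb{F}_p)},$$ where $I:=H^*(\mathrm{Conf}_p(\mathbb{R}^n);\mathbb{F}_p)^{\Sigma_p}$ is the algebra of $\Sigma_p$-invariants, and the fibre product is taken over the augmentations of both factors onto their degree $0$ part $\mathbb{F}_p$.
   Context: $\mathrm{Conf}_p(\mathbb{R}^n)=\{(x_1,\ldots,x_p)\in(\mathbb{R}^n)^p: x_i\neq x_j\text{ if }i\neq j\}$, with the symmetric group $\Sigma_p$ acting by permuting coordinates, and $B_p(\mathbb{R}^n)=\mathrm{Conf}_p(\mathbb{R}^n)/\Sigma_p$. $H^*(\Sigma_p;\mathbb{F}_p)$ is the group cohomology of $\Sigma_p$ with trivial coefficients, and $H^{>m}(\Sigma_p;\mathbb{F}_p)$ is the ideal of elements of degree greater than $m$. *)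

(* Defs.v *)
From HB Require Import structures.
From mathcomp Require Import all_fingroup all_boot all_order all_algebra.
From mathcomp Require Import all_classical all_reals all_analysis.
From mathcomp Require Import zify.
Import GRing.Theory Num.Theory numFieldNormedType.Exports.
Set Implicit Arguments.
Unset Strict Implicit.
Unset Printing Implicit Defensive.
Local Open Scope quotient_scope.
Local Open Scope classical_set_scope.
Local Open Scope ring_scope.

Record submodule (F : fieldType) (V : lmodType F) := Submodule {
  submod_pred :> {pred V};
  submodP : submod_closed submod_pred }.

Section Submodule.
Variables (F : fieldType) (V : lmodType F) (S : submodule V).

HB.instance Definition _ :=
  GRing.isZmodClosed.Build V (submod_pred S)
    (GRing.submod_closedB (submodP S)).

Lemma submodZ (a : F) (x : V) : x \in submod_pred S -> a *: x \in submod_pred S.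
Proof.
by move=> Sx; rewrite -[_ *: _]addr0; case: (submodP S) => S0; apply.
Qed.

Lemma submodD (x y : V) : x \in submod_pred S -> y \in submod_pred S ->
  x + y \in submod_pred S.
Proof. by move=> Sx Sy; rewrite rpredD. Qed.

Definition submod := {x : V | submod_pred S x}.
HB.instance Definition _ := SubChoice.on submod.
HB.instance Definition _ :=
  GRing.SubChoice_isSubLmodule.Build F V (submod_pred S) submod
    (GRing.submod_closed_semi (submodP S)).

Definition quotmod := Quotient.quot (submod_pred S : zmodClosed V).
HB.instance Definition _ := GRing.Zmodule.on quotmod.
HB.instance Definition _ := Quotient.on quotmod.

Definition qpi (x : V) : quotmod := \pi_quotmod x.

Lemma qpi_repr (a : quotmod) : qpi (repr a) = a.
Proof. exact: reprK. Qed.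

Lemma qpiP (x y : V) : reflect (qpi x = qpi y) (x - y \in submod_pred S).
Proof.
have -> : (x - y \in submod_pred S) = (x == y %[mod quotmod]).
  exact: (@Quotient.idealrBE V (submod_pred S : zmodClosed V)).
exact: eqP.
Qed.

Lemma qpiD x y : qpi (x + y) = qpi x + qpi y.
Proof. by rewrite /qpi; exact: (@pi_addr). Qed.

Definition qscale (a : F) (x : quotmod) : quotmod := qpi (a *: repr x).

Lemma qscaleE a x : qscale a (qpi x) = qpi (a *: x).
Proof.
apply/qpiP; rewrite -scalerBr; apply: submodZ; apply/qpiP; exact: qpi_repr.
Qed.

Lemma qind (P : quotmod -> Prop) : (forall x, P (qpi x)) -> forall a, P a.
Proof. by move=> H a; rewrite -[a]qpi_repr. Qed.

Fact qscalerA a b v : qscale a (qscale b v) = qscale (a * b) v.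
Proof. by elim/qind: v => v; rewrite !qscaleE scalerA. Qed.
Fact qscale1r : left_id 1 qscale.
Proof. by elim/qind => v; rewrite !qscaleE scale1r. Qed.
Fact qscalerDr : right_distributive qscale +%R.
Proof.
move=> a; elim/qind => v; elim/qind => w.
by rewrite !(qscaleE, =^~ qpiD) scalerDr.
Qed.
Fact qscalerDl v : {morph qscale^~ v : a b / a + b}.
Proof.
by elim/qind: v => v a b; rewrite !(qscaleE, =^~ qpiD) scalerDl.
Qed.
HB.instance Definition _ :=
  GRing.Zmodule_isLmodule.Build F quotmod qscalerA qscale1r qscalerDr qscalerDl.

Lemma qpi_linear : linear qpi.
Proof. by move=> a x y; rewrite qpiD -qscaleE. Qed.

End Submodule.

(* Equality of homogeneous elements whose degrees are equal, but not            *)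
(* necessarily convertible, is stated in the total space of the grading.        *)
Definition homog (F : fieldType) (V : nat -> lmodType F) (k : nat) (x : V k) :
  {k : nat & V k} := existT (fun k => V k) k x.

Record gradedAlgebra (F : fieldType) := GradedAlgebra {
  gcar :> nat -> lmodType F;
  gone : gcar 0;
  gmul : forall i j, gcar i -> gcar j -> gcar (i + j);
  gmul_linear_l : forall i j (y : gcar j), linear (fun x : gcar i => gmul x y);
  gmul_linear_r : forall i j (x : gcar i), linear (fun y : gcar j => gmul x y);
  gmulA : forall i j k (x : gcar i) (y : gcar j) (z : gcar k),
    homog (gmul x (gmul y z)) = homog (gmul (gmul x y) z);
  gmul1l : forall i (x : gcar i), homog (gmul gone x) = homog x;
  gmul1r : forall i (x : gcar i), homog (gmul x gone) = homog x }.
Arguments gone {F} _.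
Arguments gmul {F _ i j} _ _.

Record gradedMorphism (F : fieldType) (A B : gradedAlgebra F) :=
  GradedMorphism {
  gmap :> forall k, A k -> B k;
  gmap_linear : forall k, linear (@gmap k);
  gmap_one : gmap (gone A) = gone B;
  gmap_mul : forall i j (x : A i) (y : A j),
    gmap (gmul x y) = gmul (gmap x) (gmap y) }.
Arguments gmap {F A B} _ {k} _.

Lemma gmap0 (F : fieldType) (A B : gradedAlgebra F) (f : gradedMorphism A B) k :
  gmap f (0 : A k) = 0.
Proof.
have := gmap_linear f (-1) (0 : A k) 0.
by rewrite !scaleN1r oppr0 addr0 addNr.
Qed.

Definition gradedIsomorphic (F : fieldType) (A B : gradedAlgebra F) : Prop :=
  exists f : gradedMorphism A B, forall k, bijective (@gmap F A B f k).

(* A morphism of graded algebras to F, where F is concentrated in degree 0.     *)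
Record augmentation (F : fieldType) (A : gradedAlgebra F) := Augmentation {
  aug :> forall k, A k -> F^o;
  aug_linear : forall k, linear (@aug k);
  aug_pos : forall k (x : A k), (0 < k)%N -> aug x = 0;
  aug_one : aug (gone A) = 1;
  aug_mul : forall i j (x : A i) (y : A j), aug (gmul x y) = aug x * aug y }.
Arguments aug {F A} _ {k} _.

Lemma aug0 (F : fieldType) (A : gradedAlgebra F) (e : augmentation A) k :
  aug e (0 : A k) = 0.
Proof.
have := aug_linear e (-1) (0 : A k) 0.
by rewrite !scaleN1r oppr0 addr0 addNr.
Qed.

Record gradedSubalgebra (F : fieldType) (A : gradedAlgebra F) :=
  GradedSubalgebra {
  gsub_mod :> forall k, submodule (A k);
  gsub_one : gone A \in submod_pred (gsub_mod 0);
  gsub_mul : forall i j (x : A i) (y : A j),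
    x \in submod_pred (gsub_mod i) -> y \in submod_pred (gsub_mod j) ->
    gmul x y \in submod_pred (gsub_mod (i + j)) }.

Record gradedIdeal (F : fieldType) (A : gradedAlgebra F) := GradedIdeal {
  gid_mod :> forall k, submodule (A k);
  gid_mull : forall i j (x : A i) (y : A j),
    y \in submod_pred (gid_mod j) -> gmul x y \in submod_pred (gid_mod (i + j));
  gid_mulr : forall i j (x : A i) (y : A j),
    x \in submod_pred (gid_mod i) -> gmul x y \in submod_pred (gid_mod (i + j)) }.

Section SubAlgebra.
Variables (F : fieldType) (A : gradedAlgebra F) (S : gradedSubalgebra A).

Definition gsub_car (k : nat) : lmodType F := submod (S k).

Lemma homog_val i j (x : gsub_car i) (y : gsub_car j) :
  homog (val x) = homog (val y) -> homog x = homog y.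
Proof.
move=> exy; have /= eij := congr1 (@projT1 _ _) exy.
case: j / eij y exy => y exy; have {}exy := eq_from_Tagged exy.
by congr homog; exact: val_inj.
Qed.

Definition gsub_1 : gsub_car 0 := exist _ (gone A) (gsub_one S).
Definition gsub_M i j (x : gsub_car i) (y : gsub_car j) : gsub_car (i + j) :=
  exist _ (gmul (val x) (val y)) (gsub_mul (valP x) (valP y)).

Lemma gsub_linear_l i j (y : gsub_car j) :
  linear (fun x : gsub_car i => gsub_M x y).
Proof. by move=> a x x'; apply: val_inj; exact: gmul_linear_l. Qed.
Lemma gsub_linear_r i j (x : gsub_car i) :
  linear (fun y : gsub_car j => gsub_M x y).
Proof. by move=> a y y'; apply: val_inj; exact: gmul_linear_r. Qed.
Lemma gsub_A i j k (x : gsub_car i) (y : gsub_car j) (z : gsub_car k) :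
  homog (gsub_M x (gsub_M y z)) = homog (gsub_M (gsub_M x y) z).
Proof. exact/homog_val/gmulA. Qed.
Lemma gsub_1l i (x : gsub_car i) : homog (gsub_M gsub_1 x) = homog x.
Proof. exact/homog_val/gmul1l. Qed.
Lemma gsub_1r i (x : gsub_car i) : homog (gsub_M x gsub_1) = homog x.
Proof. exact/homog_val/gmul1r. Qed.

Definition gsub : gradedAlgebra F :=
  GradedAlgebra gsub_linear_l gsub_linear_r gsub_A gsub_1l gsub_1r.

Definition gsub_incl (k : nat) (x : gsub k) : A k := val (x : submod (S k)).

Variable e : augmentation A.
Let aug_sub k (x : gsub k) := aug e (gsub_incl x).

Lemma aug_sub_linear k : linear (@aug_sub k).
Proof. by move=> a x y; exact: aug_linear. Qed.
Lemma aug_sub_pos k (x : gsub k) : (0 < k)%N -> aug_sub x = 0.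
Proof. exact: aug_pos. Qed.
Lemma aug_sub_one : aug_sub (gone gsub) = 1.
Proof. exact: aug_one. Qed.
Lemma aug_sub_mul i j (x : gsub i) (y : gsub j) :
  aug_sub (gmul x y) = aug_sub x * aug_sub y.
Proof. exact: aug_mul. Qed.

Definition gsub_aug : augmentation gsub :=
  Augmentation aug_sub_linear aug_sub_pos aug_sub_one aug_sub_mul.

End SubAlgebra.

Section QuotientAlgebra.
Variables (F : fieldType) (A : gradedAlgebra F) (J : gradedIdeal A).

Definition gquot_car (k : nat) : lmodType F := quotmod (J k).

Definition gquot_proj (k : nat) (x : A k) : gquot_car k := qpi (J k) x.

Lemma gquot_proj_linear k (a : F) (x y : A k) :
  gquot_proj (a *: x + y) = a *: gquot_proj x + gquot_proj y.
Proof. exact: qpi_linear. Qed.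

Lemma gquot_ind k (P : gquot_car k -> Prop) :
  (forall x, P (gquot_proj x)) -> forall a, P a.
Proof. exact: qind. Qed.

Lemma homog_proj i j (x : A i) (y : A j) :
  homog x = homog y -> homog (gquot_proj x) = homog (gquot_proj y).
Proof.
move=> exy; have /= eij := congr1 (@projT1 _ _) exy.
by case: j / eij y exy => y exy; rewrite (eq_from_Tagged exy).
Qed.

Definition gquot_M i j (x : gquot_car i) (y : gquot_car j) :
  gquot_car (i + j) := gquot_proj (gmul (repr x) (repr y)).

Lemma gmulBl i j (x x' : A i) (y : A j) :
  gmul (x - x') y = gmul x y - gmul x' y.
Proof.
by rewrite addrC -scaleN1r gmul_linear_l scaleN1r addrC.
Qed.
Lemma gmulBr i j (x : A i) (y y' : A j) :
  gmul x (y - y') = gmul x y - gmul x y'.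
Proof.
by rewrite addrC -scaleN1r gmul_linear_r scaleN1r addrC.
Qed.

Lemma gquot_ME i j (x : A i) (y : A j) :
  gquot_M (gquot_proj x) (gquot_proj y) = gquot_proj (gmul x y).
Proof.
apply/qpiP; set x' := repr _; set y' := repr _.
have Jx : x' - x \in submod_pred (J i) by apply/qpiP; exact: qpi_repr.
have Jy : y' - y \in submod_pred (J j) by apply/qpiP; exact: qpi_repr.
have -> : gmul x' y' - gmul x y = gmul (x' - x) y' + gmul x (y' - y).
  by rewrite gmulBl gmulBr addrA subrK.
by apply: submodD; [exact: gid_mulr | exact: gid_mull].
Qed.

Lemma gquot_linear_l i j (y : gquot_car j) :
  linear (fun x : gquot_car i => gquot_M x y).
Proof.
elim/gquot_ind: y => y a; elim/gquot_ind => x; elim/gquot_ind => x'.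
rewrite -(gquot_proj_linear a x x') !gquot_ME gmul_linear_l.
exact: gquot_proj_linear.
Qed.
Lemma gquot_linear_r i j (x : gquot_car i) :
  linear (fun y : gquot_car j => gquot_M x y).
Proof.
elim/gquot_ind: x => x a; elim/gquot_ind => y; elim/gquot_ind => y'.
rewrite -(gquot_proj_linear a y y') !gquot_ME gmul_linear_r.
exact: gquot_proj_linear.
Qed.
Lemma gquot_A i j k (x : gquot_car i) (y : gquot_car j) (z : gquot_car k) :
  homog (gquot_M x (gquot_M y z)) = homog (gquot_M (gquot_M x y) z).
Proof.
elim/gquot_ind: x => x; elim/gquot_ind: y => y; elim/gquot_ind: z => z.
by rewrite !gquot_ME; exact/homog_proj/gmulA.
Qed.
Lemma gquot_1l i (x : gquot_car i) :
  homog (gquot_M (gquot_proj (gone A)) x) = homog x.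
Proof.
by elim/gquot_ind: x => x; rewrite !gquot_ME; exact/homog_proj/gmul1l.
Qed.
Lemma gquot_1r i (x : gquot_car i) :
  homog (gquot_M x (gquot_proj (gone A))) = homog x.
Proof.
by elim/gquot_ind: x => x; rewrite !gquot_ME; exact/homog_proj/gmul1r.
Qed.

Definition gquot : gradedAlgebra F :=
  GradedAlgebra gquot_linear_l gquot_linear_r gquot_A gquot_1l gquot_1r.

Variables (e : augmentation A).
Hypothesis eJ : forall k (x : A k), x \in submod_pred (J k) -> aug e x = 0.
Let aug_quot k (x : gquot k) := aug e (repr (x : quotmod (J k))).

Lemma aug_quotE k (x : A k) : aug_quot (gquot_proj x) = aug e x.
Proof.
apply/eqP; rewrite -subr_eq0 addrC -scaleN1r -aug_linear scaleN1r addrC.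
by apply/eqP/eJ/qpiP; exact: qpi_repr.
Qed.
Lemma aug_quot_linear k : linear (@aug_quot k).
Proof.
move=> a; elim/gquot_ind => x; elim/gquot_ind => y.
by rewrite -(gquot_proj_linear a x y) !aug_quotE aug_linear.
Qed.
Lemma aug_quot_pos k (x : gquot k) : (0 < k)%N -> aug_quot x = 0.
Proof. exact: aug_pos. Qed.
Lemma aug_quot_one : aug_quot (gone gquot) = 1.
Proof. by rewrite aug_quotE aug_one. Qed.
Lemma aug_quot_mul i j (x : gquot i) (y : gquot j) :
  aug_quot (gmul x y) = aug_quot x * aug_quot y.
Proof. by rewrite aug_quotE aug_mul. Qed.

Definition gquot_aug : augmentation gquot :=
  Augmentation aug_quot_linear aug_quot_pos aug_quot_one aug_quot_mul.

End QuotientAlgebra.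

(* The quotient by the ideal of elements of degree greater than m.              *)
Section Truncation.
Variables (F : fieldType) (m : nat) (A : gradedAlgebra F).

Definition above_pred (k : nat) : {pred A k} :=
  fun x => (m < k)%N || (x == 0).

Lemma above_submod k : submod_closed (@above_pred k).
Proof.
split=> [|a x y]; rewrite -!topredE /= /above_pred ?eqxx ?orbT //.
by case: ltnP => //= _ /eqP -> /eqP ->; rewrite scaler0 addr0.
Qed.

Lemma above_mull i j (x : A i) (y : A j) :
  y \in submod_pred (Submodule (@above_submod j)) ->
  gmul x y \in submod_pred (Submodule (@above_submod (i + j))).
Proof.
rewrite -!topredE /= /above_pred => /orP[mj|/eqP ->].
  by rewrite (leq_trans mj) // leq_addl.
by rewrite -(subrr 0) gmulBr subrr eqxx orbT.
Qed.
Lemma above_mulr i j (x : A i) (y : A j) :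
  x \in submod_pred (Submodule (@above_submod i)) ->
  gmul x y \in submod_pred (Submodule (@above_submod (i + j))).
Proof.
rewrite -!topredE /= /above_pred => /orP[mi|/eqP ->].
  by rewrite (leq_trans mi) // leq_addr.
by rewrite -(subrr 0) gmulBl subrr eqxx orbT.
Qed.

Definition above : gradedIdeal A := GradedIdeal above_mull above_mulr.

Definition truncation : gradedAlgebra F := gquot above.

Variable e : augmentation A.

Lemma aug_above k (x : A k) : x \in submod_pred (above k) -> aug e x = 0.
Proof.
rewrite -topredE /= => /orP[mk|/eqP ->].
  by apply: aug_pos; exact: leq_ltn_trans mk.
exact: aug0.
Qed.

Definition truncation_aug : augmentation truncation := gquot_aug aug_above.

End Truncation.

Section FibreProduct.
Variables (F : fieldType) (A B : gradedAlgebra F).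

Definition gprod_car (k : nat) : lmodType F := (A k * B k)%type.
Definition gprod_1 : gprod_car 0 := (gone A, gone B).
Definition gprod_M i j (x : gprod_car i) (y : gprod_car j) : gprod_car (i + j) :=
  (gmul x.1 y.1, gmul x.2 y.2).

Lemma homog_pair i j (x : A i) (x' : B i) (y : A j) (y' : B j) :
  homog x = homog y -> homog x' = homog y' ->
  homog ((x, x') : gprod_car i) = homog ((y, y') : gprod_car j).
Proof.
move=> exy; have /= eij := congr1 (@projT1 _ _) exy.
case: j / eij y exy y' => y exy y' exy'.
by rewrite (eq_from_Tagged exy) (eq_from_Tagged exy').
Qed.

Lemma gprod_linear_l i j (y : gprod_car j) :
  linear (fun x : gprod_car i => gprod_M x y).
Proof. by move=> a x x'; congr (_, _); exact: gmul_linear_l. Qed.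
Lemma gprod_linear_r i j (x : gprod_car i) :
  linear (fun y : gprod_car j => gprod_M x y).
Proof. by move=> a y y'; congr (_, _); exact: gmul_linear_r. Qed.
Lemma gprod_A i j k (x : gprod_car i) (y : gprod_car j) (z : gprod_car k) :
  homog (gprod_M x (gprod_M y z)) = homog (gprod_M (gprod_M x y) z).
Proof. by apply: homog_pair; exact: gmulA. Qed.
Lemma gprod_1l i (x : gprod_car i) : homog (gprod_M gprod_1 x) = homog x.
Proof. by case: x => x x'; apply: homog_pair; exact: gmul1l. Qed.
Lemma gprod_1r i (x : gprod_car i) : homog (gprod_M x gprod_1) = homog x.
Proof. by case: x => x x'; apply: homog_pair; exact: gmul1r. Qed.

Definition gprod : gradedAlgebra F :=
  GradedAlgebra gprod_linear_l gprod_linear_r gprod_A gprod_1l gprod_1r.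

Variables (e : augmentation A) (e' : augmentation B).

Definition fib_pred (k : nat) : {pred gprod k} :=
  fun x : A k * B k => aug e x.1 == aug e' x.2.

Lemma fib_submod k : submod_closed (@fib_pred k).
Proof.
split=> [|a x y]; first by apply: (introT eqP); rewrite !aug0.
move=> /(elimT eqP) ex /(elimT eqP) ey; apply: (introT eqP).
by rewrite !aug_linear ex ey.
Qed.

Lemma fib_one : gone gprod \in submod_pred (Submodule (@fib_submod 0)).
Proof. by apply: (introT eqP); rewrite !aug_one. Qed.
Lemma fib_mul i j (x : gprod i) (y : gprod j) :
  x \in submod_pred (Submodule (@fib_submod i)) ->
  y \in submod_pred (Submodule (@fib_submod j)) ->
  gmul x y \in submod_pred (Submodule (@fib_submod (i + j))).
Proof.
move=> /(elimT eqP) ex /(elimT eqP) ey; apply: (introT eqP).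
by rewrite !aug_mul ex ey.
Qed.

Definition fibreProduct : gradedAlgebra F :=
  gsub (GradedSubalgebra fib_one fib_mul).

End FibreProduct.

(* The subalgebra of elements fixed by a family of endomorphisms.               *)
Section Invariants.
Variables (F : fieldType) (A : gradedAlgebra F) (G : finType).
Variable act : G -> gradedMorphism A A.

Definition inv_pred (k : nat) : {pred A k} :=
  fun x => [forall g, gmap (act g) x == x].

Lemma inv_submod k : submod_closed (@inv_pred k).
Proof.
split=> [|a x y]; first by apply: (introT forallP) => g; rewrite gmap0.
move=> /(elimT forallP) ix /(elimT forallP) iy.
apply: (introT forallP) => g.
by rewrite gmap_linear (eqP (ix g)) (eqP (iy g)).
Qed.

Lemma inv_one : gone A \in submod_pred (Submodule (@inv_submod 0)).
Proof. by apply: (introT forallP) => g; rewrite gmap_one. Qed.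
Lemma inv_mul i j (x : A i) (y : A j) :
  x \in submod_pred (Submodule (@inv_submod i)) ->
  y \in submod_pred (Submodule (@inv_submod j)) ->
  gmul x y \in submod_pred (Submodule (@inv_submod (i + j))).
Proof.
move=> /(elimT forallP) ix /(elimT forallP) iy.
apply: (introT forallP) => g.
by rewrite gmap_mul (eqP (ix g)) (eqP (iy g)).
Qed.

Definition invariants_sub : gradedSubalgebra A :=
  GradedSubalgebra inv_one inv_mul.

Definition invariants : gradedAlgebra F := gsub invariants_sub.
Definition invariants_aug (e : augmentation A) : augmentation invariants :=
  gsub_aug invariants_sub e.

End Invariants.

Section InducedMorphisms.
Variables (F : fieldType) (A B : gradedAlgebra F) (f : gradedMorphism A B).

Section Sub.
Variables (S : gradedSubalgebra A) (T : gradedSubalgebra B).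
Hypothesis fST : forall k (x : A k),
  x \in submod_pred (S k) -> gmap f x \in submod_pred (T k).

Definition gsub_fun k (x : gsub S k) : gsub T k :=
  exist _ (gmap f (gsub_incl x)) (fST (valP x)).

Lemma gsub_fun_linear k : linear (@gsub_fun k).
Proof. by move=> a x y; apply: val_inj; exact: gmap_linear. Qed.
Lemma gsub_fun_one : gsub_fun (gone (gsub S)) = gone (gsub T).
Proof. by apply: val_inj; exact: gmap_one. Qed.
Lemma gsub_fun_mul i j (x : gsub S i) (y : gsub S j) :
  gsub_fun (gmul x y) = gmul (gsub_fun x) (gsub_fun y).
Proof. by apply: val_inj; exact: gmap_mul. Qed.

Definition gsub_morph : gradedMorphism (gsub S) (gsub T) :=
  GradedMorphism gsub_fun_linear gsub_fun_one gsub_fun_mul.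
End Sub.

Section Quot.
Variables (I : gradedIdeal A) (J : gradedIdeal B).
Hypothesis fIJ : forall k (x : A k),
  x \in submod_pred (I k) -> gmap f x \in submod_pred (J k).

Definition gquot_fun k (a : gquot I k) : gquot J k :=
  gquot_proj J (gmap f (repr (a : quotmod (I k)))).

Lemma gquot_funE k (x : A k) :
  gquot_fun (gquot_proj I x) = gquot_proj J (gmap f x).
Proof.
apply/qpiP; set x' := repr _.
have -> : gmap f x' - gmap f x = gmap f (x' - x).
  by rewrite -scaleN1r addrC -gmap_linear scaleN1r addrC.
by apply: fIJ; apply/qpiP; exact: qpi_repr.
Qed.

Lemma gquot_fun_linear k : linear (@gquot_fun k).
Proof.
move=> a; elim/gquot_ind => x; elim/gquot_ind => y.
rewrite -(gquot_proj_linear I a x y) !gquot_funE gmap_linear.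
exact: gquot_proj_linear.
Qed.
Lemma gquot_fun_one : gquot_fun (gone (gquot I)) = gone (gquot J).
Proof. by rewrite gquot_funE gmap_one. Qed.
Lemma gquot_fun_mul i j (x : gquot I i) (y : gquot I j) :
  gquot_fun (gmul x y) = gmul (gquot_fun x) (gquot_fun y).
Proof.
elim/gquot_ind: x => x; elim/gquot_ind: y => y.
have -> : gmul (gquot_proj I x : gquot I i) (gquot_proj I y : gquot I j) =
  gquot_proj I (gmul x y) by exact: gquot_ME.
rewrite !gquot_funE gmap_mul; symmetry; exact: gquot_ME.
Qed.

Definition gquot_morph : gradedMorphism (gquot I) (gquot J) :=
  GradedMorphism gquot_fun_linear gquot_fun_one gquot_fun_mul.
End Quot.

End InducedMorphisms.

Definition monotone (k l : nat) (u : 'I_k -> 'I_l) : Prop :=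
  {homo u : a b / (a <= b)%N}.

(* sact u is the structure map of a monotone map u between the ordered sets     *)
(* {0, ..., k} and {0, ..., l}; its values on other functions are irrelevant.   *)
Record simplicialSet := SimplicialSet {
  smp :> nat -> Type;
  sact : forall k l, ('I_k.+1 -> 'I_l.+1) -> smp l -> smp k;
  sact_id : forall k (s : smp k), sact id s = s;
  sact_comp : forall k l m (u : 'I_k.+1 -> 'I_l.+1) (v : 'I_l.+1 -> 'I_m.+1)
    (s : smp m), monotone u -> monotone v -> sact u (sact v s) = sact (v \o u) s }.
Arguments sact {_ k l} _ _.

Record simplicialMap (S T : simplicialSet) := SimplicialMap {
  smap :> forall k, S k -> T k;
  smap_sact : forall k l (u : 'I_k.+1 -> 'I_l.+1) (s : S l),
    monotone u -> smap (sact u s) = sact u (smap s) }.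

(* The vertices 0, ..., i and i, ..., i + j of an m-simplex, for m >= i + j; m  *)
(* is kept free so that degrees such as i + j.+1 and (i + j).+1 can be compared *)
(* without casts.                                                               *)
Definition front (i m : nat) : 'I_i.+1 -> 'I_m.+1 := fun a => inord a.
Definition back (i j m : nat) : 'I_j.+1 -> 'I_m.+1 := fun a => inord (i + a).
Definition face (k h : nat) : 'I_k.+1 -> 'I_k.+2 := fun a => inord (bump h a).

Lemma liftE k (h : 'I_k.+2) : lift h = @face k h.
Proof.
apply/funext => a; apply/val_inj; rewrite /= inordK //.
exact: (ltn_ord (lift h a)).
Qed.

Lemma face_mono k h : monotone (@face k h).
Proof.
by move=> a b ab; rewrite /face !inordK /bump; have := ltn_ord a;
  have := ltn_ord b; lia.
Qed.
Lemma front_mono i m : (i <= m)%N -> monotone (@front i m).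
Proof.
by move=> im a b ab; rewrite /front !inordK //; have := ltn_ord a;
  have := ltn_ord b; lia.
Qed.
Lemma back_mono i j m : (i + j <= m)%N -> monotone (@back i j m).
Proof.
by move=> im a b ab; rewrite /back !inordK //; have := ltn_ord a;
  have := ltn_ord b; lia.
Qed.

Section Cochains.
Variables (F : fieldType) (S : simplicialSet).

Definition cochain (k : nat) : lmodType F := S k -> F^o.

Definition codiff (k : nat) (x : cochain k) : cochain k.+1 :=
  fun s => \sum_(h < k.+2) (-1) ^+ h * x (sact (lift h) s).

Definition cupm (i j m : nat) (x : cochain i) (y : cochain j) : cochain m :=
  fun s => x (sact (@front i m) s) * y (sact (@back i j m) s).

Arguments cupm {i j} m x y.

Definition cup (i j : nat) (x : cochain i) (y : cochain j) : cochain (i + j) :=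
  cupm (i + j) x y.

Definition cochain1 : cochain 0 := fun=> 1.

Lemma cup_linear_l i j (y : cochain j) : linear (fun x : cochain i => cup x y).
Proof.
move=> a x x'; apply/funext => s; rewrite /cup /cupm /=.
by rewrite !fctE /= mulrDl -scalerAl.
Qed.
Lemma cup_linear_r i j (x : cochain i) : linear (fun y : cochain j => cup x y).
Proof.
move=> a y y'; apply/funext => s; rewrite /cup /cupm /=.
by rewrite !fctE /= mulrDr -scalerAr.
Qed.

Lemma homog_index (f : forall m, cochain m) m m' :
  m = m' -> homog (f m) = homog (f m').
Proof. by move->. Qed.

Lemma cup_A i j k (x : cochain i) (y : cochain j) (z : cochain k) :
  homog (cup x (cup y z)) = homog (cup (cup x y) z).
Proof.
pose t m : cochain m := fun s => x (sact (@front i m) s) *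
  (y (sact (@back i j m) s) * z (sact (@back (i + j) k m) s)).
have -> : cup x (cup y z) = t (i + (j + k))%N.
  apply/funext => s; rewrite /cup /cupm /t.
  rewrite !sact_comp; try by [apply: front_mono; lia | apply: back_mono; lia].
  congr (_ * (y (sact _ s) * z (sact _ s))); apply/funext => a; apply/val_inj;
    by rewrite /= !inordK //; have := ltn_ord a; lia.
have -> : cup (cup x y) z = t (i + j + k)%N.
  apply/funext => s; rewrite /cup /cupm /t mulrA.
  rewrite !sact_comp; try by [apply: front_mono; lia | apply: back_mono; lia].
  congr (x (sact _ s) * y (sact _ s) * _); apply/funext => a; apply/val_inj;
    by rewrite /= !inordK //; have := ltn_ord a; lia.
exact/homog_index/addnA.
Qed.

Lemma cup_1l i (x : cochain i) : homog (cup cochain1 x) = homog x.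
Proof.
congr homog; apply/funext => s; rewrite /cup /cupm /cochain1 mul1r.
rewrite -[in RHS](sact_id s); congr (x (sact _ s)).
by apply/funext => a; apply/val_inj; rewrite /= inordK //; have := ltn_ord a; lia.
Qed.

Lemma cup_1r i (x : cochain i) : homog (cup x cochain1) = homog x.
Proof.
pose t m : cochain m := fun s => x (sact (@front i m) s).
have -> : cup x cochain1 = t (i + 0)%N.
  by apply/funext => s; rewrite /cup /cupm /cochain1 mulr1.
rewrite (homog_index t (addn0 i)); congr homog; apply/funext => s.
rewrite -[in RHS](sact_id s); congr (x (sact _ s)).
by apply/funext => a; apply/val_inj; rewrite /= inordK //; have := ltn_ord a; lia.
Qed.

Definition cochains : gradedAlgebra F :=
  GradedAlgebra cup_linear_l cup_linear_r cup_A cup_1l cup_1r.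

Lemma codiff_linear k : linear (@codiff k).
Proof.
move=> a x y; apply/funext => s; rewrite fctE /codiff /= !fctE scaler_sumr.
rewrite -big_split /=; apply: eq_bigr => h _.
by rewrite mulrDr scalerAr.
Qed.

Lemma codiff0 k : codiff (0 : cochain k) = 0.
Proof.
by apply/funext => s; rewrite /codiff big1 // => h _; rewrite mulr0.
Qed.

Lemma codiff_nat k (x : cochain k) s :
  codiff x s = \sum_(0 <= h < k.+2) (-1) ^+ h * x (sact (@face k h) s).
Proof. by rewrite big_mkord; apply: eq_bigr => h _; rewrite liftE. Qed.

Lemma leibniz i j (x : cochain i) (y : cochain j) :
  codiff (cup x y) = cupm (i + j).+1 (codiff x) y +
    (-1) ^+ i *: cupm (i + j).+1 x (codiff y).
Proof.
apply/funext => s; rewrite !fctE /= codiff_nat /cup /cupm !codiff_nat.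
set m := (i + j)%N.
rewrite (@big_cat_nat _ _ _ i.+1) //=; last by rewrite /m; lia.
rewrite (@big_nat_recr _ _ _ i.+1) //= mulrDl.
rewrite (@big_nat_recl _ _ _ j.+1) //= expr0 mul1r.
have scE (a b : F) : a *: (b : F^o) = a * b by [].
rewrite !scE !mulrDr.
have eqv (k l : nat) (u v : 'I_k.+1 -> 'I_l.+1) (w : S l) :
    (forall a, u a = v a :> nat) -> sact u w = sact v w.
  by move=> uv; congr sact; apply/funext => a; exact/val_inj/uv.
have fm k h := @face_mono k h.
have f1 : monotone (@front i m) by apply: front_mono; rewrite /m; lia.
have f2 : monotone (@front i m.+1) by apply: front_mono; rewrite /m; lia.
have f3 : monotone (@front i.+1 m.+1) by apply: front_mono; rewrite /m; lia.
have b1 : monotone (@back i j m) by apply: back_mono; rewrite /m; lia.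
have b2 : monotone (@back i j.+1 m.+1) by apply: back_mono; rewrite /m; lia.
rewrite !(sact_comp s (fm _ _) f3) (sact_comp s (fm _ _) b2).
have c1 : sact (@front i.+1 m.+1 \o @face i i.+1) s = sact (@front i m.+1) s.
  apply: eqv => a; have := ltn_ord a => ai.
  by rewrite /= /front /face !inordK /bump /m; lia.
have c2 : sact (@back i j.+1 m.+1 \o @face j 0) s = sact (@back i.+1 j m.+1) s.
  apply: eqv => a; have := ltn_ord a => ai.
  by rewrite /= /back /face !inordK /bump /m; lia.
rewrite c1 c2 [(-1) ^+ i.+1]exprS mulN1r !mulNr -[X in _ - X]mulrA.
rewrite [RHS]addrA subrK mulr_suml !mulr_sumr; congr (_ + _).
  apply: eq_big_nat => h /andP[_ hi]; rewrite -mulrA !sact_comp //.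
  congr (_ * (x _ * y _)); apply: eqv => a; have := ltn_ord a => ai.
    by rewrite /= /front /face !inordK /bump /m; lia.
  by rewrite /= /back /face !inordK /bump /m; lia.
rewrite -{1}[i.+1]add0n big_addn.
have -> : (m.+2 - i.+1 = j.+1)%N by rewrite /m; lia.
apply: eq_big_nat => h /andP[_ hj]; rewrite !sact_comp //.
have -> : (-1) ^+ (h + i.+1) = (-1) ^+ i * (-1) ^+ h.+1 :> F.
  by rewrite -exprD; congr (_ ^+ _); lia.
rewrite -mulrA; congr (_ * _); rewrite mulrCA; congr (x _ * (_ * y _)).
  apply: eqv => a; have := ltn_ord a => ai.
  by rewrite /= /front /face !inordK /bump /m; lia.
apply: eqv => a; have := ltn_ord a => ai.
by rewrite /= /back /face !inordK /bump /m; lia.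
Qed.

Lemma codiff1 : codiff cochain1 = 0.
Proof.
apply/funext => s; rewrite /codiff /cochain1 !big_ord_recl big_ord0 !mulr1.
by rewrite addr0 expr0 expr1 subrr.
Qed.

Definition cocycle_pred (k : nat) : {pred cochains k} :=
  fun x : cochain k => codiff x == 0.

Lemma cocycle_submod k : submod_closed (@cocycle_pred k).
Proof.
split=> [|a x y]; first by apply: (introT eqP); exact: codiff0.
move=> /(elimT eqP) dx /(elimT eqP) dy; apply: (introT eqP).
by rewrite codiff_linear dx dy scaler0 addr0.
Qed.

Lemma cocycle_one :
  gone cochains \in submod_pred (Submodule (@cocycle_submod 0)).
Proof. by apply: (introT eqP); exact: codiff1. Qed.

Lemma cupm0 i j m (x : cochain i) : cupm m x (0 : cochain j) = 0.
Proof. by apply/funext => s; rewrite /cupm mulr0. Qed.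
Lemma cup0m i j m (y : cochain j) : cupm m (0 : cochain i) y = 0.
Proof. by apply/funext => s; rewrite /cupm mul0r. Qed.

Lemma cocycle_mul i j (x : cochains i) (y : cochains j) :
  x \in submod_pred (Submodule (@cocycle_submod i)) ->
  y \in submod_pred (Submodule (@cocycle_submod j)) ->
  gmul x y \in submod_pred (Submodule (@cocycle_submod (i + j))).
Proof.
move=> /(elimT eqP) dx /(elimT eqP) dy; apply: (introT eqP).
rewrite [LHS]leibniz dx dy; rewrite cupm0 cup0m.
by rewrite scaler0 addr0.
Qed.

Definition cocycles : gradedSubalgebra cochains :=
  GradedSubalgebra cocycle_one cocycle_mul.

Definition coboundary (k : nat) : cochain k -> Prop :=
  match k with
  | 0 => fun x => x = 0
  | k'.+1 => fun x => exists c : cochain k', x = codiff c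
  end.

Lemma coboundary0 k : coboundary (0 : cochain k).
Proof. by case: k => [//|k] /=; exists 0; rewrite codiff0. Qed.

Lemma coboundary_homog k l (z : cochain k) (w : cochain l) :
  homog z = homog w -> coboundary w -> coboundary z.
Proof.
move=> ezw; have /= ekl := congr1 (@projT1 _ _) ezw.
by case: l / ekl w ezw => w ezw; rewrite (eq_from_Tagged ezw).
Qed.

Definition coboundary_pred (k : nat) : {pred gsub cocycles k} :=
  fun z => `[< coboundary (gsub_incl z) >].

Lemma coboundary_submod k : submod_closed (@coboundary_pred k).
Proof.
split=> [|a x y]; first by apply: (introT (asboolP _)); exact: coboundary0.
move=> /(elimT (asboolP _)) bx /(elimT (asboolP _)) by_.
apply: (introT (asboolP _)).
have -> : gsub_incl (a *: x + y) = a *: gsub_incl x + gsub_incl y by [].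
move: (gsub_incl x) (gsub_incl y) bx by_ => {x y}; case: k => [|k] u v /=.
  by move=> -> ->; rewrite scaler0 addr0.
by move=> [c ->] [c' ->]; exists (a *: c + c'); rewrite codiff_linear.
Qed.

Lemma coboundary_mull i j (x : gsub cocycles i) (y : gsub cocycles j) :
  y \in submod_pred (Submodule (@coboundary_submod j)) ->
  gmul x y \in submod_pred (Submodule (@coboundary_submod (i + j))).
Proof.
move=> /(elimT (asboolP _)) By; apply: (introT (asboolP _)).
have -> : gsub_incl (gmul x y) = cup (gsub_incl x) (gsub_incl y) by [].
have dx : codiff (gsub_incl x) = 0 by apply/eqP; exact: (valP x).
move: (gsub_incl x) dx => {x} x dx.
move: (gsub_incl y) By => {y}; case: j => [|j] y /=.
  by move=> ->; rewrite /cup cupm0; exact: coboundary0.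
move=> [c ->]; apply: (@coboundary_homog _ (i + j).+1 _
    (cupm (i + j).+1 x (codiff c))).
  exact: (homog_index (fun m => cupm m x (codiff c)) (addnS i j)).
exists ((-1) ^+ i *: cup x c).
have := leibniz x c; rewrite dx cup0m add0r => lb.
have -> : codiff ((-1) ^+ i *: cup x c) = (-1) ^+ i *: codiff (cup x c).
  have := codiff_linear ((-1) ^+ i) (cup x c) 0.
  by rewrite codiff0 !addr0.
by rewrite lb scalerA -exprD addnn -signr_odd odd_double expr0 scale1r.
Qed.

Lemma coboundary_mulr i j (x : gsub cocycles i) (y : gsub cocycles j) :
  x \in submod_pred (Submodule (@coboundary_submod i)) ->
  gmul x y \in submod_pred (Submodule (@coboundary_submod (i + j))).
Proof.
move=> /(elimT (asboolP _)) Bx; apply: (introT (asboolP _)).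
have -> : gsub_incl (gmul x y) = cup (gsub_incl x) (gsub_incl y) by [].
have dy : codiff (gsub_incl y) = 0 by apply/eqP; exact: (valP y).
move: (gsub_incl y) dy => {y} y dy.
move: (gsub_incl x) Bx => {x}; case: i => [|i] x /=.
  by move=> ->; rewrite /cup cup0m; exact: coboundary0.
move=> [c ->]; exists (cup c y).
by rewrite leibniz dy cupm0 scaler0 addr0.
Qed.

Definition coboundaries : gradedIdeal (gsub cocycles) :=
  GradedIdeal coboundary_mull coboundary_mulr.

Definition cohomology : gradedAlgebra F := gquot coboundaries.

Variable v : S 0.

Definition aug_cochain (k : nat) : cochains k -> F^o :=
  match k with
  | 0 => fun c : cochain 0 => c v
  | _ => fun=> 0
  end.

Lemma aug_cochain_linear k : linear (@aug_cochain k).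
Proof. by case: k => [//|k] a x y /=; rewrite scaler0 addr0. Qed.
Lemma aug_cochain_pos k (x : cochains k) : (0 < k)%N -> aug_cochain x = 0.
Proof. by case: k x. Qed.
Lemma aug_cochain_one : aug_cochain (gone cochains) = 1.
Proof. by []. Qed.
Lemma aug_cochain_mul i j (x : cochains i) (y : cochains j) :
  aug_cochain (gmul x y) = aug_cochain x * aug_cochain y.
Proof.
case: i x => [|i] x; last by rewrite mul0r.
case: j y => [|j] y; last by rewrite mulr0.
rewrite /= /cup /cupm -[in RHS](sact_id v).
by congr (x (sact _ v) * y (sact _ v)); apply/funext => a; rewrite [LHS]ord1 ord1.
Qed.

Definition cochain_aug : augmentation cochains :=
  Augmentation aug_cochain_linear aug_cochain_pos aug_cochain_one
    aug_cochain_mul.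

Lemma aug_coboundary k (x : gsub cocycles k) :
  x \in submod_pred (coboundaries k) -> aug (gsub_aug cocycles cochain_aug) x = 0.
Proof.
move=> /(elimT (asboolP _)); rewrite /= /aug_cochain.
by case: k x => [|//] x ->.
Qed.

(* The augmentation given by evaluation at the vertex v; when the degree 0 part *)
(* is spanned by 1, it identifies this part with F and does not depend on v.    *)
Definition cohomology_aug : augmentation cohomology := gquot_aug aug_coboundary.

End Cochains.

Lemma codiff_codiff (F : fieldType) (S : simplicialSet) k (x : cochain F S k) :
  codiff (codiff x) = 0.
Proof.
apply/funext => s; rewrite codiff_nat.
under eq_bigr do rewrite codiff_nat mulr_sumr.
pose f (h a : nat) : F := (-1) ^+ h *
  ((-1) ^+ a * x (sact (@face k a) (sact (@face k.+1 h) s))).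
have fN h a : (a <= h)%N -> (h < k.+2)%N -> f h.+1 a = - f a h.
  move=> ah hk; rewrite /f !sact_comp; try exact: face_mono.
  rewrite exprS mulN1r mulNr mulrCA.
  congr (- (_ * (_ * x (sact _ s)))).
  apply/funext => b; apply/val_inj; have := ltn_ord b => bk.
  by rewrite /= /face !inordK /bump; lia.
transitivity (\sum_(0 <= h < k.+3) \sum_(0 <= a < k.+2) f h a); first by [].
under eq_bigr => h _ do rewrite (bigID (fun a => a < h)%N) /=.
rewrite big_split /= [X in X + _]big_nat_recl // [X in _ + X]big_nat_recr //=.
rewrite [X in X + _ + _]big_pred0 // add0r.
rewrite [X in _ + (_ + X)]big_nat_cond [X in _ + (_ + X)]big_pred0 ?addr0; last first.
  by move=> a; lia.
rewrite [X in X + _](eq_bigr (fun h =>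
  \sum_(0 <= a < k.+2) if (a < h.+1)%N then f h.+1 a else 0)); last first.
  by move=> h _; rewrite big_mkcond.
rewrite [X in _ + X](eq_bigr (fun h =>
  \sum_(0 <= a < k.+2) if (a < h)%N then 0 else f h a)); last first.
  by move=> h _; rewrite big_mkcond; apply: eq_bigr => a _; case: ltnP.
rewrite [X in _ + X]exchange_big /= -big_split /= big_nat big1 // => h /andP[_ hk].
rewrite -big_split /= big_nat big1 // => a /andP[_ ak].
rewrite ltnS; case: (leqP a h) => ah.
  by rewrite fN // addNr.
by rewrite add0r.
Qed.

Section Pullback.
Variables (F : fieldType) (S T : simplicialSet) (f : simplicialMap S T).

Definition cochain_pull (k : nat) (x : cochains F T k) : cochains F S k :=
  (x : cochain F T k) \o @smap _ _ f k.

Lemma cochain_pull_linear k : linear (@cochain_pull k).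
Proof. by []. Qed.
Lemma cochain_pull_one : cochain_pull (gone (cochains F T)) = gone (cochains F S).
Proof. by []. Qed.
Lemma cochain_pull_mul i j (x : cochains F T i) (y : cochains F T j) :
  cochain_pull (gmul x y) = gmul (cochain_pull x) (cochain_pull y).
Proof.
apply/funext => s; rewrite /cochain_pull /= /cup /cupm /=.
by rewrite !smap_sact //; [apply: back_mono | apply: front_mono; exact: leq_addr].
Qed.

Definition cochain_morph : gradedMorphism (cochains F T) (cochains F S) :=
  GradedMorphism cochain_pull_linear cochain_pull_one cochain_pull_mul.

Lemma codiff_pull k (x : cochain F T k) :
  codiff (cochain_pull x) = cochain_pull (codiff x) :> cochain F S k.+1.
Proof.
apply/funext => s; rewrite /codiff /cochain_pull /=; apply: eq_bigr => h _.
by rewrite smap_sact // liftE; exact: face_mono.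
Qed.

Lemma cocycle_pull k (x : cochains F T k) :
  x \in submod_pred (cocycles F T k) ->
  gmap cochain_morph x \in submod_pred (cocycles F S k).
Proof.
move=> /(elimT eqP) dx; apply: (introT eqP).
by rewrite [LHS]codiff_pull dx.
Qed.

Definition cocycle_morph := gsub_morph cocycle_pull.

Lemma coboundary_pull k (x : gsub (cocycles F T) k) :
  x \in submod_pred (coboundaries F T k) ->
  gmap cocycle_morph x \in submod_pred (coboundaries F S k).
Proof.
move=> /(elimT (asboolP _)) bx; apply: (introT (asboolP _)).
have -> : gsub_incl (gmap cocycle_morph x) = cochain_pull (gsub_incl x) by [].
move: (gsub_incl x) bx => {x}; case: k => [|k] x /=; first by move->.
by move=> [c ->]; exists (cochain_pull c); rewrite codiff_pull.
Qed.

Definition pullback : gradedMorphism (cohomology F T) (cohomology F S) :=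
  gquot_morph coboundary_pull.

End Pullback.

(* The nerve: a k-simplex is a k-tuple (g_0, ..., g_(k-1)) of group elements.   *)
(* Its face 0 drops g_0, its face h (0 < h < k) multiplies g_(h-1) by g_h, and  *)
(* its face k drops g_(k-1). So cochains on the nerve are the inhomogeneous     *)
(* cochains gT^k -> F, and codiff is the bar differential                       *)
(*   (dx)(g_0, ..., g_k) = x(g_1, ..., g_k)                                     *)
(*     + \sum_(0 < h <= k) (-1)^h x(..., g_(h-1) * g_h, ...)                    *)
(*     + (-1)^(k+1) x(g_0, ..., g_(k-1)).                                       *)
Section Nerve.
Variable gT : finGroupType.
Local Open Scope group_scope.

Definition nerve_act (k l : nat) (u : 'I_k.+1 -> 'I_l.+1)
    (g : {ffun 'I_l -> gT}) : {ffun 'I_k -> gT} :=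
  [ffun i : 'I_k => \prod_(j < l |
    (u (widen_ord (leqnSn k) i) <= j < u (lift ord0 i))%N) g j].

Lemma nerve_id k (g : {ffun 'I_k -> gT}) : nerve_act id g = g.
Proof.
apply/ffunP => i; rewrite ffunE (big_pred1 i) // => j /=.
by rewrite /bump /= add1n ltnS -eqn_leq eq_sym.
Qed.

Let ext l (g : {ffun 'I_l -> gT}) (j : nat) : gT :=
  if insub j is Some o then g o else 1.

Let prod_ext l (g : {ffun 'I_l -> gT}) a b : (b <= l)%N ->
  \prod_(j < l | (a <= j < b)%N) g j = \prod_(a <= j < b) ext g j.
Proof.
move=> bl; rewrite (big_nat_widen _ _ _ _ _ bl) (big_nat_widenl _ 0%N) // big_mkord.
apply: eq_big => [j|j _]; first by rewrite andbC.
by rewrite /ext valK.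
Qed.

Let prod_glue (G : nat -> gT) (t : nat -> nat) c d :
  (forall i j, (i <= j <= d)%N -> (t i <= t j)%N) -> (c <= d)%N ->
  \prod_(c <= i < d) \prod_(t i <= j < t i.+1) G j = \prod_(t c <= j < t d) G j.
Proof.
elim: d => [|d IH] tm; first by rewrite leqn0 => /eqP ->; rewrite !big_geq.
rewrite leq_eqVlt => /predU1P[->|]; first by rewrite !big_geq.
rewrite ltnS => cd; rewrite big_nat_recr //= IH //; last first.
  by move=> i j /andP[ij jd]; apply: tm; rewrite ij leqW.
by rewrite -big_cat_nat //; apply: tm; rewrite ?cd ?leqnSn ?leqnn.
Qed.

Lemma nerve_comp k l m (u : 'I_k.+1 -> 'I_l.+1) (v : 'I_l.+1 -> 'I_m.+1)
    (g : {ffun 'I_m -> gT}) : monotone u -> monotone v ->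
  nerve_act u (nerve_act v g) = nerve_act (v \o u) g.
Proof.
move=> mu mv; apply/ffunP => i; rewrite !ffunE /=.
set c := u _; set d := u _.
have cd : (c <= d)%N by apply: mu; rewrite /= /bump /= add1n.
pose t (n : nat) : nat := v (inord n).
have tE (a : 'I_l.+1) : t a = v a by rewrite /t inord_val.
have le1 (n : nat) (a : 'I_n.+1) : (a <= n)%N by rewrite -ltnS.
rewrite !prod_ext ?le1 // -!tE.
rewrite -(@prod_glue _ t) //; last first.
  move=> p q /andP[pq qd]; have dl := ltn_ord d.
  by apply: mv; rewrite !inordK //; lia.
apply: eq_big_nat => j /andP[_ jd].
have jl : (j < l)%N by have := ltn_ord d; lia.
rewrite /ext insubT /= ffunE prod_ext ?le1 // -!tE.
by congr (\prod_(t _ <= _ < t _) _).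
Qed.

Definition nerve : simplicialSet := SimplicialSet nerve_id nerve_comp.

Definition nerve_vertex : nerve 0 := [ffun=> 1].

End Nerve.

Section Singular.
Variable R : realType.

Definition stdSimplex (k : nat) : set 'rV[R]_k.+1 :=
  [set t | (forall i, 0 <= t 0 i) /\ \sum_i t 0 i = 1].
Arguments stdSimplex : clear implicits.

Definition Delta (k : nat) : topologicalType := set_type (stdSimplex k).

Section Push.
Variables (k l : nat) (u : 'I_k.+1 -> 'I_l.+1).

Definition push_row (t : 'rV[R]_k.+1) : 'rV[R]_l.+1 :=
  \row_j \sum_(i | u i == j) t 0 i.

Lemma push_stdSimplex (t : Delta k) : push_row (val t) \in stdSimplex l.
Proof.
case: t => t /= /set_mem [t0 t1]; apply/mem_set; split=> [j|].
  by rewrite mxE sumr_ge0.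
rewrite -[RHS]t1 (partition_big u xpredT) //=.
by apply: eq_bigr => j _; rewrite mxE.
Qed.

(* The affine map sending the i-th vertex to the (u i)-th one.                  *)
Definition push (t : Delta k) : Delta l :=
  exist (fun t => t \in stdSimplex l) _ (push_stdSimplex t).

Lemma push_row_continuous : continuous push_row.
Proof.
move=> t U [P tP sPU].
have coord j : continuous (fun t : 'rV[R]_k.+1 => push_row t 0 j).
  rewrite (_ : (fun _ => _) = fun t : 'rV[R]_k.+1 => \sum_(i | u i == j) t 0 i).
    by apply: continuous_big => [|i _]; [exact: add_continuous | exact: coord_continuous].
  by apply/funext => t'; rewrite mxE.
suff : nbhs t [set t' | forall i j, P i j (push_row t' i j)].
  by apply: filterS => t' Pt'; exact: sPU.
have nF : Filter (nbhs (t : 'rV[R]_k.+1)) by exact: nbhs_filter.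
apply: (@filter_forall _ _ (fun i (t' : 'rV[R]_k.+1) => forall j, P i j (push_row t' i j))
  _ nF) => i.
apply: (@filter_forall _ _ (fun j (t' : 'rV[R]_k.+1) => P i j (push_row t' i j))
  _ nF) => j.
by rewrite !ord1; apply: coord; exact: tP.
Qed.

Lemma push_continuous : continuous push.
Proof.
apply: continuous_comp_initial; rewrite (_ : _ \o _ = push_row \o set_val) //.
move=> t; apply: continuous_comp; first exact: initial_continuous.
exact: push_row_continuous.
Qed.
HB.instance Definition _ := isContinuous.Build _ _ push push_continuous.

End Push.

Variable X : topologicalType.

Definition sing_act (k l : nat) (u : 'I_k.+1 -> 'I_l.+1)
    (s : continuousType (Delta l) X) : continuousType (Delta k) X := s \o push u.

Lemma sing_id k (s : continuousType (Delta k) X) : sing_act id s = s.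
Proof.
apply/continuousEP => t /=; congr (s _); apply/val_inj/rowP => j /=.
by rewrite mxE (big_pred1 j).
Qed.

Lemma sing_comp k l m (u : 'I_k.+1 -> 'I_l.+1) (v : 'I_l.+1 -> 'I_m.+1)
    (s : continuousType (Delta m) X) : monotone u -> monotone v ->
  sing_act u (sing_act v s) = sing_act (v \o u) s.
Proof.
move=> _ _; apply/continuousEP => t /=; congr (s _); apply/val_inj/rowP => j /=.
rewrite !mxE [RHS](partition_big u (fun i => v i == j)) //=.
apply: eq_bigr => i /eqP vi; rewrite mxE; apply: eq_bigl => a.
by case: eqP => [->|]; rewrite ?andbF // vi eqxx.
Qed.

Definition sing : simplicialSet := SimplicialSet sing_id sing_comp.

Definition sing_vertex (x : X) : sing 0 := cst x.

End Singular.

Section SingularMap.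
Variables (R : realType) (X Y : topologicalType) (f : continuousType X Y).

Definition sing_fun (k : nat) (s : sing R X k) : sing R Y k :=
  f \o (s : continuousType (Delta R k) X).

Lemma sing_fun_act k l (u : 'I_k.+1 -> 'I_l.+1) (s : sing R X l) :
  monotone u -> sing_fun (sact u s) = sact u (sing_fun s).
Proof. by move=> _; apply/continuousEP. Qed.

Definition sing_map : simplicialMap (sing R X) (sing R Y) :=
  SimplicialMap sing_fun_act.

End SingularMap.

Definition singularCohomology (R : realType) (F : fieldType)
  (X : topologicalType) : gradedAlgebra F := cohomology F (sing R X).

Definition groupCohomology (F : fieldType) (gT : finGroupType) :
  gradedAlgebra F := cohomology F (nerve gT).

Definition groupCohomology_aug (F : fieldType) (gT : finGroupType) :
  augmentation (groupCohomology F gT) := cohomology_aug F (nerve_vertex gT).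

Section Configurations.
Variables (R : realType) (p n : nat).

Definition conf_set : set {ptws 'I_p -> 'rV[R]_n} := [set x | injective x].

Definition Conf : topologicalType := set_type conf_set.

Lemma conf_inj (x : Conf) : injective (val x).
Proof. by case: x => x /= /set_mem. Qed.

Definition conf_perm (s : 'S_p) (x : Conf) : Conf :=
  exist (fun x => x \in conf_set) ((val x : 'I_p -> 'rV[R]_n) \o s)
    (mem_set (inj_comp (@conf_inj x) (@perm_inj _ s))).

Lemma conf_perm_continuous s : continuous (conf_perm s).
Proof.
pose pr (i : 'I_p) (f : 'I_p -> 'rV[R]_n) := f i.
apply: continuous_comp_initial => x.
have FF : Filter ((set_val \o conf_perm s) x @[x --> x]).
  exact/fmap_filter/nbhs_filter.
apply/cvg_sup => i.
apply: (@continuous_comp_initial _ Conf _ (pr i) (set_val \o conf_perm s)).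
rewrite (_ : _ \o _ = pr (s i) \o set_val) // => y.
apply: (@continuous_comp Conf {ptws 'I_p -> 'rV[R]_n} _ set_val (pr (s i))).
  exact: initial_continuous.
exact: (@proj_continuous _ (fun=> 'rV[R]_n)).
Qed.
HB.instance Definition _ s :=
  isContinuous.Build _ _ (conf_perm s) (@conf_perm_continuous s).

Definition conf_rel (x y : Conf) : bool := [exists s : 'S_p, y == conf_perm s x].

Lemma conf_perm1 x : conf_perm 1%g x = x.
Proof. by apply/val_inj/funext => i; rewrite /= perm1. Qed.
Lemma conf_permM s t x : conf_perm s (conf_perm t x) = conf_perm (s * t)%g x.
Proof. by apply/val_inj/funext => i; rewrite /= permM. Qed.

Lemma conf_rel_refl : reflexive conf_rel.
Proof. by move=> x; apply/existsP; exists 1%g; rewrite conf_perm1. Qed.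
Lemma conf_rel_sym : symmetric conf_rel.
Proof.
suff H x y : conf_rel x y -> conf_rel y x by move=> x y; apply/idP/idP; exact: H.
move=> /existsP[s /eqP ->]; apply/existsP; exists s^-1%g.
by rewrite conf_permM mulVg conf_perm1.
Qed.
Lemma conf_rel_trans : transitive conf_rel.
Proof.
move=> y x z /existsP[s /eqP ->] /existsP[t /eqP ->]; apply/existsP.
by exists (t * s)%g; rewrite conf_permM.
Qed.

Canonical conf_equiv := EquivRel conf_rel conf_rel_refl conf_rel_sym conf_rel_trans.

Definition Bconf : topologicalType := quotient_topology {eq_quot conf_rel}.

Lemma conf_base_inj (n_gt0 : (0 < n)%N) :
  conf_set (fun i : 'I_p => const_mx (i%:R) : 'rV[R]_n).
Proof.
move=> i j /= /rowP /(_ (Ordinal n_gt0)); rewrite !mxE => /eqP.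
by rewrite eqr_nat => /eqP /val_inj.
Qed.

Definition conf_base (n_gt0 : (0 < n)%N) : Conf :=
  exist (fun x => x \in conf_set) _ (mem_set (conf_base_inj n_gt0)).

Definition confInvariants (F : fieldType) : gradedAlgebra F :=
  invariants (fun s : 'S_p => pullback F (sing_map R (conf_perm s))).

(* The degree 0 part of the invariants is spanned by 1, as 'S_p permutes the    *)
(* path components transitively, so that the choice of conf_base is immaterial. *)
Definition confInvariants_aug (F : fieldType) (n_gt0 : (0 < n)%N) :
    augmentation (confInvariants F) :=
  invariants_aug _ (cohomology_aug F (sing_vertex R (conf_base n_gt0))).

End Configurations.

(* Main.v *)
Require Import Defs.
From HB Require Import structures.
From mathcomp Require Import all_fingroup all_boot all_order all_algebra.
From mathcomp Require Import cyclic.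
From mathcomp Require Import all_classical all_reals all_analysis.
From mathcomp Require Import zify lra.
From Stdlib Require Import Ring.
Import Order.TTheory GRing.Theory Num.Theory numFieldNormedType.Exports.

(** Forgetting one point exhibits [Conf_p(R^d)], [d = n + 1], as a tower whose fibres are
    complements of points; suspending along a coordinate shows that its cohomology lives in
    the degrees [c * n], [c < p].  Put [D = n * (p - 1)].

    Below the top degree the cohomology is projective over the group ring of the cyclic group
    [K] generated by the rotation.  Indeed, moving the points of
    a configuration far apart according to a colouring by [m] colours is a self-map of
    [Conf_p]; the sum of these maps over all colourings acts on [H^(c n)] as [m^(p - c)],
    the [m] constant colourings act as the identity, and the others form free [K]-orbits.
    If [m] generates the units of [F_p], then [m^(p - c) - m] is invertible for
    [0 < c < p - 1], which verifies Higman's criterion.  So the mapping cone of the comparison from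
    the cochains of the universal [Sigma_p]-simplicial set to those of [Conf_p] has
    acyclic [K]-cohomology up to degree [D], and since the index of [K] is prime to [p],
    below [D] every invariant cocycle is a class of the group plus a norm.

    In degrees [D] and [D + 1] with [n] odd, the normaliser of [K] acts on the cohomology
    of [K] by eigenvalues different from [1] (this uses [3 < p]), hence [Sigma_p] has no
    cohomology there.  For [n] even, a class invariant under transpositions vanishes in
    positive degrees.  Above [D] the cohomology of [B_p] vanishes: the open sets on which
    a given linear form of the moment curve separates the points are finitely many and
    cover [Conf_p], and on each of them the degree one class of [K] is trivial, so periodicity
    is nilpotent.

    Simplices of [B_p] lift to [Conf_p], uniquely up to [Sigma_p], so that the cochains of [B_p]
    are the invariant cochains of [Conf_p].  For [n] odd the classes of norms, together with
    everything in degrees at least [D], form an ideal which up to degree [D] is complementary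
    to the image of the group cohomology, and which maps isomorphically onto the invariants
    of positive degree; for [n] even both this ideal and those invariants vanish. *)

Set Implicit Arguments.
Unset Strict Implicit.
Unset Printing Implicit Defensive.
Local Open Scope classical_set_scope.
Local Open Scope ring_scope.

(** Throughout, [n] is the sphere dimension, one less than that of the space. All partial
    configuration spaces are open subsets of one product [confAmbient]: in [partConf k] only the
    first [k] points must differ and the others roam freely. Forgetting a point is then an inclusion
    of open sets, and the self-maps given by colourings act on all stages at once.

    The first obstacle is degree [0]: the trivial module is not projective over the group ring of
    [K]. The universal complex cancels it in the cone, and the shift by one in the cone extends
    acyclicity up to [D]. The second obstacle is degree [D] itself, where [c = p - 1] and
    [m^(p - c) - m] vanishes; there the argument rests on the vanishing of group cohomology. With
    [h = (p - 1) / 2] the eigenvalues in degrees [D] and [D + 1] are the powers [n * h] and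
    [n * h + 1] of a generator of the units of [F_p]. For odd [n] the first exponent is not a
    multiple of [2 * h]; the second is none as soon as [h > 1], that is, [3 < p]. *)

Section RingTactic.
Variable F : fieldType.
Definition fadd (a b : F) : F := a + b.
Definition fmul (a b : F) : F := a * b.
Definition fopp (a : F) : F := - a.
Definition fsub (a b : F) : F := a - b.
Definition fzero : F := 0.
Definition fone : F := 1.

Lemma field_ring_theory : @ring_theory F fzero fone fadd fmul fsub fopp eq.
Proof.
split; [exact: add0r|exact: addrC|exact: addrA|exact: mul1r|exact: mulrC|
  exact: mulrA|exact: mulrDl|by []|exact: subrr].
Qed.
End RingTactic.

(* Stdlib's [ring] does not see through the operations of a [fieldType], which  *)
(* are therefore replaced by the transparent copies above.                      *)
Ltac ring_quote F t :=
  lazymatch t with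
  | @GRing.add _ ?a ?b =>
      let a' := ring_quote F a in let b' := ring_quote F b in constr:(@fadd F a' b')
  | @GRing.opp _ ?a => let a' := ring_quote F a in constr:(@fopp F a')
  | @GRing.mul _ ?a ?b =>
      let a' := ring_quote F a in let b' := ring_quote F b in constr:(@fmul F a' b')
  | @GRing.scale _ _ ?a ?b =>
      let a' := ring_quote F a in let b' := ring_quote F b in constr:(@fmul F a' b')
  | @GRing.zero _ => constr:(fzero F)
  | @GRing.one _ => constr:(fone F)
  | _ => constr:(t : GRing.Field.sort F)
  end.
Ltac fring F := lazymatch goal with |- @eq ?T ?a ?b =>
  let a' := ring_quote F a in let b' := ring_quote F b in
  change (@eq (GRing.Field.sort F) a' b'); ring end.

(** * Cochains on tuples of points *)
Section ListCochains.
Variables (W : eqType) (F : fieldType).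
Implicit Types (Phi Psi : seq W -> F) (s v w : seq W).

Add Ring Fring : (field_ring_theory F).

Definition lcons x Phi : seq W -> F := fun s => Phi (x :: s).

(** Lists of all lengths are treated at once, the empty list being the augmentation degree. Peeling
    off the head turns the alternating sum [ldiffE] into a recursion, and inductions on the list
    replace the bookkeeping of signs. *)
Fixpoint ldiff Phi s : F :=
  if s is x :: s' then Phi s' - ldiff (lcons x Phi) s' else 0.

Lemma ldiffB Phi Psi : ldiff (Phi \- Psi) = ldiff Phi \- ldiff Psi.
Proof.
apply/funext => s; elim: s Phi Psi => [|x s IH] Phi Psi /=; first by rewrite subr0.
have -> : lcons x (Phi \- Psi) = lcons x Phi \- lcons x Psi by [].
by rewrite IH /=; fring F.
Qed.

Lemma ldiff0 s : ldiff (fun=> 0) s = 0.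
Proof. by elim: s => //= x s; rewrite /lcons => ->; rewrite subrr. Qed.

Lemma ldiff_ldiff Phi s : ldiff (ldiff Phi) s = 0.
Proof.
elim: s Phi => [//|x s IH] Phi /=.
have -> : lcons x (ldiff Phi) = Phi \- ldiff (lcons x Phi) by [].
by rewrite ldiffB /= IH subr0 subrr.
Qed.

Lemma eq_ldiff Phi Psi v :
  (forall w, (size w).+1 = size v -> {subset w <= v} ->
     Phi w = Psi w) -> ldiff Phi v = ldiff Psi v.
Proof.
elim: v Phi Psi => [//|x v IH] Phi Psi eqP /=.
rewrite eqP //; last by move=> y yv; rewrite inE yv orbT.
congr (_ - _); apply: IH => w sw wv; apply: eqP; first by rewrite /= sw.
by move=> y; rewrite !inE => /predU1P[->|/wv ->]; rewrite ?eqxx ?orbT.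
Qed.

(** The dual of an augmentation-preserving chain map on ordered chains; [chain_nil] is the condition
    on the augmentation. *)
Record chainOp (O : (seq W -> F) -> seq W -> F) : Prop := ChainOp {
  chainB : forall Phi Psi, O (Phi \- Psi) = O Phi \- O Psi;
  chain_diff : forall Phi, O (ldiff Phi) = ldiff (O Phi);
  chain_nil : forall Phi, O Phi [::] = Phi [::] }.

Fixpoint lhtp (O O' : (seq W -> F) -> seq W -> F) Phi s : F :=
  if s is x :: s' then
    O' (lcons x Phi) s - O (lcons x Phi) s - lhtp O O' (lcons x Phi) s'
  else 0.

Lemma lhtpB O O' Phi Psi : chainOp O -> chainOp O' ->
  lhtp O O' (Phi \- Psi) = lhtp O O' Phi \- lhtp O O' Psi.
Proof.
move=> cO cO'; apply/funext => s; elim: s Phi Psi => [|x s IH] Phi Psi /=.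
  by rewrite subr0.
have -> : lcons x (Phi \- Psi) = lcons x Phi \- lcons x Psi by [].
by rewrite IH (chainB cO) (chainB cO') /=; fring F.
Qed.

(* The recursion is the cone from the first point applied to the usual formula *)
(* for the homotopy between two augmentation preserving chain maps.             *)
Lemma lhtpP O O' Phi : chainOp O -> chainOp O' ->
  forall s, ldiff (lhtp O O' Phi) s + lhtp O O' (ldiff Phi) s = O' Phi s - O Phi s.
Proof.
move=> cO cO' s; elim: s Phi => [|x s IH] Phi.
  by rewrite /= addr0 (chain_nil cO) (chain_nil cO') subrr.
have E1 : lcons x (ldiff Phi) = Phi \- ldiff (lcons x Phi) by [].
have E2 : lcons x (lhtp O O' Phi) =
  (lcons x (O' (lcons x Phi)) \- lcons x (O (lcons x Phi)))
    \- lhtp O O' (lcons x Phi) by [].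
rewrite [lhtp _ _ (ldiff Phi) _]/= E1 lhtpB //.
rewrite [ldiff (lhtp _ _ Phi) _]/= E2 !ldiffB /=.
rewrite !(chainB cO') !(chainB cO) !(chain_diff cO') !(chain_diff cO) /=.
have /(canRL (addrK _)) -> := IH (lcons x Phi).
by fring F.
Qed.

Lemma chainOp_id : chainOp id.
Proof. by split. Qed.

Lemma chainOp_comp O O' : chainOp O -> chainOp O' -> chainOp (O \o O').
Proof.
move=> cO cO'; split=> [Phi Psi|Phi|Phi] /=.
- by rewrite (chainB cO') (chainB cO).
- by rewrite (chain_diff cO') (chain_diff cO).
- by rewrite (chain_nil cO) (chain_nil cO').
Qed.

Lemma chainOp_iter O N : chainOp O -> chainOp (iter N O).
Proof. by move=> cO; elim: N => [|N IH]; [exact: chainOp_id | exact: chainOp_comp]. Qed.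

Lemma chainOp_map (f : W -> W) : chainOp (fun Phi s => Phi (map f s)).
Proof.
split=> // Phi; apply/funext => s; elim: s Phi => [//|x s IH] Phi /=.
by rewrite (IH (lcons (f x) Phi)).
Qed.

(** Singular simplices will be extended off the standard simplex by a retraction, which is not
    natural there. Locality ensures that an operator sees only the part of a cochain inside the
    simplex. *)
Definition localOp (Q : W -> Prop) O := forall Phi Psi,
  (forall w, (forall x, x \in w -> Q x) -> Phi w = Psi w) ->
  forall v, (forall x, x \in v -> Q x) -> O Phi v = O Psi v :> F.

Lemma localOp_iter Q O N : localOp Q O -> localOp Q (iter N O).
Proof.
move=> lO; elim: N => [|N IH] Phi Psi e v Qv; first exact: e.
by apply: (lO _ _ _ v Qv) => w Qw; exact: IH.
Qed.

Lemma localOp_lhtp Q O O' : localOp Q O -> localOp Q O' -> localOp Q (lhtp O O').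
Proof.
move=> lO lO' Phi Psi e v; elim: v Phi Psi e => [//|x v IH] Phi Psi e Qv /=.
have Qx : Q x by apply: Qv; rewrite mem_head.
have e' w : (forall x, x \in w -> Q x) -> lcons x Phi w = lcons x Psi w.
  by move=> Qw; apply: e => y; rewrite inE => /predU1P[->|/Qw].
rewrite (lO _ _ e') // (lO' _ _ e') // (IH _ _ e') // => y yv.
by apply: Qv; rewrite inE yv orbT.
Qed.

Variable b : seq W -> W.

Fixpoint lsd_rec n Phi v : F :=
  if n is n'.+1 then ldiff (lsd_rec n' (lcons (b v) Phi)) v else Phi [::].

(* Barycentric subdivision: the cone from b v on the subdivided boundary of v. *)
Definition lsd Phi v : F := lsd_rec (size v) Phi v.

Lemma lsdE Phi v : (0 < size v)%N -> lsd Phi v = ldiff (lsd (lcons (b v) Phi)) v.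
Proof.
case: v => // x v _.
by apply: (@eq_ldiff _ _ (x :: v)) => w [] sw _; rewrite /lsd sw.
Qed.

Lemma chainOp_lsd : chainOp lsd.
Proof.
have sB Phi Psi : lsd (Phi \- Psi) = lsd Phi \- lsd Psi.
  apply/funext => v; rewrite /lsd /=; move: (size v) => k; elim: k v Phi Psi => [//|k IH] v Phi Psi /=.
  rewrite -[RHS]/((ldiff _ \- ldiff _) v) -ldiffB; congr (ldiff _ v).
  by apply/funext => w; rewrite /= -IH.
split=> // Phi; apply/funext => v.
have [k kv] := ubnP (size v); elim: k v kv Phi => // k IH v kv Phi.
case: (posnP (size v)) => [/size0nil -> //|v0].
rewrite lsdE //.
have -> : lcons (b v) (ldiff Phi) = Phi \- ldiff (lcons (b v) Phi) by [].
rewrite sB ldiffB /=.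
rewrite (@eq_ldiff (lsd (ldiff _)) (ldiff (lsd (lcons (b v) Phi)))); last first.
  by move=> w wv _; apply: IH; lia.
by rewrite ldiff_ldiff subr0.
Qed.

Lemma localOp_lsd Q :
  (forall w, (0 < size w)%N -> (forall x, x \in w -> Q x) -> Q (b w)) -> localOp Q lsd.
Proof.
move=> Qb Phi Psi e v; have [k] := ubnP (size v).
elim: k v Phi Psi e => // k IH v Phi Psi e kv Qv.
have [/size0nil ->|v0] := posnP (size v); first exact: e.
rewrite !lsdE //; apply: eq_ldiff => w wv sw; apply: IH; last by move=> x /sw /Qv.
  by move=> u Qu; apply: e => y; rewrite inE => /predU1P[->|/Qu //]; exact: Qb.
by lia.
Qed.

End ListCochains.

Lemma ldiff_map (W W' : eqType) (F : fieldType) (a : W -> W') (Phi : seq W' -> F) v :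
  ldiff Phi (map a v) = ldiff (Phi \o map a) v.
Proof. by elim: v Phi => [//|x v IH] Phi /=; rewrite IH. Qed.

Lemma lsd_map (W W' : eqType) (F : fieldType) (b : seq W -> W) (b' : seq W' -> W')
    (a : W -> W') (Phi : seq W' -> F) v :
  (forall w, (0 < size w)%N -> a (b w) = b' (map a w)) ->
  lsd b' Phi (map a v) = lsd b (Phi \o map a) v.
Proof.
move=> ab; have [k] := ubnP (size v); elim: k v Phi => // k IH v Phi kv.
have [/size0nil ->//|v0] := posnP (size v).
rewrite !lsdE ?size_map // ldiff_map; apply: eq_ldiff => w wv _ /=.
rewrite IH; last by lia.
congr (lsd b _ w); apply/funext => u.
by rewrite /lcons /= ab.
Qed.

Lemma iter_map (W W' : eqType) (F : fieldType) (O : (seq W -> F) -> seq W -> F)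
    (O' : (seq W' -> F) -> seq W' -> F) (a : W -> W') N :
  (forall Phi v, O' Phi (map a v) = O (Phi \o map a) v) ->
  forall Phi v, iter N O' Phi (map a v) = iter N O (Phi \o map a) v.
Proof.
move=> OO'; elim: N => [//|N IH] Phi v /=; rewrite OO'; congr (O _ v).
by apply/funext => u /=; exact: IH.
Qed.

Lemma lhtp_map (W W' : eqType) (F : fieldType) (O1 O2 : (seq W -> F) -> seq W -> F)
    (O1' O2' : (seq W' -> F) -> seq W' -> F) (a : W -> W') :
  (forall Phi v, O1' Phi (map a v) = O1 (Phi \o map a) v) ->
  (forall Phi v, O2' Phi (map a v) = O2 (Phi \o map a) v) ->
  forall Phi v, lhtp O1' O2' Phi (map a v) = lhtp O1 O2 (Phi \o map a) v.
Proof.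
move=> e1 e2 Phi v; elim: v Phi => [//|x v IH] Phi /=.
by rewrite -[a x :: _]/(map a (x :: v)) e1 e2 IH.
Qed.

(** * Barycentric subdivision in normed spaces *)
Section Mesh.
Variables (R : realType) (W : normedModType R) (F : fieldType).
Implicit Types (Phi : seq W -> F) (v w : seq W).

Definition bary v : W := (size v)%:R^-1 *: \sum_(x <- v) x.

Lemma bary_const (v : seq W) (c : W) : (0 < size v)%N ->
  (size v)%:R^-1 *: \sum_(y <- v) c = c.
Proof.
move=> v0; have -> : \sum_(y <- v) c = (size v)%:R *: c.
  by rewrite big_const_seq count_predT iter_addr addr0 scaler_nat.
by rewrite scalerA mulVf ?scale1r // pnatr_eq0 -lt0n.
Qed.

Lemma bary_ball (c : W) (rho : R) w : (0 < size w)%N ->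
  (forall x, x \in w -> `|x - c| <= rho) -> `|bary w - c| <= rho.
Proof.
move=> w0 wc; have s0 : 0 < (size w)%:R :> R by rewrite ltr0n.
have -> : bary w - c = (size w)%:R^-1 *: \sum_(x <- w) (x - c).
  by rewrite sumrB scalerBr -/(bary w) bary_const.
rewrite normrZ normfV normr_nat ler_pdivrMl //.
rewrite (le_trans (ler_norm_sum _ _ _)) // mulr_natl.
rewrite big_seq (le_trans (ler_sum _ wc)) // -big_seq.
by rewrite big_const_seq count_predT iter_addr addr0.
Qed.

(** Of the [size v] differences [x - y] the one with [y = x] vanishes; this is the contraction
    factor of subdivision. *)
Lemma bary_vertex (rho : R) v x : x \in v ->
  (forall y z, y \in v -> z \in v -> `|y - z| <= rho) ->
  `|x - bary v| <= (size v).-1%:R / (size v)%:R * rho.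
Proof.
move=> xv vr; have s0 : 0 < (size v)%:R :> R.
  by rewrite ltr0n; case: v xv {vr}.
have -> : x - bary v = (size v)%:R^-1 *: \sum_(y <- v) (x - y).
  by rewrite sumrB scalerBr -/(bary v) bary_const //; case: v xv {vr s0}.
rewrite normrZ normfV normr_nat ler_pdivrMl // mulrA.
rewrite mulrCA divff ?gt_eqF // mulr1.
rewrite (big_rem x) //= subrr add0r mulr_natl.
rewrite (le_trans (ler_norm_sum _ _ _)) //.
rewrite big_seq (@le_trans _ _ (\sum_(y <- rem x v | y \in rem x v) rho)) //.
  by apply: ler_sum => y /mem_rem yv; exact: vr.
by rewrite -big_seq big_const_seq count_predT iter_addr addr0 size_rem.
Qed.

Definition baryClosed (Q : W -> Prop) :=
  forall w, (0 < size w)%N -> (forall x, x \in w -> Q x) -> Q (bary w).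

(** A second-order substitute for the convex hull: it transports the properties that pass to
    barycentres, such as lying in a ball or in the standard simplex. *)
Definition inHull v w := forall Q, baryClosed Q ->
  (forall x, x \in v -> Q x) -> forall x, x \in w -> Q x.

Definition meshle (r : R) v := forall x y, x \in v -> y \in v -> `|x - y| <= r.

(** The dual form of the fact that subdividing [v] yields simplices of smaller mesh: what vanishes
    on those vanishes on the subdivision. A list of the subdivision consists of [bary v] and a list
    from the subdivided boundary; [bary_vertex] bounds the distances to the former, the induction
    those within the latter. *)
Lemma lsd_mesh k v r Phi : size v = k.+1 -> meshle r v ->
  (forall w, size w = k.+1 -> inHull v w -> meshle (k%:R / k.+1%:R * r) w ->
     Phi w = 0) ->
  lsd bary Phi v = 0.
Proof.
elim: k v Phi => [|k IH] v Phi sv vr Phi0.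
  rewrite lsdE ?sv //; case: v sv vr Phi0 => [//|x [|//]] _ _ Phi0 /=.
  rewrite /lsd /= subr0 /lcons; apply: Phi0 => //.
    by move=> Q Qb Qv y; rewrite mem_seq1 => /eqP ->; exact: Qb.
  by move=> y z; rewrite !mem_seq1 => /eqP -> /eqP ->; rewrite subrr normr0 !mul0r.
have r0 : 0 <= r.
  case: v sv vr {Phi0} => [//|x v] _ /(_ x x); rewrite mem_head subrr normr0; exact.
rewrite lsdE ?sv // (@eq_ldiff _ _ _ (fun=> 0)); last first.
  move=> u; rewrite sv => -[su] uv; apply: IH => // [x y /uv xv /uv yv|w sw uw ww].
    exact: vr.
  apply: Phi0 => [|Q Qb Qv x|]; first by rewrite /= sw.
    rewrite inE => /predU1P[->|]; first by apply: Qb => //; rewrite sv.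
    by apply: uw => // y /uv /Qv.
  have le_th : k%:R / k.+1%:R * r <= k.+1%:R / k.+2%:R * r :> R.
    rewrite ler_wpM2r // ler_pdivrMr ?ltr0n // mulrAC ler_pdivlMr ?ltr0n //.
    by rewrite -!natrM ler_nat; lia.
  have bw x : x \in w -> `|x - bary v| <= k.+1%:R / k.+2%:R * r.
    apply: (uw (fun x => `|x - bary v| <= k.+1%:R / k.+2%:R * r)).
      by move=> z z0 zQ; exact: bary_ball.
    by move=> y /uv yv; have := bary_vertex yv vr; rewrite sv.
  move=> x y; rewrite !inE => /predU1P[->|xw] /predU1P[->|yw].
  - by rewrite subrr normr0 mulr_ge0 // divr_ge0.
  - by rewrite distrC; exact: bw.
  - exact: bw.
  - by apply: le_trans le_th; exact: ww.
exact: ldiff0.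
Qed.

Lemma lsd_iter_mesh k N v r Phi : size v = k.+1 -> meshle r v ->
  (forall w, size w = k.+1 -> inHull v w -> meshle ((k%:R / k.+1%:R) ^+ N * r) w ->
     Phi w = 0) ->
  iter N (lsd bary) Phi v = 0.
Proof.
elim: N v r => [|N IH] v r sv vr Phi0.
  by apply: Phi0 => [//|Q _ Qv //|]; rewrite expr0 mul1r.
rewrite iterS; apply: (lsd_mesh sv vr) => w sw vw wr; apply: (IH _ _ sw wr).
move=> u su wu ur; apply: Phi0 => [//|Q Qb Qv|]; first exact: wu Qb (vw Q Qb Qv).
by rewrite exprSr -mulrA.
Qed.

End Mesh.

Lemma bary_linear (R : realType) (W W' : normedModType R) (a : {linear W -> W'}) w :
  a (bary w) = bary (map a w).
Proof.
by rewrite /bary linearZ_LR linear_sum size_map big_map.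
Qed.

(** * Affine simplices *)
Section Affine.
Variables (R : realType) (W : normedModType R).
Implicit Types (w : seq W).

Definition affine l w (t : Delta R l) : W := \sum_(i < l.+1) val t 0 i *: nth 0 w i.

Lemma Delta_coord_continuous l i : continuous (fun t : Delta R l => val t 0 i).
Proof.
move=> t; apply: (@continuous_comp (Delta R l) 'rV[R]_l.+1 R set_val (fun x => x 0 i)).
  exact: initial_continuous.
exact: coord_continuous.
Qed.

Lemma continuous_sum (T : topologicalType) (I : finType) (f : I -> T -> W) :
  (forall i, continuous (f i)) -> continuous (fun x => \sum_i f i x).
Proof.
by move=> fc; apply: continuous_big => [|i _]; [exact: add_continuous | exact: fc].
Qed.

Lemma affine_continuous l w : continuous (@affine l w).
Proof.
apply: continuous_sum => i t.
apply: (@continuousZr_tmp _ _ _ (fun t : Delta R l => val t 0 i)).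
exact: Delta_coord_continuous.
Qed.
HB.instance Definition _ l w :=
  isContinuous.Build _ _ (@affine l w) (@affine_continuous l w).

Variable V : topologicalType.

Definition affSimplex (G : continuousType W V) l w : sing R V l := G \o @affine l w.

Lemma affine_push k l (u : 'I_k.+1 -> 'I_l.+1) w w' (t : Delta R k) :
  (forall i : 'I_k.+1, nth 0 w' i = nth 0 w (u i)) -> affine w (push u t) = affine w' t.
Proof.
move=> ww; rewrite /affine /= (partition_big u xpredT) //=.
apply: eq_bigr => j _; rewrite mxE scaler_suml.
by apply: eq_bigr => i /eqP <-; rewrite ww.
Qed.

Lemma affSimplex_sact (G : continuousType W V) k l (u : 'I_k.+1 -> 'I_l.+1) w w' :
  (forall i : 'I_k.+1, nth 0 w' i = nth 0 w (u i)) ->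
  sact u (affSimplex G l w) = affSimplex G k w'.
Proof. by move=> ww; apply/continuousEP => t /=; rewrite (affine_push _ ww). Qed.

Variable F : fieldType.

(** The value [0] on lists of the wrong length makes [ldiff_listCochain] an identity on all
    lists. *)
Definition listCochain (G : continuousType W V) k (phi : cochain F (sing R V) k)
  (w : seq W) : F := if size w == k.+1 then phi (affSimplex G k w) else 0.

Definition rmnth (h : nat) w := take h w ++ drop h.+1 w.

Lemma nth_rmnth h w i : (h < size w)%N -> nth 0 (rmnth h w) i = nth 0 w (bump h i).
Proof.
move=> hw; rewrite nth_cat size_take hw /bump; case: (ltnP i h) => ih; first by rewrite nth_take.
by rewrite nth_drop add1n addSn subnKC.
Qed.

Lemma ldiffE (Phi : seq W -> F) w :
  ldiff Phi w = \sum_(h < size w) (-1) ^+ h * Phi (rmnth h w).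
Proof.
elim: w Phi => [|x w IH] Phi /=; first by rewrite big_ord0.
rewrite big_ord_recl expr0 mul1r /rmnth /= drop0; congr (_ + _).
rewrite IH -sumrN; apply: eq_bigr => h _.
by rewrite /= /bump /= add1n exprS mulN1r mulNr.
Qed.

Lemma ldiff_listCochain (G : continuousType W V) k (phi : cochain F (sing R V) k) :
  ldiff (listCochain G phi) = listCochain G (codiff phi).
Proof.
apply/funext => w; rewrite ldiffE /listCochain; case: eqP => [sw|nw].
  rewrite sw; apply: eq_bigr => h _.
  have sr : size (rmnth h w) = k.+1.
    by have := ltn_ord h => hk; rewrite size_cat size_take size_drop sw hk; lia.
  rewrite sr eqxx; congr (_ * phi _); symmetry.
  by apply: affSimplex_sact => i; rewrite nth_rmnth // sw.
rewrite big1 // => h _; rewrite ifF ?mulr0 //.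
by have := ltn_ord h => hk; rewrite size_cat size_take size_drop hk; lia.
Qed.

End Affine.

(** * A retraction onto the standard simplex *)
Section Retraction.
Variable R : realType.

Lemma row_continuous (T : topologicalType) l (f : T -> 'rV[R]_l) :
  (forall j, continuous (fun x => f x 0 j)) -> continuous f.
Proof.
move=> fc x U [P xP sPU].
suff : nbhs x [set y | forall i j, P i j (f y i j)].
  by apply: filterS => y Py; exact: sPU.
have nF : Filter (nbhs x) by exact: nbhs_filter.
apply: (@filter_forall _ _ (fun i y => forall j, P i j (f y i j)) _ nF) => i.
apply: (@filter_forall _ _ (fun j y => P i j (f y i j)) _ nF) => j.
by rewrite !ord1; apply: fc; exact: xP.
Qed.

Definition posSum l (x : 'rV[R]_l) : R := \sum_i Num.max 0 (x 0 i).

(** Negative coordinates are cut off, a sum below [1] is filled up evenly, a sum above [1] is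
    divided out. Composed with this retraction a singular simplex becomes a map on the whole vector
    space, where affine simplices with arbitrary vertices make sense. *)
Definition retractRow k (x : 'rV[R]_k.+1) : 'rV[R]_k.+1 :=
  \row_i ((Num.max 0 (x 0 i) + Num.max 0 (1 - posSum x) / k.+1%:R)
    / Num.max 1 (posSum x)).

Lemma retractRow_simplex k (x : 'rV[R]_k.+1) : retractRow x \in @stdSimplex R k.
Proof.
have m0 : 0 < Num.max 1 (posSum x) by rewrite lt_max ltr01.
apply/mem_set; split=> [i|].
  by rewrite mxE divr_ge0 ?(ltW m0) // addr_ge0 ?divr_ge0 // le_max lexx.
under eq_bigr do rewrite mxE.
rewrite -mulr_suml big_split /= -/(posSum x) sumr_const card_ord -[(_ / _) *+ _]mulr_natr.
rewrite divfK ?pnatr_eq0 //.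
have -> : posSum x + Num.max 0 (1 - posSum x) = Num.max 1 (posSum x).
  by rewrite !maxEle subr_ge0; case: ifP => ?; case: ifP => ?; lra.
by rewrite divff // gt_eqF.
Qed.

Definition retract k (x : 'rV[R]_k.+1) : Delta R k :=
  exist (fun t => t \in @stdSimplex R k) _ (retractRow_simplex x).

Lemma retractK k (t : Delta R k) : retract (val t) = t.
Proof.
apply/val_inj/rowP => i; rewrite mxE; case: t => t /= /set_mem [t0 t1].
have tE j : Num.max 0 (t 0 j) = t 0 j by rewrite max_r.
have -> : posSum t = 1 by rewrite -t1; apply: eq_bigr.
by rewrite tE subrr !maxxx mul0r addr0 divr1.
Qed.

Lemma retract_id k (x : 'rV[R]_k.+1) : @stdSimplex R k x -> val (retract x) = x.
Proof. by move=> /mem_set xS; have /(congr1 val) := retractK (exist _ x xS). Qed.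

Lemma maxl_continuous (T : topologicalType) (c : R) (f : T -> R) :
  continuous f -> continuous (fun x => Num.max c (f x)).
Proof.
by move=> fc x; apply: (@continuous_max R T (fun=> c) f); [exact: cvg_cst | exact: fc].
Qed.

Lemma posSum_continuous l : continuous (@posSum l).
Proof.
apply: (@continuous_sum R R^o) => i; apply: maxl_continuous; exact: coord_continuous.
Qed.

Lemma retract_continuous k : continuous (@retract k).
Proof.
apply: continuous_comp_initial; apply: row_continuous => i.
rewrite (_ : (fun _ => _) = fun x : 'rV[R]_k.+1 =>
   ((Num.max 0 (x 0 i) + Num.max 0 (1 - posSum x) / k.+1%:R)
    / Num.max 1 (posSum x))); last by apply/funext => x; rewrite /= mxE.
have c1 : continuous (fun x : 'rV[R]_k.+1 => Num.max 1 (posSum x)).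
  by apply: maxl_continuous; exact: posSum_continuous.
have c2 : continuous (fun x : 'rV[R]_k.+1 => Num.max 0 (x 0 i)).
  by apply: maxl_continuous; exact: coord_continuous.
have c3 : continuous (fun x : 'rV[R]_k.+1 => Num.max 0 (1 - posSum x)).
  apply: maxl_continuous => x; apply: (@cvgB R R^o _ (nbhs x)); first exact: cvg_cst.
  exact: posSum_continuous.
move=> x; apply: (@cvgM R _ (nbhs x)); last first.
  apply: (@cvgV R _ (nbhs x)); last exact: c1.
  by rewrite gt_eqF // lt_max ltr01.
apply: (@cvgD _ R^o _ (nbhs x)); first exact: c2.
by apply: (@cvgMr_tmp R _ (nbhs x)); exact: c3.
Qed.
HB.instance Definition _ k :=
  isContinuous.Build _ _ (@retract k) (@retract_continuous k).

End Retraction.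

(** * Lebesgue numbers and compactness of the standard simplex *)

Section Lebesgue.
Variables (R : realType) (W : normedModType R).

(** Stated for a property inherited by subsets instead of a cover, because it serves both for pairs
    of open sets ([fine_exists]) and for evenly covered sets ([even_lebesgue]). *)
Lemma lebesgue_number (K : set W) (P : set W -> Prop) : compact K ->
  (forall A B, A `<=` B -> P B -> P A) ->
  (forall x, K x -> exists2 e : R, 0 < e & P (ball x e)) ->
  exists2 e : R, 0 < e & forall x, K x -> P (ball x e).
Proof.
move=> /compact_near_coveringP cK Pmono Ploc.
have : \forall e \near 0^'+, K `<=` (fun x => P (ball x e)).
  apply: cK => x Kx; have [e e0 Pe] := Ploc _ Kx.
  exists (ball x (e / 2), [set d | d < e / 2]) => /=.
    split; first by apply: nbhsx_ballx; rewrite divr_gt0.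
    by apply: nbhs_right_lt; rewrite divr_gt0.
  move=> [y d] /= [xy de]; apply: Pmono Pe => z yz.
  by rewrite [e]splitr; apply: ball_triangle xy _; apply: le_ball yz; exact: ltW.
move=> H; near (0 : R)^'+ => e; exists e; first by near: e; exact: nbhs_right_gt.
by near: e.
Unshelve. all: by end_near.
Qed.

Lemma stdSimplex_compact k : compact (@stdSimplex R k).
Proof.
have K : compact [set t : 'rV[R]_k.+1 | forall i, `[0, 1]%classic (t 0 i)].
  by apply: (@rV_compact R _ (fun=> `[0, 1]%classic)) => i; exact: segment_compact.
apply: subclosed_compact K _.
  have -> : @stdSimplex R k =
      \bigcap_(i in setT) [set t | 0 <= t 0 i] `&` [set t | \sum_i t 0 i = 1].
    apply/seteqP; split=> t /= [t0 t1]; split=> //; first by move=> i _; exact: t0.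
    by move=> i; exact: t0.
  apply: closedI.
    apply: closed_bigI => i _.
    apply: (@closed_comp _ _ (fun t : 'rV[R]_k.+1 => t 0 i) [set x | 0 <= x]).
      by move=> t _; exact: coord_continuous.
    exact: closed_ge.
  apply: (@closed_comp _ _ (fun t : 'rV[R]_k.+1 => \sum_i t 0 i) [set x | x = 1]).
    move=> t _; apply: (@continuous_sum R R^o) => i; exact: coord_continuous.
  exact: closed_eq.
move=> t /= [t0 t1] i; rewrite /= in_itv /= t0 /= -t1 (bigD1 i) //= lerDl.
by rewrite sumr_ge0.
Qed.

Lemma affine_stdSimplex m l (w : seq 'rV[R]_m.+1) (t : Delta R l) :
  size w = l.+1 -> (forall x, x \in w -> @stdSimplex R m x) ->
  @stdSimplex R m (affine w t).
Proof.
move=> sw wS; have nS (i : 'I_l.+1) : @stdSimplex R m (nth 0 w i).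
  by apply/wS/mem_nth; rewrite sw.
have [t0 t1] := set_mem (valP t); split=> [j|].
  rewrite /affine summxE sumr_ge0 // => i _; rewrite mxE mulr_ge0 //.
  by case: (nS i).
rewrite /affine; under eq_bigr do rewrite summxE.
rewrite exchange_big /= -[RHS]t1; apply: eq_bigr => i _.
under eq_bigr do rewrite mxE.
by rewrite -mulr_sumr; case: (nS i) => _ ->; rewrite mulr1.
Qed.

Lemma affine_near l (w : seq W) (t : Delta R l) (r : R) : size w = l.+1 ->
  meshle r w -> `|affine w t - nth 0 w 0| <= r.
Proof.
move=> sw wr; have [t0 t1] := set_mem (valP t).
have -> : affine w t - nth 0 w 0 =
    \sum_(i < l.+1) val t 0 i *: (nth 0 w i - nth 0 w 0).
  rewrite /affine /=; under [RHS]eq_bigr do rewrite scalerBr.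
  by rewrite sumrB -scaler_suml t1 scale1r.
rewrite -[r]mul1r -t1 mulr_suml (le_trans (ler_norm_sum _ _ _)) //.
apply: ler_sum => i _; rewrite normrZ ger0_norm // ler_wpM2l //.
by apply: wr; apply: mem_nth; rewrite sw.
Qed.

End Lebesgue.

(** * Operators on singular cochains *)
Section SingularOperators.
Variables (R : realType) (F : fieldType).

Definition stdBasis k : seq 'rV[R]_k.+1 := [seq delta_mx 0 i | i <- enum 'I_k.+1].

Lemma size_stdBasis k : size (stdBasis k) = k.+1.
Proof. by rewrite size_map size_enum_ord. Qed.

Lemma nth_basis k (i : 'I_k.+1) : nth 0 (stdBasis k) i = delta_mx 0 i.
Proof. by rewrite (nth_map ord0) ?size_enum_ord // nth_ord_enum. Qed.

Lemma affine_basis k (t : Delta R k) : affine (stdBasis k) t = val t.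
Proof.
rewrite [RHS]row_sum_delta; apply: eq_bigr => i _; by rewrite nth_basis.
Qed.

Lemma basis_stdSimplex k x : x \in stdBasis k -> @stdSimplex R k x.
Proof.
move=> /mapP[i _ ->]; split=> [j|]; first by rewrite mxE eqxx ler0n.
rewrite (bigD1 i) //= mxE !eqxx big1 ?addr0 // => j /negbTE ji.
by rewrite mxE ji.
Qed.

Definition pushMx k l (u : 'I_k.+1 -> 'I_l.+1) : 'M[R]_(k.+1, l.+1) :=
  \matrix_(i, j) (u i == j)%:R.

Definition pushL k l (u : 'I_k.+1 -> 'I_l.+1) : {linear 'rV[R]_k.+1 -> 'rV[R]_l.+1} :=
  mulmxr (pushMx u).

Lemma pushLE k l (u : 'I_k.+1 -> 'I_l.+1) x : pushL u x = push_row u x.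
Proof.
apply/rowP => j; rewrite !mxE [RHS]big_mkcond; apply: eq_bigr => i _.
by rewrite mxE; case: eqP; rewrite ?mulr1 ?mulr0.
Qed.

Lemma pushL_basis k l (u : 'I_k.+1 -> 'I_l.+1) i :
  pushL u (delta_mx 0 i) = delta_mx 0 (u i).
Proof.
by apply/rowP => j; rewrite /= -rowE !mxE eqxx eq_sym.
Qed.

Variable V : topologicalType.
Implicit Types (k l : nat).

Definition hat k (s : sing R V k) : continuousType 'rV[R]_k.+1 V :=
  (s : continuousType (Delta R k) V) \o @retract R k.

Lemma hat_basis k (s : sing R V k) : affSimplex (hat s) k (stdBasis k) = s.
Proof.
apply/continuousEP => t /=; congr (s _).
by apply/val_inj; rewrite affine_basis retractK.
Qed.

Definition listOps := forall k, (seq 'rV[R]_k.+1 -> F) -> seq 'rV[R]_k.+1 -> F.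

Record naturalOps (O : listOps) : Prop := NaturalOps {
  opsLocal : forall k, localOp (@stdSimplex R k) (@O k);
  opsNat : forall k l (a : {linear 'rV[R]_k.+1 -> 'rV[R]_l.+1}) Phi v,
    O l Phi (map a v) = O k (Phi \o map a) v }.

(** The method of acyclic models: an operator on lists is evaluated on the vertices of the standard
    simplex and carried along [s]. Naturality and locality make the result compatible with faces. *)
Definition singOp (O : listOps) j (phi : cochain F (sing R V) j) k (s : sing R V k) : F :=
  O k (listCochain (hat s) phi) (stdBasis k).

(** [retract] is compatible with [push_row] on the standard simplex but not off it, whence the
    restriction on [w]. *)
Lemma listCochain_sact j (phi : cochain F (sing R V) j) k l
    (u : 'I_k.+1 -> 'I_l.+1) (s : sing R V l) w :
  (forall x, x \in w -> @stdSimplex R k x) ->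
  listCochain (hat (sact u s : sing R V k)) phi w =
  listCochain (hat s) phi (map (pushL u) w).
Proof.
move=> wS; rewrite /listCochain size_map; case: eqP => // sw.
congr (phi _); apply/continuousEP => t; rewrite /= /sing_act /=; congr (s _).
have aS := affine_stdSimplex t sw wS.
have E : pushL u (affine w t) = affine (map (pushL u) w) t.
  rewrite /affine linear_sum; apply: eq_bigr => i _.
  by rewrite linearZ_LR (nth_map 0) // sw.
apply: val_inj; rewrite -[LHS]/(push_row u (val (retract (affine w t)))).
rewrite (retract_id aS) -pushLE; symmetry; rewrite E; apply: retract_id; rewrite -E.
rewrite pushLE.
exact: set_mem (push_stdSimplex u (exist (fun t => t \in @stdSimplex R k) _ (mem_set aS) : Delta R k)).
Qed.

Lemma singOp_sact (O : listOps) (nO : naturalOps O) j (phi : cochain F (sing R V) j) k l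
    (u : 'I_k.+1 -> 'I_l.+1) (s : sing R V l) :
  singOp O phi (sact u s : sing R V k) =
  O l (listCochain (hat s) phi) [seq delta_mx 0 (u i) | i <- enum 'I_k.+1].
Proof.
have -> : [seq delta_mx 0 (u i) | i <- enum 'I_k.+1] =
    map (pushL u) (stdBasis k).
  by rewrite -[RHS]map_comp; apply: eq_map => i; rewrite -pushL_basis.
rewrite (opsNat nO); apply: (opsLocal nO); last exact: basis_stdSimplex.
by move=> w wS; exact: listCochain_sact.
Qed.

Lemma codiff_singOp (O : listOps) (nO : naturalOps O) j (phi : cochain F (sing R V) j) k
    (s : sing R V k.+1) :
  codiff (fun s : sing R V k => singOp O phi s : F^o) s =
  ldiff (O k.+1 (listCochain (hat s) phi)) (stdBasis k.+1).
Proof.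
rewrite ldiffE size_stdBasis; apply: eq_bigr => h _; congr (_ * _).
rewrite singOp_sact //; congr (O _ _ _); apply: (@eq_from_nth _ 0).
  rewrite size_map size_enum_ord size_cat size_take size_drop size_stdBasis.
  by rewrite ltn_ord; have := ltn_ord h; lia.
move=> i; rewrite size_map size_enum_ord => ik.
rewrite (nth_map ord0) ?size_enum_ord // nth_rmnth ?size_stdBasis //.
by rewrite -[i]/(nat_of_ord (Ordinal ik)) nth_ord_enum -nth_basis.
Qed.

End SingularOperators.

Arguments pushL : simpl never.

(** * Small simplices *)
Section Subdivision.
Variables (R : realType) (F : fieldType).

Add Ring Fring : (field_ring_theory F).

Lemma baryClosed_stdSimplex k : baryClosed (@stdSimplex R k).
Proof.
move=> w w0 wS; have s0 : (size w)%:R != 0 :> R by rewrite pnatr_eq0 -lt0n.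
have bE j : bary w 0 j = (size w)%:R^-1 * \sum_(x <- w) x 0 j.
  by rewrite /bary mxE summxE.
split=> [j|].
  rewrite bE mulr_ge0 ?invr_ge0 // big_seq sumr_ge0 // => x /wS [x0 _].
  exact: x0.
under eq_bigr do rewrite bE.
rewrite -mulr_sumr exchange_big /= big_seq (eq_bigr (fun=> 1)).
  by rewrite -big_seq big_const_seq count_predT iter_addr addr0 mulVf.
by move=> x /wS [].
Qed.

Lemma simplex_meshle k (w : seq 'rV[R]_k.+1) :
  (forall x, x \in w -> @stdSimplex R k x) -> meshle 2 w.
Proof.
move=> wS x y /wS [x0 x1] /wS [y0 y1].
rewrite [`|_|]mx_normrE; apply/bigmax_leP; split=> // -[i j] _ /=.
rewrite !mxE (le_trans (ler_normB _ _)) // !ord1 !ger0_norm // -[2]/(1 + 1).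
have le1 (z : 'rV[R]_k.+1) : (forall i, 0 <= z 0 i) -> \sum_i z 0 i = 1 -> z 0 j <= 1.
  by move=> z0 <-; rewrite (bigD1 j) //= lerDl sumr_ge0.
by rewrite lerD // le1.
Qed.

Section Lists.
Variable k : nat.
Notation W := 'rV[R]_k.+1.
Implicit Types (Phi Psi : seq W -> F).

Definition sd : (seq W -> F) -> seq W -> F := lsd (@bary R W).
Definition sdT : (seq W -> F) -> seq W -> F := lhtp id sd.

(** The telescoping sum of the homotopies between consecutive subdivisions, from the identity to the
    [M]-th one. *)
Fixpoint sdHtp M Phi v : F :=
  if M is M'.+1 then sdHtp M' Phi v + sdT (iter M' sd Phi) v else 0.

Lemma chainOp_sd : chainOp sd. Proof. exact: chainOp_lsd. Qed.

Lemma ldiffD Phi Psi : ldiff (fun v => Phi v + Psi v) = fun v => ldiff Phi v + ldiff Psi v.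
Proof.
have -> : (fun v => Phi v + Psi v) = Phi \- ((fun=> 0) \- Psi).
  by apply/funext => v /=; rewrite sub0r opprK.
rewrite !ldiffB; apply/funext => v /=.
by rewrite ldiff0 sub0r opprK.
Qed.

Lemma iter_sd_diff M Phi : iter M sd (ldiff Phi) = ldiff (iter M sd Phi).
Proof. by rewrite (chain_diff (chainOp_iter M chainOp_sd)). Qed.

Lemma sdHtpP M Phi v :
  ldiff (sdHtp M Phi) v + sdHtp M (ldiff Phi) v = iter M sd Phi v - Phi v.
Proof.
elim: M => [|M IH]; first by rewrite ldiff0 subrr addr0.
have -> : ldiff (sdHtp M.+1 Phi) v = ldiff (sdHtp M Phi) v + ldiff (sdT (iter M sd Phi)) v.
  exact: (congr1 (fun f => f v) (ldiffD _ _)).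
rewrite /= iter_sd_diff.
have := lhtpP (iter M sd Phi) (chainOp_id _ _) chainOp_sd v.
move=> E; have key (a b c d e f g : F) :
    a + b = c - d -> e + f = d - g -> (e + a) + (f + b) = c - g.
  move=> H1 H2; have -> : e + a + (f + b) = (a + b) + (e + f) by fring F.
  by rewrite H1 H2; fring F.
exact: key E IH.
Qed.

Lemma lsd_supp Phi v : (forall w, size w = size v -> Phi w = 0) -> sd Phi v = 0.
Proof.
rewrite /sd; have [m] := ubnP (size v); elim: m v Phi => // m IH v Phi vm Phi0.
have [/size0nil v0|v0] := posnP (size v).
  by rewrite v0 /lsd /=; apply: Phi0; rewrite v0.
rewrite lsdE // (@eq_ldiff _ _ _ (fun=> 0)) ?ldiff0 // => w wv _.
by apply: IH => [|u uw]; [rewrite -ltnS wv | apply: Phi0; rewrite /= uw].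
Qed.

Lemma sd_local : localOp (@stdSimplex R k) sd.
Proof. by apply: localOp_lsd; exact: baryClosed_stdSimplex. Qed.

Lemma sdT_local : localOp (@stdSimplex R k) sdT.
Proof. by apply: localOp_lhtp sd_local => Phi Psi e v vQ; exact: e. Qed.

Lemma sdT0 v : sdT (fun=> 0) v = 0.
Proof.
have := lhtpB (fun=> 0) (fun=> 0) (chainOp_id _ _) chainOp_sd.
move=> /(congr1 (fun f => f v)) /=; rewrite subrr => E; rewrite -[RHS]E.
by congr (lhtp _ _ _ v); apply/funext => u /=; rewrite subrr.
Qed.

Lemma sdHtp_local M : localOp (@stdSimplex R k) (sdHtp M).
Proof.
elim: M => [//|M IH] Phi Psi e v vQ /=; rewrite (IH _ _ e) //.
by congr (_ + _); apply: sdT_local => // w wQ; apply: localOp_iter sd_local _ _ e _ wQ.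
Qed.

Lemma sdHtp0 M v : sdHtp M (fun=> 0) v = 0.
Proof.
elim: M v => [//|M IH] v /=; rewrite IH add0r.
suff -> : iter M sd (fun=> 0) = fun=> 0 by exact: sdT0.
by elim: M {IH} => [//|M /= ->]; apply/funext => u; exact: lsd_supp.
Qed.

End Lists.

Definition sdHomotopy M : listOps R F := fun k => @sdHtp k M.

Lemma sd_map k l (a : {linear 'rV[R]_k.+1 -> 'rV[R]_l.+1}) Phi v :
  @sd l Phi (map a v) = @sd k (Phi \o map a) v.
Proof. by apply: lsd_map => w _; exact: bary_linear. Qed.

Lemma sdHomotopy_natural M : naturalOps (sdHomotopy M).
Proof.
split=> [k|k l a Phi v]; first exact: sdHtp_local.
rewrite /sdHomotopy; elim: M => [//|M IH] /=; rewrite IH; congr (_ + _).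
rewrite /sdT (@lhtp_map _ _ _ id (@sd k) id (@sd l) a) //; last exact: sd_map.
congr (lhtp _ _ _ v); apply/funext => u /=.
by apply: iter_map; exact: sd_map.
Qed.

End Subdivision.

(** * Cochains that vanish on small simplices *)

Section SmallSimplices.
Variables (R : realType) (F : fieldType) (V : topologicalType).

Definition inside (U : set V) k (s : sing R V k) : Prop :=
  forall t, U ((s : continuousType (Delta R k) V) t).

Lemma inside_sact (U : set V) k l (u : 'I_k.+1 -> 'I_l.+1) (s : sing R V l) :
  inside U s -> inside U (sact u s : sing R V k).
Proof. by move=> Us t; exact: Us. Qed.

Lemma inside_hat (U : set V) k (s : sing R V k) l (w : seq 'rV[R]_k.+1) :
  inside U s -> inside U (affSimplex (hat s) l w).
Proof. by move=> Us t; exact: Us. Qed.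

Lemma insideS (U U' : set V) k (s : sing R V k) : U `<=` U' -> inside U s -> inside U' s.
Proof. by move=> UU' Us t; exact/UU'/Us. Qed.

Variables (A B : set V).

Definition smallSimplex k (s : sing R V k) : Prop := inside A s \/ inside B s.

(** The factor [2] bounds the mesh of lists in the standard simplex ([simplex_meshle]) and the ratio
    is the contraction of one subdivision, so the condition covers every [l]-simplex of the [N]-th
    subdivision. *)
Definition fineSub l k (s : sing R V k) (N : nat) : Prop :=
  forall w, size w = l.+1 -> (forall x, x \in w -> @stdSimplex R k x) ->
    meshle ((l%:R / l.+1%:R) ^+ N * 2) w -> smallSimplex (affSimplex (hat s) l w).

Hypotheses (oA : open A) (oB : open B).

Lemma fine_exists l k (s : sing R V k) : inside (A `|` B) s -> exists N, fineSub l s N.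
Proof.
move=> ABs; pose P (Z : set 'rV[R]_k.+1) :=
  (Z `<=` [set x | A (hat s x)]) \/ (Z `<=` [set x | B (hat s x)]).
have [Z Y ZY [YA|YB]|x _|e e0 Pe] := @lebesgue_number R _ _ P (@stdSimplex_compact R k).
- by left; apply: subset_trans YA.
- by right; apply: subset_trans YB.
- have key (C : set V) : open C -> C (hat s x) ->
      exists2 e : R, 0 < e & ball x e `<=` [set x | C (hat s x)].
    move=> oC Cx; have /nbhs_ballP[e /= e0 eC] : nbhs x (hat s @^-1` C).
      by apply: (@cts_fun _ _ (hat s) x); exact: open_nbhs_nbhs.
    by exists e.
  have [As|Bs] := ABs (retract x).
    by have [e e0 eA] := key A oA As; exists e => //; left.
  by have [e e0 eB] := key B oB Bs; exists e => //; right.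
set th : R := l%:R / l.+1%:R.
have th1 : `|th| < 1.
  by rewrite ger0_norm ?divr_ge0 // /th ltr_pdivrMr ?ltr0n // mul1r ltr_nat.
have /cvgrPdist_lt /(_ (e / 2)) := @cvg_expr R th th1.
rewrite divr_gt0 // => /(_ isT) [N _ /(_ N (leqnn N))] /=.
rewrite sub0r normrN ger0_norm; last by rewrite exprn_ge0 // divr_ge0.
rewrite ltr_pdivlMr // => eN; exists N => w sw wS wm.
have sub (C : set V) : ball (nth 0 w 0) e `<=` [set x | C (hat s x)] ->
    inside C (affSimplex (hat s) l w).
  move=> sC t; apply: sC; rewrite -ball_normE /= distrC.
  by apply: le_lt_trans eN; exact: affine_near.
have w0 : nth 0 w 0 \in w by rewrite mem_nth ?sw.
by have [/sub|/sub] := Pe _ (wS _ w0); [left | right].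
Qed.

Lemma fine_sd l k (s : sing R V k) N (phi : cochain F (sing R V) l) j w : fineSub l s N ->
  (forall s' : sing R V l, smallSimplex s' -> phi s' = 0) -> (N <= j)%N ->
  (forall x, x \in w -> @stdSimplex R k x) ->
  iter j (@sd R F k) (listCochain (hat s) phi) w = 0.
Proof.
move=> fs phi0 Nj wS; have [sw|nw] := eqVneq (size w) l.+1; last first.
  elim: j {Nj} w nw {wS} => [|j IH] w nw /=; first by rewrite /listCochain ifN.
  by apply: lsd_supp => u uw; apply: IH; rewrite uw.
apply: (lsd_iter_mesh sw (simplex_meshle wS)) => u su wu um.
rewrite /listCochain su eqxx; apply/phi0/fs => //.
  by apply: wu; [exact: baryClosed_stdSimplex | exact: wS].
move=> x y xu yu; apply: le_trans (um _ _ xu yu) _; rewrite ler_wpM2r //.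
have th0 : 0 <= l%:R / l.+1%:R :> R by rewrite divr_ge0.
have th1 : l%:R / l.+1%:R <= 1 :> R by rewrite ler_pdivrMr ?ltr0n // mul1r ler_nat.
exact: (ler_wiXn2l th0 th1 Nj).
Qed.

(** From [N] on the summands of the homotopy vanish. Its value no longer changes once the number of
    subdivisions is large, and each simplex may use its own number. *)
Lemma fine_sdHtp l k (s : sing R V k) N M (phi : cochain F (sing R V) l) w : fineSub l s N ->
  (forall s' : sing R V l, smallSimplex s' -> phi s' = 0) -> (N <= M)%N ->
  (forall x, x \in w -> @stdSimplex R k x) ->
  sdHtp M (listCochain (hat s) phi) w = sdHtp N (listCochain (hat s) phi) w.
Proof.
move=> fs phi0 NM wS; elim: M NM => [|M IH]; first by rewrite leqn0 => /eqP ->.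
rewrite leq_eqVlt => /predU1P[-> //|]; rewrite ltnS => NM /=.
rewrite IH // -[RHS]addr0; congr (_ + _).
rewrite -(@sdT0 R F k w); apply: sdT_local => // u uS.
exact: fine_sd fs phi0 NM uS.
Qed.

(** The primitive is minus the subdivision homotopy applied to [phi]. Being explicit, it inherits
    the symmetries of [A], [B] and [phi]; the last clause yields the invariant primitives of
    [small_simplices_conf]. *)
Theorem small_simplices k (phi : cochain F (sing R V) k.+1) :
  (forall s, inside (A `|` B) s -> codiff phi s = 0) ->
  (forall s, smallSimplex s -> phi s = 0) ->
  exists psi : cochain F (sing R V) k,
  [/\ forall s, smallSimplex s -> psi s = 0,
      forall s, inside (A `|` B) s -> codiff psi s = phi s &
      forall g : continuousType V V,
        (forall x, A (g x) <-> A x) -> (forall x, B (g x) <-> B x) ->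
        (forall s, inside (A `|` B) s -> phi (sing_fun g s) = phi s) ->
        forall s, inside (A `|` B) s -> psi (sing_fun g s) = psi s].
Proof.
move=> dphi phi0.
(* The choice depends only on the set of admissible [N], which is the same for [s] and for its image
   under a symmetry [g]. *)
pose m k' (s : sing R V k') : nat := xget 0 [set N | fineSub k.+1 s N].
have mP k' (s : sing R V k') : inside (A `|` B) s -> fineSub k.+1 s (m _ s).
  by move=> /(fine_exists k.+1) [N fN]; apply: (@xgetPex _ 0 [set N | fineSub k.+1 s N]); exists N.
pose psi (s : sing R V k) : F := - singOp (@sdHomotopy R F (m _ s)) phi s.
exists psi; split.
- move=> s ss; rewrite /psi /singOp.
  have -> : listCochain (hat s) phi = fun=> 0.
    apply/funext => w; rewrite /listCochain; case: eqP => // _; apply: phi0.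
    by case: ss => ss; [left|right]; exact: inside_hat.
  by rewrite /sdHomotopy sdHtp0 oppr0.
- move=> s ss.
  (* One number of subdivisions that suffices for [s] and for all its faces. *)
  pose M := maxn (m _ s) (\max_(h < k.+2) m _ (sact (lift h) s : sing R V k)).
  have psiE (h : 'I_k.+2) : psi (sact (lift h) s) =
      - singOp (@sdHomotopy R F M) phi (sact (lift h) s : sing R V k).
    congr (- _); rewrite /singOp /sdHomotopy; symmetry.
    apply: fine_sdHtp => //; first by apply: mP; exact: inside_sact.
      by rewrite leq_max (leq_bigmax h) orbT.
    exact: basis_stdSimplex.
  have := codiff_singOp (@sdHomotopy_natural R F M) phi s.
  rewrite /codiff; under [X in _ -> X = _]eq_bigr do rewrite psiE mulrN.
  rewrite sumrN => ->; have := sdHtpP M (listCochain (hat s) phi) (stdBasis R k.+1).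
  have -> : ldiff (listCochain (hat s) phi) = fun=> 0.
    rewrite ldiff_listCochain; apply/funext => w; rewrite /listCochain.
    by case: eqP => // _; apply: dphi; exact: inside_hat.
  rewrite sdHtp0 addr0 /sdHomotopy => ->.
  rewrite (@fine_sd k.+1 _ _ (m _ s)) //; last exact: basis_stdSimplex.
  - by rewrite sub0r opprK /listCochain size_stdBasis eqxx hat_basis.
  - exact: mP.
  - by rewrite leq_maxl.
- move=> g gA gB gphi s ss; rewrite /psi /singOp /sdHomotopy; congr (- _).
  have lE : listCochain (hat (sing_fun g s)) phi = listCochain (hat s) phi.
    apply/funext => w; rewrite /listCochain; case: eqP => // _.
    rewrite -[RHS]gphi; last exact: inside_hat.
    by congr (phi _); exact/continuousEP.
  rewrite lE; congr (sdHtp _ _ _); rewrite /m; congr xget.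
  apply/seteqP; split=> N fN w sw wS wm; have := fN w sw wS wm.
    by case=> iw; [left|right] => t; [apply/gA|apply/gB]; exact: iw t.
  by case=> iw; [left|right] => t; [apply/gA|apply/gB]; exact: iw t.
Qed.

End SmallSimplices.

(** * Homotopy invariance *)
Section Prism.
Variables (R : realType) (F : fieldType).

Lemma push_row_comp k l m (u : 'I_k.+1 -> 'I_l.+1) (v : 'I_l.+1 -> 'I_m.+1)
  (x : 'rV[R]_k.+1) : push_row v (push_row u x) = push_row (v \o u) x.
Proof.
apply/rowP => j; rewrite !mxE [RHS](partition_big u (fun i => v i == j)) //=.
apply: eq_bigr => i /eqP vi; rewrite mxE; apply: eq_bigl => a.
by case: eqP => [->|]; rewrite ?andbF // vi eqxx.
Qed.

Lemma push_comp k l m (u : 'I_k.+1 -> 'I_l.+1) (v : 'I_l.+1 -> 'I_m.+1) (t : Delta R k) :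
  push v (push u t) = push (v \o u) t.
Proof. by apply/val_inj; exact: push_row_comp. Qed.

Lemma push_id k (t : Delta R k) : push id t = t.
Proof. by apply/val_inj/rowP => j; rewrite mxE (big_pred1 j). Qed.

(* The vertices of the prism over a k-simplex: lshift i below, rshift i above. *)
Definition prismDim k := (k + k.+1)%N.

Definition prismFold k (i : 'I_(prismDim k).+1) : 'I_k.+1 :=
  match @fintype.split k.+1 k.+1 i with inl a => a | inr a => a end.
Definition prismLevel k (i : 'I_(prismDim k).+1) : 'I_2 :=
  match @fintype.split k.+1 k.+1 i with inl a => ord0 | inr a => ord_max end.
Definition prismMap k l (u : 'I_k.+1 -> 'I_l.+1) (i : 'I_(prismDim k).+1) :
    'I_(prismDim l).+1 :=
  match @fintype.split k.+1 k.+1 i with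
  | inl a => lshift l.+1 (u a) | inr a => rshift l.+1 (u a) end.
Definition prismBot k (i : 'I_k.+1) : 'I_(prismDim k).+1 := lshift k.+1 i.
Definition prismTop k (i : 'I_k.+1) : 'I_(prismDim k).+1 := rshift k.+1 i.

Lemma split_lshift k (i : 'I_k.+1) : @fintype.split k.+1 k.+1 (prismBot i) = inl i.
Proof. exact: (unsplitK (inl i : 'I_k.+1 + 'I_k.+1)%type). Qed.
Lemma split_rshift k (i : 'I_k.+1) : @fintype.split k.+1 k.+1 (prismTop i) = inr i.
Proof. exact: (unsplitK (inr i : 'I_k.+1 + 'I_k.+1)%type). Qed.

Lemma prismFold_map k l (u : 'I_k.+1 -> 'I_l.+1) :
  @prismFold l \o prismMap u = u \o @prismFold k.
Proof.
apply/funext => i; rewrite /= /prismMap [in RHS]/prismFold.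
case: (@fintype.split k.+1 k.+1 i) => a.
  by rewrite /prismFold (split_lshift (u a)).
by rewrite /prismFold (split_rshift (u a)).
Qed.

Lemma prismLevel_map k l (u : 'I_k.+1 -> 'I_l.+1) :
  @prismLevel l \o prismMap u = @prismLevel k.
Proof.
apply/funext => i; rewrite /= /prismMap [in RHS]/prismLevel.
case: (@fintype.split k.+1 k.+1 i) => a.
  by rewrite /prismLevel (split_lshift (u a)).
by rewrite /prismLevel (split_rshift (u a)).
Qed.

Lemma prism_ends k l (u : 'I_k.+1 -> 'I_l.+1) :
  (@prismBot l \o @prismFold l) \o prismMap u = prismMap u \o (@prismBot k \o @prismFold k) /\
  (@prismTop l \o @prismFold l) \o prismMap u = prismMap u \o (@prismTop k \o @prismFold k).
Proof.
split; apply/funext => i /=; have /(congr1 (fun f => f i)) /= -> := prismFold_map u.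
  by rewrite /prismMap split_lshift.
by rewrite /prismMap split_rshift.
Qed.

Variables (V V' : topologicalType) (h : continuousType (V * R)%type V').

(** The prism on [s] is turned into a single simplex on its [2k + 2] vertices, mapped affinely onto
    the prism by fold and level. Bottom and top are faces of it, so the homotopy formula becomes a
    statement about lists of vertices. *)
Definition prism_fun k (s : sing R V k) (t : Delta R (prismDim k)) : V' :=
  h ((s : continuousType (Delta R k) V) (push (@prismFold k) t),
     val (push (@prismLevel k) t) 0 ord_max).

Lemma prism_continuous k (s : sing R V k) : continuous (prism_fun s).
Proof.
move=> t; apply: (@continuous_comp _ (V * R)%type V'
    (fun t => ((s : continuousType (Delta R k) V) (push (@prismFold k) t),
     val (push (@prismLevel k) t) 0 ord_max)) h); last exact: cts_fun.
have c1 : {for t, continuous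
    (fun t => (s : continuousType (Delta R k) V) (push (@prismFold k) t))}.
  apply: (@continuous_comp _ (Delta R k) V (push (@prismFold k)) s).
    exact: push_continuous.
  exact: cts_fun.
have c2 : {for t, continuous
    (fun t : Delta R (prismDim k) => val (push (@prismLevel k) t) 0 ord_max : R)}.
  apply: (@continuous_comp _ (Delta R 1) R (push (@prismLevel k))
    (fun t => val t 0 ord_max)); first exact: push_continuous.
  exact: Delta_coord_continuous.
exact: (cvg_pair c1 c2).
Qed.

Definition prism k (s : sing R V k) : sing R V' (prismDim k) :=
  mkcts (@prism_continuous k s).

Lemma prism_sact k l (u : 'I_k.+1 -> 'I_l.+1) (s : sing R V l) :
  prism (sact u s : sing R V k) = sact (prismMap u) (prism s).
Proof.
apply/continuousEP => t; rewrite /= /mkcts /prism_fun /sing_act /=.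
by rewrite !push_comp !push_row_comp prismFold_map prismLevel_map.
Qed.

Definition endList k (u : 'I_k.+1 -> 'I_(prismDim k).+1) : seq 'rV[R]_(prismDim k).+1 :=
  [seq delta_mx 0 (u i) | i <- enum 'I_k.+1].

Lemma size_endList k (u : 'I_k.+1 -> 'I_(prismDim k).+1) : size (endList u) = k.+1.
Proof. by rewrite size_map size_enum_ord. Qed.

Lemma endListP k l (u : 'I_k.+1 -> 'I_l.+1) (s : sing R V' l) :
  affSimplex (hat s) k [seq delta_mx 0 (u i) | i <- enum 'I_k.+1] = sact u s.
Proof.
rewrite -[s in RHS]hat_basis; symmetry; apply: affSimplex_sact => i.
by rewrite nth_basis (nth_map ord0) ?size_enum_ord // nth_ord_enum.
Qed.

Definition toEnd k (e : 'I_k.+1 -> 'I_(prismDim k).+1)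
    (Phi : seq 'rV[R]_(prismDim k).+1 -> F) v : F :=
  Phi (map (pushL R (e \o @prismFold k)) v).

(** Collapsing to the bottom and to the top are two chain maps; the cone homotopy [lhtp] between
    them takes the place of a triangulation of the prism. *)
Definition prismOp k := lhtp (toEnd (@prismBot k)) (toEnd (@prismTop k)).

Lemma prismOp_local k : localOp (@stdSimplex R (prismDim k)) (@prismOp k).
Proof.
have H e : localOp (@stdSimplex R (prismDim k)) (@toEnd k e).
  move=> Phi Psi ePP v vS; apply: ePP => _ /mapP[x /vS xS ->]; rewrite pushLE.
  exact: set_mem (push_stdSimplex _ (exist (fun t => t \in @stdSimplex R _) _
    (mem_set xS) : Delta R _)).
exact: localOp_lhtp.
Qed.

Lemma toEnd_endList k (e : 'I_k.+1 -> 'I_(prismDim k).+1) Phi :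
  toEnd e Phi (endList (@prismBot k)) = Phi (endList e).
Proof.
rewrite /toEnd; congr (Phi _); rewrite -[LHS]map_comp; apply: eq_map => i.
by rewrite [LHS](@pushL_basis R _ _ (e \o @prismFold k) (prismBot i)) /= /prismFold split_lshift.
Qed.

Lemma prismOp_map k l (u : 'I_k.+1 -> 'I_l.+1) Phi v :
  prismOp Phi (map (pushL R (prismMap u)) v) = prismOp (Phi \o map (pushL R (prismMap u))) v.
Proof.
have [e0 e1] := prism_ends u.
have H e e' : (e' \o @prismFold l) \o prismMap u = prismMap u \o (e \o @prismFold k) ->
    forall Psi w, @toEnd l e' Psi (map (pushL R (prismMap u)) w) =
      @toEnd k e (Psi \o map (pushL R (prismMap u))) w.
  move=> E Psi w; rewrite /toEnd /=; congr (Psi _); rewrite -!map_comp.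
  apply: eq_map => x.
  transitivity (push_row (e' \o @prismFold l) (push_row (prismMap u) x)).
    by rewrite -!pushLE.
  transitivity (push_row (prismMap u) (push_row (e \o @prismFold k) x)).
    by rewrite !push_row_comp E.
  by rewrite -!pushLE.
apply: (@lhtp_map _ _ _ (toEnd (@prismBot k)) (toEnd (@prismTop k))); exact: H.
Qed.

Definition homotopyOp j (phi : cochain F (sing R V') j) k (s : sing R V k) : F :=
  prismOp (listCochain (hat (prism s)) phi) (endList (@prismBot k)).

Lemma codiff_homotopyOp j (phi : cochain F (sing R V') j) k (s : sing R V k.+1) :
  codiff (fun s : sing R V k => homotopyOp phi s : F^o) s =
  ldiff (prismOp (listCochain (hat (prism s)) phi)) (endList (@prismBot k.+1)).
Proof.
rewrite ldiffE size_endList; apply: eq_bigr => i _; congr (_ * _).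
rewrite /homotopyOp prism_sact.
have endS x : x \in endList (@prismBot k) -> @stdSimplex R _ x.
  case/mapP=> a _ ->; apply: basis_stdSimplex.
  by apply/mapP; exists (prismBot a); rewrite ?mem_enum.
rewrite (prismOp_local (fun w wS => listCochain_sact phi (prismMap (lift i)) _ wS)) //.
rewrite -[LHS](prismOp_map (lift i) (listCochain (hat (prism s)) phi)); congr prismOp.
apply: (@eq_from_nth _ 0).
  rewrite size_map size_cat size_take size_drop !size_endList.
  by rewrite ltn_ord; have := ltn_ord i; lia.
move=> a; rewrite size_map size_endList => ak.
have ia : (i < size (endList (@prismBot k.+1)))%N by rewrite size_endList.
rewrite nth_rmnth // -map_comp (nth_map ord0) ?size_enum_ord //.
rewrite -[in LHS]/(nat_of_ord (Ordinal ak)) nth_ord_enum.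
rewrite -[bump _ _]/(nat_of_ord (lift i (Ordinal ak))).
rewrite (nth_map ord0) ?size_enum_ord // nth_ord_enum.
rewrite [LHS](@pushL_basis R _ _ (prismMap (lift i)) (prismBot (Ordinal ak))).
by rewrite /prismMap split_lshift.
Qed.

Variables (U : set V) (U' : set V').
Hypothesis hU : forall x a, U x -> 0 <= a <= 1 -> U' (h (x, a)).

Lemma prism_inside k (s : sing R V k) : inside U s -> inside U' (prism s).
Proof.
move=> Us t; apply: hU; first exact: Us.
set y := push _ _; have [y0 y1] := set_mem (valP y); rewrite y0 /= -y1.
by rewrite big_ord_recr /= lerDr big_ord_recl big_ord0 addr0 y0.
Qed.

Variables f0 f1 : continuousType V V'.
Hypotheses (h0 : forall x, U x -> h (x, 0) = f0 x) (h1 : forall x, U x -> h (x, 1) = f1 x).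

Lemma prism_bottom k (s : sing R V k) : inside U s ->
  sact (@prismBot k) (prism s) = sing_fun f0 s.
Proof.
move=> Us; apply/continuousEP => t; rewrite /= /mkcts /prism_fun /= !push_comp !push_row_comp.
have -> : @prismFold k \o @prismBot k = id.
  by apply/funext => i; rewrite /= /prismFold split_lshift.
rewrite push_id mxE big1 ?h0 // => i; rewrite /= /prismLevel split_lshift.
by rewrite -(inj_eq val_inj).
Qed.

Lemma prism_top k (s : sing R V k) : inside U s ->
  sact (@prismTop k) (prism s) = sing_fun f1 s.
Proof.
move=> Us; apply/continuousEP => t; rewrite /= /mkcts /prism_fun /= !push_comp !push_row_comp.
have -> : @prismFold k \o @prismTop k = id.
  by apply/funext => i; rewrite /= /prismFold split_rshift.
rewrite push_id mxE -(h1 (Us t)); have [_ t1] := set_mem (valP t).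
rewrite -[in RHS]t1; congr (h (_, _)); apply: eq_bigl => i.
by rewrite /= /prismLevel split_rshift eqxx.
Qed.

Lemma homotopyOpP k (phi : cochain F (sing R V') k) (s : sing R V k) : inside U s ->
  (forall s', inside U' s' -> codiff phi s' = 0) ->
  phi (sing_fun f1 s) - phi (sing_fun f0 s) =
  ldiff (prismOp (listCochain (hat (prism s)) phi)) (endList (@prismBot k)).
Proof.
move=> Us dphi; have cE e : chainOp (@toEnd k e) by exact: chainOp_map.
have := lhtpP (listCochain (hat (prism s)) phi) (cE (@prismBot k)) (cE (@prismTop k))
  (endList (@prismBot k)).
rewrite !toEnd_endList ldiff_listCochain.
have -> : listCochain (hat (prism s)) (codiff phi) = fun=> 0.
  apply/funext => w; rewrite /listCochain; case: eqP => // _; apply: dphi.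
  exact: inside_hat (prism_inside Us).
have -> : lhtp (toEnd (@prismBot k)) (toEnd (@prismTop k)) (fun=> 0) (endList (@prismBot k)) = 0 :> F.
  elim: (endList _) => [//|x v IH] /=; rewrite /lcons IH /toEnd; by rewrite !subrr.
rewrite addr0 /prismOp => ->; rewrite /listCochain !size_endList eqxx.
by rewrite !endListP prism_bottom ?prism_top.
Qed.

End Prism.

(** * Cohomology of open subsets *)
Section CochainLinearity.
Variables (F : fieldType) (S : simplicialSet).
Implicit Types (k : nat).

Lemma codiffD k (x y : cochain F S k) : codiff (x + y) = codiff x + codiff y.
Proof. by rewrite -[x]scale1r codiff_linear !scale1r. Qed.
Lemma codiffZ k a (x : cochain F S k) : codiff (a *: x) = a *: codiff x.
Proof. by rewrite -[a *: x]addr0 codiff_linear codiff0 addr0. Qed.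
Lemma codiffN k (x : cochain F S k) : codiff (- x) = - codiff x.
Proof. by rewrite -scaleN1r codiffZ scaleN1r. Qed.
Lemma codiffB k (x y : cochain F S k) : codiff (x - y) = codiff x - codiff y.
Proof. by rewrite codiffD codiffN. Qed.
Lemma codiff_sum k (I : Type) (r : seq I) (P : pred I) (f : I -> cochain F S k) :
  codiff (\sum_(i <- r | P i) f i) = \sum_(i <- r | P i) codiff (f i).
Proof. by elim/big_rec2: _ => [|i y x _ <-]; rewrite ?codiff0 ?codiffD. Qed.

Lemma codiff2 k (x : cochain F S k) s : codiff (codiff x) s = 0.
Proof. by rewrite codiff_codiff. Qed.

Lemma cochainE k :
  (forall (x y : cochain F S k) s, (x + y) s = x s + y s) *
  (forall (x : cochain F S k) s, (- x) s = - x s) *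
  (forall a (x : cochain F S k) s, (a *: x) s = a * x s) *
  (forall s, (0 : cochain F S k) s = 0).
Proof. by []. Qed.

Lemma cochain_sumE k (I : Type) (r : seq I) (P : pred I) (f : I -> cochain F S k) s :
  (\sum_(i <- r | P i) f i) s = \sum_(i <- r | P i) f i s.
Proof. by elim/big_rec2: _ => // i y x _ <-. Qed.
End CochainLinearity.

Section LocalCohomology.
Variables (R : realType) (F : fieldType) (V : topologicalType).
Notation C k := (cochain F (sing R V) k).
Implicit Types (U A B : set V) (k : nat) (f g : continuousType V V).

Add Ring Fring : (field_ring_theory F).

(** All cochains are cochains of the ambient space, and an open set only decides on which simplices
    an identity is tested. Restriction to a smaller set changes the condition, not the cochain. *)
Definition coc U k (x : C k) : Prop := forall s, inside U s -> codiff x s = 0.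

Definition bnd U k : C k -> Prop :=
  match k with
  | 0 => fun x => forall s, inside U s -> x s = 0
  | k'.+1 => fun x => exists y : C k', forall s, inside U s -> x s = codiff y s
  end.

Lemma bnd_ext U k (x y : C k) : (forall s, inside U s -> x s = y s) ->
  bnd U x -> bnd U y.
Proof.
case: k x y => [|k] x y xy; first by move=> bx s Us; rewrite -xy // (bx s Us).
move=> [z xz]; exists z => s Us; by rewrite -xy // xz.
Qed.

Lemma bnd_restr U U' k (x : C k) : U `<=` U' -> bnd U' x -> bnd U x.
Proof.
move=> UU'; case: k x => [|k] x => [bx s Us|[z xz]].
  by apply: bx; exact: insideS Us.
by exists z => s Us; apply: xz; exact: insideS Us.
Qed.

Lemma coc_restr U U' k (x : C k) : U `<=` U' -> coc U' x -> coc U x.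
Proof. by move=> UU' cx s Us; apply: cx; exact: insideS Us. Qed.

Lemma bnd_lin U k a (x y : C k) : bnd U x -> bnd U y -> bnd U (a *: x + y).
Proof.
case: k x y => [|k] x y => [bx by_ s Us|[x' xx'] [y' yy']].
  by rewrite !cochainE (bx s Us) (by_ s Us) mulr0 addr0.
by exists (a *: x' + y') => s Us; rewrite codiff_linear !cochainE xx' ?yy'.
Qed.

Lemma bnd0 U k : bnd U (0 : C k).
Proof. by case: k => [//|k]; exists 0 => s _; rewrite codiff0. Qed.
Lemma bndD U k (x y : C k) : bnd U x -> bnd U y -> bnd U (x + y).
Proof. by move=> bx by_; rewrite -[x]scale1r; exact: bnd_lin. Qed.
Lemma bndZ U k a (x : C k) : bnd U x -> bnd U (a *: x).
Proof. by move=> bx; rewrite -[_ *: _]addr0; apply: bnd_lin => //; exact: bnd0. Qed.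
Lemma bndN U k (x : C k) : bnd U x -> bnd U (- x).
Proof. by move=> bx; rewrite -scaleN1r; exact: bndZ. Qed.
Lemma bndB U k (x y : C k) : bnd U x -> bnd U y -> bnd U (x - y).
Proof. by move=> bx by_; apply: bndD => //; exact: bndN. Qed.
Lemma bnd_sum U k (I : Type) (r : seq I) (P : pred I) (x : I -> C k) :
  (forall i, P i -> bnd U (x i)) -> bnd U (\sum_(i <- r | P i) x i).
Proof. by move=> bx; elim/big_ind: _ => //; [exact: bnd0 | exact: bndD]. Qed.
Lemma bnd_trans U k (y x z : C k) : bnd U (x - y) -> bnd U (y - z) -> bnd U (x - z).
Proof. by move=> bx by_; rewrite -[x](subrK y) -addrA; exact: bndD. Qed.
Lemma bnd_sym U k (x y : C k) : bnd U (x - y) -> bnd U (y - x).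
Proof. by move=> bx; rewrite -opprB; exact: bndN. Qed.
Lemma bnd_subl U k (x y : C k) : bnd U (x - y) -> bnd U y -> bnd U x.
Proof. by move=> bx by_; rewrite -[x](subrK y); exact: bndD. Qed.

Lemma coc_lin U k a (x y : C k) : coc U x -> coc U y -> coc U (a *: x + y).
Proof.
by move=> cx cy s Us; rewrite codiff_linear !cochainE cx ?cy // mulr0 addr0.
Qed.
Lemma coc0 U k : coc U (0 : C k).
Proof. by move=> s _; rewrite codiff0. Qed.
Lemma cocD U k (x y : C k) : coc U x -> coc U y -> coc U (x + y).
Proof. by move=> bx by_; rewrite -[x]scale1r; exact: coc_lin. Qed.
Lemma cocZ U k a (x : C k) : coc U x -> coc U (a *: x).
Proof. by move=> bx; rewrite -[_ *: _]addr0; apply: coc_lin => //; exact: coc0. Qed.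
Lemma cocN U k (x : C k) : coc U x -> coc U (- x).
Proof. by move=> bx; rewrite -scaleN1r; exact: cocZ. Qed.
Lemma cocB U k (x y : C k) : coc U x -> coc U y -> coc U (x - y).
Proof. by move=> bx by_; apply: cocD => //; exact: cocN. Qed.
Lemma coc_sum U k (I : Type) (r : seq I) (P : pred I) (x : I -> C k) :
  (forall i, P i -> coc U (x i)) -> coc U (\sum_(i <- r | P i) x i).
Proof. by move=> bx; elim/big_ind: _ => //; [exact: coc0 | exact: cocD]. Qed.

Definition pull f k (x : C k) : C k := fun s => x (sing_fun f s).

Lemma pullB f k (x y : C k) : pull f (x - y) = pull f x - pull f y.
Proof. by []. Qed.
Lemma pullD f k (x y : C k) : pull f (x + y) = pull f x + pull f y.
Proof. by []. Qed.
Lemma pull_sum f k (I : Type) (r : seq I) (P : pred I) (x : I -> C k) :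
  pull f (\sum_(i <- r | P i) x i) = \sum_(i <- r | P i) pull f (x i).
Proof. by elim/big_rec2: _ => // i y z _ <-. Qed.
Lemma codiff_pullE f k (x : C k) : codiff (pull f x) = pull f (codiff x).
Proof. exact: (codiff_pull (sing_map R f) x). Qed.

Lemma pull_comp f g k (x : C k) : pull f (pull g x) = pull (g \o f) x.
Proof. by apply/funext => s; congr (x _); exact/continuousEP. Qed.

Lemma bnd_pull U U' f k (x : C k) : (forall v, U v -> U' (f v)) ->
  bnd U' x -> bnd U (pull f x).
Proof.
move=> fU; have fs j (s : sing R V j) : inside U s -> inside U' (sing_fun f s).
  by move=> Us t; apply: fU; exact: Us.
case: k x => [|k] x => [bx s Us|[y xy]]; first by apply: bx; exact: fs.
by exists (pull f y) => s Us; rewrite codiff_pullE /pull xy //; exact: fs.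
Qed.

Lemma coc_pull U U' f k (x : C k) : (forall v, U v -> U' (f v)) ->
  coc U' x -> coc U (pull f x).
Proof.
move=> fU cx s Us; rewrite codiff_pullE; apply: cx => t; apply: fU; exact: Us.
Qed.

Lemma homotopy_bnd U U' (h : continuousType (V * R)%type V) f0 f1 k (x : C k) :
  (forall v a, U v -> 0 <= a <= 1 -> U' (h (v, a))) ->
  (forall v, U v -> h (v, 0) = f0 v) -> (forall v, U v -> h (v, 1) = f1 v) ->
  coc U' x -> bnd U (pull f1 x - pull f0 x).
Proof.
move=> hU h0 h1 cx.
have E s : inside U s -> (pull f1 x - pull f0 x) s =
    ldiff (prismOp (listCochain (hat (prism h s)) x)) (endList R (@prismBot k)).
  by move=> Us; exact: (homotopyOpP hU).
case: k x cx E => [|k] x cx E.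
  move=> s Us; rewrite E //; have := size_endList R (@prismBot 0).
  case: (endList _ _) => [//|v [|//]] _ /=.
  by rewrite /prismOp subrr.
exists (fun s => homotopyOp h x s) => s Us.
by rewrite E // codiff_homotopyOp.
Qed.

(** * Gluing over two open sets *)

Section MayerVietoris.
Variables (A B : set V).
Hypotheses (oA : open A) (oB : open B).

Lemma bnd_small k (x : C k.+1) : coc (A `|` B) x ->
  (forall s, smallSimplex A B s -> x s = 0) -> bnd (A `|` B) x.
Proof.
move=> cx x0; have [y [_ yx _]] := small_simplices oA oB cx x0.
by exists y => s Us; rewrite yx.
Qed.

(** A primitive [q] of [a - b] on the intersection corrects [a] so that it agrees there with [b].
    The glued cochain is a primitive of [x] on small simplices, and [bnd_small] treats the
    remainder. *)
Lemma bnd_glue k (x : C k.+1) (a b : C k) : coc (A `|` B) x ->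
  (forall s, inside A s -> x s = codiff a s) ->
  (forall s, inside B s -> x s = codiff b s) ->
  bnd (A `&` B) (a - b) -> bnd (A `|` B) x.
Proof.
move=> cx xa xb bab.
have {bab} [a' xa' ab] : exists2 a' : C k, (forall s, inside A s -> x s = codiff a' s) &
    forall s, inside (A `&` B) s -> a' s = b s.
  case: k x a b cx xa xb bab => [|k] x a b cx xa xb.
    by move=> bab; exists a => // s ABs; apply/eqP; rewrite -subr_eq0; exact/eqP/bab.
  move=> [q qP]; exists (a - codiff q) => s; first by
    move=> As; rewrite codiffB codiff_codiff subr0 xa.
  by move=> ABs; rewrite !cochainE -(qP s ABs) !cochainE; fring F.
pose h : C k := fun s => if `[< inside A s >] then a' s else b s.
have hA s : inside A s -> h s = a' s by move=> As; rewrite /h asboolT.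
have hB s : inside B s -> h s = b s.
  move=> Bs; rewrite /h; case: asboolP => // As; apply: ab => t.
  by split; [exact: As | exact: Bs].
have dh : coc (A `|` B) (x - codiff h).
  by apply: cocB => // s _; rewrite codiff_codiff.
have := bnd_small dh; case => [s [As|Bs]|y yP].
- rewrite !cochainE xa' //; apply/eqP; rewrite subr_eq0; apply/eqP.
  by apply: eq_bigr => i _; rewrite hA //; exact: inside_sact.
- rewrite !cochainE xb //; apply/eqP; rewrite subr_eq0; apply/eqP.
  by apply: eq_bigr => i _; rewrite hB //; exact: inside_sact.
- exists (h + y) => s Us; rewrite codiffD !cochainE -(yP s Us) !cochainE; fring F.
Qed.

Lemma bnd_glue0 (x : C 0) : (forall s, inside A s -> x s = 0) ->
  (forall s, inside B s -> x s = 0) -> bnd (A `|` B) x.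
Proof.
move=> xA xB s Us; have Delta0 (t t' : Delta R 0) : t = t'.
  apply/val_inj/rowP => i; rewrite ord1.
  have [_] := set_mem (valP t); have [_] := set_mem (valP t').
  by rewrite !big_ord_recl !big_ord0 !addr0 => -> ->.
have [t _] : exists t : Delta R 0, True.
  by exists (retract 0).
have [As|Bs] := Us t; first by apply: xA => t'; rewrite (Delta0 t' t).
by apply: xB => t'; rewrite (Delta0 t' t).
Qed.

(** The connecting homomorphism sends [x] to the class of [y0 - y1], where [y0] is the coboundary of
    [x] on simplices in [A] and [0] elsewhere, and [y1] makes it closed. It restricts to zero on
    [B], so it vanishes by the injectivity assumption, and a primitive of it splits [x]. *)
Lemma coc_split k (x : C k) : coc (A `&` B) x ->
  (forall y : C k.+1, coc (A `|` B) y -> bnd B y -> bnd (A `|` B) y) ->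
  exists a b : C k, [/\ coc A a, coc B b & forall s, inside (A `&` B) s -> x s = a s - b s].
Proof.
move=> cx inj.
pose y0 : C k.+1 := fun s => if `[< inside A s >] then codiff x s else 0.
have y0A s : inside A s -> y0 s = codiff x s by move=> As; rewrite /y0 asboolT.
have y0B s : inside B s -> y0 s = 0.
  move=> Bs; rewrite /y0; case: asboolP => // As; apply: cx => t.
  by split; [exact: As | exact: Bs].
have dy0 s : smallSimplex A B s -> codiff y0 s = 0.
  case=> [As|Bs]; last first.
    by rewrite /codiff big1 // => h _; rewrite y0B ?mulr0 //; exact: inside_sact.
  rewrite -[RHS](codiff2 x s) /codiff; apply: eq_bigr => h _.
  by rewrite y0A //; exact: inside_sact.
have [y1 [y1s y1d _]] := small_simplices oA oB
  (fun s _ => codiff2 y0 s) dy0.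
have cy : coc (A `|` B) (y0 - y1).
  by move=> s Us; rewrite codiffB !cochainE y1d // subrr.
have [|z zP] := inj _ cy.
  exists 0 => s Bs; rewrite codiff0 !cochainE y0B // y1s ?subr0 //; by right.
exists (x - z), (- z); split.
- move=> s As; rewrite codiffB !cochainE -zP; last by move=> t; left; exact: As.
  by rewrite !cochainE y0A // y1s ?subr0 ?subrr //; left.
- move=> s Bs; rewrite codiffN !cochainE -zP; last by move=> t; right; exact: Bs.
  by rewrite !cochainE y0B // y1s ?subr0 ?oppr0 //; right.
- by move=> s _; rewrite !cochainE; fring F.
Qed.

End MayerVietoris.
End LocalCohomology.

(** * Configurations as subsets of a product *)
Section ConfSpace.
Variables (R : realType) (p n : nat).
Notation E := 'rV[R]_n.+1.
Definition confAmbient : topologicalType := {ptws 'I_p -> E}.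
Notation V := confAmbient.

Lemma ptws_continuous (T : topologicalType) (f : T -> V) :
  (forall i, continuous (fun t => (f t : 'I_p -> E) i)) -> continuous f.
Proof.
pose pr (i : 'I_p) (g : 'I_p -> E) := g i.
move=> fc x; have FF : Filter (f y @[y --> x]) by apply: fmap_filter; exact: nbhs_filter.
apply/cvg_sup => i.
by apply: (@continuous_comp_initial _ T _ (pr i) f); exact: fc.
Qed.

Lemma coord_cts i : continuous (fun x : V => (x : 'I_p -> E) i).
Proof. exact: (@proj_continuous _ (fun=> E)). Qed.

Lemma cts_coord (f : continuousType V V) i : continuous (fun x : V => (f x : 'I_p -> E) i).
Proof.
move=> x; apply: (@continuous_comp V V E f (fun y => (y : 'I_p -> E) i)).
  exact: cts_fun.
exact: coord_cts.
Qed.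

Definition lineFun (f0 f1 : V -> V) (xa : V * R) : V :=
  fun i => (1 - xa.2) *: (f0 xa.1 : 'I_p -> E) i + xa.2 *: (f1 xa.1 : 'I_p -> E) i.

Lemma line_continuous (f0 f1 : continuousType V V) : continuous (lineFun f0 f1).
Proof.
have ev (f : continuousType V V) i : continuous (fun xa : V * R => (f xa.1 : 'I_p -> E) i).
  move=> xa; apply: (@continuous_comp _ V E fst (fun x => (f x : 'I_p -> E) i)).
    exact: cvg_fst.
  exact: cts_coord.
apply: ptws_continuous => i xa; rewrite /lineFun.
apply: (@cvgD R E _ (nbhs xa)); apply: (@cvgZ R E _ (nbhs xa)); try exact: ev.
  apply: (@cvgB R R^o _ (nbhs xa)); [exact: cvg_cst | exact: cvg_snd].
exact: cvg_snd.
Qed.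
HB.instance Definition _ (f0 f1 : continuousType V V) :=
  isContinuous.Build _ _ (lineFun f0 f1) (@line_continuous f0 f1).

Lemma open_forall (T : topologicalType) (I : finType) (P : I -> set T) :
  (forall i, open (P i)) -> open [set x | forall i, P i x].
Proof.
move=> oP; rewrite openE => x Px; rewrite /interior.
have nF : Filter (nbhs x) by exact: nbhs_filter.
apply: (@filter_forall _ _ (fun i y => P i y) _ nF) => i.
by apply: open_nbhs_nbhs; split; [exact: oP | exact: Px].
Qed.

Lemma open_exists (T : topologicalType) (I : Type) (P : I -> set T) :
  (forall i, open (P i)) -> open [set x | exists i, P i x].
Proof.
move=> oP; rewrite openE => x [i Pix]; rewrite /interior.
apply: (@filterS _ _ _ (P i)); first by move=> y Piy; exists i.
by apply: open_nbhs_nbhs; split.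
Qed.

Lemma open_imp (T : topologicalType) (Q : Prop) (A : set T) :
  open A -> open [set x | Q -> A x].
Proof.
move=> oA; have [q|nq] := pselect Q.
  by rewrite (_ : mkset _ = A) //; apply/seteqP; split=> x /=; [exact | move=> Ax _].
by rewrite (_ : mkset _ = setT); [exact: openT | apply/seteqP; split=> x //= _ q; case: nq].
Qed.

Lemma open_and (T : topologicalType) (Q : Prop) (A : set T) :
  open A -> open [set x | Q /\ A x].
Proof.
move=> oA; have [q|nq] := pselect Q.
  by rewrite (_ : mkset _ = A) //; apply/seteqP; split=> x /=; [case | move=> Ax].
by rewrite (_ : mkset _ = set0); [exact: open0 | apply/seteqP; split=> x // [q]].
Qed.

Lemma diff_cts i j : continuous (fun x : V => (x : 'I_p -> E) i - (x : 'I_p -> E) j).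
Proof. by move=> x; apply: (@cvgB R E _ (nbhs x)); exact: coord_cts. Qed.

Lemma diff_coord_cts i j l :
  continuous (fun x : V => ((x : 'I_p -> E) i - (x : 'I_p -> E) j) 0 l).
Proof.
move=> x; apply: (@continuous_comp V E R (fun x => (x : 'I_p -> E) i - (x : 'I_p -> E) j)
  (fun v => v 0 l)); [exact: diff_cts | exact: coord_continuous].
Qed.

Lemma rV_neq0P (v : E) : v <> 0 <-> exists l, v 0 l != 0.
Proof.
split=> [v0|[l /eqP vl] v0]; last by apply: vl; rewrite v0 mxE.
apply: contrapT => nl; apply: v0; apply/rowP => l; rewrite mxE.
by apply/eqP/negP => vl; apply: nl; exists l; exact/negP.
Qed.

Lemma open_neq_coord i j l :
  open [set x : V | ((x : 'I_p -> E) i - (x : 'I_p -> E) j) 0 l != 0].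
Proof.
apply: (@open_comp _ _ (fun x : V => ((x : 'I_p -> E) i - (x : 'I_p -> E) j) 0 l)
  [set r | r != 0]); last exact: open_neq.
by move=> x _; exact: diff_coord_cts.
Qed.

Lemma open_neq_pt i j : open [set x : V | (x : 'I_p -> E) i <> (x : 'I_p -> E) j].
Proof.
have -> : [set x : V | (x : 'I_p -> E) i <> (x : 'I_p -> E) j] =
    [set x | exists l, ((x : 'I_p -> E) i - (x : 'I_p -> E) j) 0 l != 0].
  apply/seteqP; split=> x /=.
    by move=> xij; apply/rV_neq0P => xij0; apply: xij; apply/eqP; rewrite -subr_eq0 xij0.
  by move=> /rV_neq0P xij xij'; apply: xij; rewrite xij' subrr.
by apply: open_exists => l; exact: open_neq_coord.
Qed.

Definition partConf (k : nat) : set V :=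
  [set x | forall i j : 'I_p, (i < k)%N -> (j < k)%N -> i <> j ->
     (x : 'I_p -> E) i <> (x : 'I_p -> E) j].

Lemma partConf_open k : open (partConf k).
Proof.
have -> : partConf k = [set x | forall ij : 'I_p * 'I_p,
    [set x : V | (ij.1 < k)%N -> (ij.2 < k)%N -> ij.1 <> ij.2 ->
       (x : 'I_p -> E) ij.1 <> (x : 'I_p -> E) ij.2] x].
  by apply/seteqP; split=> x /= Cx => [[i j]|i j]; [exact: Cx | exact: (Cx (i, j))].
apply: open_forall => -[i j].
by do 3![apply: open_imp]; exact: open_neq_pt.
Qed.

(** * The relative position of two points *)

Section Pair.
Variables (z i : 'I_p).
Hypothesis iz : (i < z)%N.

Definition gap (x : V) : E := (x : 'I_p -> E) z - (x : 'I_p -> E) i.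

(** Fibrewise a sphere of dimension [q - 1] up to homotopy; for [q = n + 1] the condition is that
    the points [z] and [i] differ ([Y_P]). *)
Definition dLevel (q : nat) : set V :=
  [set x | partConf z x /\ exists l : 'I_n.+1, (l < q)%N /\ gap x 0 l != 0].
(** Two thickened hemispheres: [aLevel l] and [bLevel l] cover [dLevel l.+1], meet in [dLevel l] and
    retract fibrewise to a point, so that Mayer-Vietoris for them is the suspension. *)
Definition aLevel (l : 'I_n.+1) : set V :=
  [set x | partConf z x /\ ((exists l' : 'I_n.+1, (l' < l)%N /\ gap x 0 l' != 0) \/ 0 < gap x 0 l)].
Definition bLevel (l : 'I_n.+1) : set V :=
  [set x | partConf z x /\ ((exists l' : 'I_n.+1, (l' < l)%N /\ gap x 0 l' != 0) \/ gap x 0 l < 0)].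

Lemma open_gap (P : set R) l : open P -> open [set x | P (gap x 0 l)].
Proof.
move=> oP; apply: (@open_comp _ _ (fun x : V => gap x 0 l) P) => // x _.
exact: diff_coord_cts.
Qed.

Lemma open_dgap q : open [set x | exists l : 'I_n.+1, (l < q)%N /\ gap x 0 l != 0].
Proof.
apply: open_exists => l; apply: open_and.
by apply: (open_gap (P := [set r | r != 0])); exact: open_neq.
Qed.

Lemma dLevel_open q : open (dLevel q).
Proof. by apply: openI; [exact: partConf_open | exact: open_dgap]. Qed.

Lemma aLevel_open l : open (aLevel l).
Proof.
apply: openI; [exact: partConf_open | apply: openU; [exact: open_dgap |]].
by apply: (open_gap (P := [set r | 0 < r])); exact: open_gt.
Qed.

Lemma bLevel_open l : open (bLevel l).
Proof.
apply: openI; [exact: partConf_open | apply: openU; [exact: open_dgap |]].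
by apply: (open_gap (P := [set r | r < 0])); exact: open_lt.
Qed.

Lemma dLevelS (l : 'I_n.+1) : dLevel l.+1 = aLevel l `|` bLevel l.
Proof.
apply/seteqP; split=> x /=.
  move=> [Cx [l' [l'l g]]]; move: l'l; rewrite ltnS leq_eqVlt => /predU1P[/val_inj e|l'l].
    move: g; rewrite {}e neq_lt => /orP[g|g]; first by right; split=> //; right.
    by left; split=> //; right.
  by left; split=> //; left; exists l'.
by case=> -[Cx [[l' [l'l g]]|g]]; split=> //;
  [exists l'; rewrite (leq_trans l'l) | exists l; rewrite ?gt_eqF //
  |exists l'; rewrite (leq_trans l'l) | exists l; rewrite ?lt_eqF //].
Qed.

Lemma dLevelI (l : 'I_n.+1) : aLevel l `&` bLevel l = dLevel l.
Proof.
apply/seteqP; split=> x /=.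
  case=> -[Cx [d|g]] [_ [d'|g']] //; try by split.
  by have := lt_trans g g'; rewrite ltxx.
by case=> Cx d; split; split=> //; left.
Qed.

Lemma dLevel0 : dLevel 0 = set0.
Proof. by apply/seteqP; split=> x // [_ [l []]]. Qed.

Lemma dLevel_sub q : dLevel q `<=` partConf z. Proof. by move=> x []. Qed.
Lemma aLevel_sub l : aLevel l `<=` partConf z. Proof. by move=> x []. Qed.
Lemma bLevel_sub l : bLevel l `<=` partConf z. Proof. by move=> x []. Qed.

(** With [v] the first axis this provides base points for the fibrewise spheres: a class is reduced
    when its pullback along this section is trivial. *)
Definition secFun (v : E) (x : V) : V :=
  fun j => if j == z then (x : 'I_p -> E) i + v else (x : 'I_p -> E) j.

Lemma sec_continuous v : continuous (secFun v).
Proof.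
apply: ptws_continuous => j; rewrite /secFun; case: eqP => _; last exact: coord_cts.
by move=> x; apply: (@cvgD R E _ (nbhs x)); [exact: coord_cts | exact: cvg_cst].
Qed.
HB.instance Definition _ v := isContinuous.Build _ _ (secFun v) (@sec_continuous v).

Lemma sec_lt v x (j : 'I_p) : (j < z)%N -> (secFun v x : 'I_p -> E) j = (x : 'I_p -> E) j.
Proof. by move=> jz; rewrite /secFun; case: eqP jz => // ->; rewrite ltnn. Qed.

Lemma sec_gap v x : gap (secFun v x) = v.
Proof. by rewrite /gap [X in _ - X]sec_lt // /secFun eqxx addrAC subrr add0r. Qed.

Lemma sec_sec v w x : secFun v (secFun w x) = secFun v x.
Proof. by apply/funext => j; rewrite /secFun; case: eqP => // jz; rewrite ifF //; apply/eqP => iz'; move: iz; rewrite iz' ltnn. Qed.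

Lemma partConf_eq x y : (forall j : 'I_p, (j < z)%N -> (x : 'I_p -> E) j = (y : 'I_p -> E) j) ->
  partConf z x -> partConf z y.
Proof. by move=> xy Cx j k jz kz jk; rewrite -!xy //; exact: Cx. Qed.

Lemma sec_partConf v x : partConf z x -> partConf z (secFun v x).
Proof. by apply: partConf_eq => j jz; rewrite sec_lt. Qed.

Lemma line_partConf (f0 f1 : V -> V) x a :
  (forall j : 'I_p, (j < z)%N -> (f0 x : 'I_p -> E) j = (f1 x : 'I_p -> E) j) ->
  partConf z (f0 x) -> partConf z (lineFun f0 f1 (x, a)).
Proof.
move=> e; apply: partConf_eq => j jz; rewrite /lineFun /= -e //.
by rewrite -scalerDl subrK scale1r.
Qed.

Lemma line_gap (f0 f1 : V -> V) x a :
  gap (lineFun f0 f1 (x, a)) = (1 - a) *: gap (f0 x) + a *: gap (f1 x).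
Proof. by rewrite /gap /lineFun /= !scalerBr opprD addrACA. Qed.

End Pair.
End ConfSpace.

(** * The complement of a point, fibrewise *)
Section Suspension.
Variables (R : realType) (p n : nat) (F : fieldType).
Notation E := 'rV[R]_n.+1.
Notation V := (confAmbient R p n).
Notation C k := (cochain F (sing R V) k).

Add Ring Fring : (field_ring_theory F).

(** Formal combinations of self-maps. Coefficients are included so that an operator minus its
    eigenvalue is again of this kind and can be suspended. *)
Definition ops := seq (F * continuousType V V).
Definition applyOps (L : ops) k (x : C k) : C k := \sum_(o <- L) o.1 *: pull o.2 x.

Definition opsMap (L : ops) (U U' : set V) :=
  forall o, o \in L -> forall v, U v -> U' (o.2 v).

Lemma applyOpsB L k (x y : C k) : applyOps L (x - y) = applyOps L x - applyOps L y.
Proof.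
by rewrite /applyOps -sumrB; apply: eq_bigr => o _; rewrite pullB scalerBr.
Qed.

Lemma codiff_applyOps L k (x : C k) : codiff (applyOps L x) = applyOps L (codiff x).
Proof.
rewrite codiff_sum; apply: eq_bigr => o _.
by rewrite codiffZ codiff_pullE.
Qed.

Lemma bnd_applyOps L U U' k (x : C k) : opsMap L U U' -> bnd U' x -> bnd U (applyOps L x).
Proof.
move=> LU bx; rewrite /applyOps big_seq; apply: bnd_sum => o oL.
by apply: bndZ; apply: bnd_pull bx; exact: LU.
Qed.

Lemma coc_applyOps L U U' k (x : C k) : opsMap L U U' -> coc U' x -> coc U (applyOps L x).
Proof.
move=> LU bx; rewrite /applyOps big_seq; apply: coc_sum => o oL.
by apply: cocZ; apply: coc_pull bx; exact: LU.
Qed.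

Lemma applyOps_ext L U U' k (x y : C k) : opsMap L U U' ->
  (forall s, inside U' s -> x s = y s) ->
  forall s, inside U s -> applyOps L x s = applyOps L y s.
Proof.
move=> LU xy s Us; rewrite /applyOps !cochain_sumE !big_seq; apply: eq_bigr => o oL.
by rewrite !cochainE; congr (_ * _); apply: xy => t; apply: LU => //; exact: Us.
Qed.

Lemma line_bnd U U' (f0 f1 : continuousType V V) k (x : C k) :
  (forall v a, U v -> 0 <= a <= 1 -> U' (lineFun f0 f1 (v, a))) ->
  coc U' x -> bnd U (pull f1 x - pull f0 x).
Proof.
move=> fU; apply: (homotopy_bnd (h := lineFun f0 f1) fU) => v _; apply/funext => j.
  by rewrite /= /lineFun /= subr0 scale1r scale0r addr0.
by rewrite /= /lineFun /= subrr scale0r scale1r add0r.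
Qed.

Lemma pull_id k (x : C k) : pull idfun x = x.
Proof. by apply/funext => s; congr (x _); exact/continuousEP. Qed.

Lemma bnd_set0 k (x : C k) : bnd set0 x.
Proof. 
case: k x => [|k] x; first by move=> s s0; case: (s0 (retract 0)).
by exists 0 => s s0; case: (s0 (retract 0)).
Qed.

Variables (z i : 'I_p).
Hypothesis iz : (i < z)%N.
Notation Cz := (@partConf R p n z).
Notation D := (@dLevel R p n z i).
Notation A := (@aLevel R p n z i).
Notation B := (@bLevel R p n z i).
Notation sec := (@secFun R p n z i).
Notation gap := (@gap R p n z i).

Definition axis (l : 'I_n.+1) : E := delta_mx 0 l.
Definition e0 : E := axis ord0.

Lemma axisE l l' : axis l 0 l' = (l' == l)%:R.
Proof. by rewrite mxE. Qed.

(** The points from index [z] on are unconstrained, so a straight line joins any two maps that agree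
    on the earlier points. *)
Lemma free_htp (f0 f1 : continuousType V V) k (x : C k) :
  (forall v (j : 'I_p), Cz v -> (j < z)%N -> (f0 v : 'I_p -> E) j = (f1 v : 'I_p -> E) j) ->
  (forall v, Cz v -> Cz (f0 v)) -> coc Cz x -> bnd Cz (pull f1 x - pull f0 x).
Proof.
move=> e f0C; apply: line_bnd => v a Cv _; apply: line_partConf; last exact: f0C.
by move=> j; exact: e.
Qed.

Lemma sec_dLevel (v : E) q x : Cz x -> (exists l : 'I_n.+1, (l < q)%N /\ v 0 l != 0) ->
  D q (sec v x).
Proof. by move=> Cx vq; split; [exact: sec_partConf | rewrite sec_gap]. Qed.

Lemma sec_htp (v v' : E) q k (x : C k) :
  (forall a, 0 <= a <= 1 -> exists l : 'I_n.+1, (l < q)%N /\ ((1 - a) *: v + a *: v') 0 l != 0) ->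
  coc (D q) x -> bnd Cz (pull (sec v') x - pull (sec v) x).
Proof.
move=> vv; apply: line_bnd => y a Cy a01; split.
  by apply: line_partConf => [j jz|] /=; [rewrite !sec_lt | exact: sec_partConf].
by rewrite line_gap !sec_gap //; exact: vv.
Qed.

Lemma lineE (a : R) (u v : E) l : ((1 - a) *: u + a *: v) 0 l = (1 - a) * u 0 l + a * v 0 l.
Proof. by rewrite !mxE. Qed.

Lemma line_retract (v : E) (l l' : 'I_n.+1) a (y : V) : (l' < l)%N -> a < 1 ->
  v 0 l' = 0 -> gap y 0 l' != 0 -> ((1 - a) *: gap y + a *: v) 0 l' != 0.
Proof.
move=> l'l a1 v0 g; rewrite lineE v0 mulr0 addr0 mulf_neq0 // subr_eq0.
by rewrite gt_eqF.
Qed.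

Lemma axis_lt (l l' : 'I_n.+1) : (l' < l)%N -> axis l 0 l' = 0.
Proof. by move=> ll; rewrite axisE; case: eqP ll => // ->; rewrite ltnn. Qed.

Lemma a_retract l k (x : C k) : coc (A l) x -> bnd (A l) (pull (sec (axis l)) x - x).
Proof.
move=> cx; rewrite -[X in _ - X]pull_id; apply: line_bnd cx => y a [Cy g] /andP[a0 a1]; split.
  by apply: line_partConf => // j jz /=; rewrite sec_lt.
rewrite line_gap sec_gap //=; move: a1; rewrite le_eqVlt => /predU1P[->|a1].
  by right; rewrite lineE subrr mul0r add0r mul1r axisE eqxx ltr01.
case: g => [[l' [l'l g]]|g].
  by left; exists l'; split=> //; apply: (line_retract l'l _ _ g) => //; exact: axis_lt.
right; rewrite lineE axisE eqxx mulr1.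
by rewrite ltr_pwDl // mulr_gt0 // subr_gt0.
Qed.

Lemma b_retract l k (x : C k) : coc (B l) x -> bnd (B l) (pull (sec (- axis l)) x - x).
Proof.
move=> cx; rewrite -[X in _ - X]pull_id; apply: line_bnd cx => y a [Cy g] /andP[a0 a1]; split.
  by apply: line_partConf => // j jz /=; rewrite sec_lt.
have NE l' : (- axis l) 0 l' = - axis l 0 l' by rewrite mxE.
rewrite line_gap sec_gap //=; move: a1; rewrite le_eqVlt => /predU1P[->|a1].
  by right; rewrite lineE NE subrr mul0r add0r mul1r axisE eqxx oppr_lt0 ltr01.
case: g => [[l' [l'l g]]|g].
  left; exists l'; split=> //; apply: (line_retract l'l _ _ g) => //.
  by rewrite NE axis_lt ?oppr0.
right; rewrite lineE NE axisE eqxx mulrN mulr1.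
have : (1 - a) * gap y 0 l < 0 by rewrite pmulr_rlt0 // subr_gt0.
by lra.
Qed.

(** Each half retracts to the section at plus or minus [axis l]. For [l > 0] a segment leads from
    there to [e0] without passing through zero, so a reduced class is trivial on both halves. *)
Lemma cover_bnd (l : 'I_n.+1) k (x : C k) : (0 < l)%N -> coc (D l.+1) x ->
  bnd Cz (pull (sec e0) x) -> bnd (A l) x /\ bnd (B l) x.
Proof.
move=> l0 cx bx.
have AD : A l `<=` D l.+1 by rewrite dLevelS; left.
have BD : B l `<=` D l.+1 by rewrite dLevelS; right.
have key (v : E) : (forall a, 0 <= a <= 1 -> exists l' : 'I_n.+1, (l' < l.+1)%N /\
    ((1 - a) *: e0 + a *: v) 0 l' != 0) -> bnd Cz (pull (sec v) x).
  by move=> hv; apply: bnd_subl bx; exact: sec_htp hv cx.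
have H (c : R) : c != 0 -> forall a, 0 <= a <= 1 -> exists l' : 'I_n.+1, (l' < l.+1)%N /\
    ((1 - a) *: e0 + a *: (c *: axis l)) 0 l' != 0.
  have l0' : (ord0 == l) = false by apply/negP => /eqP e; move: l0; rewrite -e.
  move=> c0 a _; have [->|a0] := eqVneq a 0.
    by exists ord0; rewrite lineE axisE eqxx subr0 mul1r mul0r addr0 oner_neq0.
  have cE : (c *: axis l) 0 l = c by rewrite mxE axisE eqxx mulr1.
  exists l; split=> //; rewrite lineE cE /e0 axisE [l == _]eq_sym l0'.
  by rewrite mulr0 add0r mulf_neq0.
split.
- have := a_retract (coc_restr AD cx) => /bnd_sym; move/bnd_subl; apply.
  apply: (bnd_restr (@aLevel_sub _ _ _ _ _ _)); apply: key.
  by rewrite -[axis l]scale1r; apply: H; exact: oner_neq0.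
- have := b_retract (coc_restr BD cx) => /bnd_sym; move/bnd_subl; apply.
  apply: (bnd_restr (@bLevel_sub _ _ _ _ _ _)); apply: key.
  by rewrite -scaleN1r; apply: H; rewrite oppr_eq0 oner_neq0.
Qed.

(** The desuspension [a - b], normalised to pull back to zero exactly and not only up to a
    coboundary: a cocycle from [partConf z] is subtracted from [a], which remains a primitive. *)
Lemma cover_class (l : 'I_n.+1) k (x : C k.+1) : (0 < l)%N -> coc (D l.+1) x ->
  bnd Cz (pull (sec e0) x) -> exists a b : C k,
  [/\ forall s, inside (A l) s -> x s = codiff a s,
      forall s, inside (B l) s -> x s = codiff b s,
      coc (D l) (a - b) & pull (sec e0) (a - b) = 0].
Proof.
move=> l0 cx bx; have [[a xa] [b xb]] := cover_bnd l0 cx bx.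
have cab : coc (D l) (a - b).
  move=> s Ds; rewrite codiffB !cochainE -xa; last first.
    by apply: insideS Ds; rewrite -dLevelI => x' [].
  by rewrite -xb ?subrr //; apply: insideS Ds; rewrite -dLevelI => x' [].
have e0D y : Cz y -> D l (sec e0 y).
  by move=> Cy; apply: sec_dLevel => //; exists ord0; rewrite axisE eqxx oner_neq0.
have cd : coc Cz (pull (sec e0) (a - b)) := coc_pull e0D cab.
exists (a - pull (sec e0) (a - b)), b; split=> //.
- move=> s As; rewrite codiffB !cochainE -xa // cd ?subr0 //.
  by apply: insideS As; exact: aLevel_sub.
- rewrite addrAC; apply: cocB => //; apply: coc_restr cd; exact: dLevel_sub.
- rewrite addrAC; move: (a - b) => w; rewrite pullB pull_comp.
  have -> : pull (sec e0 \o sec e0) w = pull (sec e0) w.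
    apply/funext => s; congr (w _); apply/continuousEP => t /=.
    by rewrite sec_sec.
  by rewrite subrr.
Qed.

(** Such operators preserve all levels and both halves, hence commute with desuspension. *)
Definition gapOps (L : ops) := opsMap L Cz Cz /\
  forall o, o \in L -> forall v, Cz v -> gap (o.2 v) = gap v.

Lemma gapOps_A L l : gapOps L -> opsMap L (A l) (A l).
Proof. by move=> [LC Lg] o oL v [Cv g]; split; [exact: LC | rewrite Lg]. Qed.
Lemma gapOps_B L l : gapOps L -> opsMap L (B l) (B l).
Proof. by move=> [LC Lg] o oL v [Cv g]; split; [exact: LC | rewrite Lg]. Qed.
Lemma gapOps_D L q : gapOps L -> opsMap L (D q) (D q).
Proof. by move=> [LC Lg] o oL v [Cv g]; split; [exact: LC | rewrite Lg]. Qed.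

Lemma bnd_D1 k (x : C k) : coc (D 1) x -> bnd (A ord0) x -> bnd (B ord0) x -> bnd (D 1) x.
Proof.
have D1 := @dLevelS R p n z i ord0; rewrite D1.
case: k x => [|k] x cx; first by move=> xA xB; exact: bnd_glue0.
move=> [a xa] [b xb]; apply: (@bnd_glue R F V _ _ (@aLevel_open R p n z i ord0) (@bLevel_open R p n z i ord0) k x a b cx xa xb).
by rewrite dLevelI dLevel0; exact: bnd_set0.
Qed.

Lemma Ne0_D1 y : Cz y -> D 1 (sec (- e0) y).
Proof.
move=> Cy; apply: sec_dLevel => //; exists ord0; rewrite mxE axisE eqxx.
by rewrite oppr_eq0 oner_neq0.
Qed.

Lemma D1_sub_A : A ord0 `<=` D 1. Proof. by rewrite (@dLevelS R p n z i ord0); left. Qed.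
Lemma D1_sub_B : B ord0 `<=` D 1. Proof. by rewrite (@dLevelS R p n z i ord0); right. Qed.

(** After [q] desuspensions a reduced class of degree [t] has degree [t - q] and lives on
    [dLevel 1], up to homotopy two disjoint copies of the base. It is trivial on one of them and
    comes from [partConf z] on the other. *)
Theorem suspension (q : nat) L : (q < n.+1)%N -> gapOps L -> forall t (x : C t),
  coc (D q.+1) x -> bnd Cz (pull (sec e0) x) ->
  (forall t' (y : C t'), (t' + q = t)%N -> coc Cz y -> bnd Cz (applyOps L y)) ->
  bnd (D q.+1) (applyOps L x).
Proof.
move=> qn gL; elim: q qn => [|q IH] qn t x cx bx hL.
  apply: bnd_D1; first exact: (coc_applyOps (gapOps_D gL) cx).
    apply: (bnd_applyOps (gapOps_A gL)).
    have := a_retract (coc_restr D1_sub_A cx) => /bnd_sym/bnd_subl; apply.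
    by apply: bnd_restr bx; exact: aLevel_sub.
  have := b_retract (coc_restr D1_sub_B cx) => /bnd_sym bx'.
  have := bnd_applyOps (gapOps_B gL) bx'; rewrite applyOpsB => /bnd_subl; apply.
  apply: (bnd_restr (@bLevel_sub _ _ _ _ _ _)); apply: hL; first by rewrite addn0.
  exact: coc_pull Ne0_D1 cx.
pose l : 'I_n.+1 := Ordinal qn.
have DE : D q.+2 = A l `|` B l := @dLevelS R p n z i l.
case: t x cx bx hL => [|t] x cx bx hL.
  have [bA bB] := @cover_bnd l _ x isT cx bx.
  apply: (bnd_applyOps (gapOps_D gL)); rewrite DE; exact: bnd_glue0.
have [a [b [xa xb cab sab]]] := @cover_class l _ x isT cx bx.
rewrite DE; apply: (@bnd_glue R F V _ _ (@aLevel_open R p n z i l) (@bLevel_open R p n z i l) _ _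
    (applyOps L a) (applyOps L b)).
- by rewrite -DE; exact: (coc_applyOps (gapOps_D gL) cx).
- move=> s As; rewrite codiff_applyOps.
  exact: (applyOps_ext (gapOps_A gL) xa As).
- move=> s Bs; rewrite codiff_applyOps.
  exact: (applyOps_ext (gapOps_B gL) xb Bs).
rewrite -applyOpsB dLevelI; apply: IH => //; first exact: ltnW.
  by rewrite sab; exact: bnd0.
by move=> t' y tq; apply: hL; rewrite addnS tq.
Qed.

Definition antiFun (x : V) : V := fun j =>
  if j == z then (x : 'I_p -> E) i - gap x else (x : 'I_p -> E) j.

Lemma anti_continuous : continuous antiFun.
Proof.
apply: ptws_continuous => j; rewrite /antiFun; case: eqP => _; last exact: coord_cts.
move=> x; apply: (@cvgB R E _ (nbhs x)); [exact: coord_cts | exact: diff_cts].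
Qed.
HB.instance Definition _ := isContinuous.Build _ _ antiFun anti_continuous.

Lemma anti_lt x (j : 'I_p) : (j < z)%N -> (antiFun x : 'I_p -> E) j = (x : 'I_p -> E) j.
Proof. by move=> jz; rewrite /antiFun; case: eqP jz => // ->; rewrite ltnn. Qed.
Lemma anti_gap x : gap (antiFun x) = - gap x.
Proof. by rewrite {1}/gap [X in _ - X]anti_lt // /antiFun eqxx addrAC subrr add0r. Qed.
Lemma anti_partConf x : Cz x -> Cz (antiFun x).
Proof. by apply: partConf_eq => j jz; rewrite anti_lt. Qed.
Lemma anti_D q x : D q x -> D q (antiFun x).
Proof.
move=> [Cx [l [lq g]]]; split; first exact: anti_partConf.
by exists l; rewrite anti_gap mxE oppr_eq0.
Qed.
Lemma anti_AB l x : (A l x -> B l (antiFun x)) /\ (B l x -> A l (antiFun x)).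
Proof.
split=> -[Cx g]; (split; first exact: anti_partConf); case: g => [[l' [l'l g]]|g];
  try by left; exists l'; rewrite anti_gap mxE oppr_eq0.
  by right; rewrite anti_gap mxE oppr_lt0.
by right; rewrite anti_gap mxE oppr_gt0.
Qed.

Lemma anti_free k (x : C k) : coc Cz x -> bnd Cz (pull antiFun x - x).
Proof.
move=> cx; rewrite -[X in _ - X]pull_id; apply: free_htp cx => //= v j _ jz.
by rewrite anti_lt.
Qed.

(** The antipode exchanges the halves and so contributes one sign for each suspension. For [q = 0]
    it exchanges two points, and the failure of the image to be reduced is the error term [v], which
    disappears after one suspension. *)
Theorem antipode (q : nat) : (q < n.+1)%N -> forall t (x : C t),
  coc (D q.+1) x -> bnd Cz (pull (sec e0) x) ->
  exists v : C t, [/\ coc Cz v, (0 < q)%N -> v = 0 &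
    bnd (D q.+1) (pull antiFun x - (-1) ^+ q.+1 *: x - v)].
Proof.
elim: q => [|q IH] qn t x cx bx.
  have cv : coc Cz (pull (sec (- e0)) x) by exact: coc_pull Ne0_D1 cx.
  exists (pull (sec (- e0)) x); split=> //; rewrite expr1 scaleN1r opprK.
  have bA : bnd (A ord0) x.
    have := a_retract (coc_restr D1_sub_A cx) => /bnd_sym/bnd_subl; apply.
    by apply: bnd_restr bx; exact: aLevel_sub.
  have bB := b_retract (coc_restr D1_sub_B cx).
  apply: bnd_D1.
  - apply: cocB; last by apply: coc_restr cv; exact: dLevel_sub.
    by apply: cocD => //; apply: coc_pull cx; exact: anti_D.
  - rewrite addrAC; apply: bndD => //.
    have b1 : bnd (A ord0) (pull antiFun (pull (sec (- e0)) x - x)).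
      by apply: bnd_pull bB => v; case: (anti_AB ord0 v).
    have b2 : bnd (A ord0) (pull antiFun (pull (sec (- e0)) x) - pull (sec (- e0)) x).
      by apply: (bnd_restr (@aLevel_sub _ _ _ _ _ _)); exact: anti_free.
    by apply: bnd_trans b2; apply: bnd_sym; rewrite -pullB.
  - rewrite -addrA; apply: bndD; last exact: bnd_sym.
    by apply: bnd_pull bA => v; case: (anti_AB ord0 v).
pose l : 'I_n.+1 := Ordinal qn.
have DE : D q.+2 = A l `|` B l := @dLevelS R p n z i l.
exists 0; split=> //; first exact: coc0.
rewrite subr0.
case: t x cx bx => [|t] x cx bx.
  have [bA bB] := @cover_bnd l _ x isT cx bx.
  have b0 : bnd (D q.+2) x by rewrite DE; exact: bnd_glue0.
  by apply: bndB; [apply: bnd_pull b0; exact: anti_D | exact: bndZ].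
have [a [b [xa xb cab sab]]] := @cover_class l _ x isT cx bx.
have [|v [cv _ bv]] := IH (ltnW qn) _ _ cab; first by rewrite sab; exact: bnd0.
set c := (-1) ^+ q.+2.
(* The antipode interchanges the two primitives. The error term of the induction is a cocycle on the
   base and is absorbed into the primitive on [aLevel]. *)
rewrite DE; apply: (@bnd_glue R F V _ _ (@aLevel_open R p n z i l) (@bLevel_open R p n z i l) _ _
    (pull antiFun b - c *: a + v) (pull antiFun a - c *: b)).
- rewrite -DE; apply: cocB; last exact: cocZ.
  by apply: coc_pull cx; exact: anti_D.
- move=> s As; rewrite codiffD codiffB codiffZ codiff_pullE !cochainE.
  rewrite cv; last by apply: insideS As; exact: aLevel_sub.
  rewrite addr0 -xa //; congr (_ - _); apply: xb => t'.
  by apply: (anti_AB l _).1; exact: As.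
- move=> s Bs; rewrite codiffB codiffZ codiff_pullE !cochainE -xb //.
  by congr (_ - _); apply: xa => t'; apply: (anti_AB l _).2; exact: Bs.
rewrite dLevelI; have := bndN bv; congr (bnd _ _).
have -> : c = - (-1) ^+ q.+1 by rewrite /c exprS mulN1r.
by rewrite pullB; apply/funext => s; rewrite !cochainE; fring F.
Qed.

End Suspension.

(** * Cohomology of configuration spaces *)
Section Spanning.
Variables (R : realType) (p n : nat) (F : fieldType).
Notation E := 'rV[R]_n.+1.
Notation V := (confAmbient R p n).
Notation C k := (cochain F (sing R V) k).
Notation pt x i := ((x : 'I_p -> E) i).

Section Adding.
Variable z : 'I_p.
Notation Cz := (@partConf R p n z).
Notation Y i := (@dLevel R p n z i n.+1).
Notation sec i := (@secFun R p n z i).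

Lemma Y_P i x : Y i x <-> Cz x /\ pt x z <> pt x i.
Proof.
split=> [[Cx [l [_ g]]]|[Cx xzi]]; split=> //.
  by move=> e; move: g; rewrite /gap e subrr mxE eqxx.
have /rV_neq0P [l g] : gap z i x <> 0.
  by move=> e; apply: xzi; apply/eqP; rewrite -subr_eq0; exact/eqP.
by exists l.
Qed.

Lemma ltnS_ord (i j : 'I_p) : (i < j.+1)%N -> i = j \/ (i < j)%N.
Proof.
rewrite ltnS leq_eqVlt => /predU1P[e|]; [by left; exact: val_inj | by right].
Qed.

Definition stage (j : nat) : set V := [set x | Cz x /\ forall i : 'I_p, (i < j)%N -> pt x z <> pt x i].

Lemma stage_top : stage z = @partConf R p n z.+1.
Proof.
apply/seteqP; split=> x /=.
  move=> [Cx xz] i j /ltnS_ord[->|iz] /ltnS_ord[->|jz] // ij.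
  - exact: xz.
  - by move=> e; exact: (xz i).
  - exact: Cx.
move=> Cx; split=> [i j iz jz|i iz]; first by apply: Cx; rewrite ltnS ltnW.
apply: Cx => //; first by rewrite ltnS ltnW.
by move=> e; rewrite -e ltnn in iz.
Qed.

Lemma stage_open j : open (stage j).
Proof.
apply: openI; first exact: partConf_open.
have H (i : 'I_p) : open [set x : V | (i < j)%N -> pt x z <> pt x i].
  by apply: open_imp; exact: open_neq_pt.
exact: (open_forall H).
Qed.

Lemma stageS (i : 'I_p) : stage i.+1 = stage i `&` Y i.
Proof.
apply/seteqP; split=> x.
  move=> [Cx xz]; split; first by split=> // j ji; apply: xz; rewrite ltnS ltnW.
  by apply/Y_P; split=> //; exact: xz.
move=> [[Cx xz] /Y_P[_ xi]]; split=> // j /ltnS_ord[-> //|]; exact: xz.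
Qed.

(** If the point [z] meets the point [i], it differs from the earlier ones, since those differ from
    the point [i]. *)
Lemma stageU (i : 'I_p) : (i < z)%N -> stage i `|` Y i = Cz.
Proof.
move=> iz; apply/seteqP; split=> x; first by case=> [[]|/Y_P[]].
move=> Cx; have [e|ne] := pselect (pt x z = pt x i); last by right; apply/Y_P.
left; split=> // j ji; rewrite e; apply: Cx => //; first exact: ltn_trans ji iz.
by move=> ij; rewrite ij ltnn in ji.
Qed.

Lemma sec_Y (i : 'I_p) x : (i < z)%N -> Cz x -> Y i (sec i (e0 R n) x).
Proof.
by move=> iz Cx; apply: sec_dLevel => //; exists ord0; rewrite axisE eqxx oner_neq0.
Qed.

Lemma sec_free (i : 'I_p) (iz : (i < z)%N) k (x : C k) : coc Cz x ->
  bnd Cz (pull (sec i (e0 R n)) x - x).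
Proof.
move=> cx; rewrite -[X in _ - X]pull_id.
apply: (@free_htp R p n F z idfun (sec i (e0 R n)) k x _ _ cx) => //= v j _ jz.
by rewrite sec_lt.
Qed.

(** Placing [z] next to the point [i] is a homotopy section of the inclusion. *)
Lemma Y_inj (i : 'I_p) (iz : (i < z)%N) k (x : C k) : coc Cz x -> bnd (Y i) x -> bnd Cz x.
Proof.
move=> cx bx; have := sec_free iz cx => /bnd_sym/bnd_subl; apply.
by apply: bnd_pull bx => v; exact: sec_Y.
Qed.

(** The points are avoided one at a time. At each stage the union of the two open sets is
    [partConf z], so that [Y_inj] supplies the injectivity asked for by [coc_split]. *)
Lemma span_stage (j : nat) k (x : C k) : (j < z)%N -> coc (stage j.+1) x ->
  exists w : 'I_p -> C k, (forall i : 'I_p, (i <= j)%N -> coc (Y i) (w i)) /\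
    forall s, inside (stage j.+1) s -> x s = \sum_(i : 'I_p | (i <= j)%N) w i s.
Proof.
elim: j x => [|j IH] x jz.
  have p0 : (0 < p)%N by apply: leq_ltn_trans (ltn_ord z).
  have -> : stage 1 = Y (Ordinal p0).
    rewrite (stageS (Ordinal p0)); apply/seteqP; split=> x'; first by case.
    by move=> Yx; split; last exact: Yx; split=> //; case: Yx.
  move=> cx; exists (fun _ : 'I_p => x); split=> [i|s _].
    by rewrite leqn0 => /eqP i0; rewrite (_ : i = Ordinal p0) //; exact: val_inj.
  by rewrite (big_pred1 (Ordinal p0)) // => i; rewrite leqn0.
have jp : (j.+1 < p)%N by apply: ltn_trans (ltn_ord z).
pose i := Ordinal jp; have iz : (i < z)%N by [].
rewrite (stageS i) => cx.
have [|a [b [ca cb xab]]] := coc_split (stage_open i) (@dLevel_open R p n z i n.+1) cx.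
  by rewrite (stageU iz) => y cy; exact: Y_inj.
have [w [cw aw]] := IH a (ltnW jz) ca.
exists (fun i' => if i' == i then - b else w i'); split=> [i'|s Us].
  case: (eqVneq i' i) => [-> _|ne]; first exact: cocN.
  rewrite leq_eqVlt => /predU1P[e|/cw //]; by case/eqP: ne; exact: val_inj.
rewrite xab // (bigD1 i) //= eqxx addrC; congr (_ + _).
rewrite aw; last by apply: insideS Us => y [].
apply: eq_big => [i'|i' i'j]; last first.
  by rewrite ifF //; apply/negP => /eqP e; rewrite e /= ltnn in i'j.
rewrite [in RHS]leq_eqVlt ltnS; case: (eqVneq i' i) => [->|ne] /=.
  by rewrite ltnn eqxx.
rewrite andbT; case: eqP => // e; by case/eqP: ne; exact: val_inj.
Qed.

Lemma span k (x : C k) : (0 < z)%N -> coc (@partConf R p n z.+1) x ->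
  exists w : 'I_p -> C k, (forall i : 'I_p, (i < z)%N -> coc (Y i) (w i)) /\
    forall s, inside (@partConf R p n z.+1) s -> x s = (\sum_(i : 'I_p | (i < z)%N) w i) s.
Proof.
rewrite -stage_top; case: (nat_of_ord z) (@span_stage) => // m sp _ cx.
have [w [cw xw]] := sp m k x (ltnSn m) cx.
by exists w; split=> [i|s Us]; [exact: cw | rewrite xw // cochain_sumE].
Qed.

Lemma partConfS_Y (i : 'I_p) : (i < z)%N -> @partConf R p n z.+1 `<=` Y i.
Proof.
by rewrite -stage_top => iz x [Cx xz]; apply/Y_P; split=> //; exact: xz.
Qed.

Lemma partConfS_sub : @partConf R p n z.+1 `<=` Cz.
Proof. by rewrite -stage_top => x []. Qed.

Lemma coc_sec (i : 'I_p) (iz : (i < z)%N) k (x : C k) : coc (Y i) x -> coc Cz (pull (sec i (e0 R n)) x).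
Proof. by apply: coc_pull => v; exact: sec_Y. Qed.

Lemma sec_rest (i : 'I_p) (iz : (i < z)%N) k (x : C k) :
  pull (sec i (e0 R n)) (x - pull (sec i (e0 R n)) x) = 0.
Proof.
rewrite pullB pull_comp.
have -> : pull (sec i (e0 R n) \o sec i (e0 R n)) x = pull (sec i (e0 R n)) x.
  apply/funext => s; congr (x _); apply/continuousEP => t /=.
  by rewrite sec_sec.
by rewrite subrr.
Qed.

Lemma Y_sub i : Y i `<=` Cz. Proof. by move=> x []. Qed.

Lemma coc_rest (i : 'I_p) (iz : (i < z)%N) k (x : C k) : coc (Y i) x ->
  coc (Y i) (x - pull (sec i (e0 R n)) x).
Proof.
move=> cx; apply: cocB => //; apply: coc_restr (@Y_sub i) _; exact: coc_sec.
Qed.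

Lemma suspension_Y (i : 'I_p) (iz : (i < z)%N) L k (x : C k) :
  gapOps z i L -> coc (Y i) x -> pull (sec i (e0 R n)) x = 0 ->
  (forall t (y : C t), (t + n = k)%N -> coc Cz y -> bnd Cz (applyOps L y)) ->
  bnd (Y i) (applyOps L x).
Proof.
move=> gL cx sx hL; apply: suspension => //; by rewrite sx; exact: bnd0.
Qed.

Lemma suspension_id (i : 'I_p) (iz : (i < z)%N) k (x : C k) :
  coc (Y i) x -> pull (sec i (e0 R n)) x = 0 ->
  (forall t (y : C t), (t + n = k)%N -> coc Cz y -> bnd Cz y) -> bnd (Y i) x.
Proof.
move=> cx sx hL; have opE t (y : C t) : applyOps [:: (1 : F, idfun : continuousType V V)] y = y.
  by rewrite /applyOps big_seq1 scale1r pull_id.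
rewrite -[x]opE; apply: suspension_Y => //.
  by split; move=> o; rewrite inE => /eqP ->.
by move=> t y tk cy; rewrite opE; exact: hL.
Qed.

End Adding.

Lemma partConf1 : @partConf R p n 1 = setT.
Proof.
apply/seteqP; split=> x // _ i j; rewrite !ltnS !leqn0 => /eqP i0 /eqP j0 ij.
by case: ij; apply: val_inj; rewrite /= i0 j0.
Qed.

Lemma const_homotopy k (x : C k) : coc setT x -> bnd setT (pull (cst (0 : V)) x - x).
Proof. by move=> cx; rewrite -[X in _ - X]pull_id; apply: line_bnd cx. Qed.

Lemma pull_const k (x : C k) (v : V) : exists c : F, forall s, pull (cst v) x s = c.
Proof.
exists (x (cst v : sing R V k)) => s; congr (x _); exact/continuousEP.
Qed.

Lemma sum_signs N : \sum_(h < N) (-1) ^+ h = (odd N)%:R :> F.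
Proof.
elim: N => [|N IH]; first by rewrite big_ord0.
rewrite big_ord_recr /= IH -signr_odd; case: (odd N) => /=.
  by rewrite expr1 subrr.
by rewrite expr0 add0r.
Qed.

(** The pulled back cochain has one constant value, and the signs of a coboundary sum to [0] or [1]
    by parity. In even degree the constant is a coboundary; in odd degree being a cocycle forces it
    to vanish. *)
Lemma const_bnd k (x : C k.+1) (v : V) : coc setT x -> bnd setT (pull (cst v) x).
Proof.
move=> cx; have [c xc] := pull_const x v; have [odk|evk] := boolP (odd k).
  exists (fun=> c) => s _; rewrite xc /codiff -big_distrl /= sum_signs /= negbK odk.
  by rewrite mul1r.
suff c0 : c = 0 by exists 0 => s _; rewrite codiff0 xc c0.
have /cx : inside setT (cst v : sing R V k.+2) by [].
rewrite /codiff (eq_bigr (fun h : 'I_k.+3 => (-1) ^+ h * c)); last first.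
  by move=> h _; rewrite -(xc (cst v : sing R V k.+1)); congr (_ * x _); exact/continuousEP.
by rewrite -big_distrl /= sum_signs /= negbK evk mul1r.
Qed.

(** The cohomological form of the fibration: a part from the base plus, for every earlier point, a
    reduced class of the sphere around it. *)
Lemma decompose (z : 'I_p) k (x : C k) : (0 < z)%N -> coc (@partConf R p n z.+1) x ->
  exists y : C k, exists w : 'I_p -> C k, [/\ coc (@partConf R p n z) y,
    forall i : 'I_p, (i < z)%N -> coc (@dLevel R p n z i n.+1) (w i),
    forall i : 'I_p, (i < z)%N -> pull (secFun z i (e0 R n)) (w i) = 0 &
    forall s, inside (@partConf R p n z.+1) s ->
      x s = (y + \sum_(i : 'I_p | (i < z)%N) w i) s].
Proof.
move=> z0 cx; have [w [cw xw]] := span z0 cx.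
exists (\sum_(i : 'I_p | (i < z)%N) pull (secFun z i (e0 R n)) (w i)).
exists (fun i => w i - pull (secFun z i (e0 R n)) (w i)); split.
- by apply: coc_sum => i iz; apply: coc_sec => //; exact: cw.
- by move=> i iz; apply: coc_rest => //; exact: cw.
- by move=> i iz; exact: sec_rest.
- by move=> s Us; rewrite xw // sumrB addrC subrK.
Qed.

(** A further point either leaves the degree alone or, through a reduced class, raises it by [n]. *)
Theorem conf_vanishing (k : nat) : (0 < k <= p)%N -> forall t (x : C t),
  coc (@partConf R p n k) x -> (forall c, (c < k)%N -> t <> (c * n)%N) ->
  bnd (@partConf R p n k) x.
Proof.
elim: k => [//|[|k] IH] /= kp t x cx tn.
  rewrite partConf1 in cx *; case: t x cx tn => [|t] x cx tn.
    by case: (tn 0%N isT).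
  have := const_homotopy cx => /bnd_sym/bnd_subl; apply.
  exact: const_bnd.
pose z : 'I_p := Ordinal kp.
have {}IH : forall t (x : C t), coc (@partConf R p n z) x ->
    (forall c, (c < z)%N -> t <> (c * n)%N) -> bnd (@partConf R p n z) x.
  exact: IH (ltnW kp).
have [y [w [cy cw sw xE]]] := @decompose z _ _ isT cx.
apply: (@bnd_ext _ _ _ _ _ (y + \sum_(i : 'I_p | (i < z)%N) w i)).
  by move=> s Us; rewrite xE.
apply: bndD.
  apply: (bnd_restr (@partConfS_sub z)); apply: IH => // c cz; apply: tn.
  exact: ltnW.
apply: bnd_sum => i iz; apply: (bnd_restr (@partConfS_Y z _ iz)).
apply: (@suspension_id z i iz) => //; [exact: cw | exact: sw | ].
move=> t' y' tt cy'; apply: IH => // c cz t'c; apply: (tn c.+1) => //.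
by rewrite -tt t'c mulSn addnC.
Qed.

Theorem conf_connected (k : nat) : (0 < n)%N -> (0 < k <= p)%N -> forall x : C 0,
  coc (@partConf R p n k) x -> exists c : F, forall s, inside (@partConf R p n k) s -> x s = c.
Proof.
move=> n0; elim: k => [//|[|k] IH] /= kp x cx.
  rewrite partConf1 in cx *; have [c xc] := pull_const x 0; exists c => s Us.
  have := const_homotopy cx => /(_ s Us); rewrite !cochainE xc => /eqP.
  by rewrite subr_eq0 => /eqP.
pose z : 'I_p := Ordinal kp.
have [y [w [cy cw sw xE]]] := @decompose z _ _ isT cx.
have [c yc] := IH (ltnW kp) y cy.
exists c => s Us; rewrite xE // cochainE cochain_sumE big1 ?addr0.
  by apply: yc; apply: insideS Us; exact: (@partConfS_sub z).
move=> i iz; have bw : bnd (@dLevel R p n z i n.+1) (w i).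
  apply: (@suspension_id z i iz) => //; [exact: cw | exact: sw |].
  by move=> t' y' /eqP; rewrite addn_eq0 => /andP[_ /eqP nz]; rewrite nz in n0.
by apply: bw; exact: insideS (@partConfS_Y z _ iz) Us.
Qed.

End Spanning.

(** * Separating the points by colour *)
Section Colors.
Variables (R : realType) (p n : nat) (F : fieldType).
Notation E := 'rV[R]_n.+1.
Notation V := (confAmbient R p n).
Notation C k := (cochain F (sing R V) k).
Notation pt x i := ((x : 'I_p -> E) i).
Notation conf k := (@partConf R p n k).

Add Ring Fring : (field_ring_theory F).

Lemma coord_le_norm (v : E) l : `|v 0 l| <= `|v|.
Proof. by rewrite [`|v|]mx_normrE; exact: (le_bigmax _ _ (0, l)). Qed.

(** It exceeds all distances between points ([spread_gt]), so that shifts by integral multiples of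
    it cannot make points of different colours collide; it is continuous and invariant under
    permutations. *)
Definition spread (x : V) : R := 1 + 2 * \sum_i `|pt x i|.

Lemma spread_gt0 x : 0 < spread x.
Proof. by rewrite ltr_pwDl // mulr_ge0 // sumr_ge0. Qed.

Lemma spread_gt x i j : `|pt x i - pt x j| < spread x.
Proof.
have le k : `|pt x k| <= \sum_i `|pt x i| by rewrite (bigD1 k) //= lerDl sumr_ge0.
apply: le_lt_trans (ler_normB _ _) _; rewrite /spread.
by have := le i; have := le j; lra.
Qed.

Lemma norm_pt_lt x i : `|pt x i| < spread x.
Proof.
have le : `|pt x i| <= \sum_i `|pt x i| by rewrite (bigD1 i) //= lerDl sumr_ge0.
have : 0 <= \sum_i `|pt x i| by exact: sumr_ge0.
by rewrite /spread; lra.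
Qed.

Lemma spread_continuous : continuous spread.
Proof.
have c1 : continuous (fun x : V => \sum_i `|pt x i|).
  apply: (@continuous_sum R R^o) => i x.
  apply: (@continuous_comp V E R (fun x => pt x i) Num.norm); first exact: coord_cts.
  exact: norm_continuous.
move=> x; apply: (@cvgD R R^o _ (nbhs x)); first exact: cvg_cst.
by apply: (@cvgMl_tmp R _ (nbhs x)); exact: c1.
Qed.

Definition shiftBy (a : 'I_p -> R) (x : V) : V :=
  fun j => pt x j + (spread x * a j) *: e0 R n.

Lemma shift_continuous a : continuous (shiftBy a).
Proof.
apply: ptws_continuous => j x; apply: (@cvgD R E _ (nbhs x)); first exact: coord_cts.
apply: (@cvgZr_tmp R E _ (nbhs x)); apply: (@cvgMr_tmp R _ (nbhs x)).
exact: spread_continuous.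
Qed.
HB.instance Definition _ a := isContinuous.Build _ _ (shiftBy a) (@shift_continuous a).

Lemma e0E : e0 R n 0 0 = 1. Proof. by rewrite axisE eqxx. Qed.

Lemma far_coord (v : E) (s a : R) : `|v| < s -> 1 <= `|a| -> (v + (s * a) *: e0 R n) 0 0 != 0.
Proof.
move=> vs a1; rewrite !mxE eqxx mulr1; apply/negP; rewrite addr_eq0 => /eqP e.
have := coord_le_norm v 0; rewrite e normrN normrM => H.
have s0 : 0 < s by apply: le_lt_trans vs.
rewrite (gtr0_norm s0) in H; have : s <= s * `|a| by rewrite ler_peMr // ltW.
by move: H vs; lra.
Qed.

Lemma shift_diff a x i j : pt (shiftBy a x) i - pt (shiftBy a x) j =
  (pt x i - pt x j) + (spread x * (a i - a j)) *: e0 R n.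
Proof. by rewrite /shiftBy mulrBr scalerBl opprD addrACA. Qed.

Lemma shift_neq a x (i j : 'I_p) : a i = a j \/ 1 <= `|a i - a j| ->
  (a i = a j -> pt x i <> pt x j) -> pt (shiftBy a x) i <> pt (shiftBy a x) j.
Proof.
case=> [aij /(_ aij) xij e|aij _ e].
  apply: xij; apply/eqP; rewrite -subr_eq0.
  by have := shift_diff a x i j; rewrite e subrr aij subrr mulr0 scale0r addr0 => <-.
by have := far_coord (spread_gt x i j) aij; rewrite -shift_diff e subrr mxE eqxx.
Qed.

Variable m : nat.
Definition coloring := {ffun 'I_p -> 'I_m}.
Definition level (c : coloring) (i : 'I_p) : R := (c i)%:R.
Definition separate (c : coloring) : continuousType V V := shiftBy (level c).

Lemma level_sep (c : coloring) i j : c i = c j \/ 1 <= `|level c i - level c j|.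
Proof.
have [->|ne] := eqVneq (c i) (c j); [by left | right].
wlog : i j ne / (c i < c j)%N.
  move=> W; have := ne; rewrite -(inj_eq val_inj) neq_ltn => /orP[lt|lt].
    exact: W.
  by rewrite distrC; apply: W => //; rewrite eq_sym.
move=> lt; rewrite distrC /level.
have -> : (c j)%:R - (c i)%:R = (c j - c i)%N%:R :> R by rewrite natrB // ltnW.
by rewrite normr_nat ler1n subn_gt0.
Qed.

Lemma level_sep' (c : coloring) i j : level c i = level c j \/ 1 <= `|level c i - level c j|.
Proof. by have [e|] := level_sep c i j; [left; rewrite /level e | right]. Qed.

Lemma separate_conf (c : coloring) k x : conf k x -> conf k (separate c x).
Proof.
move=> Cx i j ik jk ij; apply: shift_neq => [|_]; first exact: level_sep'.
exact: Cx.
Qed.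

Lemma separate_gap (c : coloring) z i x : c z = c i -> gap z i (separate c x) = gap z i x.
Proof. by move=> cz; rewrite /gap shift_diff /level cz subrr mulr0 scale0r addr0. Qed.

Definition psiOps : ops R p n F := [seq (1, separate c) | c <- index_enum coloring].
Definition psi k (x : C k) : C k := \sum_(c : coloring) pull (separate c) x.

Lemma psiE k (x : C k) : applyOps psiOps x = psi x.
Proof. by rewrite /applyOps big_map; apply: eq_bigr => c _; rewrite scale1r. Qed.

Lemma psiD k (x y : C k) : psi (x + y) = psi x + psi y.
Proof. by rewrite /psi -big_split. Qed.

Lemma psi_sum k (I : Type) (r : seq I) (P : pred I) (x : I -> C k) :
  psi (\sum_(i <- r | P i) x i) = \sum_(i <- r | P i) psi (x i).
Proof.
rewrite /psi exchange_big; apply: eq_bigr => c _.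
by rewrite pull_sum.
Qed.

Lemma bnd_psi U k (x : C k) : (forall c v, U v -> U (separate c v)) ->
  bnd U x -> bnd U (psi x).
Proof.
move=> cU bx; apply: bnd_sum => c _; apply: bnd_pull bx; exact: cU.
Qed.

Section Point.
Variables z i : 'I_p.
Hypotheses (iz : (i < z)%N) (n0 : (0 < n)%N).
Notation Y := (@dLevel R p n z i n.+1).
Notation sec := (@secFun R p n z i).

(** For [n > 0] the sphere is connected: the path from [e0] to its negative runs through a second
    axis. *)
Lemma sec_neg k (x : C k) : coc Y x -> bnd (conf z) (pull (sec (e0 R n)) x) ->
  bnd (conf z) (pull (sec (- e0 R n)) x).
Proof.
move=> cx bx; have ln : (1 < n.+1)%N by [].
pose l : 'I_n.+1 := Ordinal ln.
have l0 : (l == ord0) = false by [].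
have b1 : bnd (conf z) (pull (sec (axis R l)) x).
  apply: bnd_subl bx; apply: sec_htp cx => // a _.
  have [->|a0] := eqVneq a 0.
    by exists ord0; split=> //; rewrite lineE e0E subr0 mul1r mul0r addr0 oner_neq0.
  exists l; split=> //; rewrite lineE /e0 !axisE l0 eqxx mulr0 add0r mulr1.
  exact: a0.
apply: bnd_subl b1; apply: sec_htp cx => // a _.
have NE : (- e0 R n) 0 0 = -1 by rewrite mxE e0E.
have [->|a0] := eqVneq a 0.
  by exists l; split=> //; rewrite lineE axisE eqxx subr0 mul1r mul0r addr0 oner_neq0.
exists ord0; split=> //; rewrite lineE NE axisE [ord0 == l]eq_sym l0 mulr0 add0r mulrN1.
by rewrite oppr_eq0.
Qed.

(** Points of different colours are pulled apart in a fixed direction, so the map to the sphere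
    around the point [i] is homotopic to a constant, and the reduced class pulls back to zero. *)
Lemma separate_bnd (c : coloring) k (x : C k) : c z <> c i -> coc Y x ->
  bnd (conf z) (pull (sec (e0 R n)) x) -> bnd Y (pull (separate c) x).
Proof.
move=> cz cx bx; set d := level c z - level c i.
have d1 : 1 <= `|d| by have [/cz|] := level_sep c z i.
(* [s] is the sign of [d], the direction in which [z] moves away from [i]. *)
have [s [s1 sd bs]] : exists s : R, [/\ s * s = 1, 0 < s * d &
    bnd (conf z) (pull (sec (s *: e0 R n)) x)].
  have [d0|d0] := ltrP 0 d; first by exists 1; rewrite scale1r !mul1r.
  exists (-1); rewrite scaleN1r !mulN1r opprK oppr_gt0; split=> //; last exact: sec_neg.
  by rewrite lt_neqAle d0 andbT -normr_gt0 (lt_le_trans _ d1).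
(* An intermediate map whose gap is exactly a multiple of [e0]; straight lines with nonzero gap join
   it to [separate c] and to the section. *)
pose g (x : V) : V := fun j => if j == z then pt x i + (spread x * level c z) *: e0 R n
  else pt (separate c x) j.
have gc : continuous g.
  apply: ptws_continuous => j; rewrite /g; case: eqP => _; last first.
    by move=> y; exact: cts_coord.
  move=> y; apply: (@cvgD R E _ (nbhs y)); first exact: coord_cts.
  apply: (@cvgZr_tmp R E _ (nbhs y)); apply: (@cvgMr_tmp R _ (nbhs y)).
  exact: spread_continuous.
have zi : (i == z) = false by apply/negP => /eqP e; move: iz; rewrite e ltnn.
have g_lt y (j : 'I_p) : (j < z)%N -> pt (g y) j = pt (separate c y) j.
  by move=> jz; rewrite /g; case: eqP jz => // ->; rewrite ltnn.
have g_gap y : gap z i (g y) = (spread y * d) *: e0 R n.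
  rewrite /gap [X in _ - X]g_lt // /g eqxx /= /shiftBy opprD addrACA subrr add0r.
  by rewrite -scalerBl -mulrBr.
have g_C y : conf z y -> conf z (g y).
  by move=> Cy; have := @separate_conf c _ _ Cy; apply: partConf_eq => j jz; rewrite g_lt.
have Y0 y : conf z y -> gap z i y 0 0 != 0 -> Y y.
  by move=> Cy g0; split=> //; exists ord0.
apply: (@bnd_subl _ _ _ _ _ _ (pull (mkcts gc) x)).
  apply: bnd_sym; apply: line_bnd cx => y a Yy a01; have Cy : conf z y by case: Yy.
  have Cs := @separate_conf c _ _ Cy.
  apply: Y0; first by apply: line_partConf => // j jz; rewrite /= /mkcts g_lt.
  rewrite line_gap /= /mkcts g_gap {1}/gap shift_diff -/d scalerDr !scalerA -addrA -scalerDl.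
  rewrite -mulrDl subrK mul1r; apply: far_coord => //.
  rewrite normrZ; apply: le_lt_trans (spread_gt y z i).
  rewrite ler_piMl // ger0_norm ?subr_ge0; by case/andP: a01 => ? ?; lra.
apply: (@bnd_subl _ _ _ _ _ _ (pull (sec (s *: e0 R n) \o separate c) x)).
  apply: bnd_sym; apply: line_bnd cx => y a Yy /andP[a0 a1].
  have Cy : conf z y by case: Yy.
  apply: Y0.
    apply: line_partConf; last by rewrite /= /mkcts; exact: g_C.
    by move=> j jz; rewrite /= /mkcts g_lt // sec_lt.
  rewrite line_gap /= /mkcts g_gap sec_gap // !scalerA -scalerDl.
  rewrite mxE e0E mulr1; apply/negP => /eqP e.
  have : s * ((1 - a) * (spread y * d) + a * s) = 0 by rewrite e mulr0.
  have := spread_gt0 y; move: (spread y) => S S0.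
  have -> : s * ((1 - a) * (S * d) + a * s) = (1 - a) * S * (s * d) + a * (s * s).
    by lra.
  rewrite s1 mulr1 => H.
  have : 0 <= (1 - a) * S * (s * d).
    by apply: mulr_ge0; [apply: mulr_ge0; [rewrite subr_ge0 | exact: ltW] | exact: ltW].
  move=> H'; have az : a = 0 by lra.
  move: H; rewrite az subr0 mul1r addr0 => /eqP; rewrite mulf_eq0 => /orP[] /eqP E.
    by rewrite E ltxx in S0.
  by rewrite E ltxx in sd.
rewrite -pull_comp; apply: (bnd_pull _ bs) => y [Cy _]; exact: separate_conf.
Qed.

Lemma opsE (L : seq coloring) k (x : C k) :
  applyOps [seq (1, separate c) | c <- L] x = \sum_(c <- L) pull (separate c) x.
Proof. by rewrite /applyOps big_map; apply: eq_bigr => c _; rewrite scale1r. Qed.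

Definition recolor (c : coloring) (a : 'I_m) : coloring := [ffun j => if j == z then a else c j].

Lemma recolor_bnd c a k (x : C k) : coc (conf z) x ->
  bnd (conf z) (pull (separate c) x - pull (separate (recolor c a)) x).
Proof.
move=> cx; apply: free_htp cx => v.
  move=> j Cv jz; rewrite /= /shiftBy; congr (_ + (_ * _) *: _).
  by rewrite /level ffunE; case: eqP jz => // ->; rewrite ltnn.
exact: separate_conf.
Qed.

(** On [partConf z] the colour of [z] matters only up to homotopy. It may be changed to that of [i],
    and each resulting colouring arises [m] times. *)
Lemma psi_equal_colors k (x : C k) : coc (conf z) x ->
  bnd (conf z) (psi x - m%:R *: \sum_(c : coloring | c z == c i) pull (separate c) x).
Proof.
move=> cx; rewrite /psi (partition_big (fun c : coloring => c z) xpredT) //=.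
rewrite scaler_nat -[m in _ *+ m]card_ord -sumr_const -sumrB.
apply: bnd_sum => a _.
have iz' : (i == z) = false by apply/negP => /eqP e; move: iz; rewrite e ltnn.
rewrite [X in _ - X](_ : _ =
    \sum_(c : coloring | c z == a) pull (separate (recolor c (c i))) x).
  by rewrite -sumrB; apply: bnd_sum => c _; exact: recolor_bnd.
rewrite (reindex_onto (fun c : coloring => recolor c (c i)) (fun c => recolor c a)).
  apply: eq_bigl => c; rewrite !ffunE eqxx iz' eqxx /=; apply/eqP/eqP => [<-|ca].
    by rewrite ffunE eqxx.
  by apply/ffunP => j; rewrite !ffunE; case: eqP => // ->.
move=> c /eqP cz; apply/ffunP => j; rewrite !ffunE iz'.
by case: (eqVneq j z) => [->|jz]; rewrite ?eqxx ?cz.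
Qed.

End Point.

Hypotheses (n0 : (0 < n)%N) (m0 : m%:R != 0 :> F).

(** Constants are multiplied by the number [m^p] of colourings. On a reduced class around the point
    [i] only colourings that give [z] and [i] the same colour survive, which by [psi_equal_colors]
    costs a factor [m]; each rise of the degree by [n] thus removes one factor. *)
Theorem psi_eigen (k : nat) : (0 < k <= p)%N -> forall c t (x : C t), (c <= p)%N ->
  t = (c * n)%N -> coc (conf k) x -> bnd (conf k) (psi x - m%:R ^+ (p - c) *: x).
Proof.
elim: k => [//|[|k] IH] /= kp c t x cp tE cx.
  case: c cp tE => [|c] cp tE; last first.
    have bx : bnd (conf 1) x.
      apply: conf_vanishing => // d; rewrite ltnS leqn0 => /eqP ->.
      by rewrite tE mul0n mulSn => /eqP; rewrite addn_eq0 => /andP[/eqP n00]; move: n0; rewrite n00.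
    apply: bndB; last exact: bndZ.
    by apply: bnd_psi bx => d v; exact: separate_conf.
  case: t x tE cx => // x _ cx; have [a xa] := conf_connected n0 (k := 1) kp cx.
  move=> s Us; rewrite !cochainE /psi cochain_sumE.
  rewrite (eq_bigr (fun=> a)); last first.
    by move=> d _; apply: xa => u; apply: separate_conf; exact: Us.
  rewrite xa // sumr_const card_ffun !card_ord subn0.
  have -> : a *+ (m ^ p) = m%:R ^+ p * a :> F by rewrite -natrX mulr_natl.
  exact: subrr.
pose z : 'I_p := Ordinal kp.
have [y [w [cy cw sw xE]]] := @decompose R p n F z _ _ isT cx.
set lam := m%:R ^+ (p - c).
have psi_ext (u u' : C t) U : (forall d v, U v -> U (separate d v)) ->
    (forall s, inside U s -> u s = u' s) ->
    forall s, inside U s -> (psi u - lam *: u) s = (psi u' - lam *: u') s.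
  move=> sU uu s Us; rewrite !cochainE /psi !cochain_sumE uu //; congr (_ - _).
  by apply: eq_bigr => d _; apply: uu => v; apply: sU; exact: Us.
apply: (@bnd_ext _ _ _ _ _ (psi (y + \sum_(i : 'I_p | (i < z)%N) w i)
   - lam *: (y + \sum_(i : 'I_p | (i < z)%N) w i))).
  move=> s Us; apply: (psi_ext _ _ (conf z.+1)) => //; first by move=> d v; exact: separate_conf.
  by move=> s' Us'; apply/esym; exact: xE.
rewrite psiD scalerDr opprD addrACA; apply: bndD.
  by apply: (bnd_restr (@partConfS_sub _ _ _ z)); apply: IH => //; exact: ltnW.
rewrite psi_sum scaler_sumr -sumrB; apply: bnd_sum => i iz.
apply: (bnd_restr (@partConfS_Y _ _ _ z _ iz)).
set x' := w i; have cx' := cw i iz; have sx' := sw i iz; rewrite -/x' in cx' sx'.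
rewrite /psi (bigID (fun d : coloring => d z == d i)) /= addrAC.
apply: bndD; last first.
  apply: bnd_sum => d /eqP dz; apply: (separate_bnd iz n0 dz cx').
  by rewrite sx'; exact: bnd0.
(* The surviving colourings preserve the gap. Together with minus the eigenvalue they form one
   operator, whose triviality on the base carries over by suspension. *)
pose L : ops R p n F := (- lam, idfun : continuousType V V) ::
  [seq (1, separate d) | d : coloring <- index_enum coloring & d z == d i].
have LE t' (u : C t') : applyOps L u =
    \sum_(d : coloring | d z == d i) pull (separate d) u - lam *: u.
  rewrite /applyOps big_cons addrC pull_id /= scaleNr; congr (_ - _).
  by rewrite -/(applyOps _ u) opsE big_filter.
rewrite -LE; apply: (suspension_Y iz) => //.
  split=> o; rewrite inE => /predU1P[-> //|/mapP[d]].
    by rewrite mem_filter => /andP[/eqP dz _] -> u Cu; exact: separate_conf.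
  by rewrite mem_filter => /andP[/eqP dz _] -> u Cu; rewrite /= separate_gap.
move=> t' u tt cu; rewrite LE.
case: c cp tE @lam psi_ext @L LE => [|c] cp tE lam _ L LE.
  by exfalso; move: n0 tt; rewrite tE mul0n; case: (n) => // n' _; rewrite addnS.
have t'E : t' = (c * n)%N by apply/eqP; rewrite -(eqn_add2r n) tt tE mulSn addnC.
have := IH (ltnW kp) c t' u (ltnW cp) t'E cu; have := psi_equal_colors iz cu.
have -> : m%:R ^+ (p - c) = m%:R * lam :> F by rewrite -exprS /lam; congr (_ ^+ _); lia.
set Q := \sum_(d | _) _ => b1 b2.
have := bndZ m%:R^-1 (bndB b2 b1); congr bnd.
apply/funext => s; rewrite !cochainE.
have mm : m%:R^-1 * m%:R = 1 :> F by rewrite mulVf.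
transitivity ((m%:R^-1 * m%:R) * (Q s - lam * u s)); last by rewrite mm mul1r.
have eqn (a b q e l d : F) : a * (b - q * l * d - (b - q * e)) = a * q * (e - l * d) by fring F.
exact: eqn.
Qed.

End Colors.

(** * Classes invariant under transpositions *)
Section Permutations.
Variables (R : realType) (p n : nat) (F : fieldType).
Notation E := 'rV[R]_n.+1.
Notation V := (confAmbient R p n).
Notation C k := (cochain F (sing R V) k).
Notation pt x i := ((x : 'I_p -> E) i).
Notation conf k := (@partConf R p n k).

Definition permFun (s : 'S_p) (x : V) : V := fun i => pt x (s i).

Lemma permFun_continuous s : continuous (permFun s).
Proof. by apply: ptws_continuous => i; exact: coord_cts. Qed.
HB.instance Definition _ s := isContinuous.Build _ _ (permFun s) (@permFun_continuous s).

Lemma permFun_conf (k : nat) (s : 'S_p) x : (forall i : 'I_p, (s i < k)%N = (i < k)%N) ->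
  conf k x -> conf k (permFun s x).
Proof.
move=> sk Cx i j ik jk ij; apply: Cx; rewrite ?sk //.
by move=> /perm_inj.
Qed.

Lemma tperm_lt (k : nat) (i j l : 'I_p) : (i < k)%N -> (j < k)%N -> (tperm i j l < k)%N = (l < k)%N.
Proof. by move=> ik jk; case: tpermP => [->|->|//]; rewrite ik jk. Qed.

(** * Two points close together *)

Section Cherry.
Variables z i : 'I_p.
Hypothesis iz : (i < z)%N.
Notation Cz := (@partConf R p n z).
Notation Y j := (@dLevel R p n z j n.+1).
Notation gap := (@gap R p n z i).
Notation anti := (@antiFun R p n z i).

Lemma neq_iz : (i == z) = false.
Proof. by apply/negP => /eqP e; move: iz; rewrite e ltnn. Qed.

(** Each factor [d / (1 + d)] is at most [1] and, for [d > 0], less than [d]. The scaled gap is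
    therefore shorter than the distance from the point [i] to any other of the first [z] points,
    while the scale is continuous and positive. *)
Definition scaleGap (x : V) : R :=
  (\prod_(j : 'I_p | (j < z)%N && (j != i)) (`|pt x i - pt x j| / (1 + `|pt x i - pt x j|)))
  / (1 + `|gap x|).

Lemma norm_diff_cts (j j' : 'I_p) : continuous (fun x : V => `|pt x j - pt x j'|).
Proof.
move=> x; apply: (@continuous_comp V E R (fun x => pt x j - pt x j') Num.norm); first exact: diff_cts.
exact: norm_continuous.
Qed.

Lemma inv1D_cts (f : V -> R) : continuous f -> (forall x, 0 <= f x) ->
  continuous (fun x => (1 + f x)^-1).
Proof.
move=> fc f0 x; apply: (@cvgV R _ (nbhs x)); first by rewrite gt_eqF // ltr_pwDl.
by apply: (@cvgD R R^o _ (nbhs x)); [exact: cvg_cst | exact: fc].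
Qed.

Lemma scaleGap_continuous : continuous scaleGap.
Proof.
move=> x; apply: (@cvgM R _ (nbhs x)); last first.
  by apply: inv1D_cts => // y; exact: norm_diff_cts.
have mc : continuous (fun x : R * R => x.1 * x.2) by exact: mul_continuous.
apply: (continuous_big (P := fun j : 'I_p => (j < z)%N && (j != i)) mc) => j _ {}x.
apply: (@cvgM R _ (nbhs x)); first exact: norm_diff_cts.
by apply: inv1D_cts => // y; exact: norm_diff_cts.
Qed.

Lemma frac_bound (d : R) : 0 <= d -> 0 <= d / (1 + d) <= 1.
Proof.
move=> d0; have d1 : 0 < 1 + d by rewrite ltr_pwDl.
by apply/andP; split; [apply: divr_ge0 => //; exact: ltW | rewrite ler_pdivrMr // mul1r lerDr].
Qed.

Lemma frac_lt (d : R) : 0 < d -> d / (1 + d) < d.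
Proof.
move=> d0; have d1 : 0 < 1 + d by rewrite addr_gt0.
by rewrite ltr_pdivrMr // mulrDr mulr1 ltrDl mulr_gt0.
Qed.

Lemma norm_gt0 (x : V) (j j' : 'I_p) : pt x j <> pt x j' -> 0 < `|pt x j - pt x j'|.
Proof. by move=> ne; rewrite normr_gt0 subr_eq0; exact/eqP. Qed.

Lemma scaleGap_gt0 x : Cz x -> 0 < scaleGap x.
Proof.
move=> Cx; rewrite divr_gt0 ?ltr_pwDl // prodr_gt0 // => j /andP[jz ji].
have d0 : 0 < `|pt x i - pt x j| by apply: norm_gt0; apply: Cx => // e; rewrite e eqxx in ji.
by rewrite divr_gt0 // addr_gt0.
Qed.

Lemma scaleGap_lt x (j : 'I_p) : Cz x -> (j < z)%N -> j != i ->
  `|scaleGap x *: gap x| < `|pt x i - pt x j|.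
Proof.
move=> Cx jz ji; rewrite normrZ gtr0_norm ?scaleGap_gt0 // /scaleGap.
have d0 : 0 < `|pt x i - pt x j| by apply: norm_gt0; apply: Cx => // e; rewrite e eqxx in ji.
rewrite (bigD1 j) /=; last by rewrite jz ji.
set P := \prod_(_ | _) _; set d := `|pt x i - pt x j| in d0 *; set g := `|_|.
have P1 : 0 <= P <= 1.
  rewrite prodr_ile1 ?andbT => [|l _]; last exact: frac_bound.
  by apply: prodr_ge0 => l _; case/andP: (@frac_bound `|pt x i - pt x l| (normr_ge0 _)).
have g1 : 0 <= g / (1 + g) <= 1 by apply: frac_bound; exact: normr_ge0.
have f1 := frac_lt d0; have /andP[f0 _] := frac_bound (ltW d0).
have -> : d / (1 + d) * P / (1 + g) * g = d / (1 + d) * (P * (g / (1 + g))).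
  by rewrite -!mulrA [(1 + g)^-1 * g]mulrC.
apply: le_lt_trans f1; rewrite ler_piMr //.
case/andP: P1 => P0 P1; case/andP: g1 => g0 g1.
by apply: le_trans g1; rewrite ler_piMl.
Qed.

Definition shrinkGap (x : V) : V := secFun z i (scaleGap x *: gap x) x.

Lemma shrink_continuous : continuous shrinkGap.
Proof.
apply: ptws_continuous => j; rewrite /shrinkGap /secFun; case: eqP => _; last exact: coord_cts.
move=> x; apply: (@cvgD R E _ (nbhs x)); first exact: coord_cts.
by apply: (@cvgZ R E _ (nbhs x)); [exact: scaleGap_continuous | exact: diff_cts].
Qed.
HB.instance Definition _ := isContinuous.Build _ _ shrinkGap shrink_continuous.

(** The points [i] and [z] stay in a ball around the old point [i] that contains none of the
    others. *)
Lemma move_conf (x y : V) (b c : R) (w : E) : Cz x ->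
  (forall j : 'I_p, (j < z)%N -> j != i -> pt y j = pt x j) ->
  (forall j : 'I_p, (j < z)%N -> j != i -> `|w| < `|pt x i - pt x j|) ->
  pt y i = pt x i + b *: w -> pt y z = pt x i + c *: w ->
  `|b| <= 1 -> `|c| <= 1 -> (b - c) *: w <> 0 -> conf z.+1 y.
Proof.
move=> Cx yE lt yi yz b1 c1 bcw.
have far (a : R) (j : 'I_p) : `|a| <= 1 -> (j < z)%N -> j != i -> pt x i + a *: w <> pt x j.
  move=> a1 jz ji e; have := lt j jz ji.
  have -> : pt x i - pt x j = - (a *: w) by rewrite -e opprD addrA subrr add0r.
  by rewrite normrN normrZ ltNge ler_piMl.
have off (j : 'I_p) : (j < z.+1)%N -> j <> i -> j <> z -> pt y j = pt x j /\ (j < z)%N /\ j != i.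
  by move=> /ltnS_ord[-> //|jz] /eqP ji _; rewrite yE.
suff W (j k : 'I_p) : (j < z.+1)%N -> (k < z.+1)%N -> (j < k)%N -> pt y j <> pt y k.
  move=> j k jz kz jk; have : (j != k :> nat) by apply/eqP => /val_inj.
  by rewrite neq_ltn => /orP[] lt'; [exact: W | apply/nesym/W].
have iz0 : (i < z.+1)%N by rewrite ltnS ltnW.
have neq_bc : pt x i + b *: w <> pt x i + c *: w.
  by move=> /addrI e; apply: bcw; rewrite scalerBl e subrr.
have izN : i <> z by apply/eqP; rewrite neq_iz.
move=> jz kz jk; have [ej|nj] := pselect (j = i); have [ek|nk] := pselect (k = z).
- by rewrite ej ek yi yz.
- have nki : k <> i by move=> e; move: jk; rewrite ej e ltnn.
  by have [-> [kz' ki']] := off k kz nki nk; rewrite ej yi; exact: far.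
- have njz : j <> z by move=> e; move: jk; rewrite ek e ltnn.
  by have [-> [jz' ji']] := off j jz nj njz; rewrite ek yz; apply/nesym/far.
have njz : j <> z.
  by move=> e; move: kz jk; rewrite e ltnS => kz /(leq_trans)/(_ kz); rewrite ltnn.
have [-> [jz' ji']] := off j jz nj njz.
have [ek|nki] := pselect (k = i); first by rewrite ek yi; apply/nesym/far.
have [-> [kz' ki']] := off k kz nki nk.
by apply: Cx => // e; move: jk; rewrite e ltnn.
Qed.

Lemma shrink_lt x (j : 'I_p) : (j < z)%N -> pt (shrinkGap x) j = pt x j.
Proof. exact: sec_lt. Qed.

Lemma shrink_z x : pt (shrinkGap x) z = pt x i + scaleGap x *: gap x.
Proof. by rewrite /shrinkGap /secFun eqxx. Qed.

Lemma shrink_gap x : gap (shrinkGap x) = scaleGap x *: gap x.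
Proof. exact: sec_gap. Qed.

Lemma scaleGap_anti x : scaleGap (anti x) = scaleGap x.
Proof.
rewrite /scaleGap anti_gap // normrN; congr (_ / _).
by apply: eq_bigr => j /andP[jz _]; rewrite !anti_lt.
Qed.

Lemma shrink_conf x : Y i x -> conf z.+1 (shrinkGap x).
Proof.
move=> /Y_P[Cx xz]; apply: (@move_conf x _ 0 1 (scaleGap x *: gap x)) => //.
- by move=> j jz _; exact: shrink_lt.
- by move=> j jz ji; exact: scaleGap_lt.
- by rewrite shrink_lt // scale0r addr0.
- by rewrite shrink_z scale1r.
- by rewrite normr0.
- by rewrite normr1.
rewrite sub0r scaleN1r => /eqP; rewrite oppr_eq0 scaler_eq0 gt_eqF ?scaleGap_gt0 //=.
by rewrite subr_eq0 => /eqP.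
Qed.

(** After shrinking, [z] avoids the point [j] even where it met it before. Pullbacks of classes
    around such points thus extend to [partConf z], where the antipode is homotopic to the
    identity. *)
Lemma shrink_off x (j : 'I_p) : (j < z)%N -> j != i -> Cz x -> Y j (shrinkGap x).
Proof.
move=> jz ji Cx; apply/Y_P; split; first exact: sec_partConf.
rewrite shrink_z shrink_lt // => e; have := scaleGap_lt Cx jz ji.
have -> : pt x i - pt x j = - (scaleGap x *: gap x) by rewrite -e opprD addrA subrr add0r.
by rewrite normrN ltxx.
Qed.

Lemma shrink_htp k (x : C k) : coc (Y i) x -> bnd (Y i) (pull shrinkGap x - x).
Proof.
move=> cx; rewrite -[X in _ - X]pull_id; apply: line_bnd cx => v a /Y_P[Cv vz] /andP[a0 a1].
have g0 : gap v <> 0 by move=> /eqP; rewrite subr_eq0 => /eqP.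
split.
  by apply: line_partConf => // j jz; rewrite /= shrink_lt.
have /rV_neq0P [l gl] : gap (lineFun idfun shrinkGap (v, a)) <> 0.
  rewrite line_gap shrink_gap scalerA -scalerDl => /eqP; rewrite scaler_eq0 => /orP[|/eqP //].
  have e0 := scaleGap_gt0 Cv; move: e0; set e := scaleGap v => e0 /eqP H.
  have H1 : 0 <= a * e by rewrite mulr_ge0 // ltW.
  have a1' : a = 1 by lra.
  by move: H; rewrite a1' subrr add0r mul1r => H; rewrite H ltxx in e0.
by exists l; split=> //; exact: ltn_ord.
Qed.

(** Swapping the close pair and reflecting [z] in [i] produce pairs with the same difference, which
    are joined by translating the pair along the shrunken gap. *)
Lemma cherry_htp k (x : C k) : coc (conf z.+1) x ->
  bnd (Y i) (pull (shrinkGap \o anti) x - pull (permFun (tperm i z) \o shrinkGap) x).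
Proof.
move=> cx; apply: line_bnd cx => v a /Y_P[Cv vz] /andP[a0 a1].
have zi : (z == i) = false by rewrite eq_sym neq_iz.
apply: (@move_conf v _ (1 - a) (- a) (scaleGap v *: gap v)) => //.
- move=> j jz ji; rewrite /lineFun /= shrink_lt // anti_lt // /permFun tpermD; first last.
  + by apply/eqP => e; move: jz; rewrite e ltnn.
  + by rewrite eq_sym.
  by rewrite shrink_lt // -scalerDl subrK scale1r.
- by move=> j jz ji; exact: scaleGap_lt.
- rewrite /lineFun /= /permFun tpermL shrink_z shrink_lt // anti_lt //.
  by rewrite scalerDr addrAC -scalerDl subrK scale1r.
- rewrite /lineFun /= /permFun tpermR shrink_z shrink_lt // anti_lt // anti_gap //.
  by rewrite scaleGap_anti scalerN scalerBr addrA -scalerDl subrK scale1r scaleNr.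
- by rewrite ger0_norm ?subr_ge0 // lerBlDr lerDl.
- by rewrite normrN ger0_norm.
rewrite opprK subrK scale1r => /eqP; rewrite scaler_eq0 gt_eqF ?scaleGap_gt0 //=.
by rewrite subr_eq0 => /eqP.
Qed.

Hypotheses (n_even : ~~ odd n) (n0 : (0 < n)%N) (two : 2%:R != 0 :> F).

(** On close pairs, invariance under the swap becomes invariance under the antipode, and all
    summands but [w i] drop out. As [n] is even, the antipode acts on [w i] by [-1], so twice [w i]
    is a coboundary. *)
Lemma cherry_vanish k (y : C k) (w : 'I_p -> C k) :
  coc Cz y -> (forall j : 'I_p, (j < z)%N -> coc (Y j) (w j)) ->
  pull (secFun z i (e0 R n)) (w i) = 0 ->
  let u := y + \sum_(j : 'I_p | (j < z)%N) w j in
  bnd (conf z.+1) (pull (permFun (tperm i z)) u - u) -> bnd (Y i) (w i).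
Proof.
move=> cy cw sw u bu.
have cu : coc (conf z.+1) u.
  apply: cocD; first exact: coc_restr (@partConfS_sub R p n z) cy.
  by apply: coc_sum => j jz; apply: (coc_restr (partConfS_Y jz)); exact: cw.
pose T (x : C k) : C k := pull anti (pull shrinkGap x) - pull shrinkGap x.
have TD x x' : T (x + x') = T x + T x' by rewrite /T !pullD opprD addrACA.
have T0 : T 0 = 0 by rewrite /T -[in LHS](subrr 0) !pullB !subrr.
have Tsum (P : pred 'I_p) : T (\sum_(j | P j) w j) = \sum_(j | P j) T (w j).
  by rewrite (big_morph T TD T0).
have Tu : bnd (Y i) (T u).
  have b1 := cherry_htp cu; have b2 := bnd_pull shrink_conf bu.
  rewrite pullB pull_comp in b2; rewrite -pull_comp in b1.
  exact: bnd_trans b1 b2.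
have off x : coc Cz (pull shrinkGap x) -> bnd (Y i) (T x).
  by move=> cx; apply: (bnd_restr (@Y_sub _ _ _ z i)); exact: anti_free.
have Tw : bnd (Y i) (T (w i)).
  have -> : T (w i) = T u - (T y + \sum_(j : 'I_p | (j < z)%N && (j != i)) T (w j)).
    by rewrite TD Tsum (bigD1 i) //= [X in _ = X]addrC opprD addrACA addNr add0r addrC addrK.
  apply: bndB => //; apply: bndD.
    apply: off; apply: coc_pull cy => v; exact: sec_partConf.
  apply: bnd_sum => j /andP[jz ji]; apply: off.
  by apply: coc_pull (cw j jz) => v; exact: shrink_off.
have b0 : bnd (Y i) (pull anti (w i) - w i).
  have sh := shrink_htp (cw i iz).
  have := bnd_pull (@anti_D R p n z i iz n.+1) sh; rewrite pullB => ash.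
  apply: bnd_trans sh; apply: bnd_trans Tw; exact: bnd_sym.
have bs : bnd Cz (pull (secFun z i (e0 R n)) (w i)) by rewrite sw; exact: bnd0.
have [v [_ v0 bv]] := antipode iz (ltnSn n) (cw i iz) bs.
move: bv; rewrite v0 // subr0 -signr_odd /= n_even expr1 scaleN1r opprK => bv.
have := bndZ 2%:R^-1 (bndB bv b0).
have -> : pull anti (w i) + w i - (pull anti (w i) - w i) = 2%:R *: w i.
  by rewrite opprB [w i - _]addrC addrACA subrr add0r scaler_nat mulr2n.
by rewrite scalerA mulVf // scale1r.
Qed.

End Cherry.

Hypotheses (n_even : ~~ odd n) (n0 : (0 < n)%N) (two : 2%:R != 0 :> F).

Theorem tperm_invariant_bnd (k : nat) : (0 < k <= p)%N -> forall t (x : C t), (0 < t)%N ->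
  coc (conf k) x ->
  (forall i j : 'I_p, (i < k)%N -> (j < k)%N -> bnd (conf k) (pull (permFun (tperm i j)) x - x)) ->
  bnd (conf k) x.
Proof.
elim: k => [//|[|k] IH] /= kp t x t0 cx inv.
  apply: conf_vanishing => // c; rewrite ltnS leqn0 => /eqP ->.
  by rewrite mul0n => t00; rewrite t00 in t0.
pose z : 'I_p := Ordinal kp.
have [y [w [cy cw sw xE]]] := @decompose R p n F z _ x isT cx.
set u := y + _ in xE.
have tC (i j : 'I_p) (m : nat) : (i < m)%N -> (j < m)%N -> forall v, conf m v -> conf m (permFun (tperm i j) v).
  by move=> im jm v; apply: permFun_conf => l; exact: tperm_lt.
have bu (i j : 'I_p) : (i < z.+1)%N -> (j < z.+1)%N ->
    bnd (conf z.+1) (pull (permFun (tperm i j)) u - u).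
  move=> iz jz; apply: bnd_ext (inv i j iz jz) => s Us; rewrite !cochainE -xE //.
  congr (_ - _); apply: xE => v; apply: tC => //; exact: Us.
have bw (i : 'I_p) : (i < z)%N -> bnd (conf z.+1) (w i).
  move=> iz; apply: (bnd_restr (partConfS_Y iz)).
  by apply: (@cherry_vanish z i iz n_even n0 two t y w) => //; [exact: sw | apply: bu => //; exact: ltnW].
have bxy : bnd (conf z.+1) (u - y).
  by rewrite /u addrAC subrr add0r; apply: bnd_sum => i iz; exact: bw.
have by_ : bnd (conf z) y.
  apply: IH => // [|i j iz jz]; first exact: ltnW.
  (* A section of forgetting [z], which is put farther from the origin than the other points. It
     carries the invariance of [y] back to [partConf z]. *)
  pose far (v : V) : V := fun j => if j == z then spread v *: e0 R n else pt v j.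
  have fc : continuous far.
    apply: ptws_continuous => l; rewrite /far; case: eqP => _ v; last exact: coord_cts.
    by apply: (@cvgZr_tmp R E _ (nbhs v)); exact: spread_continuous.
  have far_lt v (l : 'I_p) : (l < z)%N -> pt (far v) l = pt v l.
    by move=> lz; rewrite /far; case: eqP lz => // ->; rewrite ltnn.
  have farz v (l : 'I_p) : (l < z)%N -> pt (far v) z <> pt (far v) l.
    move=> lz; rewrite (far_lt v l lz) /far eqxx => e; have := norm_pt_lt v l.
    have := coord_le_norm (pt v l) 0; rewrite -e mxE e0E mulr1.
    by have := ler_norm (spread v); lra.
  have farC v : conf z v -> conf z.+1 (far v).
    move=> Cv l m /ltnS_ord[->|lz] /ltnS_ord[->|mz] lm //; first exact: farz.
      exact/nesym/farz.
    by rewrite !far_lt //; exact: Cv.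
  pose g := mkcts fc.
  have bC : bnd (conf z.+1) (pull (permFun (tperm i j)) y - y).
    have iz1 := ltnW iz : (i < z.+1)%N; have jz1 := ltnW jz : (j < z.+1)%N.
    have := bnd_pull (tC i j z.+1 iz1 jz1) bxy; rewrite pullB => b1.
    apply: bnd_trans bxy; apply: bnd_trans (bu i j iz1 jz1); exact: bnd_sym.
  have := bnd_pull (f := g) farC bC; set d := pull _ y - y => b2.
  have cd : coc (conf z) d by apply: cocB => //; apply: coc_pull cy; exact: tC.
  have b3 : bnd (conf z) (pull g d - pull idfun d).
    by apply: free_htp cd => // v l _ lz; apply/esym; exact: far_lt.
  by rewrite pull_id in b3; apply: bnd_subl b2; exact: bnd_sym.
apply: (bnd_ext (x := u)) => [s Us|]; first by rewrite xE.
apply: bnd_subl bxy _; exact: bnd_restr (@partConfS_sub R p n z) by_.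
Qed.

End Permutations.

(** * Complexes with a group action *)
Section CosetSums.
Variables (F : fieldType) (V : lmodType F) (gT : finGroupType) (K : {group gT}).

Lemma sum_rcosets (f : gT -> V) :
  \sum_s f s = \sum_(A in rcosets K [set: gT]%SET) \sum_(k in K) f (k * fingroup.repr A)%g.
Proof.
rewrite (partition_big (fun s => K :* s)%g (mem (rcosets K [set: gT]%SET))) /=; last first.
  by move=> s _; apply/rcosetsP; exists s.
apply: eq_bigr => A /rcosetsP[s _ AE]; set r := fingroup.repr A.
have AK : A = (K :* r)%g.
  have : r \in (K :* s)%g by rewrite /r AE mem_repr_rcoset.
  by rewrite AE => /rcoset_eqP ->.
rewrite (reindex_onto (fun k => k * r)%g (fun t => t * r^-1)%g) => [|t _]; last by rewrite mulgKV.
apply: eq_bigl => k; rewrite mulgK eqxx andbT [in X in _ == X]AK.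
rewrite rcosetM; apply/eqP/idP => [e|kK]; last by rewrite rcoset_id.
have : (K :* k)%g = K.
  by have := congr1 (fun B => B :* r^-1)%g e; rewrite /= -!rcosetM mulgK mulgV mulg1.
by move=> <-; exact: rcoset_refl.
Qed.
End CosetSums.

(** [act_M] is the contravariant convention of an action by pullback. [hig] and [higP] are Higman's
    criterion in each degree; they make every term Tate acyclic for cyclic subgroups ([ker_tau],
    [ker_nrm]). *)
Record gcomplex (F : fieldType) (gT : finGroupType) := GComplex {
  car :> nat -> lmodType F;
  dif : forall k, car k -> car k.+1;
  actc : gT -> forall k, car k -> car k;
  hig : forall k, car k -> car k;
  dif_linear : forall k, linear (@dif k);
  act_linear : forall s k, linear (@actc s k);
  hig_linear : forall k, linear (@hig k);
  dif_dif : forall k (x : car k), dif (dif x) = 0;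
  dif_act : forall s k (x : car k), dif (actc s x) = actc s (dif x);
  act_1 : forall k (x : car k), actc 1%g x = x;
  act_M : forall s t k (x : car k), actc s (actc t x) = actc (t * s)%g x;
  higP : forall k (x : car k), \sum_s actc s (hig (actc s^-1%g x)) = x }.
Arguments dif {F gT g k} _ : rename.
Arguments actc {F gT g} _ {k} _ : rename.
Arguments hig {F gT g k} _ : rename.

HB.instance Definition _ F gT (C : gcomplex F gT) k :=
  GRing.isLinear.Build F (C k) (C k.+1) _ (@dif F gT C k) (@dif_linear _ _ C k).
HB.instance Definition _ F gT (C : gcomplex F gT) s k :=
  GRing.isLinear.Build F (C k) (C k) _ (@actc F gT C s k) (@act_linear _ _ C s k).
HB.instance Definition _ F gT (C : gcomplex F gT) k :=
  GRing.isLinear.Build F (C k) (C k) _ (@hig F gT C k) (@hig_linear _ _ C k).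

Section Complex.
Variables (F : fieldType) (gT : finGroupType) (C : gcomplex F gT) (g : gT).
Implicit Types (k : nat).
Notation K := (<[g]>)%g.

Definition cobd k : C k -> Prop :=
  match k with 0 => fun x => x = 0 | k'.+1 => fun x => exists y : C k', x = dif y end.

Lemma cobd_lin k a (x y : C k) : cobd x -> cobd y -> cobd (a *: x + y).
Proof.
case: k x y => [|k] x y /= => [-> ->|[x' ->] [y' ->]]; first by rewrite scaler0 addr0.
by exists (a *: x' + y'); rewrite linearP.
Qed.
Lemma cobd0 k : cobd (0 : C k).
Proof. by case: k => [//|k]; exists 0; rewrite linear0. Qed.
Lemma cobdD k (x y : C k) : cobd x -> cobd y -> cobd (x + y).
Proof. by move=> bx by_; rewrite -[x]scale1r; exact: cobd_lin. Qed.
Lemma cobdZ k a (x : C k) : cobd x -> cobd (a *: x).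
Proof. by move=> bx; rewrite -[_ *: _]addr0; apply: cobd_lin => //; exact: cobd0. Qed.
Lemma cobdN k (x : C k) : cobd x -> cobd (- x).
Proof. by move=> bx; rewrite -scaleN1r; exact: cobdZ. Qed.
Lemma cobdB k (x y : C k) : cobd x -> cobd y -> cobd (x - y).
Proof. by move=> bx by_; apply: cobdD => //; exact: cobdN. Qed.
Lemma cobd_sum k (I : Type) (r : seq I) (P : pred I) (x : I -> C k) :
  (forall i, P i -> cobd (x i)) -> cobd (\sum_(i <- r | P i) x i).
Proof. by move=> bx; elim/big_ind: _ => //; [exact: cobd0 | exact: cobdD]. Qed.
Lemma cobd_act k s (x : C k) : cobd x -> cobd (actc s x).
Proof. by case: k x => [|k] x /= => [->|[y ->]]; [rewrite linear0 | exists (actc s y); rewrite dif_act]. Qed.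
Lemma cobd_coc k (x : C k) : cobd x -> dif x = 0.
Proof. by case: k x => [|k] x /= => [->|[y ->]]; [rewrite linear0 | rewrite dif_dif]. Qed.
Lemma cobd_sym k (x y : C k) : cobd (x - y) -> cobd (y - x).
Proof. by move=> bx; rewrite -opprB; exact: cobdN. Qed.
Lemma cobd_trans k (y x z : C k) : cobd (x - y) -> cobd (y - z) -> cobd (x - z).
Proof. by move=> bx by_; rewrite -[x](subrK y) -addrA; exact: cobdD. Qed.

Definition tau k (x : C k) : C k := actc g x - x.
Definition nrm k (x : C k) : C k := \sum_(s in K) actc s x.

Lemma tau_linear k : linear (@tau k).
Proof. by move=> a x y; rewrite /tau linearP scalerBr opprD addrACA. Qed.
HB.instance Definition _ k := GRing.isLinear.Build F (C k) (C k) _ (@tau k) (@tau_linear k).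
Lemma nrm_linear k : linear (@nrm k).
Proof.
move=> a x y; rewrite /nrm scaler_sumr -big_split; apply: eq_bigr => s _; exact: linearP.
Qed.
HB.instance Definition _ k := GRing.isLinear.Build F (C k) (C k) _ (@nrm k) (@nrm_linear k).

Lemma dif_tau k (x : C k) : dif (tau x) = tau (dif x).
Proof. by rewrite /tau linearB /= dif_act. Qed.
Lemma dif_nrm k (x : C k) : dif (nrm x) = nrm (dif x).
Proof. by rewrite /nrm linear_sum /=; apply: eq_bigr => s _; rewrite dif_act. Qed.

Lemma tau_inv k (x : C k) : tau x = 0 -> forall s, s \in K -> actc s x = x.
Proof.
move=> /eqP; rewrite subr_eq0 => /eqP gx s /cycleP[i ->].
elim: i => [|i IH]; first exact: act_1.
by rewrite expgSr -act_M IH.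
Qed.

Lemma act_nrm k s (x : C k) : s \in K -> actc s (nrm x) = nrm x.
Proof.
move=> sK; rewrite /nrm linear_sum /= [RHS](reindex_inj (mulIg s)) /=.
by apply: eq_big => t; [rewrite groupMr | rewrite act_M].
Qed.
Lemma nrm_act k s (x : C k) : s \in K -> nrm (actc s x) = nrm x.
Proof.
move=> sK; rewrite /nrm [RHS](reindex_inj (mulgI s)) /=.
by apply: eq_big => t; [rewrite groupMl | rewrite act_M].
Qed.
Lemma tau_nrm k (x : C k) : tau (nrm x) = 0.
Proof. by rewrite /tau act_nrm ?subrr ?cycle_id. Qed.
Lemma nrm_tau k (x : C k) : nrm (tau x) = 0.
Proof. by rewrite linearB /= nrm_act ?subrr ?cycle_id. Qed.

Lemma act_pow_sub k i (x : C k) : actc (g ^+ i)%g x - x = tau (\sum_(j < i) actc (g ^+ j)%g x).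
Proof.
elim: i => [|i IH]; first by rewrite big_ord0 linear0 act_1 subrr.
have -> : tau (\sum_(j < i.+1) actc (g ^+ j)%g x) =
    tau (\sum_(j < i) actc (g ^+ j)%g x) + tau (actc (g ^+ i)%g x).
  by rewrite big_ord_recr linearD.
by rewrite -IH /tau act_M -expgSr [RHS]addrC addrA subrK.
Qed.

Lemma act_sub k s (x : C k) : s \in K ->
  exists i, actc s x - x = tau (\sum_(j < i) actc (g ^+ j)%g x).
Proof. by move=> /cycleP[i ->]; exists i; exact: act_pow_sub. Qed.

(** The Higman endomorphism for [K]: summed over coset representatives, it again has the identity as
    its trace. *)
Definition higK k (x : C k) : C k :=
  \sum_(A in rcosets K [set: gT]%SET) actc (fingroup.repr A)^-1%g (hig (actc (fingroup.repr A) x)).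

Lemma higKP k (x : C k) : \sum_(s in K) actc s (higK (actc s^-1%g x)) = x.
Proof.
rewrite -[RHS]higP.
transitivity (\sum_s actc s^-1%g (hig (actc s x))); last first.
  by rewrite [RHS](reindex_inj invg_inj); apply: eq_bigr => s _; rewrite invgK.
rewrite (sum_rcosets (<[g]>)%G) exchange_big /= [LHS](reindex_inj invg_inj) /=.
apply: eq_big => [s|s sK]; first by rewrite groupV.
rewrite linear_sum /=; apply: eq_bigr => A _.
by rewrite invgK !act_M invMg.
Qed.

Lemma ker_tau k (x : C k) : tau x = 0 -> exists y, x = nrm y.
Proof.
move=> ix; exists (higK x); rewrite -[LHS]higKP; apply: eq_bigr => s sK.
by rewrite (tau_inv ix) // groupV.
Qed.

Definition im_tau k (x : C k) : Prop := exists y, x = tau y.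
Lemma im_tau_sum k (P : pred gT) (x : gT -> C k) :
  (forall s, P s -> im_tau (x s)) -> im_tau (\sum_(s | P s) x s).
Proof.
move=> h; elim/big_ind: _ => //; first by exists 0; rewrite linear0.
by move=> _ _ [y ->] [z ->]; exists (y + z); rewrite linearD.
Qed.

Lemma ker_nrm k (x : C k) : nrm x = 0 -> exists y, x = tau y.
Proof.
move=> nx; rewrite -/(im_tau x) -[x]higKP.
have -> : \sum_(s in K) actc s (higK (actc s^-1%g x)) =
    \sum_(s in K) (actc s (higK (actc s^-1%g x)) - higK (actc s^-1%g x)).
  rewrite sumrB [X in _ - X](_ : _ = 0) ?subr0 //.
  have hK0 : higK (nrm x) = 0.
    by rewrite nx /higK big1 // => A _; rewrite !linear0.
  transitivity (higK (nrm x)); last exact: hK0.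
  rewrite /higK /nrm exchange_big /=; apply: eq_bigr => A _.
  rewrite !linear_sum [LHS](reindex_inj invg_inj) /=.
  by apply: eq_big => [s|s _]; [rewrite groupV | rewrite invgK].
apply: im_tau_sum => s sK; have [i ->] := act_sub (higK (actc s^-1%g x)) sK.
by eexists.
Qed.

(** Together with [acNrm]: Tate acyclicity of the cohomology in degree [k] as a module over [K],
    stated on representatives. *)
Definition acTau k := forall x : C k, dif x = 0 -> cobd (tau x) ->
  exists y : C k, dif y = 0 /\ cobd (x - nrm y).
Definition acNrm k := forall x : C k, dif x = 0 -> cobd (nrm x) ->
  exists y : C k, dif y = 0 /\ cobd (x - tau y).

(* Higman's criterion on cohomology classes. *)
Lemma higman_ac k (phi : C k -> C k) :
  (forall x y, phi (x - y) = phi x - phi y) -> (forall x, dif x = 0 -> dif (phi x) = 0) ->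
  (forall x, cobd x -> cobd (phi x)) ->
  (forall x, dif x = 0 -> cobd (x - \sum_(s in K) actc s (phi (actc s^-1%g x)))) ->
  acTau k /\ acNrm k.
Proof.
move=> phiB phiZ phib phiP; split=> x dx bx.
  exists (phi x); split; first exact: phiZ.
  apply: cobd_trans (phiP x dx) _; rewrite /nrm -sumrB; apply: cobd_sum => s sK.
  rewrite -linearB /= -phiB; apply/cobd_act/phib.
  have /(act_sub x)[i ->] : s^-1%g \in K by rewrite groupV.
  rewrite linear_sum /=; apply: cobd_sum => j _.
  have -> : tau (actc (g ^+ j)%g x) = actc (g ^+ j)%g (tau x).
    by rewrite /tau linearB /= !act_M -expgS expgSr.
  exact: cobd_act.
have phi0 : phi 0 = 0 by rewrite -[X in phi X](subrr 0) phiB subrr.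
have phiD y z : phi (y + z) = phi y + phi z.
  by rewrite -[z in LHS]opprK phiB -[- z]sub0r phiB phi0 sub0r opprK.
pose y s := higK (actc s^-1%g x).
have [t [dt tE]] : exists t : C k, dif t = 0 /\
    \sum_(s in K) (actc s (phi (actc s^-1%g x)) - phi (actc s^-1%g x)) = tau t.
  elim/big_ind: _ => [|_ _ [a [da ->]] [b [db ->]]|s sK].
  - by exists 0; rewrite !linear0.
  - by exists (a + b); rewrite !linearD /= da db addr0.
  have [i ->] := act_sub (phi (actc s^-1%g x)) sK.
  eexists; split; last by [].
  rewrite linear_sum /= big1 // => j _; rewrite dif_act phiZ ?linear0 //.
  by rewrite dif_act dx linear0.
exists t; split=> //; rewrite -tE; apply: cobd_trans (phiP x dx) _.
rewrite sumrB opprB addrCA subrr addr0.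
have -> : \sum_(s in K) phi (actc s^-1%g x) = phi (nrm x).
  rewrite /nrm (big_morph phi phiD phi0) (reindex_inj invg_inj) /=.
  by apply: eq_big => [s|s _]; [rewrite groupV | rewrite invgK].
exact: phib.
Qed.

Lemma acTau_trivial k : (forall x : C k, dif x = 0 -> cobd x) -> acTau k /\ acNrm k.
Proof.
move=> triv; split=> x dx _; exists 0; split; rewrite linear0 // subr0; exact: triv.
Qed.

(** An invariant coboundary has an invariant primitive: the form in which acyclicity of the
    cohomology is used on cochains. *)
Definition liftTau k := forall y : C k, tau (dif y) = 0 ->
  exists z : C k, tau z = 0 /\ dif z = dif y.
Definition liftNrm k := forall y : C k, nrm (dif y) = 0 ->
  exists z : C k, nrm z = 0 /\ dif z = dif y.

(** The cocycle [tau y] has norm zero, hence is [tau t] up to a coboundary. The norm version one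
    degree lower gives this coboundary a primitive of the form [tau u], and [y - t - dif u] is
    invariant. The other half exchanges [tau] and [nrm]. *)
Lemma lift_step k : (forall j, k = j.+1 -> liftTau j /\ liftNrm j) ->
  acTau k -> acNrm k -> liftTau k /\ liftNrm k.
Proof.
move=> IH aT aN; split=> y yd.
  have dty : dif (tau y) = 0 by rewrite dif_tau.
  have [|t [dt bt]] := aN (tau y) dty; first by rewrite nrm_tau; exact: cobd0.
  have [r [tr ry]] : exists r : C k, dif r = 0 /\ tau (y - t) = tau r.
    case: k IH y yd dty t dt bt {aT aN} => [|k] IH y yd dty t dt /= bt.
      by exists 0; rewrite linear0; split=> //; rewrite linear0 linearB.
    case: bt => r rE; have [_ /(_ r) lN] := IH k erefl.
    have [|r' [nr' dr']] := lN.
      by rewrite -rE linearB /= nrm_tau nrm_tau subrr.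
    have [u uE] := ker_nrm nr'; exists (dif u); split; first exact: dif_dif.
    by rewrite linearB /= rE -dr' uE dif_tau.
  exists (y - t - r); split; first by rewrite linearB /= ry subrr.
  by rewrite !linearB /= dt tr !subr0.
have dny : dif (nrm y) = 0 by rewrite dif_nrm.
have [|t [dt bt]] := aT (nrm y) dny; first by rewrite tau_nrm; exact: cobd0.
have [r [tr ry]] : exists r : C k, dif r = 0 /\ nrm (y - t) = nrm r.
  case: k IH y yd dny t dt bt {aT aN} => [|k] IH y yd dny t dt /= bt.
    by exists 0; rewrite linear0; split=> //; rewrite linear0 linearB.
  case: bt => r rE; have [/(_ r) lT _] := IH k erefl.
  have [|r' [nr' dr']] := lT.
    by rewrite -rE linearB /= !tau_nrm subrr.
  have [u uE] := ker_tau nr'; exists (dif u); split; first exact: dif_dif.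
  by rewrite linearB /= rE -dr' uE dif_nrm.
exists (y - t - r); split; first by rewrite linearB /= ry subrr.
by rewrite !linearB /= dt tr !subr0.
Qed.

Lemma lift_upto m : (forall j, (j <= m)%N -> acTau j /\ acNrm j) ->
  forall j, (j <= m)%N -> liftTau j /\ liftNrm j.
Proof.
move=> ac; elim=> [|j IH] jm.
  by have [a b] := ac 0%N jm; apply: lift_step.
have [a b] := ac _ jm; apply: lift_step => // i [<-].
by apply: IH; exact: ltnW.
Qed.

Hypothesis index_unit : (#|[set: gT]%SET : <[g]>|)%g%:R != 0 :> F.

Definition ginv k (x : C k) : Prop := forall s, actc s x = x.
(** The transfer from [K] to the whole group divided by the index, a projection of the
    [K]-invariants onto the invariants of the group. *)
Definition avg k (x : C k) : C k :=
  (#|[set: gT]%SET : <[g]>|)%g%:R^-1 *: \sum_(A in rcosets K [set: gT]%SET) actc (fingroup.repr A) x.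
Definition gnrm k (x : C k) : C k := \sum_s actc s x.

Lemma avg_linear k : linear (@avg k).
Proof.
move=> a x y; rewrite /avg scalerA mulrC -scalerA -scalerDr; congr (_ *: _).
rewrite scaler_sumr -big_split; apply: eq_bigr => s _; exact: linearP.
Qed.
HB.instance Definition _ k := GRing.isLinear.Build F (C k) (C k) _ (@avg k) (@avg_linear k).

Lemma avg_ginv k (x : C k) : tau x = 0 -> ginv (avg x).
Proof.
move=> ix s; rewrite /avg linearZ /=; congr (_ *: _); rewrite linear_sum /=.
have inj : injective (fun A : {set gT} => A :* s)%g.
  by move=> A B /(congr1 (fun A => A :* s^-1)%g); rewrite /= -!rcosetM mulgV !mulg1.
rewrite [RHS](reindex_inj inj) /=; apply: eq_big => A.
  apply/rcosetsP/rcosetsP => -[t _ tE].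
    by exists (t * s)%g; rewrite ?inE // rcosetM -tE.
  exists (t * s^-1)%g; rewrite ?inE // rcosetM -tE -rcosetM mulgV.
  by rewrite mulg1.
move=> /rcosetsP[t _ AE]; rewrite act_M.
have : fingroup.repr A \in (K :* t)%g by rewrite AE mem_repr_rcoset.
have : fingroup.repr (A :* s)%g \in (K :* (t * s))%g by rewrite AE -rcosetM mem_repr_rcoset.
move=> /rcosetP[a aK ->] /rcosetP[b bK ->].
have kE u w : u \in K -> actc (u * w)%g x = actc w x.
  by move=> uK; rewrite -act_M (tau_inv ix).
by rewrite -mulgA (kE b) // (kE a).
Qed.

Lemma avg_dif k (x : C k) : dif (avg x) = avg (dif x).
Proof.
by rewrite linearZ /= linear_sum /=; congr (_ *: _); apply: eq_bigr => A _; rewrite dif_act.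
Qed.

Lemma avg_id k (x : C k) : ginv x -> avg x = x.
Proof.
move=> ix; rewrite /avg (eq_bigr (fun=> x)) // sumr_const -scaler_nat.
by rewrite scalerA mulVf // scale1r.
Qed.

Lemma avg_nrm k (x : C k) : avg (nrm x) = (#|[set: gT]%SET : <[g]>|)%g%:R^-1 *: gnrm x.
Proof.
rewrite /avg /gnrm (sum_rcosets (<[g]>)%G); congr (_ *: _); apply: eq_bigr => A _.
by rewrite /nrm linear_sum /=; apply: eq_bigr => s _; rewrite act_M.
Qed.

Lemma gnrm_nrm k (x : C k) : exists y : C k, (dif x = 0 -> dif y = 0) /\ gnrm x = nrm y.
Proof.
exists (\sum_(A in rcosets K [set: gT]%SET) actc (fingroup.repr A)^-1%g x); split=> [dx|].
  by rewrite linear_sum /= big1 // => A _; rewrite dif_act dx linear0.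
rewrite /gnrm (reindex_inj invg_inj) /= (sum_rcosets (<[g]>)%G) exchange_big /=.
rewrite /nrm [RHS](reindex_inj invg_inj) /=; apply: eq_big => [s|s _]; first by rewrite groupV.
by rewrite linear_sum /=; apply: eq_bigr => A _; rewrite act_M invMg.
Qed.

Lemma ginv_tau k (x : C k) : ginv x -> tau x = 0.
Proof. by move=> ix; rewrite /tau ix subrr. Qed.

Lemma avg_class k (x : C k) : (forall s, cobd (actc s x - x)) -> cobd (avg x - x).
Proof.
move=> ix; have -> : avg x - x = (#|[set: gT]%SET : <[g]>|)%g%:R^-1 *:
    \sum_(A in rcosets K [set: gT]%SET) (actc (fingroup.repr A) x - x).
  by rewrite sumrB scalerBr sumr_const -scaler_nat scalerA mulVf // scale1r.
by apply: cobdZ; apply: cobd_sum => A _.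
Qed.

Lemma gnrm_ginv k (x : C k) : ginv (gnrm x).
Proof.
move=> s; rewrite /gnrm linear_sum /= [RHS](reindex_inj (mulIg s)).
by apply: eq_bigr => t _; rewrite act_M.
Qed.

Lemma dif_gnrm k (x : C k) : dif (gnrm x) = gnrm (dif x).
Proof. by rewrite /gnrm linear_sum /=; apply: eq_bigr => s _; rewrite dif_act. Qed.

End Complex.

(** * The mapping cone *)
Section Cone.
Variables (F : fieldType) (gT : finGroupType) (E C : gcomplex F gT).
Variable f : forall k, E k -> C k.
Hypotheses (f_linear : forall k, linear (@f k))
  (f_dif : forall k (x : E k), f (dif x) = dif (f x))
  (f_act : forall s k (x : E k), f (actc s x) = actc s (f x)).

HB.instance Definition _ k := GRing.isLinear.Build F (E k) (C k) _ (@f k) (@f_linear k).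

Definition cone_tail k : lmodType F := if k is k'.+1 then C k' else 'rV[F]_0.
Definition cone_car k : lmodType F := (E k * cone_tail k)%type.

Definition cone_dif k : cone_car k -> cone_car k.+1 :=
  match k with
  | 0 => fun x => (dif x.1, f x.1)
  | k'.+1 => fun x : E k'.+1 * C k' => (dif x.1, f x.1 - dif x.2)
  end.
Definition tail_act s k : cone_tail k -> cone_tail k :=
  match k with 0 => id | k'.+1 => fun x : C k' => actc s x end.
Definition tail_hig k : cone_tail k -> cone_tail k :=
  match k with 0 => id | k'.+1 => fun x : C k' => hig x end.
Definition cone_act s k (x : cone_car k) : cone_car k := (actc s x.1, tail_act s x.2).
Definition cone_hig k (x : cone_car k) : cone_car k := (hig x.1, tail_hig x.2).

Lemma cone_dif_linear k : linear (@cone_dif k).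
Proof.
case: k => [|k] a [x x'] [y y']; rewrite /cone_dif /=; congr (_, _); try exact: linearP.
by rewrite !linearP /= addrACA -scalerDr.
Qed.
Lemma cone_act_linear s k : linear (@cone_act s k).
Proof.
case: k => [|k] a [x x'] [y y']; rewrite /cone_act /=; congr (_, _); try exact: linearP; by [].
Qed.
Lemma cone_hig_linear k : linear (@cone_hig k).
Proof.
case: k => [|k] a [x x'] [y y']; rewrite /cone_hig /=; congr (_, _); try exact: linearP; by [].
Qed.
Lemma cone_dif_dif k (x : cone_car k) : cone_dif (cone_dif x) = 0.
Proof.
case: k x => [|k] [x x'] /=; congr (_, _); rewrite ?dif_dif //.
  by rewrite f_dif subrr.
by rewrite linearB /= dif_dif subr0 f_dif subrr.
Qed.
Lemma cone_dif_act s k (x : cone_car k) : cone_dif (cone_act s x) = cone_act s (cone_dif x).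
Proof.
case: k x => [|k] [x x']; rewrite /cone_act /=; congr (_, _); rewrite ?dif_act ?f_act //.
by rewrite linearB.
Qed.
Lemma cone_act_1 k (x : cone_car k) : cone_act 1%g x = x.
Proof. by case: k x => [|k] [x x']; rewrite /cone_act /= !act_1. Qed.
Lemma cone_act_M s t k (x : cone_car k) : cone_act s (cone_act t x) = cone_act (t * s)%g x.
Proof. by case: k x => [|k] [x x']; rewrite /cone_act /= !act_M. Qed.

Lemma cone_sum k (x : gT -> cone_car k) : \sum_s x s = (\sum_s (x s).1, \sum_s (x s).2).
Proof. by rewrite [LHS]surjective_pairing; congr (_, _); apply: big_morph. Qed.

Lemma cone_higP k (x : cone_car k) : \sum_s cone_act s (cone_hig (cone_act s^-1%g x)) = x.
Proof.
rewrite cone_sum /=; case: k x => [|k] [x x'] /=; rewrite higP; congr (_, _); last exact: higP.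
by apply/rowP => -[].
Qed.

Definition cone : gcomplex F gT := GComplex cone_dif_linear cone_act_linear cone_hig_linear
  cone_dif_dif cone_dif_act cone_act_1 cone_act_M cone_higP.

Definition toCone k (c : C k) : cone k.+1 := (0, c).

Lemma toCone_linear k : linear (@toCone k).
Proof. move=> a x y; change ((0, a *: x + y) = (a *: 0 + 0, a *: x + y) :> cone_car k.+1).
by rewrite scaler0 addr0. Qed.
HB.instance Definition _ k := GRing.isLinear.Build F (C k) (cone k.+1) _ (@toCone k) (@toCone_linear k).

Lemma dif_toCone k (c : C k) : dif (toCone c) = - toCone (dif c).
Proof. change ((dif (0 : E k.+1), f (0 : E k.+1) - dif c) = (- 0, - dif c) :> cone_car k.+2).
by rewrite !linear0 ?oppr0 sub0r. Qed.
Lemma act_toCone s k (c : C k) : actc s (toCone c) = toCone (actc s c).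
Proof. by rewrite /actc /= /cone_act /= linear0. Qed.

Variable g : gT.

Lemma tau_toCone k (c : C k) : tau g (toCone c) = toCone (tau g c).
Proof. by rewrite /tau act_toCone linearB. Qed.
Lemma nrm_toCone k (c : C k) : nrm g (toCone c) = toCone (nrm g c).
Proof. by rewrite /nrm linear_sum; apply: eq_bigr => s _; exact: act_toCone. Qed.

Hypotheses (E_acyclic : forall k (x : E k.+1), dif x = 0 -> exists y, x = dif y)
  (f_inj0 : forall x : E 0, dif x = 0 -> f x = 0 -> x = 0)
  (f_surj0 : forall c : C 0, dif c = 0 -> exists2 x : E 0, dif x = 0 & c = f x).

Lemma cobd_toCone k (c : C k.+1) : cobd c -> cobd (toCone c).
Proof. by move=> [y ->]; exists (- toCone y); rewrite linearN [X in _ = - X]dif_toCone opprK. Qed.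

Lemma cobd_graph k (a : E k) : cobd ((dif a, f a) : cone k.+1).
Proof. by case: k a => [|k] a; exists (a, 0); congr (_, _); rewrite linear0 subr0. Qed.

Lemma toCone_cobd k (c : C k.+1) : cobd (toCone c) -> cobd c.
Proof.
move=> [[a b] /= /(congr1 (fun x => (x.1, x.2))) [/esym da ->]].
have [a0 ->] := E_acyclic da.
by exists (f a0 - b); rewrite linearB /= f_dif.
Qed.

Lemma cone_class k (x : cone k.+1) : dif x = 0 ->
  exists c : C k, [/\ dif c = 0, cobd (x - toCone c) & exists a : E k, x.1 = dif a].
Proof.
case: x => e c /= [de dc]; have [a aE] := E_acyclic de.
exists (c - f a); split.
- by rewrite linearB /= -f_dif -aE; apply/eqP; rewrite subr_eq0 eq_sym -subr_eq0 dc.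
- case: k e c de dc a aE => [|k] e c de dc a aE.
    by exists (a, 0); congr (_, _); [rewrite /= subr0 | rewrite /= opprB addrCA subrr addr0].
  by exists (a, 0); congr (_, _); [rewrite /= subr0 | rewrite /= linear0 subr0 opprB addrCA subrr addr0].
- by exists a.
Qed.

Variable D : nat.
Hypotheses (D_gt0 : (0 < D)%N)
  (C_ac : forall j, (0 < j < D)%N -> acTau C g j /\ acNrm C g j).

(** As [E] is acyclic, the cone has the cohomology of [C] shifted by one, except in degrees [0] and
    [1], where it is trivial because [f] is an isomorphism on cohomology in degree zero. The shift
    makes degree [D] available. *)
Lemma cone_ac j : (j <= D)%N -> acTau cone g j /\ acNrm cone g j.
Proof.
case: j => [_|[_|j jD]].
- apply: acTau_trivial => -[e v] /= [de fe]; congr (_, _); first exact: f_inj0.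
  by apply/rowP => -[].
- apply: acTau_trivial => -[e c] /= [de dc]; have [a aE] := E_acyclic de.
  have dca : dif (c - f a) = 0.
    by rewrite linearB /= -f_dif -aE; apply/eqP; rewrite subr_eq0 eq_sym -subr_eq0 dc.
  have [b db cE] := f_surj0 dca; exists (a + b, 0); congr (_, _).
    by rewrite linearD /= db addr0.
  by rewrite linearD /= -cE addrC subrK.
have [aT aN] := C_ac (j := j.+1) jD; split=> x dx bx.
  have [c [dc bc _]] := cone_class dx.
  have [|y [dy by_]] := aT c dc.
    apply: toCone_cobd; rewrite -tau_toCone.
    have -> : tau g (toCone c) = tau g x - tau g (x - toCone c) by rewrite -linearB /= opprB addrCA subrr addr0.
    by apply: cobdB => //; apply: cobdB => //; exact: cobd_act.
  exists (toCone y); split; first by rewrite dif_toCone dy ?linear0 ?oppr0.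
  apply: cobd_trans bc _; rewrite nrm_toCone -linearB; exact: cobd_toCone.
have [c [dc bc _]] := cone_class dx.
have [|y [dy by_]] := aN c dc.
  apply: toCone_cobd; rewrite -nrm_toCone.
  have -> : nrm g (toCone c) = nrm g x - nrm g (x - toCone c) by rewrite -linearB /= opprB addrCA subrr addr0.
  by apply: cobdB => //; apply: cobd_sum => s _; exact: cobd_act.
exists (toCone y); split; first by rewrite dif_toCone dy ?linear0 ?oppr0.
apply: cobd_trans bc _; rewrite tau_toCone -linearB; exact: cobd_toCone.
Qed.

Lemma cone_lift j : (j <= D)%N -> liftTau cone g j /\ liftNrm cone g j.
Proof. exact: (lift_upto cone_ac). Qed.

Hypothesis index_unit : (#|[set: gT]%SET : <[g]>|)%g%:R != 0 :> F.

(** Coboundaries of the complex of invariants; for configurations these are the coboundaries of the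
    quotient space. *)
Definition gcobd (B : gcomplex F gT) k : B k -> Prop :=
  match k with 0 => fun x => x = 0 | k'.+1 => fun x => exists y : B k', ginv y /\ x = dif y end.

Lemma gcobd_avg (B : gcomplex F gT) k (x : B k.+1) (z : B k) :
  ginv x -> tau g z = 0 -> x = dif z -> gcobd x.
Proof.
move=> ix tz xz; exists (avg g z); split; first exact: avg_ginv.
by rewrite avg_dif -xz avg_id.
Qed.

Lemma f_avg k (x : E k) : f (avg g x) = avg g (f x).
Proof. by rewrite linearZ linear_sum /=; congr (_ *: _); apply: eq_bigr => s _; rewrite f_act. Qed.

Lemma cone_split k (c y : C k) (r : cone k) : (0 < k)%N -> (k <= D)%N -> ginv c -> dif c = 0 ->
  toCone (c - nrm g y) = dif r ->
  exists e : E k, [/\ ginv e, dif e = 0 &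
    exists y' : C k, (dif y = 0 -> dif y' = 0) /\ gcobd (c - f e - gnrm y')].
Proof.
case: k c y r => // k c y r _ kD ic dc rE.
have [lT _] := cone_lift kD; have [|[e c'] [tz dz]] := lT r.
  rewrite -rE tau_toCone (_ : tau g (c - nrm g y) = 0); first exact: linear0.
  by rewrite linearB /= (ginv_tau g ic) tau_nrm subr0.
have te : tau g e = 0 by case: tz.
have tc : tau g c' = 0 by case: tz.
move: dz; rewrite -rE => -[de cE].
exists (avg g e); split.
- exact: avg_ginv.
- by rewrite avg_dif de linear0.
exists ((#|[set: gT]%SET : <[g]>|)%g%:R^-1 *: y); split.
  by move=> dy; rewrite linearZ /= dy scaler0.
exists (- avg g c'); split; first by move=> s; rewrite linearN /= avg_ginv.
have -> : gnrm ((#|[set: gT]%SET : <[g]>|)%g%:R^-1 *: y) = avg g (nrm g y).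
  by rewrite avg_nrm /gnrm scaler_sumr; apply: eq_bigr => s _; rewrite linearZ.
transitivity (avg g (c - f e - nrm g y)); first by rewrite !linearB /= (avg_id index_unit ic) f_avg.
by rewrite addrAC -cE addrAC subrr add0r linearN /= linearN /= avg_dif.
Qed.

(** Acyclicity writes [c] as a norm plus a coboundary. In the cone this coboundary has an invariant
    primitive, whose first component is the class [e] of the group; averaging passes from [K] to the
    whole group. *)
Theorem split_norm k (c : C k) : (0 < k < D)%N -> ginv c -> dif c = 0 ->
  exists e : E k, [/\ ginv e, dif e = 0 &
    exists y : C k, dif y = 0 /\ gcobd (c - f e - gnrm y)].
Proof.
case: k c => // k c /andP[_ kD] ic dc; have [aT _] := C_ac (j := k.+1) kD.
have [|y [dy by_]] := aT c dc; first by rewrite (ginv_tau g ic); exact: cobd0.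
have [r rE] := cobd_toCone by_.
have [e [ie de [y' [dy' by']]]] := cone_split (ltn0Sn k) (ltnW kD) ic dc rE.
by exists e; split=> //; exists y'; split=> //; exact: dy'.
Qed.

(** With no norm to split off, acyclicity of the cone is enough, and the range includes [D]. *)
Theorem split_cobd k (c : C k) : (0 < k <= D)%N -> ginv c -> cobd c ->
  exists e : E k, [/\ ginv e, dif e = 0 & gcobd (c - f e)].
Proof.
case: k c => // k c /andP[_ kD] ic bc; have dc := cobd_coc bc.
have [r rE] := cobd_toCone bc.
have [lT _] := cone_lift kD; have [|[e1 c'] [tz dz]] := lT r.
  by rewrite -rE tau_toCone (ginv_tau g ic) !linear0.
have te : tau g e1 = 0 by case: tz.
have tc : tau g c' = 0 by case: tz.
move: dz; rewrite -rE => -[de1 cE].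
exists (avg g e1); split.
- exact: avg_ginv.
- by rewrite avg_dif de1 linear0.
exists (- avg g c'); split; first by move=> s; rewrite linearN /= avg_ginv.
transitivity (avg g (c - f e1)); first by rewrite linearB /= (avg_id index_unit ic) f_avg.
by rewrite -cE addrAC subrr add0r linearN /= linearN /= avg_dif.
Qed.

(** The pair [(e, c)] is an invariant cocycle of the cone, hence a norm up to a coboundary, which
    has an invariant primitive. The first component of the norm is the norm of a coboundary of [E],
    so [e] is the coboundary of an invariant cochain. *)
Theorem gcobd_inj k (e : E k) : (k <= D)%N -> ginv e -> dif e = 0 -> gcobd (f e) -> gcobd e.
Proof.
case: k e => [|k] e kD ie de; first by move=> fe; exact: f_inj0.
move=> [c [ic fe]]; pose q : cone k.+1 := (e, c).
have dq : dif q = 0 by congr (_, _); rewrite ?de // fe subrr.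
have [aT _] := cone_ac kD; have [|y [dy [r rE]]] := aT q dq.
  rewrite (_ : tau g q = 0); first exact: cobd0.
  by congr (_, _); [exact: (ginv_tau g ie) | exact: (ginv_tau g ic)].
have [lT _] := cone_lift (ltnW kD); have [|z [tz dz]] := lT r.
  rewrite -rE linearB /= tau_nrm subr0.
  by congr (_, _); [exact: (ginv_tau g ie) | exact: (ginv_tau g ic)].
have [_ [_ _ [a aE]]] := cone_class dy.
have nrm1 j (x : cone j) : (nrm g x).1 = nrm g x.1.
  by rewrite /nrm; apply: (big_morph (fun x : cone j => x.1)).
have dif1 j (x : cone j) : (dif x).1 = dif x.1 by case: j x.
have eE : e = dif (nrm g a + z.1).
  rewrite linearD /= -dif1 dz -rE dif_nrm -aE -nrm1.
  by rewrite [X in _ = _ + X]/= addrC subrK.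
apply: (gcobd_avg ie _ eE); rewrite linearD /= tau_nrm add0r.
by have := congr1 fst tz.
Qed.

Theorem gnrm_inj k (y : C k) : (0 < k < D)%N -> dif y = 0 -> cobd (gnrm y) -> gcobd (gnrm y).
Proof.
case: k y => // k y /andP[_ kD] dy bn; have [_ aN] := C_ac (j := k.+1) kD.
have [y1 [dy1 yE]] := gnrm_nrm g y.
have [|t [dt [r rE]]] := aN y1 (dy1 dy); first by rewrite -yE.
apply: (gcobd_avg (z := nrm g r) (@gnrm_ginv _ _ _ _ y)); first exact: tau_nrm.
by rewrite dif_nrm -rE linearB /= nrm_tau subr0.
Qed.

Theorem class_gnrm k (c : C k) : (0 < k < D)%N -> dif c = 0 ->
  (forall s, cobd (actc s c - c)) -> exists y : C k, dif y = 0 /\ cobd (gnrm y - c).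
Proof.
move=> kD dc ic; have [aT _] := C_ac kD; have [|y [dy by_]] := aT c dc; first exact: ic.
exists ((#|[set: gT]%SET : <[g]>|)%g%:R^-1 *: y); split; first by rewrite linearZ /= dy scaler0.
have -> : gnrm ((#|[set: gT]%SET : <[g]>|)%g%:R^-1 *: y) = avg g (nrm g y).
  by rewrite avg_nrm /gnrm scaler_sumr; apply: eq_bigr => s _; rewrite linearZ.
apply: cobd_trans (avg_class index_unit ic); rewrite -linearB.
apply: cobdZ; apply: cobd_sum => A _; apply: cobd_act; exact: cobd_sym.
Qed.

Hypothesis E_top : forall e : E D.+1, ginv e -> dif e = 0 -> gcobd e.

Theorem class_top (c : C D) : dif c = 0 -> (forall s, cobd (actc s c - c)) ->
  exists c' : C D, [/\ ginv c', dif c' = 0 & cobd (c' - c)].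
Proof.
have [D' DE] : exists D', D = D'.+1 by exists D.-1; rewrite prednK.
move=> dc ic; have [r rE] : cobd (toCone (tau g c)).
  by move: (c) (ic g); rewrite DE => c0 b; exact: cobd_toCone.
have [_ lN] := cone_lift (leqnn D); have [|r' [nr' dr']] := lN r.
  by rewrite -rE nrm_toCone nrm_tau linear0.
have [u uE] := ker_nrm nr'; pose q := toCone c - dif u.
have tq : tau g q = 0 by rewrite linearB /= tau_toCone rE -dr' uE dif_tau subrr.
have dq : dif q = 0.
  have -> : dif q = dif (toCone c) - dif (dif u) by exact: linearB.
  by rewrite dif_toCone dc dif_dif subr0 linear0 ?oppr0.
have iq := avg_ginv tq; have dqa : dif (avg g q) = 0 by rewrite avg_dif dq linear0.
have bq : cobd (avg g q - toCone c).
  have icc s : cobd (actc s (toCone c) - toCone c).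
    rewrite act_toCone -linearB; move: (ic s); move: (actc s c - c); rewrite DE => c0.
    exact: cobd_toCone.
  have iqs s : cobd (actc s q - q).
    have -> : actc s q - q = (actc s (toCone c) - toCone c) - (actc s (dif u) - dif u).
      have -> : actc s q = actc s (toCone c) - actc s (dif u) by exact: linearB.
      by rewrite /q opprD opprK addrACA opprB [- _ + dif u]addrC.
    apply: cobdB; first exact: icc.
    exists (actc s u - u); transitivity (dif (actc s u) - dif u); last exact/esym/linearB.
    by rewrite dif_act.
  apply: cobd_trans (avg_class index_unit iqs) _.
  by exists (- u); rewrite /q addrAC subrr add0r linearN.
case: (avg g q) iq dqa bq => e c1 iq [de dc1] bq.
have ie : ginv e by move=> s; exact: (congr1 fst (iq s)).
have ic1 : ginv c1 by move=> s; exact: (congr1 snd (iq s)).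
have [a [ia aE]] := E_top ie de; exists (c1 - f a); split.
- by move=> s; rewrite linearB /= -f_act ia ic1.
- by rewrite linearB /= -f_dif -aE; apply/eqP; rewrite subr_eq0 eq_sym -subr_eq0 dc1.
have : cobd (toCone (c1 - f a - c)).
  have -> : toCone (c1 - f a - c) = ((e, c1) : cone D.+1) - toCone c - (e, f a).
    by congr (_, _); rewrite /= ?subr0 ?subrr // addrAC.
  by apply: cobdB => //; rewrite aE; exact: cobd_graph.
move: (c1 - f a - c); rewrite DE => c0; exact: toCone_cobd.
Qed.

End Cone.

(** * Free actions on simplicial sets *)
Section CochainComplex.
Variables (F : fieldType) (gT : finGroupType) (S : simplicialSet).
Variable a : gT -> simplicialMap S S.
Variable lam : forall k, S k -> gT.
Hypotheses (a1 : forall k (s : S k), smap (a 1%g) s = s)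
  (aM : forall g h k (s : S k), smap (a g) (smap (a h) s) = smap (a (g * h)%g) s)
  (lam_a : forall g k (s : S k), lam (smap (a g) s) = (g * lam s)%g).

Definition actCochain (g : gT) k (x : cochain F S k) : cochain F S k := fun s => x (smap (a g) s).
(** Restriction to the fundamental domain where [lam] is trivial; its translates partition the
    simplices, which gives [higP]. *)
Definition higCochain k (x : cochain F S k) : cochain F S k :=
  fun s => if lam s == 1%g then x s else 0.

Lemma actCochain_linear g k : linear (@actCochain g k). Proof. by []. Qed.
Lemma higCochain_linear k : linear (@higCochain k).
Proof.
move=> b x y; apply/funext => s; rewrite /higCochain !cochainE.
by case: ifP => _; rewrite ?mulr0 ?addr0.
Qed.
Lemma actCochain_dif g k (x : cochain F S k) : codiff (actCochain g x) = actCochain g (codiff x).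
Proof. exact: (codiff_pull (a g) x). Qed.
Lemma actCochain_1 k (x : cochain F S k) : actCochain 1%g x = x.
Proof. by apply/funext => s; rewrite /actCochain a1. Qed.
Lemma actCochain_M g h k (x : cochain F S k) :
  actCochain g (actCochain h x) = actCochain (h * g)%g x.
Proof. by apply/funext => s; rewrite /actCochain aM. Qed.
Lemma higCochainP k (x : cochain F S k) :
  \sum_g actCochain g (higCochain (actCochain g^-1%g x)) = x.
Proof.
apply/funext => s; rewrite cochain_sumE (bigD1 (lam s)^-1%g) //= big1 => [|g ne].
  by rewrite addr0 /actCochain /higCochain lam_a mulVg eqxx invgK aM mulgV a1.
rewrite /actCochain /higCochain lam_a; case: eqP => // e; case/eqP: ne.
by rewrite -[g]mulg1 -(mulgV (lam s)) mulgA e mul1g.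
Qed.

Definition cochainComplex : gcomplex F gT := GComplex (@codiff_linear F S) actCochain_linear
  higCochain_linear (@codiff_codiff F S) actCochain_dif actCochain_1 actCochain_M higCochainP.
End CochainComplex.

(** * The universal free simplicial set *)
Section Universal.
Variables (F : fieldType) (gT : finGroupType).

Definition univ : simplicialSet :=
  @SimplicialSet (fun k => 'I_k.+1 -> gT) (fun k l u e => e \o u) (fun k e => erefl)
    (fun k l m u v e _ _ => erefl).

Definition univ_act (g : gT) : simplicialMap univ univ :=
  @SimplicialMap univ univ (fun k e i => g * e i)%g (fun k l u e _ => erefl).

Lemma univ_act1 k (e : univ k) : smap (univ_act 1%g) e = e.
Proof. by apply/funext => i; rewrite /= mul1g. Qed.
Lemma univ_actM g h k (e : univ k) : smap (univ_act g) (smap (univ_act h) e) = smap (univ_act (g * h)%g) e.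
Proof. by apply/funext => i; rewrite /= mulgA. Qed.
Definition univ_head k (e : univ k) : gT := e ord0.
Lemma univ_headM g k (e : univ k) : univ_head (smap (univ_act g) e) = (g * univ_head e)%g.
Proof. by []. Qed.

Definition univComplex : gcomplex F gT := cochainComplex F univ_act1 univ_actM univ_headM.

Definition univ_cons k (e : univ k) : univ k.+1 :=
  fun i => if unlift ord0 i is Some j then e j else 1%g.

Lemma univ_cons0 k (e : univ k) : sact (lift ord0) (univ_cons e) = e.
Proof. by apply/funext => i; rewrite /= /univ_cons liftK. Qed.

Lemma univ_consS k (e : univ k.+1) (h : 'I_k.+2) :
  sact (lift (lift ord0 h)) (univ_cons e) = univ_cons (sact (lift h) e).
Proof.
apply/funext => i; rewrite /= /univ_cons; case: (unliftP ord0 i) => [j|] ->.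
  have -> : lift (lift ord0 h) (lift ord0 j) = lift ord0 (lift h j).
    by apply/val_inj; rewrite /= /bump /=; lia.
  by rewrite liftK.
have -> : lift (lift ord0 h) ord0 = ord0 by apply/val_inj.
by rewrite unlift_none.
Qed.

Lemma univ_acyclic k (x : univComplex k.+1) : dif x = 0 -> exists y, x = dif y.
Proof.
move=> dx; exists ((fun e => (x : cochain F univ k.+1) (univ_cons e)) : cochain F univ k).
apply/funext => e; have := congr1 (fun c : cochain F univ k.+2 => c (univ_cons e)) dx.
rewrite /= /codiff big_ord_recl expr0 mul1r univ_cons0 => /eqP; rewrite addr_eq0 => /eqP ->.
rewrite -sumrN; apply: eq_bigr => h _; rewrite univ_consS.
by rewrite /= /bump /= add1n exprS mulN1r mulNr opprK.
Qed.

Lemma univ_const (x : univComplex 0) : dif x = 0 -> forall e e' : univ 0,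
  (x : cochain F univ 0) e = (x : cochain F univ 0) e'.
Proof.
move=> dx e e'; pose s : univ 1 := fun i => if i == ord0 then e ord0 else e' ord0.
have := congr1 (fun c : cochain F univ 1 => c s) dx.
rewrite /= /codiff !big_ord_recl big_ord0 expr0 mul1r expr1 addr0 mulN1r => /eqP.
rewrite subr_eq0 => /eqP.
have -> : sact (lift ord0) s = e' by apply/funext => i; rewrite (ord1 i).
suff -> : sact (lift (lift ord0 ord0)) s = e by move=> ->.
by apply/funext => i; rewrite (ord1 i).
Qed.

Lemma univ_const_ginv (x : univComplex 0) : dif x = 0 -> ginv x.
Proof. by move=> dx s; apply/funext => e; exact: (univ_const dx (smap (univ_act s) e) e). Qed.

End Universal.

(** * Eigenvalues of the normaliser *)
Section Eigenvalues.
Variables (F : fieldType) (gT : finGroupType) (E : gcomplex F gT).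
Hypotheses (E_acyclic : forall k (x : E k.+1), dif x = 0 -> exists y, x = dif y)
  (E_const : forall x : E 0, dif x = 0 -> ginv x).
Variables (g s : gT) (v : nat).
Hypotheses (gs : (g * s = s * g ^+ v)%g) (v0 : v%:R != 0 :> F).
Hypothesis index_unit : (#|[set: gT]%SET : <[g]>|)%g%:R != 0 :> F.
Notation K := (<[g]>)%g.
Notation u := (v%:R^-1 : F).

Lemma norm_K : s \in 'N(K)%g.
Proof.
by rewrite inE -cycleJ cycle_subG conjgE gs mulKg mem_cycle.
Qed.

Lemma actc_tau k (y : E k) :
  actc s (tau g y) = tau g (\sum_(j < v) actc (g ^+ j)%g (actc s y)).
Proof. by rewrite -act_pow_sub /tau linearB /= !act_M gs. Qed.

Lemma actc_nrm k (y : E k) : actc s (nrm g y) = nrm g (actc s y).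
Proof.
rewrite /nrm linear_sum /= [RHS](reindex_inj (conjg_inj s)) /=.
apply: eq_big => [t|t _]; first by rewrite memJ_norm // norm_K.
by rewrite !act_M conjgC.
Qed.

Lemma actc_inv k (x : E k) : tau g x = 0 -> tau g (actc s x) = 0.
Proof. by move=> /ker_tau[y ->]; rewrite actc_nrm tau_nrm. Qed.

(** The induction follows the two-periodicity of the cohomology of [K]: [tau] leads from the first
    statement in degree [k + 1] to the second in degree [k], and [nrm] from the second to the first.
    Only [tau] meets the [v] summands of [actc_tau], so every second degree contributes a factor
    [u]. *)
Lemma normaliser_eigen k :
  (forall x : E k, dif x = 0 -> tau g x = 0 ->
    exists t : E k, dif t = 0 /\ actc s x - u ^+ uphalf k *: x = nrm g t) /\
  (forall x : E k, dif x = 0 -> nrm g x = 0 ->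
    exists t : E k, dif t = 0 /\ actc s x - u ^+ k./2 *: x = tau g t).
Proof.
elim: k => [|k [IHA IHB]].
  by split=> x dx _; exists 0; rewrite !linear0 /= expr0 scale1r E_const // subrr.
split=> x dx kx; have [y xE] := E_acyclic dx.
  have dty : dif (tau g y) = 0 by rewrite dif_tau -xE.
  have [t [dt tE]] := IHB _ dty (nrm_tau g y).
  set w := \sum_(j < v) actc (g ^+ j)%g (actc s y) in tE *.
  pose z := w - u ^+ k./2 *: y - t.
  have tz : tau g z = 0.
    by rewrite /z linearB linearB /= linearZ /= -actc_tau tE subrr.
  (* All [v] summands of [w] have the same coboundary, because [g] fixes [actc s x]. *)
  have dz : dif z = v%:R *: actc s x - u ^+ k./2 *: x.
    rewrite /z linearB linearB /= linearZ /= dt subr0 -xE; congr (_ - _).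
    rewrite /w linear_sum /= (eq_bigr (fun=> actc s x)).
      by rewrite sumr_const card_ord scaler_nat.
    move=> j _; rewrite dif_act dif_act -xE (tau_inv (actc_inv kx)) //.
    exact: mem_cycle.
  have [z' zE] := ker_tau tz; exists (u *: dif z'); split; first by rewrite linearZ /= dif_dif scaler0.
  rewrite [nrm g _]linearZ /= -dif_nrm -zE dz scalerBr !scalerA mulVf // scale1r.
  by rewrite -exprS.
have dny : dif (nrm g y) = 0 by rewrite dif_nrm -xE.
have [t [dt tE]] := IHA _ dny (tau_nrm g y).
pose z := actc s y - u ^+ uphalf k *: y - t.
have nz : nrm g z = 0.
  by rewrite /z linearB linearB /= linearZ /= -actc_nrm tE subrr.
have [z' zE] := ker_nrm nz; exists (dif z'); split; first exact: dif_dif.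
have dz : dif z = actc s x - u ^+ uphalf k *: x.
  by rewrite /z linearB linearB /= linearZ /= dt subr0 dif_act -xE.
by rewrite -dif_tau -zE dz.
Qed.

(** An element fixed by the group is fixed by [s], so a nonzero multiple of [x] is the norm of a
    cocycle, that is, of a coboundary. *)
Theorem normaliser_vanishing k (x : E k.+1) : u ^+ uphalf k.+1 != 1 -> ginv x -> dif x = 0 ->
  gcobd x.
Proof.
move=> une ix dx; have tx := ginv_tau g ix; have [y xE] := E_acyclic dx.
have [t [dt tE]] := (normaliser_eigen k.+1).1 x dx tx.
have [r rE] := E_acyclic dt.
apply: (@gcobd_avg _ _ g index_unit _ _ _ ((1 - u ^+ uphalf k.+1)^-1 *: nrm g r)) => //.
  by rewrite linearZ /= tau_nrm scaler0.
rewrite linearZ /= dif_nrm -rE -tE ix -{2}[x]scale1r -scalerBl scalerA mulVf ?scale1r //.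
by rewrite subr_eq0 eq_sym.
Qed.

End Eigenvalues.

(** * The affine group of Z/p *)
Section Affine.
Variable p : nat.
Hypothesis p_prime : prime p.

Let p0 : (0 < p)%N. Proof. exact: prime_gt0. Qed.
Definition affFun (a b : nat) (i : 'I_p) : 'I_p := Ordinal (ltn_pmod (a * i + b) p0).

Lemma affFun_inj a b : coprime a p -> injective (affFun a b).
Proof.
move=> ap i j /(congr1 val) /= /eqP; rewrite eqn_modDr.
wlog ij : i j / (i <= j)%N => [W e|].
  by case: (leqP i j) => [|/ltnW] ij; [exact: W | apply/esym/W; rewrite // eq_sym].
rewrite eq_sym eqn_mod_dvd ?leq_mul2l ?ij ?orbT // -mulnBr Gauss_dvdr 1?coprime_sym //.
move=> d; case: (posnP (j - i)) => [/eqP|ji]; last by have := dvdn_leq ji d; have := ltn_ord j; lia.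
by rewrite subn_eq0 => ji; apply/val_inj/eqP; rewrite eqn_leq ij ji.
Qed.

Definition rotation : 'S_p := perm (@affFun_inj 1 1 (coprime1n p)).

Lemma rotationX k i : (rotation ^+ k)%g i = ((i + k) %% p)%N :> nat.
Proof.
elim: k => [|k IH]; first by rewrite expg0 perm1 addn0 modn_small.
by rewrite expgSr permM permE /= mul1n IH modnDml addn1 addnS.
Qed.

Lemma rotation_order : #[rotation]%g = p.
Proof.
have : (#[rotation]%g %| p)%N.
  rewrite order_dvdn; apply/eqP/perm.permP => i; apply/val_inj.
  by rewrite /= rotationX perm1 modnDr modn_small.
move: p_prime => /primeP[p1 pd] /pd /orP[|/eqP //]; rewrite order_eq1 => /eqP e.
have := rotationX 1 (Ordinal p0); rewrite expg1 e perm1 /= add0n modn_small //.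
Qed.

Lemma rotation_trans (i j : 'I_p) : exists2 s, s \in <[rotation]>%g & s i = j.
Proof.
exists (rotation ^+ (j + (p - i)))%g; first exact: mem_cycle.
apply/val_inj; rewrite /= rotationX.
have -> : (i + (j + (p - i)) = j + p)%N by have := ltn_ord i; lia.
by rewrite modnDr modn_small.
Qed.

Lemma index_rotation : (#|[set: 'S_p]%SET : <[rotation]>|)%g = (p.-1)`!%N.
Proof.
have := LagrangeI [set: 'S_p]%G <[rotation]>%G; rewrite finset.setTI finset.cardsT card_Sn.
rewrite -orderE rotation_order => e; apply/eqP; rewrite -(eqn_pmul2l p0) e.
by rewrite -{1 2}(prednK p0) factS.
Qed.

Lemma fact_pred_unit : (p.-1)`!%N%:R != 0 :> 'F_p.
Proof.
rewrite -(dvdn_pcharf (pchar_Fp p_prime)).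
suff H n : (n < p)%N -> ~~ (p %| n`!)%N by apply: H; rewrite prednK.
elim: n => [|n IH] np; first by rewrite fact0 dvdn1; case: (p) p_prime => [|[]].
by rewrite factS Euclid_dvdM // negb_or IH ?(ltnW np) // andbT gtnNdvd.
Qed.

Lemma rotation_index_unit : (#|[set: 'S_p]%SET : <[rotation]>|)%g%:R != 0 :> 'F_p.
Proof. by rewrite index_rotation fact_pred_unit. Qed.

Lemma dilation_normal v (vp : coprime v p) :
  (rotation * perm (@affFun_inj v 0 vp) = perm (@affFun_inj v 0 vp) * rotation ^+ v)%g.
Proof.
apply/perm.permP => i; apply/val_inj; rewrite /= !permM rotationX !permE /= addn0.
by rewrite modnMmr modnDml mul1n addn0 addn1 mulnS addnC.
Qed.

Lemma primitive_exists : exists v : nat, [/\ v%:R != 0 :> 'F_p &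
  forall i, (v%:R ^+ i == 1 :> 'F_p) = (p.-1 %| i)%N].
Proof.
have p1 : (0 < p.-1)%N by have := prime_gt1 p_prime; lia.
have cF : #|'F_p| = p by rewrite card_Fp.
have Fx (x : 'F_p) : x != 0 -> x ^+ p.-1 = 1.
  move=> x0; have x1 : (0 < x)%N by rewrite lt0n; apply: contraNneq x0 => e; apply/eqP/val_inj.
  have cop : coprime x p.
    by rewrite coprime_sym prime_coprime // gtnNdvd //; have := ltn_ord x; rewrite {2}Fp_cast.
  have := Euler_exp_totient cop; rewrite totient_prime // => e.
  by rewrite -[x]natr_Zp -natrX -(Fp_nat_mod p_prime) e (Fp_nat_mod p_prime).
have [z] : exists z : 'F_p, (p.-1).-primitive_root z.
  suff /hasP[z _ zp] : has (p.-1).-primitive_root [seq x <- enum 'F_p | x != 0] by exists z.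
  apply: has_prim_root => //.
  - by apply/allP => x; rewrite mem_filter => /andP[x0 _]; apply/unity_rootP; exact: Fx.
  - by rewrite filter_uniq // enum_uniq.
  - rewrite size_filter; have := count_predC (fun x : 'F_p => x == 0) (enum 'F_p).
    have -> : count (fun x : 'F_p => x == 0) (enum 'F_p) = 1%N.
      by rewrite (count_uniq_mem _ (enum_uniq _)) mem_enum.
    rewrite -cardE cF; set c := count _ _ => e; have -> : p.-1 = c by move: e; lia.
    by apply: sub_count => x.
move=> zp; exists (val z); rewrite natr_Zp; split.
  apply/eqP => z0; have := prim_expr_order zp; rewrite z0 expr0n (gtn_eqF p1) mulr0n => /esym/eqP.
  by rewrite (oner_eq0 'F_p).
by move=> i; rewrite (prim_order_dvd zp).
Qed.

End Affine.

(** * The singular complex of the configuration space *)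
Section Corestriction.
Variables (R : realType) (p n : nat) (F : fieldType).
Notation E := 'rV[R]_n.+1.
Notation V := (confAmbient R p n).
Notation X := (Conf R p n.+1).
Notation C k := (cochain F (sing R V) k).
Notation CX k := (cochain F (sing R X) k).
Notation pt x i := ((x : 'I_p -> E) i).
Notation U := (@partConf R p n p).

Lemma partConf_inj x : U x <-> conf_set x.
Proof.
split=> [Ux i j xij|ix i j _ _ ij /ix //].
by apply: contrapT => ij; exact: (Ux i j (ltn_ord i) (ltn_ord j) ij xij).
Qed.

Definition confVal (x : X) : V := val x.
Lemma confVal_continuous : continuous confVal.
Proof. by move=> x; exact: initial_continuous. Qed.
HB.instance Definition _ := isContinuous.Build _ _ confVal confVal_continuous.

Lemma confVal_in x : U (confVal x).
Proof. by apply/partConf_inj => i j; exact: (@conf_inj R p n.+1 x). Qed.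

Definition toConf (x : V) (Ux : U x) : X :=
  exist (fun x => x \in @conf_set R p n.+1) x (mem_set ((partConf_inj x).1 Ux)).

Section Cores.
Variables (T : topologicalType) (s : continuousType T V) (Us : forall t, U (s t)).
Definition cores (t : T) : X := @toConf (s t) (@Us t).
Lemma cores_continuous : continuous cores.
Proof.
apply: continuous_comp_initial; rewrite (_ : _ \o _ = s); first exact: cts_fun.
by apply/funext.
Qed.
HB.instance Definition _ := isContinuous.Build _ _ cores cores_continuous.
End Cores.

Lemma confVal_injective : injective confVal.
Proof. by move=> x y e; apply: val_inj. Qed.

Definition ext k (x : CX k) : C k := fun s =>
  if pselect (inside U s) is left Us then x (@cores _ s Us : continuousType _ _) else 0.

Lemma extE k (x : CX k) (s : sing R V k) (t : sing R X k) :
  (forall a, confVal ((t : continuousType _ X) a) = (s : continuousType _ V) a) -> ext x s = x t.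
Proof.
move=> ts; rewrite /ext; case: pselect => [Us|nU]; last first.
  by case: nU => a; rewrite -ts; exact: confVal_in.
congr (x _); apply/continuousEP => a; apply: confVal_injective; rewrite ts; by [].
Qed.

Lemma ext_val k (x : CX k) (t : sing R X k) : ext x (sing_fun confVal t) = x t.
Proof. by apply: extE. Qed.

Lemma ext_lin k a (x y : CX k) : ext (a *: x + y) = a *: ext x + ext y.
Proof.
apply/funext => s; rewrite /ext !cochainE; case: pselect => [//|_].
by rewrite mulr0 addr0.
Qed.
Lemma ext0 k : ext (0 : CX k) = 0.
Proof. by apply/funext => s; rewrite /ext; case: pselect. Qed.
Lemma extB k (x y : CX k) : ext (x - y) = ext x - ext y.
Proof. by rewrite addrC -scaleN1r ext_lin scaleN1r addrC. Qed.

Lemma codiff_ext k (x : CX k) s : inside U s -> codiff (ext x) s = ext (codiff x) s.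
Proof.
move=> Us; rewrite (@extE _ (codiff x) s (@cores _ s Us : continuousType _ _)) //.
by rewrite /codiff; apply: eq_bigr => h _; congr (_ * _); apply: extE.
Qed.

Lemma coc_ext_conf k (x : CX k) : codiff x = 0 -> coc U (ext x).
Proof. by move=> dx s Us; rewrite codiff_ext // dx ext0. Qed.

Lemma inside_val k (t : sing R X k) : inside U (sing_fun confVal t).
Proof. by move=> a; exact: confVal_in. Qed.

Lemma bnd_ext_conf k (x : CX k) : bnd U (ext x) <-> coboundary x.
Proof.
case: k x => [|k] x /=; split.
- by move=> bx; apply/funext => t; rewrite -ext_val bx //; exact: inside_val.
- by move=> -> s _; rewrite ext0.
- move=> [y xy]; exists (fun t => y (sing_fun confVal t)); apply/funext => t.
  rewrite -ext_val xy; last exact: inside_val.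
  by rewrite /codiff; apply: eq_bigr => h _; congr (_ * y _); exact/continuousEP.
- by move=> [y ->]; exists (ext y) => s Us; rewrite codiff_ext.
Qed.

Definition coresMap (f : continuousType V V) (fU : forall v, U v -> U (f v)) (x : X) : X :=
  @toConf (f (confVal x)) (@fU (confVal x) (@confVal_in x)).
Lemma coresMap_continuous f fU : continuous (@coresMap f fU).
Proof.
apply: continuous_comp_initial; rewrite (_ : _ \o _ = f \o confVal); last by apply/funext.
move=> x; apply: continuous_comp; first exact: confVal_continuous.
exact: cts_fun.
Qed.
HB.instance Definition _ f fU := isContinuous.Build _ _ (@coresMap f fU) (@coresMap_continuous f fU).

Definition pullX (f : continuousType X X) k (x : CX k) : CX k := fun t => x (sing_fun f t).

Lemma ext_pull (f : continuousType V V) (fX : continuousType X X) k (x : CX k) s :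
  (forall y, confVal (fX y) = f (confVal y)) -> inside U s -> ext (pullX fX x) s = pull f (ext x) s.
Proof.
move=> fE Us; rewrite (@extE _ _ s (@cores _ s Us : continuousType _ _)) // /pullX /pull.
by apply/esym/extE => a /=; rewrite fE.
Qed.

(** The permutation that relates [x] to the chosen point of its orbit: an equivariant map to ['S_p]
    without any continuity. It is evaluated only at vertices of singular simplices. *)
Definition lamX (x : X) : 'S_p :=
  odflt 1%g [pick s | x == conf_perm s (repr (\pi_{eq_quot (@conf_rel R p n.+1)} x)%qT)].

Lemma lamXP x : x = conf_perm (lamX x) (repr (\pi_{eq_quot (@conf_rel R p n.+1)} x)%qT).
Proof.
rewrite /lamX; case: pickP => [s /eqP //|no].
have : conf_rel (repr (\pi_{eq_quot (@conf_rel R p n.+1)} x)%qT) x.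
  by apply/eqquotP; exact: reprK.
by move=> /existsP[s sx]; have := no s; rewrite sx.
Qed.

Lemma conf_perm_free (s t : 'S_p) (x : X) : conf_perm s x = conf_perm t x -> s = t.
Proof.
move=> e; apply/perm.permP => i; apply: (@conf_inj R p n.+1 x).
exact: (congr1 (fun y : X => (val y : 'I_p -> E) i) e).
Qed.

Lemma pi_perm s (x : X) : (\pi_{eq_quot (@conf_rel R p n.+1)} (conf_perm s x) =
  \pi_{eq_quot (@conf_rel R p n.+1)} x)%qT.
Proof. by apply/esym/eqquotP; apply/existsP; exists s. Qed.

Lemma lamX_perm s x : lamX (conf_perm s x) = (s * lamX x)%g.
Proof.
apply: (@conf_perm_free _ _ (repr (\pi_{eq_quot (@conf_rel R p n.+1)} x)%qT)).
by rewrite -conf_permM -lamXP -(pi_perm s) -lamXP.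
Qed.

Definition vert k (i : 'I_k.+1) : Delta R k := retract (delta_mx 0 i).

Lemma val_vert k (i : 'I_k.+1) : val (vert i) = delta_mx 0 i.
Proof. by apply: retract_id; apply: basis_stdSimplex; apply/mapP; exists i; rewrite ?mem_enum. Qed.

Lemma push_vert k l (u : 'I_k.+1 -> 'I_l.+1) i : @push R k l u (vert i) = vert (u i).
Proof.
apply/val_inj; rewrite val_vert; transitivity (push_row u (val (vert i))); first by [].
rewrite val_vert; apply/rowP => j; rewrite !mxE eqxx /= (bigID (pred1 i)) /=.
rewrite [X in _ + X]big1 => [|a /andP[_ ai]]; last by rewrite mxE (negPf ai) andbF.
rewrite addr0; case: (eqVneq (u i) j) => [<-|ne].
  rewrite (big_pred1 i) => [|a]; first by rewrite mxE !eqxx.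
  by rewrite /=; case: (eqVneq a i) => [->|]; rewrite ?eqxx ?andbF.
rewrite big_pred0 // => a.
by case: (eqVneq a i) => [->|]; rewrite ?(negPf ne) ?andbF.
Qed.

(** The classifying map of the covering on the level of simplicial sets. *)
Definition vertexMap k (t : sing R X k) : univ 'S_p k :=
  fun i => lamX ((t : continuousType _ X) (vert i)).

Lemma vertexMap_act k l (u : 'I_k.+1 -> 'I_l.+1) (t : sing R X l) : Defs.monotone u ->
  vertexMap (sact u t) = sact u (vertexMap t).
Proof. by move=> _; apply/funext => i; rewrite /vertexMap /= push_vert. Qed.

Definition vertices : simplicialMap (sing R X) (univ 'S_p) := SimplicialMap vertexMap_act.

Definition permMap (s : 'S_p) : simplicialMap (sing R X) (sing R X) := sing_map R (conf_perm s).

Lemma permMap1 k (t : sing R X k) : smap (permMap 1%g) t = t.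
Proof. by apply/continuousEP => a /=; rewrite conf_perm1. Qed.
Lemma permMapM s s' k (t : sing R X k) :
  smap (permMap s) (smap (permMap s') t) = smap (permMap (s * s')%g) t.
Proof. by apply/continuousEP => a /=; rewrite conf_permM. Qed.

Lemma vertices_perm s k (t : sing R X k) :
  smap vertices (smap (permMap s) t) = smap (univ_act s) (smap vertices t).
Proof. by apply/funext => i; rewrite /= /vertexMap /= lamX_perm. Qed.

Definition headX k (t : sing R X k) : 'S_p := univ_head (smap vertices t).
Lemma headX_perm s k (t : sing R X k) : headX (smap (permMap s) t) = (s * headX t)%g.
Proof. by rewrite /headX vertices_perm univ_headM. Qed.

Definition confComplex : gcomplex F 'S_p := cochainComplex F permMap1 permMapM headX_perm.

Lemma cobdE k (x : confComplex k) : cobd x <-> coboundary (x : CX k).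
Proof. by case: k x. Qed.

Lemma conf_exact k (x : confComplex k) : (0 < p)%N -> (forall c, (c < p)%N -> k <> (c * n)%N) ->
  dif x = 0 -> cobd x.
Proof.
move=> p0 kc dx; apply/cobdE/bnd_ext_conf; apply: conf_vanishing => //.
  by rewrite p0 leqnn.
exact: coc_ext_conf.
Qed.

Lemma conf_const (x : confComplex 0) : (0 < p)%N -> (0 < n)%N -> dif x = 0 ->
  exists a : F, forall t, (x : CX 0) t = a.
Proof.
move=> p0 n0 dx; have pp : (0 < p <= p)%N by rewrite p0 leqnn.
have [a xa] := conf_connected n0 pp (coc_ext_conf dx); exists a => t.
by rewrite -ext_val xa //; exact: inside_val.
Qed.

Lemma conf_invariant_exact k (x : confComplex k) : (0 < p)%N -> ~~ odd n -> 2%:R != 0 :> F ->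
  (0 < k)%N -> dif x = 0 -> (forall s, cobd (actc s x - x)) -> cobd x.
Proof.
move=> p0 n_even two k0 dx inv.
have pp : (0 < p <= p)%N by rewrite p0 leqnn.
have [n00|n0] := posnP n.
  by apply: conf_exact => // c _; rewrite n00 muln0 => kE; rewrite kE in k0.
apply/cobdE/bnd_ext_conf; apply: tperm_invariant_bnd => //; first exact: coc_ext_conf.
move=> i j _ _; have /cobdE/bnd_ext_conf := inv (tperm i j).
apply: bnd_ext => s Us; rewrite extB !cochainE; congr (_ - _).
exact: (@ext_pull (permFun (tperm i j)) (conf_perm (tperm i j))).
Qed.

End Corestriction.

(** * Acyclicity of the cohomology as a module over the cyclic group *)
Section Acyclicity.
Variables (R : realType) (p n : nat).
Hypothesis p_prime : prime p.
Notation F := ('F_p : fieldType).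
Notation E := 'rV[R]_n.+1.
Notation V := (confAmbient R p n).
Notation X := (Conf R p n.+1).
Notation CX k := (cochain F (sing R X) k).
Notation pt x i := ((x : 'I_p -> E) i).
Notation U := (@partConf R p n p).
Notation K := (<[rotation p_prime]>)%g.
Notation complex := (confComplex R p n F).
Variable m : nat.
Notation coloring := (@coloring p m).

Lemma spread_perm (s : 'S_p) (x : V) : spread (permFun s x) = spread x.
Proof. by rewrite /spread [in RHS](reindex_inj (@perm_inj _ s)). Qed.

Definition recolorBy (s : 'S_p) (c : coloring) : coloring := [ffun i => c (s i)].

Lemma recolorBy1 c : recolorBy 1%g c = c.
Proof. by apply/ffunP => i; rewrite ffunE perm1. Qed.
Lemma recolorByM s t c : recolorBy s (recolorBy t c) = recolorBy (s * t)%g c.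
Proof. by apply/ffunP => i; rewrite !ffunE permM. Qed.
Lemma recolorBy_inj s : injective (recolorBy s).
Proof.
by move=> c d /(congr1 (recolorBy s^-1%g)); rewrite !recolorByM mulVg !recolorBy1.
Qed.

Definition sepX (c : coloring) : continuousType X X :=
  @coresMap R p n (@separate R p n m c) (fun x Ux => @separate_conf R p n m c p x Ux).

Lemma sepX_conj s c (x : X) :
  conf_perm s^-1%g (sepX c (conf_perm s x)) = sepX (recolorBy s^-1%g c) x.
Proof.
apply: confVal_injective; apply/funext => i.
change (pt (confVal x) (s (s^-1%g i)) +
  (spread (permFun s (confVal x)) * (c (s^-1%g i))%:R) *: e0 R n =
  pt (confVal x) i + (spread (confVal x) * (recolorBy s^-1%g c i)%:R) *: e0 R n).
by rewrite spread_perm permKV ffunE.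
Qed.

Lemma actc_sep s c k (x : complex k) :
  actc s (pullX (sepX c) (actc s^-1%g x : complex k) : complex k) =
  pullX (sepX (recolorBy s^-1%g c)) x :> CX k.
Proof.
apply/funext => t; rewrite /= /actCochain /pullX; congr (x _).
by apply/continuousEP => a; exact: sepX_conj.
Qed.

Definition monochrome (c : coloring) : bool := c \in codom (fun a : 'I_m => [ffun=> a] : coloring).

Lemma monochrome_recolor s c : monochrome (recolorBy s c) = monochrome c.
Proof.
suff H s' c' : monochrome c' -> monochrome (recolorBy s' c').
  apply/idP/idP; last exact: H.
  by move=> /(H s^-1%g); rewrite recolorByM mulVg recolorBy1.
by move=> /codomP[a ->]; apply/codomP; exists a; apply/ffunP => i; rewrite !ffunE.
Qed.

Lemma prime_cycle (h : 'S_p) : h \in K -> h != 1%g -> <[h]>%g = K.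
Proof.
move=> hK h1; apply/eqP; rewrite eqEcard cycle_subG hK -!orderE rotation_order /=.
have : (#[h]%g %| p)%N by have := order_dvdG hK; rewrite -[in X in (_ %| X)%N -> _]orderE rotation_order.
move: (p_prime) => /primeP[_ pd] /pd /orP[|/eqP -> //].
by rewrite order_eq1 (negPf h1).
Qed.

(** As [p] is prime, a nontrivial element generates [K], which is transitive on the points; a
    colouring that it fixes is constant. *)
Lemma recolor_free h c : h \in K -> ~~ monochrome c -> recolorBy h c = c -> h = 1%g.
Proof.
move=> hK nc hc; apply/eqP; apply: contraNT nc => h1.
have cK s : s \in K -> recolorBy s c = c.
  rewrite -(prime_cycle hK h1) => /cycleP[i ->]; elim: i => [|i IH]; first exact: recolorBy1.
  by rewrite expgS -recolorByM IH.
pose i0 : 'I_p := Ordinal (prime_gt0 p_prime).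
apply/codomP; exists (c i0); apply/ffunP => i; rewrite ffunE.
have [s sK si] := rotation_trans p_prime i0 i.
by rewrite -[in RHS](cK s sK) ffunE si.
Qed.

Definition colorOrbit (c : coloring) : {set coloring} := [set recolorBy s c | s in K]%SET.
Definition colorRep (c : coloring) : coloring := odflt c [pick d in colorOrbit c].

Lemma colorOrbit_recolor s c : s \in K -> colorOrbit (recolorBy s c) = colorOrbit c.
Proof.
move=> sK; apply/setP => d; apply/imsetP/imsetP => -[t tK ->].
  by exists (t * s)%g; rewrite ?groupM // recolorByM.
by exists (t * s^-1)%g; rewrite ?groupM ?groupV // recolorByM mulgKV.
Qed.

Lemma colorRep_in c : colorRep c \in colorOrbit c.
Proof.
have cO : c \in colorOrbit c by apply/imsetP; exists 1%g; rewrite ?group1 ?recolorBy1.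
by rewrite /colorRep; case: pickP => [//|no]; have := no c; rewrite /= cO.
Qed.

Lemma colorRep_recolor s c : s \in K -> colorRep (recolorBy s c) = colorRep c.
Proof.
move=> sK; rewrite /colorRep (colorOrbit_recolor c sK); case: pickP => [//|no].
by have := colorRep_in c; rewrite /colorRep; case: pickP => [d dO|_]; rewrite no.
Qed.

(** The indicator of one representative for each [K]-orbit. On free orbits its translates sum to
    [1], which turns a sum over colourings into a trace over [K]. *)
Definition weight (c : coloring) : F := (c == colorRep c)%:R.

Lemma weight_sum c : ~~ monochrome c -> \sum_(s in K) weight (recolorBy s c) = 1.
Proof.
move=> nc; have /imsetP[s0 s0K rE] := colorRep_in c.
rewrite (bigD1 s0) //= big1 ?addr0 => [|s /andP[sK ne]].
  by rewrite /weight colorRep_recolor // rE eqxx.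
rewrite /weight colorRep_recolor // rE; case: eqP => // e; case/eqP: ne.
have hK : (s0^-1 * s)%g \in K by rewrite groupM // groupV.
have := recolor_free hK nc; rewrite -recolorByM e recolorByM mulVg recolorBy1 => /(_ erefl) h1.
by rewrite -[s0]mulg1 -h1 mulKVg.
Qed.

Lemma monochrome_htp c k (x : CX k) : monochrome c -> codiff x = 0 ->
  coboundary (pullX (sepX c) x - x).
Proof.
move=> /codomP[a ca] dx; apply/bnd_ext_conf.
have cx := coc_ext_conf dx.
have b : bnd U (pull (@separate R p n m c) (ext x) - pull idfun (ext x)).
  apply: line_bnd cx => v t Uv _ i j ip jp ij e; apply: (Uv i j ip jp ij).
  have lev l : c l = a by rewrite ca ffunE.
  move: e; rewrite /lineFun /= /shiftBy /level !lev !scalerDr !addrA -!scalerDl !subrK.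
  by rewrite !scale1r => /addIr.
rewrite pull_id in b; apply: bnd_ext b => s Us; rewrite extB !cochainE; congr (_ - _).
by apply/esym; apply: ext_pull.
Qed.

Lemma psi_conf c k (x : CX k) : (0 < n)%N -> m%:R != 0 :> F -> (c <= p)%N -> k = (c * n)%N ->
  codiff x = 0 -> coboundary (\sum_(d : coloring) pullX (sepX d) x - m%:R ^+ (p - c) *: x).
Proof.
move=> n0 m0 cp kE dx; apply/bnd_ext_conf.
have pp : (0 < p <= p)%N by rewrite prime_gt0 // leqnn.
have := psi_eigen n0 m0 pp cp kE (coc_ext_conf dx).
apply: bnd_ext => s Us; pose t := (@cores R p n _ s Us : continuousType _ _).
rewrite (@extE _ _ _ _ _ _ s t) // /psi !cochainE !cochain_sumE; congr (_ - _ * _); last exact: extE.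
by apply: eq_bigr => d _; apply: extE.
Qed.

Theorem conf_acyclic j : (0 < n)%N -> m%:R != 0 :> F ->
  (forall i, (m%:R ^+ i == 1 :> F) = (p.-1 %| i)%N) -> (0 < j < n * p.-1)%N ->
  acTau complex (rotation p_prime) j /\ acNrm complex (rotation p_prime) j.
Proof.
move=> n0 m0 m_prim /andP[j0 jD]; have p0 := prime_gt0 p_prime.
have [[c [cp jE]]|no] := pselect (exists c, (c < p)%N /\ j = (c * n)%N); last first.
  by apply: acTau_trivial => x; apply: conf_exact => // c cp jE; apply: no; exists c.
have c0 : (0 < c)%N by move: j0; rewrite jE; case: (c).
have c1 : (c < p.-1)%N by move: jD; rewrite jE mulnC ltn_mul2l => /andP[].
(* The eigenvalue of the sum over all colourings minus the contribution of the [m] constant ones,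
   which act as the identity. *)
pose mu : F := m%:R ^+ (p - c) - m%:R.
have mu0 : mu != 0.
  have -> : mu = m%:R * (m%:R ^+ (p - c).-1 - 1).
    by rewrite mulrBr mulr1 -exprS prednK // subn_gt0.
  rewrite mulf_neq0 // subr_eq0 m_prim gtnNdvd //; lia.
(* The trace of [phi] over [K] is the sum over all non-constant colourings divided by [mu], hence
   the identity on classes. *)
pose phi (x : CX j) : CX j :=
  mu^-1 *: \sum_(d : coloring | ~~ monochrome d) weight d *: pullX (sepX d) x.
apply: (@higman_ac _ _ complex (rotation p_prime) j phi).
- move=> x y; rewrite /phi -scalerBr -sumrB; congr (_ *: _).
  by apply: eq_bigr => d _; rewrite -scalerBr.
- move=> x dx; have dp d : codiff (pullX (sepX d) x) = 0.
    have := codiff_pull (sing_map R (sepX d)) x; rewrite (dx : codiff (x : CX j) = 0); exact.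
  rewrite [LHS](codiffZ mu^-1) codiff_sum big1 ?scaler0 // => d _.
  by rewrite codiffZ dp scaler0.
- move=> x bx; have bp d : coboundary (pullX (sepX d) x).
    case: (j) x bx => [|j'] x /= => [->|[y ->]]; first by [].
    exists (pullX (sepX d) y); exact/esym/(codiff_pull (sing_map R (sepX d)) y).
  by apply: (@cobdZ _ _ complex); apply: (@cobd_sum _ _ complex) => d _;
    apply: (@cobdZ _ _ complex); apply/cobdE.
move=> x dx.
have -> : \sum_(s in K) actc s (phi (actc s^-1%g x : complex j) : complex j) =
    mu^-1 *: \sum_(d : coloring | ~~ monochrome d) pullX (sepX d) x :> CX j.
  transitivity (\sum_(s in K) mu^-1 *: \sum_(d : coloring | ~~ monochrome d)
      weight (recolorBy s d) *: pullX (sepX d) x : CX j).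
    apply: eq_bigr => s _; rewrite /phi [LHS]linearZ; congr (_ *: _).
    rewrite [LHS]linear_sum /= [RHS](reindex_inj (@recolorBy_inj s^-1%g)) /=.
    apply: eq_big => [d|d _]; first by rewrite monochrome_recolor.
    by rewrite recolorByM mulgV recolorBy1 -actc_sep.
  rewrite -scaler_sumr exchange_big /=; congr (_ *: _); apply: eq_bigr => d nd.
  by rewrite -scaler_suml weight_sum // scale1r.
have b1 := psi_conf n0 m0 (ltnW cp) jE dx.
have b2 : cobd (\sum_(d : coloring | monochrome d) (pullX (sepX d) x - x) : complex j).
  by apply: cobd_sum => d md; apply/cobdE; exact: monochrome_htp.
have -> : x - mu^-1 *: \sum_(d : coloring | ~~ monochrome d) pullX (sepX d) x =
    mu^-1 *: (\sum_(d : coloring | monochrome d) (pullX (sepX d) x - x) -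
      (\sum_(d : coloring) pullX (sepX d) x - m%:R ^+ (p - c) *: x)) :> CX j.
  rewrite [X in X - _ = _](_ : _ = mu^-1 *: (mu *: x : CX j)); last first.
    by rewrite scalerA mulVf // scale1r.
  rewrite -scalerBr; congr (_ *: _); rewrite sumrB [X in _ = _ - (X - _)](bigID monochrome) /=.
  rewrite sumr_const -scaler_nat.
  have -> : #|[pred d : coloring | monochrome d]| = m.
    have := card_codom (f := fun a : 'I_m => [ffun=> a] : coloring).
    rewrite card_ord => cc; rewrite -[RHS]cc //; move=> a b /ffunP/(_ (Ordinal p0)).
    by rewrite !ffunE.
  have ab (a b u w : CX j) : a - b - w = u - b - (u + w - a).
    by rewrite opprB opprD addrCA addrACA subrr add0r addrA.
  by rewrite /mu scalerBl; exact: ab.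
by apply: cobdZ; apply: cobdB => //; exact/cobdE.
Qed.

End Acyclicity.

(** * Vanishing above the top degree *)
Section Nilpotence.
Variables (R : realType) (p n : nat).
Hypothesis p_prime : prime p.
Notation F := ('F_p : fieldType).
Notation E := 'rV[R]_n.+1.
Notation V := (confAmbient R p n).
Notation X := (Conf R p n.+1).
Notation CX k := (cochain F (sing R X) k).
Notation pt x i := ((x : 'I_p -> E) i).
Notation U := (@partConf R p n p).
Notation g := (rotation p_prime).
Notation K := (<[g]>)%g.
Notation complex := (confComplex R p n F).
Notation permg t := (smap (permMap R n g) t).
Implicit Types (A B : set V).

Definition inX A k (t : sing R X k) : Prop := inside A (sing_fun (@confVal R p n) t).
Definition symmetric_set A : Prop := forall (s : 'S_p) v, A (permFun s v) <-> A v.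

Lemma inX_act A k l (u : 'I_k.+1 -> 'I_l.+1) (t : sing R X l) : inX A t -> inX A (sact u t).
Proof. by move=> At a; exact: At. Qed.

Lemma inX_perm A k (s : 'S_p) (t : sing R X k) : symmetric_set A ->
  inX A (smap (permMap R n s) t) <-> inX A t.
Proof.
by move=> sA; split=> At a; apply/(sA s (confVal ((t : continuousType _ X) a))); exact: (At a).
Qed.

Definition cut A k (x : CX k) : CX k := fun t => if pselect (inX A t) then x t else 0.

Lemma cutE A k (x : CX k) t : inX A t -> cut A x t = x t.
Proof. by rewrite /cut; case: pselect. Qed.

Lemma codiff_cut A k (x : CX k) t : inX A t -> codiff (cut A x) t = codiff x t.
Proof. by move=> At; apply: eq_bigr => h _; rewrite cutE //; exact: inX_act. Qed.

Lemma tauP k (x : complex k) : tau g x = 0 <-> forall t, (x : CX k) (permg t) = (x : CX k) t.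
Proof.
split=> [/(congr1 (fun y : CX k => y _)) xt t|xt]; last first.
  by apply/funext => t; apply/eqP; rewrite subr_eq0; apply/eqP; exact: xt.
by have /eqP := xt t; rewrite subr_eq0 => /eqP.
Qed.

Lemma cut_tau A k (x : CX k) : symmetric_set A ->
  (forall t, inX A t -> x (permg t) = x t) -> tau g (cut A x : complex k) = 0.
Proof.
move=> sA xA; apply/tauP => t; rewrite /cut.
case: pselect => [At|nA]; case: pselect => [At'|nA'] //; first exact: xA.
  by case: nA'; exact/(inX_perm g t sA).
by case: nA; exact/(inX_perm g t sA).
Qed.

Lemma small_simplices_conf A B k (x : CX k.+1) : open A -> open B -> A `<=` U -> B `<=` U ->
  symmetric_set A -> symmetric_set B -> codiff x = 0 ->
  (forall t, inX A t \/ inX B t -> x t = 0) -> (forall t, x (permg t) = x t) ->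
  exists y : CX k, (forall t, inX (A `|` B) t -> codiff y t = x t) /\
    (forall t, inX (A `|` B) t -> y (permg t) = y t).
Proof.
move=> oA oB AU BU sA sB dx xAB xg.
have UAB : A `|` B `<=` U by move=> v [/AU|/BU].
have inC k' (s : sing R V k') (Us : inside U s) A' : inside A' s ->
    inX A' ((@cores R p n _ s Us : continuousType _ _) : sing R X k') by move=> As a; exact: As.
have extC k' (y : CX k') (s : sing R V k') (Us : inside U s) :
    ext y s = y (@cores R p n _ s Us : continuousType _ _) by apply: extE.
have [||psi [_ dpsi gpsi]] := @small_simplices R F V A B oA oB k (ext x).
- by move=> s ABs; rewrite codiff_ext ?dx ?ext0 //; exact: insideS ABs.
- move=> s [As|Bs].
    have Us : inside U s by exact: insideS As.
    by rewrite (extC _ _ _ Us) xAB //; left; exact: inC.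
  have Us : inside U s by exact: insideS Bs.
  by rewrite (extC _ _ _ Us) xAB //; right; exact: inC.
have {}gpsi := gpsi (permFun g : continuousType V V) (sA g) (sB g) _.
exists (fun t => psi (sing_fun (@confVal R p n) t)); split=> t At.
  transitivity (codiff psi (sing_fun (@confVal R p n) t)).
    by apply: eq_bigr => h _; congr (_ * psi _); exact/continuousEP.
  by rewrite dpsi // ext_val.
rewrite -[RHS]gpsi //; first by congr psi; exact/continuousEP.
move=> s ABs; have Us : inside U s by exact: insideS ABs.
rewrite (extC _ _ _ Us) -xg; apply: extE => a; by [].
Qed.

Lemma tau_cup i j (x : complex i) (y : complex j) : tau g x = 0 -> tau g y = 0 ->
  tau g (cup (x : CX i) (y : CX j) : complex (i + j)%N) = 0.
Proof.
move=> /tauP xg /tauP yg; apply/tauP => t; rewrite /cup /cupm -!smap_sact ?xg ?yg //.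
  exact: back_mono.
by apply: front_mono; exact: leq_addr.
Qed.

Definition unitC : complex 0 := @cochain1 F (sing R X).

(** As the norm of [u] is [1], its coboundary has norm zero and is [tau v]. The coboundary [beta] of
    [v] is then an invariant cocycle representing the periodicity class of degree two. *)
Lemma bockstein_exists : exists (u : complex 0) (v : complex 1), nrm g u = unitC /\ dif u = tau g v.
Proof.
have [u uE] : exists u : complex 0, unitC = nrm g u by apply: ker_tau; exact/tauP.
exists u; have [v vE] : exists v : complex 1, dif u = tau g v.
  by apply: ker_nrm; rewrite -dif_nrm -uE; exact: codiff1.
by exists v.
Qed.

(** * Multiplication by the periodicity class *)

Section Raise.
Variables (u : complex 0) (v : complex 1).
Hypotheses (uE : nrm g u = unitC) (vE : dif u = tau g v).
Let beta : CX 2 := codiff (v : CX 1).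

Lemma beta_coc : codiff beta = 0. Proof. exact: codiff_codiff. Qed.
Lemma beta_tau : tau g (beta : complex 2) = 0.
Proof. by rewrite -[beta]/(dif v) -dif_tau -vE dif_dif. Qed.

Definition kcobd k : complex k -> Prop :=
  match k with 0 => fun x => x = 0 | k'.+1 => fun x => exists y : complex k', tau g y = 0 /\ x = dif y end.

Lemma actc_cup i j s (x : complex i) (y : complex j) :
  actc s (cup (x : CX i) (y : CX j) : complex (i + j)%N) =
  cup (actc s x : CX i) (actc s y : CX j) :> CX (i + j)%N.
Proof.
apply/funext => t; rewrite /= /actCochain /cup /cupm -!smap_sact //.
  exact: back_mono.
by apply: front_mono; exact: leq_addr.
Qed.

(** With [x' = u x] and [w = v x] one has [nrm x' = x], [dif x' = tau w] and [dif w = beta x].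
    Exactness above degree [k] pulls an invariant primitive of [beta x] back through [w] and [x'] to
    one of [x]. *)
Lemma raise_inj k (x : complex k.+1) :
  (forall j (y : complex j.+1), (k <= j)%N -> dif y = 0 -> cobd y) ->
  tau g x = 0 -> dif x = 0 -> kcobd (cup beta (x : CX k.+1) : complex k.+3) -> kcobd x.
Proof.
move=> ex tx dx [z [tz zE]].
pose x' : complex k.+1 := cup (u : CX 0) (x : CX k.+1).
pose w : complex k.+2 := cup (v : CX 1) (x : CX k.+1).
have xinv s : s \in K -> actc s x = x := tau_inv tx (s := s).
have nx' : nrm g x' = x.
  apply/funext => t; have := congr1 (fun y : CX 0 => y (sact (@front 0 k.+1) t)) uE.
  rewrite /nrm [X in X = _ -> _]cochain_sumE => uu; rewrite [LHS]cochain_sumE.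
  rewrite (eq_bigr (fun s => (actc s u : CX 0) (sact (@front 0 k.+1) t) * (x : CX k.+1) t)).
    by rewrite -big_distrl /= uu mul1r.
  move=> s sK; rewrite [LHS](congr1 (fun y : CX k.+1 => y t) (actc_cup s u x)) xinv //.
  rewrite /cup /cupm; congr (_ * (x : CX k.+1) _); rewrite -[RHS]sact_id; congr (sact _ t).
  apply/funext => a; apply/val_inj; rewrite /= inordK //; exact: ltn_ord.
have dx' : dif x' = tau g w.
  have := leibniz (u : CX 0) (x : CX k.+1); rewrite (dx : codiff (x : CX k.+1) = 0) cupm0 scaler0 addr0.
  rewrite (vE : codiff (u : CX 0) = tau g v) => L; apply: (etrans L).
  rewrite /tau [in RHS](actc_cup g v x) xinv ?cycle_id //.
  by apply/funext => t; rewrite /cupm !cochainE mulrBl.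
have dw : dif w = cup beta (x : CX k.+1).
  have := leibniz (v : CX 1) (x : CX k.+1); rewrite (dx : codiff (x : CX k.+1) = 0) cupm0 scaler0 addr0.
  by move=> L; exact: (etrans L).
have [|r rE] := ex k.+1 (w - z) (leqnSn k); first by have -> : dif (w - z) = dif w - dif z := linearB _ _ _; rewrite -zE dw subrr.
have [|q qE] := ex k (x' - tau g r) (leqnn k).
  have -> : dif (x' - tau g r) = dif x' - dif (tau g r) := linearB _ _ _.
  rewrite dx' dif_tau -rE; have -> : tau g (w - z) = tau g w - tau g z := linearB _ _ _.
  by rewrite tz subr0 subrr.
exists (nrm g q); split; first exact: tau_nrm.
by rewrite dif_nrm -qE linearB /= nrm_tau subr0 nx'.
Qed.

(** The iterated addition keeps the degree convertible to that of the cup product, so no cast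
    appears. *)
Fixpoint raise M k (x : CX k.+1) : CX (iter M (addn 2) k).+1 :=
  match M return CX (iter M (addn 2) k).+1 with
  | 0 => x
  | M'.+1 => cup beta (@raise M' k x)
  end.
Arguments raise M {k} x.

Lemma raise_coc M k (x : CX k.+1) : codiff x = 0 -> codiff (raise M x) = 0.
Proof.
by move=> dx; elim: M => [//|M IH]; apply: (etrans (leibniz beta (raise M x))); rewrite beta_coc IH cupm0 cup0m scaler0 addr0.
Qed.
Lemma raise_tau M k (x : complex k.+1) : tau g x = 0 ->
  tau g (raise M (x : CX k.+1) : complex (iter M (addn 2) k).+1) = 0.
Proof. by move=> tx; elim: M => [//|M IH]; exact: (tau_cup beta_tau IH). Qed.

(** The cup-length argument: if [x] is exact on [A] and [beta] on [B], the product of the corrected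
    cocycles vanishes on all small simplices, hence is exact on the union. *)
Lemma raise_union A B k (x : CX k.+1) (y : CX k) (w : CX 1) : open A -> open B ->
  A `<=` U -> B `<=` U -> symmetric_set A -> symmetric_set B ->
  codiff x = 0 -> tau g (x : complex k.+1) = 0 ->
  tau g (y : complex k) = 0 -> tau g (w : complex 1) = 0 ->
  (forall t, inX A t -> x t = codiff y t) -> (forall t, inX B t -> beta t = codiff w t) ->
  exists z : CX k.+2, tau g (z : complex k.+2) = 0 /\
    forall t, inX (A `|` B) t -> cup beta x t = codiff z t.
Proof.
move=> oA oB AU BU sA sB dx tx ty tw xy bw.
pose b' : CX 2 := beta - codiff w; pose x' : CX k.+1 := x - codiff y.
have db' : codiff b' = 0 by rewrite codiffB beta_coc codiff_codiff subrr.
have dx' : codiff x' = 0 by rewrite codiffB dx codiff_codiff subrr.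
have tb' : tau g (b' : complex 2) = 0.
  by rewrite linearB /= beta_tau -[codiff w]/(dif (w : complex 1)) -dif_tau tw linear0 subrr.
have tx' : tau g (x' : complex k.+1) = 0.
  by rewrite linearB /= tx -[codiff y]/(dif (y : complex k)) -dif_tau ty linear0 subrr.
pose f : CX k.+3 := cup b' x'.
have df : codiff f = 0 by apply: (etrans (leibniz b' x')); rewrite db' dx' cupm0 cup0m scaler0 addr0.
have [||z [dz gz]] := small_simplices_conf (x := f) oA oB AU BU sA sB df.
- move=> t [At|Bt]; rewrite /f /cup /cupm.
    by rewrite [X in _ * X](_ : _ = 0) ?mulr0 // /x' !cochainE xy ?subrr //; exact: inX_act.
  by rewrite [X in X * _](_ : _ = 0) ?mul0r // /b' !cochainE bw ?subrr //; exact: inX_act.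
- exact/tauP/(tau_cup tb' tx').
have sAB : symmetric_set (A `|` B) by move=> s q; rewrite /setU /= sA sB.
(* [c1] and [c2] undo the corrections: [beta x] is [b' x'] plus the coboundaries of both. *)
pose c1 : CX k.+2 := cup beta y; pose c2 : CX k.+2 := cup w x'.
(* Cut off outside the union, since the invariance of [z] is known only there. *)
exists (cut (A `|` B) (z + (c1 + c2))); split.
  apply: cut_tau => // t ABt; rewrite !cochainE gz //; congr (_ + (_ + _)).
    by move: t {ABt}; exact/tauP/(tau_cup beta_tau ty).
  by move: t {ABt}; exact/tauP/(tau_cup tw tx').
move=> t ABt; rewrite codiff_cut // !codiffD !cochainE dz //.
have E1 : codiff (cup beta y) = @cupm F (sing R X) 2 k.+1 (2 + k).+1 beta (codiff y).
  rewrite leibniz.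
  by rewrite beta_coc cup0m add0r expr2 mulrNN mulr1 scale1r.
have E2 : codiff (cup w x') = @cupm F (sing R X) 2 k.+1 (1 + k.+1).+1 (codiff w) x'.
  by rewrite leibniz dx' cupm0 scaler0 addr0.
have {}E1 : codiff c1 = @cupm F (sing R X) 2 k.+1 k.+3 beta (codiff y) := E1.
have {}E2 : codiff c2 = @cupm F (sing R X) 2 k.+1 k.+3 (codiff w) x' := E2.
rewrite E1 E2 /f /cup /cupm /b' /x' !cochainE.
set p1 := beta _; set p2 := codiff w _; set q1 := x _; set q2 := codiff y _.
have -> : (p1 - p2) * (q1 - q2) + (p1 * q2 + p2 * (q1 - q2)) = p1 * q1; last by [].
by rewrite mulrBl [p1 * q2 + _]addrC addrA subrK -mulrDr subrK.
Qed.

Definition covered A := exists w : CX 1, tau g (w : complex 1) = 0 /\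
  forall t, inX A t -> beta t = codiff w t.

Lemma raise_cover (W : nat -> set V) : (forall i, open (W i)) -> (forall i, W i `<=` U) ->
  (forall i, symmetric_set (W i)) -> (forall i, covered (W i)) ->
  forall M k (x : CX k.+1), codiff x = 0 -> tau g (x : complex k.+1) = 0 ->
  exists z : CX (iter M (addn 2) k), tau g (z : complex _) = 0 /\
    forall t, inX [set v | exists i, (i < M)%N /\ W i v] t -> raise M x t = codiff z t.
Proof.
move=> oW WU sW cW M k x dx tx; elim: M => [|M [z [tz zE]]].
  exists 0; rewrite linear0; split=> // t /(_ (vert R ord0)) [i []] //.
pose A := [set v | exists i, (i < M)%N /\ W i v].
have -> : [set v | exists i, (i < M.+1)%N /\ W i v] = A `|` W M.
  apply/seteqP; split=> q.
    move=> [i []]; rewrite ltnS leq_eqVlt => /predU1P[->|iM] Wv; first by right.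
    by left; exists i.
  by move=> [[i [iM Wv]]|Wv]; [exists i; rewrite ltnW | exists M].
have oA : open A by apply: open_exists => i; exact: open_and.
have AU : A `<=` U by move=> q [i [_ /WU]].
have sA : symmetric_set A.
  by move=> s q; split=> -[i [iM Wv]]; exists i; split=> //; apply/(sW i s q).
have [w [tw wE]] := cW M.
exact: (raise_union oA (oW M) AU (WU M) sA (sW M) (raise_coc M dx) (raise_tau M tx) tz tw zE wE).
Qed.

Lemma raise_kcobd M k (x : complex k.+1) :
  (forall j (y : complex j.+1), (k <= j)%N -> dif y = 0 -> cobd y) ->
  tau g x = 0 -> dif x = 0 ->
  kcobd (raise M (x : CX k.+1) : complex (iter M (addn 2) k).+1) -> kcobd x.
Proof.
move=> ex tx dx; elim: M => [//|M IH] b; apply: IH.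
apply: raise_inj b; [|exact: raise_tau|exact: raise_coc].
move=> j y kj; apply: ex; apply: leq_trans kj.
by elim: (M) => [//|M' IH']; exact: (leq_trans IH' (leq_addl 2 _)).
Qed.

(* The moment curve supplies finitely many linear forms, one of which separates any given configuration. *)
Definition moment (a : nat) (w : E) : R := \sum_(l < n.+1) w 0 l * a%:R ^+ l.
Definition momentSet (a : nat) : set V :=
  [set x | forall i j : 'I_p, i <> j -> moment a (pt x i - pt x j) != 0].

Lemma momentB a (w w' : E) : moment a (w - w') = moment a w - moment a w'.
Proof. by rewrite /moment -sumrB; apply: eq_bigr => l _; rewrite !mxE mulrBl. Qed.

Lemma moment_diff_cts a i j : continuous (fun x : V => moment a (pt x i - pt x j)).
Proof.
apply: (@continuous_sum R R^o) => l x; apply: (@cvgMr_tmp R _ (nbhs x)).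
exact: diff_coord_cts.
Qed.

Lemma momentSet_open a : open (momentSet a).
Proof.
have -> : momentSet a = [set x | forall ij : 'I_p * 'I_p,
    [set x : V | ij.1 <> ij.2 -> moment a (pt x ij.1 - pt x ij.2) != 0] x].
  by apply/seteqP; split=> x /= Cx => [[i j]|i j]; [exact: Cx | exact: (Cx (i, j))].
apply: open_forall => -[i j]; apply: open_imp.
apply: (@open_comp _ _ (fun x : V => moment a (pt x i - pt x j)) [set r | r != 0]); last exact: open_neq.
by move=> x _; exact: moment_diff_cts.
Qed.

Lemma momentSet_sub a : momentSet a `<=` U.
Proof.
move=> x Wx i j _ _ ij e; have := Wx i j ij; rewrite e subrr /moment big1 ?eqxx // => l _.
by rewrite mxE mul0r.
Qed.

Lemma momentSet_sym a : symmetric_set (momentSet a).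
Proof.
suff H s v' : momentSet a v' -> momentSet a (permFun s v').
  move=> s v'; split; last exact: H.
  move=> /(H s^-1%g); have -> // : permFun s^-1%g (permFun s v') = v'.
  by apply/funext => i; rewrite /permFun permKV.
by move=> Wv i j ij; apply: Wv => /perm_inj.
Qed.

(** On a nonzero difference the form is a nonzero polynomial in [a] of degree at most [n]; the
    product over all pairs has fewer than [M] roots. *)
Lemma momentSet_cover : exists M, forall x : V, U x -> exists a, (a < M)%N /\ momentSet a x.
Proof.
exists (\sum_(ij : 'I_p * 'I_p) n.+1).+2 => x Ux; apply: contrapT => no.
pose q (ij : 'I_p * 'I_p) : {poly R} :=
  \poly_(l < n.+1) (pt x ij.1 - pt x ij.2) 0 (inord l).
have qE ij a : (q ij).[a%:R] = moment a (pt x ij.1 - pt x ij.2).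
  by rewrite horner_poly; apply: eq_bigr => l _; rewrite inord_val.
have q0 ij : ij.1 != ij.2 -> q ij != 0.
  move=> /eqP ne; apply/eqP => qz; apply: (Ux ij.1 ij.2 (ltn_ord _) (ltn_ord _) ne).
  apply/eqP; rewrite -subr_eq0; apply/eqP/rowP => l; rewrite [RHS]mxE.
  have := congr1 (fun r : {poly R} => r`_l) qz; rewrite coef_poly ltn_ord coef0 inord_val //.
pose Q : {poly R} := \prod_(ij : 'I_p * 'I_p | ij.1 != ij.2) q ij.
have Q0 : Q != 0 by apply/prodf_neq0 => ij; exact: q0.
set M := (_).+2 in no.
have Qr : all (root Q) [seq a%:R | a <- iota 0 M].
  apply/allP => r /mapP[a]; rewrite mem_iota add0n => /= aM ->.
  have [ij nij r0] : exists2 ij : 'I_p * 'I_p, ij.1 != ij.2 & moment a (pt x ij.1 - pt x ij.2) = 0.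
    apply: contrapT => nr; apply: no; exists a; split=> // i j ij; apply/eqP => e.
    by apply: nr; exists (i, j) => //; exact/eqP.
  by rewrite rootE /Q horner_prod (bigD1 ij) //= qE r0 mul0r.
have uM : uniq [seq a%:R : R | a <- iota 0 M].
  by rewrite map_inj_uniq ?iota_uniq // => a b /eqP; rewrite eqr_nat => /eqP.
have := max_poly_roots Q0 Qr uM; rewrite size_map size_iota ltnNge.
have sQ : (size Q <= (\sum_(ij : 'I_p * 'I_p) n.+1).+1)%N.
  apply: leq_trans (size_prod_leq _ _) _; apply: leq_trans (leq_subr _ _) _; rewrite ltnS.
  rewrite [X in (_ <= X)%N](bigID (fun ij : 'I_p * 'I_p => ij.1 != ij.2)) /=.
  apply: leq_trans (leq_addr _ _); apply: leq_sum => ij _; exact: size_poly.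
by rewrite (leq_trans sQ) // /M.
Qed.

Lemma nonvanishing_sign k (f : Delta R k -> R) (a b : Delta R k) : continuous f ->
  (forall t, f t != 0) -> 0 < f a -> 0 < f b.
Proof.
move=> fc f0 c0; rewrite ltNge; apply/negP => d0.
pose h (r : R) : 'rV[R]_k.+1 := (1 - r) *: val a + r *: val b.
have hc : continuous h.
  move=> r; apply: (@cvgD R 'rV[R]_k.+1 _ (nbhs r)).
    apply: (@cvgZr_tmp R 'rV[R]_k.+1 _ (nbhs r)); apply: (@cvgB R R^o _ (nbhs r)); [exact: cvg_cst | exact: cvg_id].
  by apply: (@cvgZr_tmp R 'rV[R]_k.+1 _ (nbhs r)); exact: cvg_id.
pose G (r : R) : R := f (retract (h r)).
have Gc : continuous G.
  move=> r; apply: (@continuous_comp R (Delta R k) R (fun r => retract (h r)) f); last exact: fc.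
  apply: (@continuous_comp R 'rV[R]_k.+1 (Delta R k) h (@retract R k)); first exact: hc.
  exact: retract_continuous.
have G0 : G 0 = f a by rewrite /G /h subr0 scale1r scale0r addr0 retractK.
have G1 : G 1 = f b by rewrite /G /h subrr scale1r scale0r add0r retractK.
have [|r _ Gr] := @IVT R G 0 1 0 ler01 (continuous_subspaceT Gc).
  by rewrite G0 G1 ge_min d0 orbT le_max (ltW c0).
by have := f0 (retract (h r)); rewrite -/(G r) Gr eqxx.
Qed.

Definition firstMax a (x : V) : bool :=
  [forall j : 'I_p, (j != Ordinal (prime_gt0 p_prime)) ==>
     (0 < moment a (pt x (Ordinal (prime_gt0 p_prime)) - pt x j))].

(** The form attains its maximum at exactly one point, and exactly one rotation gives that point the
    index [0]. *)
Lemma firstMax_sum a (x : V) : momentSet a x ->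
  \sum_(s in K) (firstMax a (permFun s x))%:R = 1 :> F.
Proof.
move=> Wx; pose i0 := Ordinal (prime_gt0 p_prime).
pose im := [arg max_(i > i0) moment a (pt x i)]%O.
have imP j : moment a (pt x j) <= moment a (pt x im) by rewrite /im; case: arg_maxP => // i _; apply.
have lt j : j != im -> 0 < moment a (pt x im - pt x j).
  by move=> /eqP/nesym ne; rewrite lt_neqAle eq_sym (Wx _ _ ne) /= momentB subr_ge0; exact: imP.
have fE s : firstMax a (permFun s x) = (s i0 == im).
  apply/forallP/eqP => [h|si j].
    apply/eqP/negPn/negP => ne; have := h (s^-1%g im); rewrite /permFun permKV -/i0.
    have -> : s^-1%g im != i0 by apply: contraNneq ne => <-; rewrite permKV.
    by rewrite /= momentB subr_gt0 ltNge imP.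
  by apply/implyP => ji; rewrite /permFun si; apply: lt; rewrite -si (inj_eq perm_inj).
have [s sK si] := rotation_trans p_prime i0 im.
rewrite (bigD1 s) //= fE si eqxx big1 ?addr0 // => t /andP[tK ts]; rewrite fE.
case: eqP => // ti; case/eqP: ts.
have : (t * s^-1)%g \in K by rewrite groupM // groupV.
move=> /cycleP[k kE]; have : (g ^+ k)%g i0 = i0 by rewrite -kE permM ti -si permK.
move=> /(congr1 val); rewrite /= rotationX /= add0n => /eqP kp.
have : (g ^+ k)%g = 1%g by apply/eqP; rewrite -order_dvdn rotation_order.
by rewrite -kE => /eqP; rewrite -eq_mulgV1 => /eqP.
Qed.

(** The choice of the extremal point is a locally constant cochain [ua] of norm [1] on this set.
    Hence [u - ua] is some [tau y] there, and [v] minus the coboundary of [y] is an invariant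
    primitive of [beta]. *)
Lemma momentSet_covered a : covered (momentSet a).
Proof.
pose W := momentSet a; have sW := momentSet_sym a.
pose ua : CX 0 := fun t => (firstMax a (confVal ((t : continuousType _ X) (vert R ord0))))%:R.
pose h : complex 0 := cut W ((u : CX 0) - ua).
have nh : nrm g h = 0.
  apply/funext => t; rewrite /nrm [LHS]cochain_sumE.
  have [Wt|nW] := pselect (inX W t); last first.
    rewrite big1 // => s _; rewrite /= /actCochain /h /cut; case: pselect => // Wt.
    by case: nW; exact/(inX_perm s t sW).
  rewrite (eq_bigr (fun s => (actc s u : CX 0) t -
    (firstMax a (permFun s (confVal ((t : continuousType _ X) (vert R ord0)))))%:R)); last first.
    move=> s _; rewrite /= /actCochain /h cutE //; exact/(inX_perm s t sW).
  rewrite sumrB firstMax_sum; last exact: Wt.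
  have := congr1 (fun y : CX 0 => y t) uE; rewrite /nrm [X in X = _ -> _]cochain_sumE => ->.
  by rewrite /unitC /cochain1 subrr.
have [y yE] := ker_nrm nh.
have dua t : inX W t -> codiff ua t = 0.
  move=> Wt; rewrite /codiff !big_ord_recl big_ord0 expr0 mul1r expr1 addr0 mulN1r.
  apply/eqP; rewrite subr_eq0; apply/eqP; rewrite /ua; congr (_%:R); congr nat_of_bool.
  apply: eq_forallb => j; case: eqP => [//|/nesym j0] /=.
  pose f (b : Delta R 1) := moment a (pt (confVal ((t : continuousType _ X) b)) (Ordinal (prime_gt0 p_prime)) - pt (confVal ((t : continuousType _ X) b)) j).
  have f0 b : f b != 0 by exact: (Wt b _ _ j0).
  suff fc : continuous f by apply/idP/idP; exact: (nonvanishing_sign _ fc f0).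
  move=> b.
  apply: (@continuous_comp _ V R (fun b => confVal ((t : continuousType _ X) b))
    (fun x : V => moment a (pt x (Ordinal (prime_gt0 p_prime)) - pt x j))); last exact: moment_diff_cts.
  apply: (@continuous_comp _ X V (t : continuousType _ X) (@confVal R p n)).
    exact: (@cts_fun _ _ (t : continuousType _ X) b).
  exact: confVal_continuous.
pose w : CX 1 := (v : CX 1) - codiff (y : CX 0).
exists (cut W w); split=> [|t Wt]; last first.
  by rewrite codiff_cut // /w codiffB codiff_codiff subr0.
apply: cut_tau => // t Wt.
have e1 : codiff (h : CX 0) t = codiff (u : CX 0) t.
  by rewrite (codiff_cut _ Wt) codiffB !cochainE dua // subr0.
have e2 : (dif h : CX 1) t = (dif u : CX 1) t := e1.
rewrite yE dif_tau vE in e2; rewrite /w !cochainE.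
have {}e2 : (codiff (y : CX 0)) (permg t) - codiff (y : CX 0) t = (v : CX 1) (permg t) - (v : CX 1) t := e2.
have -> : (v : CX 1) (permg t) =
    codiff (y : CX 0) (permg t) - codiff (y : CX 0) t + (v : CX 1) t by rewrite e2 subrK.
by rewrite addrAC [X in X - _]addrC addrK addrC.
Qed.

End Raise.

(** Multiplied by [beta] once for each set of the cover, the class becomes exact, and above degree
    [D] this multiplication is injective. *)
Theorem quotient_exact k (x : complex k.+1) : (n * p.-1 <= k)%N -> tau g x = 0 -> dif x = 0 ->
  kcobd x.
Proof.
move=> kD tx dx; have [u [v [uE vE]]] := bockstein_exists.
have [M cM] := momentSet_cover.
apply: (@raise_kcobd u v uE vE M k x) => // [j y kj dy|].
  apply: conf_exact => //; first exact: prime_gt0.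
  move=> c cp jE; have : (c * n <= n * p.-1)%N by rewrite mulnC leq_mul2l; apply/orP; right; lia.
  by rewrite -jE; lia.
have [z [tz zE]] := raise_cover vE momentSet_open momentSet_sub momentSet_sym
  (momentSet_covered uE vE) M dx tx.
exists z; split=> //; apply/funext => t; apply: zE => a; apply: cM; exact: confVal_in.
Qed.

End Nilpotence.

(** * Lifting simplices to the configuration space *)
Section Covering.
Variables (R : realType) (p n : nat).
Hypothesis p_gt0 : (0 < p)%N.
Notation E := 'rV[R]_n.+1.
Notation V := (confAmbient R p n).
Notation X := (Conf R p n.+1).
Notation B := (Bconf R p n.+1).
Notation pt x i := ((x : 'I_p -> E) i).
Notation cv x i := ((confVal x : 'I_p -> E) i).

Definition piX (x : X) : B := (\pi_B x)%qT.

Lemma piX_continuous : continuous piX.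
Proof. exact: pi_continuous. Qed.
HB.instance Definition _ := isContinuous.Build _ _ piX piX_continuous.

Lemma piXP x y : piX x = piX y <-> exists s, y = conf_perm s x.
Proof.
split=> [/eqquotP/existsP[s /eqP]|[s ->]]; first by exists s.
by apply/eqquotP/existsP; exists s.
Qed.

Lemma piX_perm s x : piX (conf_perm s x) = piX x.
Proof. by apply/esym/piXP; exists s. Qed.

Lemma piX_surj b : exists x, piX x = b.
Proof. by exists (repr b); exact: reprK. Qed.

Lemma piX_open (O : set X) : open O -> open (piX @` O).
Proof.
move=> oO; have -> : open (piX @` O) = open (piX @^-1` (piX @` O)) by [].
have -> : piX @^-1` (piX @` O) = [set x | exists s : 'S_p, (conf_perm s @^-1` O) x].
  apply/seteqP; split=> x /=.
    by move=> [y Oy /esym/piXP[s yE]]; exists s; rewrite /= -yE.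
  by move=> [s Os]; exists (conf_perm s x) => //; exact: piX_perm.
apply: open_exists => s; move/continuousP: (@conf_perm_continuous R p n.+1 s); exact.
Qed.

(** Near lifts are unique within their orbit ([near_unique]), so nearness takes the place of the
    sheets of the covering. *)
Definition near_conf (x y : X) : Prop := exists r : R,
  (forall i j : 'I_p, i <> j -> 4 * r < `|cv x i - cv x j|) /\ forall i, `|cv x i - cv y i| < r.

Lemma near_unique x y s : near_conf x y -> near_conf x (conf_perm s y) -> s = 1%g.
Proof.
move=> [r [rx ry]] [r' [rx' ry']]; apply/perm.permP => i; rewrite perm1.
apply: contrapT => si; have e1 := ry' i; have e2 := ry (s i).
have e1' : `|cv x i - cv y (s i)| < r' := e1.
have a1 := rx _ _ si; have a2 := rx' _ _ si.
have := ler_distD (cv y (s i)) (cv x (s i)) (cv x i); rewrite [X in _ <= _ + X]distrC.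
by have := normr_ge0 (cv x i - cv y (s i)); have := normr_ge0 (cv x (s i) - cv y (s i)); lra.
Qed.

Lemma near_perm s x y : near_conf x y -> near_conf (conf_perm s x) (conf_perm s y).
Proof.
move=> [r [rx ry]]; exists r; split=> [i j ij|i]; last exact: ry.
by apply: rx => /perm_inj.
Qed.

Lemma cv_cts (T : topologicalType) (f : T -> X) i : continuous f ->
  continuous (fun t => cv (f t) i).
Proof.
move=> fc t; apply: (@continuous_comp T X E f (fun x => cv x i)); first exact: fc.
apply: (@continuous_comp X V E (@confVal R p n) (fun x => pt x i)); last exact: coord_cts.
exact: confVal_continuous.
Qed.

Lemma dist_cts (T : topologicalType) (f h : T -> X) i j : continuous f -> continuous h ->
  continuous (fun t => `|cv (f t) i - cv (h t) j|).
Proof.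
move=> fc hc t; apply: (@continuous_comp T E R (fun t => cv (f t) i - cv (h t) j) Num.norm).
  by apply: (@cvgB R E _ (nbhs t)); exact: cv_cts.
exact: norm_continuous.
Qed.

Lemma open_lt_cts (T : topologicalType) (f : T -> R) r : continuous f -> open [set t | f t < r].
Proof.
move=> fc; apply: (@open_comp _ _ f [set q | q < r]); last exact: open_lt.
by move=> t _; exact: fc.
Qed.
Lemma open_gt_cts (T : topologicalType) (f : T -> R) r : continuous f -> open [set t | r < f t].
Proof.
move=> fc; apply: (@open_comp _ _ f [set q | r < q]); last exact: open_gt.
by move=> t _; exact: fc.
Qed.

Lemma near_open : open [set xy : X * X | near_conf xy.1 xy.2].
Proof.
pose A (r : R) : set (X * X) := [set xy | forall ij : 'I_p * 'I_p,
  [set xy : X * X | ij.1 <> ij.2 -> 4 * r < `|cv xy.1 ij.1 - cv xy.1 ij.2|] xy].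
pose A' (r : R) : set (X * X) := [set xy | forall i, [set xy : X * X | `|cv xy.1 i - cv xy.2 i| < r] xy].
have -> : [set xy : X * X | near_conf xy.1 xy.2] = [set xy | exists r, (A r `&` A' r) xy].
  apply/seteqP; split=> -[x y] [r [rx ry]]; exists r; split=> //; first by case=> i j; exact: rx.
  by move=> i j; exact: (rx (i, j)).
apply: open_exists => r; apply: openI.
  apply: open_forall => -[i j]; apply: open_imp; apply: open_gt_cts.
  by apply: dist_cts => q; exact: cvg_fst.
apply: open_forall => i; apply: open_lt_cts.
by apply: dist_cts => q; [exact: cvg_fst | exact: cvg_snd].
Qed.

Lemma near_nbhs x y : near_conf x y ->
  exists A A' : set X, [/\ nbhs x A, nbhs y A' & forall x' y', A x' -> A' y' -> near_conf x' y'].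
Proof.
move=> xy; have : nbhs (x, y) [set xy : X * X | near_conf xy.1 xy.2].
  by apply: open_nbhs_nbhs; split; [exact: near_open | exact: xy].
case=> -[A A'] /= [nA nA'] AA; exists A, A'; split=> // x' y' Ax Ay.
exact: (AA (x', y')).
Qed.

Lemma gap_exists (x : X) : exists2 r : R, 0 < r & forall i j : 'I_p, i <> j ->
  r < `|cv x i - cv x j|.
Proof.
pose r := \prod_(ij : 'I_p * 'I_p | ij.1 != ij.2)
  (`|cv x ij.1 - cv x ij.2| / (1 + `|cv x ij.1 - cv x ij.2|)).
have d0 (i j : 'I_p) : i <> j -> 0 < `|cv x i - cv x j|.
  by move=> ij; rewrite normr_gt0 subr_eq0; apply/eqP => /(@conf_inj R p n.+1 x).
exists r.
  apply: prodr_gt0 => -[i j] /= /eqP ij; have dij := d0 _ _ ij.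
  by rewrite divr_gt0 // addr_gt0.
move=> i j ij; have dij := d0 _ _ ij; rewrite /r (bigD1 (i, j)) /=; last exact/eqP.
apply: le_lt_trans (frac_lt dij); have /andP[f0 _] := frac_bound (ltW dij).
apply: ler_piMr => //; apply: prodr_ile1 => l _; exact: frac_bound.
Qed.

Definition even_set (O : set B) : Prop := forall x b, O (piX x) -> O b ->
  exists y, piX y = b /\ near_conf x y.

Lemma even_cover (b : B) : exists O : set B, [/\ open O, O b & even_set O].
Proof.
have [x0 xb] := piX_surj b; have [r0 r00 r0x] := gap_exists x0.
(* Configurations within [r] and [r'] of [x0] are within [2 max(r, r')] of each other. The points of
   the first remain more than [14 max(r, r')] apart, beyond the [8 max(r, r')] that [near_conf]
   demands. *)
pose N : set X := [set y | exists r : R,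
  (forall i j : 'I_p, i <> j -> 16 * r < `|cv x0 i - cv x0 j|) /\ forall i, `|cv x0 i - cv y i| < r].
have oN : open N.
  apply: open_exists => r; apply: open_and; apply: (open_forall (P := fun i => [set y | `|cv x0 i - cv y i| < r])) => i.
  apply: open_lt_cts; apply: (@dist_cts X (cst x0) id i i); [exact: cst_continuous | move=> q; exact: cvg_id].
exists (piX @` N); split; first exact: piX_open.
  exists x0 => //; exists (r0 / 16); split=> [i j ij|i].
    by have := r0x i j ij; lra.
  by rewrite subrr normr0; lra.
move=> x c [y [r [rx ry]] yx] [y' [r' [rx' ry']] yc].
have [s ->] := (piXP y x).1 yx; exists (conf_perm s y'); split; first by rewrite piX_perm.
apply: near_perm; exists (2 * Num.max r r').
have rm : r <= Num.max r r' by rewrite le_max lexx.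
have rm' : r' <= Num.max r r' by rewrite le_max lexx orbT.
split=> [i j ij|i]; last first.
  have := ler_distD (cv x0 i) (cv y i) (cv y' i); rewrite [X in _ <= X + _]distrC.
  by have := ry i; have := ry' i; lra.
have m16 : 16 * Num.max r r' < `|cv x0 i - cv x0 j|.
  by rewrite /Num.max; case: ifP => _; [exact: rx' | exact: rx].
have := ler_distD (cv y i) (cv x0 i) (cv x0 j).
have := ler_distD (cv y j) (cv y i) (cv x0 j).
have := ry i; have := ry j; have := normr_ge0 (cv x0 i - cv y i).
by rewrite [`|cv y j - cv x0 j|]distrC; lra.
Qed.

(** The lifts are picked pointwise and vary continuously because near lifts are unique and the
    projection is open. *)
Lemma near_step (T : topologicalType) (f : continuousType T X) (s : continuousType T B) :
  (forall t, exists y, piX y = s t /\ near_conf (f t) y) ->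
  exists h : continuousType T X, forall t, piX (h t) = s t.
Proof.
move=> ex; have [h hP] := choice ex.
suff hc : continuous h by exists (mkcts hc) => t; have [] := hP t.
move=> t W nW; have [ht nt] := hP t; have [A [A' [nA nA' AA]]] := near_nbhs nt.
have nWA : nbhs (h t) (W `&` A') by apply: filterI.
have [ O [oO Ot OW]] : exists O : set X, [/\ open O, O (h t) & (O `<=` (W `&` A'))].
  by move: nWA; rewrite nbhsE => -[ O [oO Ot] OW]; exists O.
have nf : nbhs t (f @^-1` A) by exact: (@cts_fun _ _ f t).
have ns : nbhs t (s @^-1` (piX @` O)).
  apply: (@cts_fun _ _ s t); apply: open_nbhs_nbhs; split; first exact: piX_open.
  by exists (h t).
apply: filterS2 nf ns => t' Af [y Oy ys].
have [hy hn] := hP t'; have [Wy A'y] := OW y Oy.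
have [s0 hE] := (piXP y (h t')).1 (etrans ys (esym hy)).
have ny : near_conf (f t') y by exact: AA.
by move: hn; rewrite hE => hn; rewrite /= hE (near_unique ny hn) conf_perm1.
Qed.

Lemma even_lebesgue k (s : continuousType (Delta R k) B) : exists2 e : R, 0 < e &
  forall a a' : Delta R k, `|val a - val a'| < e -> forall x, piX x = s a ->
    exists y, piX y = s a' /\ near_conf x y.
Proof.
pose P (A : set 'rV[R]_k.+1) := exists O : set B, even_set O /\ forall a : Delta R k, A (val a) -> O (s a).
have [||e e0 Pe] := @lebesgue_number R 'rV[R]_k.+1 (@stdSimplex R k) P (@stdSimplex_compact R k).
- by move=> A A' AA [ O [eO sO]]; exists O; split=> // a /AA; exact: sO.
- move=> v Kv; pose a0 : Delta R k := exist (fun t => t \in @stdSimplex R k) v (mem_set Kv).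
  have [ O [oO Oa eO]] := even_cover (s a0).
  have no : nbhs v ((s \o @retract R k) @^-1` O).
    apply: (@continuous_comp _ _ _ (@retract R k) s v); first exact: retract_continuous.
      exact: cts_fun.
    apply: open_nbhs_nbhs; split=> //.
    by have ra : retract v = a0 := retractK a0; rewrite /= ra.
  move: no; rewrite -nbhs_ballE => -[e /= e0 be]; exists e => //.
  exists O; split=> // a ba; have := be _ ba; rewrite /= retractK; exact.
exists e => // a a' aa x xa.
have [ O [eO sO]] := Pe (val a) (set_mem (valP a)).
apply: eO; first by rewrite xa; apply: sO; exact: ballxx.
by apply: sO; rewrite -ball_normE.
Qed.

Lemma simplex_norm_le k (a b : Delta R k) : `|val a - val b| <= 2.
Proof.
have le1 (c : Delta R k) : `|val c| <= 1.
  have [c0 c1] := set_mem (valP c); rewrite [`|_|]mx_normrE; apply/bigmax_leP; split=> // -[i j] _.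
  rewrite ord1 /= ger0_norm ?c0 // -c1 (bigD1 j) //= lerDl sumr_ge0 // => l _; exact: c0.
by apply: le_trans (ler_normB _ _) _; have := le1 a; have := le1 b; lra.
Qed.

(** The contraction of the simplex to a point is lifted in [N] steps, each short enough for
    [even_lebesgue] and lifted near the previous one. *)
Theorem simplex_lift k (s : continuousType (Delta R k) B) :
  exists t : continuousType (Delta R k) X, forall a, piX (t a) = s a.
Proof.
have [e e0 eP] := even_lebesgue s.
have [a0 _] : exists a0 : Delta R k, True by exists (retract 0).
pose z (r : R) (a : Delta R k) : 'rV[R]_k.+1 := (1 - r) *: val a0 + r *: val a.
have zS r a : 0 <= r <= 1 -> @stdSimplex R k (z r a).
  move=> /andP[r0 r1]; have [p0 p1] := set_mem (valP a0); have [q0 q1] := set_mem (valP a).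
  split=> [i|]; first by rewrite !mxE; apply: addr_ge0; apply: mulr_ge0; rewrite ?subr_ge0 ?p0 ?q0.
  rewrite (eq_bigr (fun i => (1 - r) * (val a0) 0 i + r * (val a) 0 i)) => [|i _]; last by rewrite !mxE.
  by rewrite big_split /= -!mulr_sumr p1 q1 !mulr1 subrK.
have zc r : continuous (fun a => retract (z r a)).
  move=> a; apply: (@continuous_comp (Delta R k) 'rV[R]_k.+1 (Delta R k) (z r) (@retract R k)).
    apply: (@cvgD R 'rV[R]_k.+1 _ (nbhs a)); first exact: cvg_cst.
    apply: (@cvgZl_tmp R 'rV[R]_k.+1 _ (nbhs a)); exact: initial_continuous.
  exact: retract_continuous.
pose sz r : continuousType (Delta R k) B := s \o mkcts (zc r).
have szE r b : sz r b = s (retract (z r b)) by [].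
(* A step has length at most [2 / N], where [2] bounds the diameter of the simplex. *)
have [N N0 Ne] : exists2 N : nat, (0 < N)%N & 2 / N%:R < e.
  exists (Num.bound (2 / e)); first by rewrite /Num.bound.
  have := archi_boundP (divr_ge0 (ler0n R 2) (ltW e0)); set N := Num.bound _ => h.
  have N0 : 0 < N%:R :> R by apply: le_lt_trans h; rewrite divr_ge0 // ltW.
  by rewrite ltr_pdivrMr // mulrC -ltr_pdivrMr.
suff H i : (i <= N)%N -> exists t : continuousType (Delta R k) X, forall a, piX (t a) = sz (i%:R / N%:R) a.
  have [t tE] := H N (leqnn N); exists t => a; rewrite tE szE; congr (s _).
  rewrite divff ?pnatr_eq0 -?lt0n // /z subrr scale0r add0r scale1r; exact: retractK.
have Nn0 : 0 < N%:R :> R by rewrite ltr0n.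
elim: i => [|i IH] iN.
  have [x0 x0E] := piX_surj (s a0); exists (cst x0) => a; rewrite szE /= x0E; congr (s _).
  by rewrite mul0r /z subr0 scale1r scale0r addr0 retractK.
have [t tE] := IH (ltnW iN); apply: (near_step (f := t) (s := sz (i.+1%:R / N%:R))) => a.
have in01 j : (j <= N)%N -> 0 <= (j%:R / N%:R : R) <= 1.
  by move=> jN; rewrite divr_ge0 ?ler0n //= ler_pdivrMr // mul1r ler_nat.
apply: (eP (retract (z (i%:R / N%:R) a)) (retract (z (i.+1%:R / N%:R) a)) _ (t a) (tE a)).
rewrite (retract_id (zS _ a (in01 i (ltnW iN)))) (retract_id (zS _ a (in01 i.+1 iN))).
have -> : z (i%:R / N%:R) a - z (i.+1%:R / N%:R) a = (- N%:R^-1) *: (val a - val a0).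
  rewrite /z -[i.+1]addn1 natrD mulrDl mul1r; apply/rowP => l; rewrite !mxE; lra.
rewrite normrZ normrN gtr0_norm ?invr_gt0 //; apply: le_lt_trans Ne.
by rewrite mulrC ler_wpM2r ?invr_ge0 ?(ltW Nn0) // simplex_norm_le.
Qed.

Definition sepW (x : V) : R :=
  \prod_(ij : 'I_p * 'I_p | ij.1 != ij.2) (`|pt x ij.1 - pt x ij.2| / (1 + `|pt x ij.1 - pt x ij.2|)).

Lemma sepW_cts : continuous sepW.
Proof.
have mc : continuous (fun x : R * R => x.1 * x.2) by exact: mul_continuous.
apply: (continuous_big (P := fun ij : 'I_p * 'I_p => ij.1 != ij.2) mc) => ij _ x.
apply: (@cvgM R _ (nbhs x)); first exact: norm_diff_cts.
by apply: inv1D_cts => // y; exact: norm_diff_cts.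
Qed.

Lemma sepW_bound (x : X) : 0 < sepW (confVal x) /\
  forall i j : 'I_p, i <> j -> sepW (confVal x) < `|cv x i - cv x j|.
Proof.
have d0 (i j : 'I_p) : i <> j -> 0 < `|cv x i - cv x j|.
  by move=> ij; rewrite normr_gt0 subr_eq0; apply/eqP => /(@conf_inj R p n.+1 x).
split.
  apply: prodr_gt0 => -[i j] /= /eqP ij; have dij := d0 _ _ ij.
  by rewrite divr_gt0 // addr_gt0.
move=> i j ij; have dij := d0 _ _ ij; rewrite /sepW (bigD1 (i, j)) /=; last exact/eqP.
apply: le_lt_trans (frac_lt dij); have /andP[f0 _] := frac_bound (ltW dij).
apply: ler_piMr => //; apply: prodr_ile1 => l _; exact: frac_bound.
Qed.

(** [f] is positive where [t'] is the translate of [t] by [s0], and negative elsewhere, since there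
    some point is off by more than [sepW]. A continuous function without zeros on a simplex keeps
    its sign. *)
Theorem lift_unique k (t t' : continuousType (Delta R k) X) : (forall a, piX (t a) = piX (t' a)) ->
  exists s : 'S_p, forall a, t' a = conf_perm s (t a).
Proof.
move=> tt'; pose a0 : Delta R k := retract 0; have [s0 s0E] := (piXP _ _).1 (tt' a0).
exists s0 => a; pose f (b : Delta R k) : R :=
  sepW (confVal (t b)) / 2 - \sum_i `|cv (t' b) i - cv (conf_perm s0 (t b)) i|.
have tc : continuous (t : Delta R k -> X) by exact: cts_fun.
have tc' : continuous (t' : Delta R k -> X) by exact: cts_fun.
have ptc : continuous (fun b => conf_perm s0 (t b)).
  move=> b; apply: (@continuous_comp _ X X t (conf_perm s0)); first exact: tc.
  exact: conf_perm_continuous.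
have fc : continuous f.
  move=> b; apply: (@cvgB R R^o _ (nbhs b)); last first.
    by apply: (@continuous_sum R R^o) => i; exact: dist_cts.
  apply: (@cvgMr_tmp R _ (nbhs b)).
  apply: (@continuous_comp _ V R (fun b => confVal (t b)) sepW); last exact: sepW_cts.
  apply: (@continuous_comp _ X V t (@confVal R p n)); [exact: tc | exact: confVal_continuous].
have f_on b : t' b = conf_perm s0 (t b) -> 0 < f b.
  move=> e; rewrite /f e big1 => [|i _]; last by rewrite subrr normr0.
  by have [s_gt0 _] := sepW_bound (t b); lra.
have f_off b : t' b <> conf_perm s0 (t b) -> f b < 0.
  move=> ne; have [s sE] := (piXP _ _).1 (tt' b).
  have [i si] : exists i, s i <> s0 i.
    apply: contrapT => no; apply: ne; rewrite sE; congr (conf_perm _ _).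
    by apply/perm.permP => i; apply: contrapT => si; apply: no; exists i.
  have [s_gt0 /(_ _ _ si) sb] := sepW_bound (t b).
  rewrite /f (bigD1 i) //= sE.
  have : 0 <= \sum_(j | j != i) `|cv (conf_perm s (t b)) j - cv (conf_perm s0 (t b)) j| by apply: sumr_ge0.
  have <- : `|cv (t b) (s i) - cv (t b) (s0 i)| = `|cv (conf_perm s (t b)) i - cv (conf_perm s0 (t b)) i| by [].
  by lra.
have f0 b : f b != 0.
  have [/f_on h|/f_off h] := pselect (t' b = conf_perm s0 (t b)); first by rewrite gt_eqF.
  by rewrite lt_eqF.
have fa := nonvanishing_sign a fc f0 (f_on a0 s0E).
by apply: contrapT => /f_off; have := fa; lra.
Qed.

End Covering.

(** * Recognising a fibre product of graded algebras *)
Section Assembly.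
Variables (F : fieldType) (A B J : gradedAlgebra F).
Variables (f : gradedMorphism B A) (q : gradedMorphism A J).
Variables (eJ : augmentation J) (eB : augmentation B) (m : nat).
Variable W : forall k, A k -> Prop.
Hypotheses (W_lin : forall k a (x y : A k), W x -> W y -> W (a *: x + y))
  (W_0 : forall k, W (0 : A k))
  (W_deg0 : forall x : A 0, W x -> x = 0)
  (W_mull : forall i j (x : A i) (y : A j), W y -> W (gmul x y))
  (W_mulr : forall i j (x : A i) (y : A j), W x -> W (gmul x y))
  (W_dec : forall k (x : A k), (k <= m)%N -> exists b : B k, W (x - gmap f b))
  (f_inj : forall k (b : B k), (k <= m)%N -> gmap f b = 0 -> b = 0)
  (W_top : forall k (x : A k), (m < k)%N -> W x)
  (q_surj : forall k (j : J k), (0 < k)%N -> exists2 w : A k, W w & gmap q w = j)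
  (q_inj : forall k (w : A k), (0 < k)%N -> W w -> gmap q w = 0 -> w = 0)
  (qf : forall k (b : B k), (0 < k)%N -> gmap q (gmap f b) = 0)
  (qf0 : forall b : B 0, aug eJ (gmap q (gmap f b)) = aug eB b)
  (eJ_inj : forall j : J 0, aug eJ j = 0 -> j = 0).

Notation T := (truncation m B).
Notation proj := (@gquot_proj F B (above m B)).

Lemma gmapD (A' B' : gradedAlgebra F) (h : gradedMorphism A' B') k (x y : A' k) :
  gmap h (x + y) = gmap h x + gmap h y.
Proof. by have := gmap_linear h 1 x y; rewrite !scale1r. Qed.
Lemma gmapB (A' B' : gradedAlgebra F) (h : gradedMorphism A' B') k (x y : A' k) :
  gmap h (x - y) = gmap h x - gmap h y.
Proof. by rewrite addrC -scaleN1r gmap_linear scaleN1r addrC. Qed.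
Lemma augB (A' : gradedAlgebra F) (e : augmentation A') k (x y : A' k) :
  aug e (x - y) = aug e x - aug e y.
Proof. by rewrite addrC -scaleN1r aug_linear scaleN1r addrC. Qed.

Lemma W_B k (x y : A k) : W x -> W y -> W (x - y).
Proof. by move=> Wx Wy; rewrite addrC -scaleN1r; exact: W_lin. Qed.

Lemma comp_exists k (x : A k) : exists b : B k, W (x - gmap f b).
Proof. by case: (leqP k m) => [/W_dec|/W_top]; [exact | exists 0]. Qed.

Lemma comp_unique k (x : A k) (b b' : B k) : W (x - gmap f b) -> W (x - gmap f b') ->
  proj b = proj b'.
Proof.
move=> Wb Wb'; apply/qpiP; case: (ltnP m k) => [mk|km]; first by apply/orP; left.
apply/orP; right; apply/eqP; apply: f_inj => //.
have Wf : W (gmap f (b - b')).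
  have -> : gmap f (b - b') = (x - gmap f b') - (x - gmap f b).
    by rewrite gmapB opprB [RHS]addrC addrA subrK.
  exact: W_B.
case: k x b b' Wb Wb' km Wf => [|k] x b b' Wb Wb' km Wf; first exact: W_deg0.
by apply: q_inj => //; rewrite qf.
Qed.

(** The projection to the group part along the ideal [W]; above degree [m] the truncation absorbs
    the choice. *)
Definition comp k (x : A k) : T k := proj (projT1 (cid (comp_exists x))).

Lemma compE k (x : A k) (b : B k) : W (x - gmap f b) -> comp x = proj b.
Proof. by move=> Wb; rewrite /comp; case: cid => b' Wb' /=; exact: comp_unique Wb' Wb. Qed.

Lemma comp_linear k : linear (@comp k).
Proof.
move=> a x y; have [b Wb] := comp_exists x; have [b' Wb'] := comp_exists y.
rewrite (compE Wb) (compE Wb') -gquot_proj_linear; apply: compE.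
rewrite gmap_linear opprD addrACA -scalerBr; exact: W_lin.
Qed.

Lemma comp_one : comp (gone A) = gone T.
Proof. by apply: compE; rewrite gmap_one subrr. Qed.

Lemma comp_mul i j (x : A i) (y : A j) : comp (gmul x y) = gmul (comp x) (comp y).
Proof.
have [b Wb] := comp_exists x; have [b' Wb'] := comp_exists y.
rewrite (compE Wb) (compE Wb'); have -> : gmul (proj b : T i) (proj b' : T j) = proj (gmul b b') by exact: gquot_ME.
apply: compE; rewrite gmap_mul.
have -> : gmul x y - gmul (gmap f b) (gmap f b') =
    1 *: gmul (x - gmap f b) y + gmul (gmap f b) (y - gmap f b').
  by rewrite scale1r gmulBl gmulBr addrA subrK.
by apply: W_lin; [exact: W_mulr | exact: W_mull].
Qed.

Lemma trunc_augE k (b : B k) : aug (truncation_aug m eB) (proj b) = aug eB b.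
Proof. exact: (@aug_quotE F B (above m B) eB (@aug_above F m B eB) k b). Qed.

Lemma proj0 k : proj (0 : B k) = 0.
Proof.
have := gquot_proj_linear (above m B) (-1) (0 : B k) 0.
by rewrite scaleN1r oppr0 addr0 scaleN1r addNr.
Qed.

Lemma comp_aug k (x : A k) : aug eJ (gmap q x) == aug (truncation_aug m eB) (comp x).
Proof.
case: k x => [|k] x; last by rewrite (aug_pos eJ) // (aug_pos (truncation_aug m eB)).
have [b Wb] := comp_exists x; rewrite (compE Wb).
have -> : x = gmap f b by apply/eqP; rewrite -subr_eq0; apply/eqP; exact: W_deg0.
by rewrite qf0 trunc_augE.
Qed.

Notation P := (fibreProduct eJ (truncation_aug m eB)).

Definition toFibre k (x : A k) : P k := exist _ (gmap q x, comp x) (comp_aug x).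

Lemma toFibre_linear k : linear (@toFibre k).
Proof.
move=> a x y; apply: val_inj; rewrite /= gmap_linear comp_linear; by [].
Qed.
Lemma toFibre_one : toFibre (gone A) = gone P.
Proof. by apply: val_inj; rewrite /= gmap_one comp_one. Qed.
Lemma toFibre_mul i j (x : A i) (y : A j) : toFibre (gmul x y) = gmul (toFibre x) (toFibre y).
Proof. by apply: val_inj; rewrite /= gmap_mul comp_mul. Qed.

Definition fibreMorphism : gradedMorphism A P :=
  GradedMorphism toFibre_linear toFibre_one toFibre_mul.

Lemma toFibre_inj k : injective (@toFibre k).
Proof.
suff H (x : A k) : gmap q x = 0 -> comp x = 0 -> x = 0.
  move=> x y /(congr1 val) [qxy cxy]; apply/eqP; rewrite -subr_eq0; apply/eqP; apply: H.
    by rewrite gmapB qxy subrr.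
  have -> : x - y = -1 *: y + x by rewrite scaleN1r addrC.
  by rewrite comp_linear cxy scaleN1r addNr.
move=> qx cx; have [b Wb] := comp_exists x; have p0 : proj b = proj 0.
  by rewrite -(compE Wb) cx proj0.
have Wx : W x.
  case: (ltnP m k) => [|km]; first exact: W_top.
  move/qpiP: p0; rewrite subr0 => /orP[|/eqP b0]; first by rewrite ltnNge km.
  by move: Wb; rewrite b0 gmap0 subr0.
by case: k x qx cx b Wb p0 Wx => [|k] x qx cx b Wb p0 Wx; [exact: W_deg0 | exact: q_inj].
Qed.

Lemma toFibre_surj k (y : P k) : exists x, toFibre x = y.
Proof.
case: y => -[j t] jt; elim/gquot_ind: t jt => b jt.
suff [x qx cx] : exists2 x : A k, gmap q x = j & W (x - gmap f b).
  by exists x; apply: val_inj; rewrite /= qx (compE cx).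
case: k j b jt => [|k] j b jt.
  exists (gmap f b); last by rewrite subrr.
  apply/eqP; rewrite -subr_eq0; apply/eqP; apply: eJ_inj; rewrite augB qf0.
  have /eqP je : aug eJ j == aug (truncation_aug m eB) (proj b) := jt.
  by rewrite je trunc_augE subrr.
have [w Ww wj] := @q_surj k.+1 j isT; exists (w + gmap f b); first by rewrite gmapD qf // addr0.
by rewrite addrK.
Qed.

(** Up to degree [m] the algebra is the sum of [W] and the image of [f]; above, it is [W]. In
    positive degrees [q] is bijective on [W] and zero on the image of [f], so [q] and the projection
    along [W] together are bijective. *)
Theorem fibre_isomorphic : gradedIsomorphic A P.
Proof.
exists fibreMorphism => k; have [h hP] := choice (@toFibre_surj k).
by exists h => [x|y]; [apply: (@toFibre_inj k); exact: hP | exact: hP].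
Qed.

End Assembly.

(** * Cohomology classes *)
Section Classes.
Variables (F : fieldType) (S : simplicialSet).
Implicit Types (k : nat).

Definition cocycleOf k (x : cochain F S k) (dx : codiff x = 0) : gsub (cocycles F S) k :=
  exist _ x (introT eqP dx).

Definition cls k (x : cochain F S k) : cohomology F S k :=
  if pselect (codiff x = 0) is left dx then gquot_proj (coboundaries F S) (cocycleOf dx) else 0.

Lemma clsE k (x : cochain F S k) (dx : codiff x = 0) :
  cls x = gquot_proj (coboundaries F S) (cocycleOf dx).
Proof.
rewrite /cls; case: pselect => [dx'|//]; congr gquot_proj; exact: val_inj.
Qed.

Lemma cls_surj k (a : cohomology F S k) : exists x : cochain F S k, codiff x = 0 /\ a = cls x.
Proof.
elim/gquot_ind: a => -[x xz]; have dx : codiff x = 0 by exact/eqP.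
by exists x; split=> //; rewrite (clsE dx); congr gquot_proj; exact: val_inj.
Qed.

Lemma cls_lin k a (x y : cochain F S k) : codiff x = 0 -> codiff y = 0 ->
  cls (a *: x + y) = a *: cls x + cls y.
Proof.
move=> dx dy; have dxy : codiff (a *: x + y) = 0 by rewrite codiff_linear dx dy scaler0 addr0.
rewrite (clsE dx) (clsE dy) (clsE dxy) -(gquot_proj_linear (coboundaries F S)).
by congr gquot_proj; exact: val_inj.
Qed.

Lemma cls_eq0 k (x : cochain F S k) : codiff x = 0 -> cls x = 0 <-> coboundary x.
Proof.
move=> dx; rewrite (clsE dx).
have p0 : gquot_proj (coboundaries F S) (0 : gsub (cocycles F S) k) = 0.
  have := gquot_proj_linear (coboundaries F S) (-1) (0 : gsub (cocycles F S) k) 0.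
  by rewrite scaleN1r oppr0 addr0 scaleN1r addNr.
split=> [|bx].
  rewrite -p0 => /qpiP; rewrite subr0 => /(elimT (asboolP _)); exact.
rewrite -p0; apply/qpiP; rewrite subr0; exact: (introT (asboolP _)).
Qed.

Lemma cls0 k : cls (0 : cochain F S k) = 0.
Proof. by apply/cls_eq0; [exact: codiff0 | exact: coboundary0]. Qed.

Lemma clsB k (x y : cochain F S k) : codiff x = 0 -> codiff y = 0 -> cls (x - y) = cls x - cls y.
Proof. by move=> dx dy; rewrite addrC -scaleN1r cls_lin // scaleN1r addrC. Qed.

Lemma cls_eq k (x y : cochain F S k) : codiff x = 0 -> codiff y = 0 ->
  coboundary (x - y) -> cls x = cls y.
Proof.
move=> dx dy bxy; apply/eqP; rewrite -subr_eq0 -clsB //; apply/eqP/cls_eq0 => //.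
by rewrite codiffB dx dy subrr.
Qed.

Lemma cup_coc i j (x : cochain F S i) (y : cochain F S j) : codiff x = 0 -> codiff y = 0 ->
  codiff (cup x y) = 0.
Proof. by move=> dx dy; rewrite leibniz dx dy cupm0 cup0m scaler0 addr0. Qed.

Lemma cls_mul i j (x : cochain F S i) (y : cochain F S j) : codiff x = 0 -> codiff y = 0 ->
  gmul (cls x) (cls y) = cls (cup x y).
Proof.
move=> dx dy; rewrite (clsE dx) (clsE dy) (clsE (cup_coc dx dy)).
rewrite [LHS](gquot_ME (coboundaries F S) (cocycleOf dx) (cocycleOf dy)).
by congr gquot_proj; exact: val_inj.
Qed.

Lemma cls_aug (v : S 0) (x : cochain F S 0) : codiff x = 0 -> aug (cohomology_aug F v) (cls x) = x v.
Proof. by move=> dx; rewrite (clsE dx); exact: (aug_quotE (@aug_coboundary F S v) (cocycleOf dx)). Qed.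

End Classes.

Lemma cls_pull (F : fieldType) (S T : simplicialSet) (f : simplicialMap S T) k (x : cochain F T k) :
  codiff x = 0 -> gmap (pullback F f) (cls x) = cls (cochain_pull f x : cochain F S k).
Proof.
move=> dx; have dfx : codiff (cochain_pull f x : cochain F S k) = 0 by rewrite codiff_pull dx.
rewrite (clsE dx) (clsE dfx).
have <- : gmap (cocycle_morph F f) (cocycleOf dx) = cocycleOf dfx by exact: val_inj.
exact: (gquot_funE (@coboundary_pull F S T f) (cocycleOf dx)).
Qed.

Section LiftToSub.
Variables (F : fieldType) (A B : gradedAlgebra F) (h : gradedMorphism A B) (S : gradedSubalgebra B).
Hypothesis hS : forall k (x : A k), gmap h x \in submod_pred (S k).

Definition toSub k (x : A k) : gsub S k := exist _ (gmap h x) (hS x).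
Lemma toSub_linear k : linear (@toSub k).
Proof. by move=> a x y; apply: val_inj; exact: gmap_linear. Qed.
Lemma toSub_one : toSub (gone A) = gone (gsub S).
Proof. by apply: val_inj; exact: gmap_one. Qed.
Lemma toSub_mul i j (x : A i) (y : A j) : toSub (gmul x y) = gmul (toSub x) (toSub y).
Proof. by apply: val_inj; exact: gmap_mul. Qed.
Definition subMorphism : gradedMorphism A (gsub S) := GradedMorphism toSub_linear toSub_one toSub_mul.
End LiftToSub.

(** * The nerve as a quotient of the universal free simplicial set *)
Section Edges.
Variables (F : fieldType) (gT : finGroupType).

(** From homogeneous to inhomogeneous bar coordinates. Left translations cancel, which makes the
    nerve the quotient of [univ] ([edges_fibre], [unroll_edges]). *)
Definition edgesOf k (e : univ gT k) : nerve gT k :=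
  [ffun i : 'I_k => ((e (widen_ord (leqnSn k) i))^-1 * e (lift ord0 i))%g].

Lemma prod_telescope (h : nat -> gT) a b : (a <= b)%N ->
  (\prod_(a <= j < b) ((h j)^-1 * h j.+1))%g = ((h a)^-1 * h b)%g.
Proof.
elim: b => [|b IH]; first by rewrite leqn0 => /eqP ->; rewrite big_geq // mulVg.
rewrite leq_eqVlt => /predU1P[<-|]; first by rewrite big_geq // mulVg.
by rewrite ltnS => ab; rewrite big_nat_recr //= IH // mulgA mulgK.
Qed.

Lemma edges_act k l (u : 'I_k.+1 -> 'I_l.+1) (e : univ gT l) : Defs.monotone u ->
  edgesOf (sact u e) = sact u (edgesOf e).
Proof.
move=> mu; apply/ffunP => i; rewrite !ffunE /=.
set a := u (widen_ord _ i); set b := u (lift ord0 i).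
have ab : (a <= b)%N by apply: mu; rewrite /= /bump /= add1n.
pose h (j : nat) : gT := e (inord j).
have hE (j : 'I_l.+1) : e j = h j by rewrite /h inord_val.
rewrite (hE a) (hE b) -(prod_telescope h ab).
have bl : (b <= l)%N by rewrite -ltnS.
rewrite (big_nat_widen _ _ _ _ _ bl) (big_nat_widenl _ 0%N) // big_mkord.
apply: eq_big => [j|j _]; first by rewrite andbC.
by rewrite ffunE !hE /= /bump /= add1n.
Qed.

Definition edges : simplicialMap (univ gT) (nerve gT) := SimplicialMap edges_act.

Lemma edges_univ_act g k (e : univ gT k) : smap edges (smap (univ_act g) e) = smap edges e.
Proof. by apply/ffunP => i; rewrite !ffunE /= invMg mulgA mulgKV. Qed.

Definition unroll k (x : nerve gT k) : univ gT k :=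
  fun i => (\prod_(j < k | (j < i)%N) (x : {ffun 'I_k -> gT}) j)%g.

Lemma unroll_edges k (x : nerve gT k) : smap edges (unroll x) = x.
Proof.
apply/ffunP => i; rewrite ffunE /unroll /=.
pose h (j : nat) : gT := if insub j is Some o then (x : {ffun 'I_k -> gT}) o else 1%g.
have hE (b : nat) : (b <= k)%N -> (\prod_(j < k | (j < b)%N) (x : {ffun 'I_k -> gT}) j = \prod_(0 <= j < b) h j)%g.
  move=> bk; rewrite (big_nat_widen _ _ _ _ _ bk) big_mkord.
  by apply: eq_bigr => j _; rewrite /h valK.
by rewrite /bump /= add1n (hE _ (ltn_ord i)) (hE _ (ltnW (ltn_ord i))) big_nat_recr //= mulKg /h valK.
Qed.

Lemma edges_fibre k (e e' : univ gT k) : smap edges e = smap edges e' ->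
  exists g, e' = smap (univ_act g) e.
Proof.
move=> ee; exists (e' ord0 * (e ord0)^-1)%g; apply/funext => i; rewrite /=.
have H (m : nat) : (m <= k)%N -> e' (inord m) = (e' ord0 * (e ord0)^-1 * e (inord m))%g.
  elim: m => [|m IH] mk.
    have -> : inord 0 = ord0 :> 'I_k.+1 by apply/val_inj; rewrite /= inordK.
    by rewrite mulgKV.
  have := congr1 (fun h : {ffun 'I_k -> gT} => h (Ordinal mk)) ee; rewrite !ffunE.
  have -> : widen_ord (leqnSn k) (Ordinal mk) = inord m.
    by apply/val_inj; rewrite /= inordK // ltnS ltnW.
  have -> : lift ord0 (Ordinal mk) = inord m.+1.
    by apply/val_inj; rewrite /= inordK // /bump /= add1n.
  move=> /(congr1 (mulg (e' (inord m)))); rewrite mulKVg => <-.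
  by rewrite (IH (ltnW mk)) !mulgA mulgK.
by have := H i; rewrite inord_val; apply; rewrite -ltnS.
Qed.

Lemma edges_ginv k (y : univComplex F gT k) : ginv y ->
  exists z : cochain F (nerve gT) k, (cochain_pull edges z : cochain F (univ gT) k) = y.
Proof.
move=> iy; exists (fun x => (y : cochain F (univ gT) k) (unroll x)); apply/funext => e.
rewrite /cochain_pull /=; have [g gE] := edges_fibre (unroll_edges (smap edges e)).
have := congr1 (fun h : cochain F (univ gT) k => h (unroll (smap edges e))) (iy g).
by rewrite /= /actCochain -gE => ->.
Qed.

Lemma edges_pull_inj k (z : cochain F (nerve gT) k) :
  (cochain_pull edges z : cochain F (univ gT) k) = 0 -> z = 0.
Proof.
move=> z0; apply/funext => x; have := congr1 (fun h : cochain F (univ gT) k => h (unroll x)) z0.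
by rewrite /cochain_pull /= -[edgesOf _]/(smap edges (unroll x)) unroll_edges.
Qed.

Lemma edges_pull_ginv k (z : cochain F (nerve gT) k) :
  ginv (cochain_pull edges z : univComplex F gT k).
Proof.
move=> g; apply/funext => e; rewrite /= /actCochain /cochain_pull /=.
by congr (z _); exact: edges_univ_act.
Qed.

Lemma edges_gcobd k (z : cochain F (nerve gT) k) :
  gcobd (cochain_pull edges z : univComplex F gT k) -> coboundary z.
Proof.
case: k z => [|k] z /=; first exact: edges_pull_inj.
move=> [y [iy yE]]; have [w wE] := edges_ginv iy; exists w; apply/eqP; rewrite -subr_eq0.
apply/eqP/edges_pull_inj; have := codiff_pull edges w; rewrite wE => e.
apply/funext => s.
transitivity ((cochain_pull edges z : cochain F (univ gT) k.+1) s -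
  (cochain_pull edges (codiff w) : cochain F (univ gT) k.+1) s); first by [].
by rewrite -e yE; exact: subrr.
Qed.

End Edges.

(** * Cohomology of the unordered configuration space *)
Section Unordered.
Variables (R : realType) (p n : nat).
Hypotheses (p_prime : prime p) (p_gt3 : (3 < p)%N).
Notation F := ('F_p : fieldType).
Notation G := ('S_p).
Notation X := (Conf R p n.+1).
Notation B := (Bconf R p n.+1).
Notation CX k := (cochain F (sing R X) k).
Notation CB k := (cochain F (sing R B) k).
Notation CN k := (cochain F (nerve G) k).
Notation complex := (confComplex R p n F).
Notation univC := (univComplex F G).
Notation g := (rotation p_prime).

Definition pr : simplicialMap (sing R X) (sing R B) :=
  sing_map R (@piX R p n : continuousType X B).

Lemma pr_surj k (s : sing R B k) : exists t : sing R X k, smap pr t = s.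
Proof.
have [t tE] := simplex_lift (s : continuousType _ B); exists t.
by apply/continuousEP => a; exact: tE.
Qed.

Lemma pr_fibre k (t t' : sing R X k) : smap pr t = smap pr t' ->
  exists s, t' = smap (permMap R n s) t.
Proof.
move=> e; have [s sE] := @lift_unique R p n k t t' (fun a =>
  congr1 (fun u : sing R B k => (u : continuousType _ B) a) e).
by exists s; apply/continuousEP => a; exact: sE.
Qed.

Lemma pr_perm s k (t : sing R X k) : smap pr (smap (permMap R n s) t) = smap pr t.
Proof. by apply/continuousEP => a; exact: piX_perm. Qed.

Definition liftS k (s : sing R B k) : sing R X k := projT1 (cid (pr_surj s)).
Lemma liftSK k (s : sing R B k) : smap pr (liftS s) = s.
Proof. by rewrite /liftS; case: cid. Qed.

(** Another lift changes the vertex labels by a left translation, which disappears in the nerve;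
    hence the choice of lifts does not obstruct simpliciality. *)
Definition nuOf k (s : sing R B k) : nerve G k := smap (edges G) (smap (vertices R p n) (liftS s)).

Lemma nuOf_pr k (t : sing R X k) : nuOf (smap pr t) = smap (edges G) (smap (vertices R p n) t).
Proof.
have [s sE] := pr_fibre (liftSK (smap pr t)); rewrite /nuOf [in RHS]sE.
by rewrite [in RHS]vertices_perm edges_univ_act.
Qed.

Lemma nu_act k l (u : 'I_k.+1 -> 'I_l.+1) (s : sing R B l) : Defs.monotone u ->
  nuOf (sact u s) = sact u (nuOf s).
Proof.
move=> mu; rewrite -{1}(liftSK s) -(smap_sact pr _ mu) nuOf_pr (smap_sact (vertices R p n) _ mu).
by rewrite (smap_sact (edges G) _ mu).
Qed.

Definition nu : simplicialMap (sing R B) (nerve G) := SimplicialMap nu_act.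

Notation prC := (fun k (z : CB k) => (cochain_pull pr z : complex k)).
Notation edgeC := (fun k (z : CN k) => (cochain_pull (edges G) z : univC k)).
Notation nuC := (fun k (z : CN k) => (cochain_pull nu z : CB k)).

Definition vertC k (x : univC k) : complex k := cochain_pull (vertices R p n) (x : cochain F (univ G) k).

Lemma vertC_linear k : linear (@vertC k). Proof. by []. Qed.
Lemma vertC_dif k (x : univC k) : vertC (dif x) = dif (vertC x).
Proof. by apply/esym; exact: (codiff_pull (vertices R p n)). Qed.
Lemma vertC_act s k (x : univC k) : vertC (actc s x) = actc s (vertC x).
Proof.
apply/funext => t; rewrite /vertC /= /actCochain /cochain_pull /=.
by congr (x _); exact/esym/vertices_perm.
Qed.

Lemma prC_dif k (z : CB k) : dif (prC k z) = prC k.+1 (codiff z).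
Proof. exact: (codiff_pull pr). Qed.

Lemma prC_nu k (b : CN k) : prC k (nuC k b) = vertC (edgeC k b).
Proof. by apply/funext => t; rewrite /vertC /cochain_pull /= nuOf_pr. Qed.

Lemma prC_ginv k (z : CB k) : ginv (prC k z).
Proof.
move=> s; apply/funext => t; rewrite /= /actCochain /cochain_pull /=.
by congr (z _); exact: pr_perm.
Qed.

Lemma prC_surj k (y : complex k) : ginv y -> exists z : CB k, prC k z = y.
Proof.
move=> iy; exists (fun s => (y : CX k) (liftS s)); apply/funext => t; rewrite /cochain_pull /=.
have [s sE] := pr_fibre (liftSK (smap pr t)).
have := congr1 (fun h : CX k => h (liftS (smap pr t))) (iy s).
by rewrite /= /actCochain -sE => ->.
Qed.

Lemma prC_inj k (z : CB k) : prC k z = 0 -> z = 0.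
Proof.
move=> z0; apply/funext => s; have := congr1 (fun h : CX k => h (liftS s)) z0.
by rewrite /cochain_pull /= -[sing_fun _ _]/(smap pr (liftS s)) liftSK.
Qed.

Lemma prC_gcobd k (z : CB k) : gcobd (prC k z) -> coboundary z.
Proof.
case: k z => [|k] z /=; first exact: prC_inj.
move=> [y [iy yE]]; have [w wE] := prC_surj iy; exists w; apply/eqP; rewrite -subr_eq0.
apply/eqP/prC_inj; have := prC_dif w; rewrite wE => e.
transitivity (prC k.+1 z - prC k.+1 (codiff w)); first by [].
by rewrite -e yE; exact: subrr.
Qed.

Lemma prC_coc k (z : CB k) : dif (prC k z) = 0 -> codiff z = 0.
Proof. by rewrite prC_dif => /prC_inj. Qed.

Lemma prC_cls0 k (z : CB k) : codiff z = 0 -> gcobd (prC k z) -> cls z = 0.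
Proof. by move=> dz bz; apply/cls_eq0 => //; exact: prC_gcobd. Qed.

Lemma edgeC_lift k (e : univC k) : ginv e -> dif e = 0 ->
  exists b : CN k, codiff b = 0 /\ edgeC k b = e.
Proof.
move=> ie de; have [b bE] := edges_ginv ie; exists b; split=> //.
apply: (@edges_pull_inj F G); have := codiff_pull (edges G) b; rewrite bE => <-; exact: de.
Qed.

Lemma nuC_coc k (b : CN k) : codiff b = 0 -> codiff (nuC k b) = 0.
Proof. by move=> db; rewrite codiff_pull db. Qed.

Let p0 : (0 < p)%N. Proof. exact: prime_gt0. Qed.
Let p_odd : odd p. Proof. by case: (even_prime p_prime) => // e; have := p_gt3; rewrite e. Qed.
Let index_unit : (#|[set: 'S_p]%SET : <[g]>|)%g%:R != 0 :> F := rotation_index_unit p_prime.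

Lemma two_unit : 2%:R != 0 :> F.
Proof. by rewrite -(dvdn_pcharf (pchar_Fp p_prime)) gtnNdvd // (ltn_trans _ p_gt3). Qed.

Definition basePoint : X := conf_base R p (ltn0Sn n).

Lemma codiff_path (c : CX 0) (s : sing R X 1) : codiff c = 0 ->
  c (sact (lift ord0) s) = c (sact (lift (lift ord0 ord0)) s).
Proof.
move=> dc; have := congr1 (fun h : CX 1 => h s) dc.
rewrite /codiff !big_ord_recl big_ord0 expr0 mul1r expr1 addr0 mulN1r => /eqP.
by rewrite subr_eq0 => /eqP.
Qed.

(* On the line any two increasing configurations are joined by a segment of increasing configurations. *)
Definition increasing (x : X) : Prop :=
  forall i j : 'I_p, (i < j)%N -> (confVal x : 'I_p -> 'rV[R]_n.+1) i 0 0 < (confVal x : 'I_p -> 'rV[R]_n.+1) j 0 0.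

Lemma increasing_path (c : CX 0) (x y : X) : codiff c = 0 -> increasing x -> increasing y ->
  c (cst x) = c (cst y).
Proof.
move=> dc ix iy.
pose h (t : Delta R 1) : confAmbient R p n := fun i =>
  (val t) 0 ord0 *: (confVal x : 'I_p -> 'rV[R]_n.+1) i + (val t) 0 (lift ord0 ord0) *: (confVal y : 'I_p -> 'rV[R]_n.+1) i.
have hc : continuous h.
  apply: ptws_continuous => i t; apply: (@cvgD R 'rV[R]_n.+1 _ (nbhs t)).
    by apply: (@cvgZr_tmp R 'rV[R]_n.+1 _ (nbhs t)); exact: Delta_coord_continuous.
  by apply: (@cvgZr_tmp R 'rV[R]_n.+1 _ (nbhs t)); exact: Delta_coord_continuous.
have hU t : @partConf R p n p (mkcts hc t).
  have [t0] := set_mem (valP t); rewrite !big_ord_recl big_ord0 addr0 => t1.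
  suff W (i j : 'I_p) : (i < j)%N -> (h t i) 0 0 < (h t j) 0 0.
    move=> i j _ _ ij e; have /negP : ~~ (i == j :> nat) by apply/eqP => /val_inj.
    by case; rewrite eqn_leq; apply/andP; split; rewrite leqNgt; apply/negP => /W;
      rewrite -[h t i]/(mkcts hc t i) -[h t j]/(mkcts hc t j) e ltxx.
  move=> ij; rewrite /h !mxE; have a0 := t0 ord0; have b0 := t0 (lift ord0 ord0).
  have lx := ix i j ij; have ly := iy i j ij.
  have [a1|a1] := ltrP 0 ((val t) 0 ord0).
    by apply: ltr_leD; [rewrite ltr_pM2l | apply: ler_wpM2l => //; exact: ltW].
  have az : (val t) 0 ord0 = 0 by apply/eqP; rewrite eq_le a1.
  by rewrite az add0r in t1 *; rewrite !mul0r !add0r t1 !mul1r.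
pose sg : sing R X 1 := (cores hU : continuousType _ X).
have := codiff_path sg dc.
have D0 (a : Delta R 0) : a = vert R ord0.
  apply/val_inj/rowP => i; rewrite (ord1 i) val_vert mxE !eqxx.
  by have [_] := set_mem (valP a); rewrite big_ord1.
have E1 : sact (lift ord0) sg = cst y :> sing R X 0.
  apply/continuousEP => a; rewrite (D0 a); apply: confVal_injective; apply/funext => i.
  transitivity (h (vert R (lift ord0 (ord0 : 'I_1))) i); first by rewrite -push_vert.
  by rewrite /h !val_vert !mxE /= scale0r add0r scale1r.
have E2 : sact (lift (lift ord0 ord0)) sg = cst x :> sing R X 0.
  apply/continuousEP => a; rewrite (D0 a); apply: confVal_injective; apply/funext => i.
  transitivity (h (vert R (lift (lift ord0 ord0) (ord0 : 'I_1))) i); first by rewrite -push_vert.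
  by rewrite /h !val_vert !mxE /= scale0r addr0 scale1r.
by rewrite E1 E2 => ->.
Qed.

Lemma increasing_exists (x : X) : n = 0%N -> exists s : 'S_p, increasing (conf_perm s x).
Proof.
move=> n00; pose v (i : 'I_p) : R := (confVal x : 'I_p -> 'rV[R]_n.+1) i 0 0.
have v_inj : injective v.
  move=> i j vij; apply: (@conf_inj R p n.+1 x); apply/rowP => l.
  have -> : l = 0.
    apply/val_inj/eqP; rewrite /= -leqn0; apply: leq_trans (_ : (n <= 0)%N); last by rewrite n00.
    by rewrite -ltnS.
  exact: vij.
pose t := [tuple v i | i < p].
have sz : size (sort <=%R t) == p by rewrite size_sort size_tuple.
have /tuple_permP[s sE] : perm_eq (Tuple sz) t by rewrite /= perm_sort.
exists s => i j ij; have srt : sorted <=%R (sort <=%R t) by apply: sort_sorted; exact: le_total.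
have nthE (l : 'I_p) : nth 0 (sort <=%R t) l = v (s l).
  have -> : sort <=%R t = [tuple tnth t (s i) | i < p] := sE.
  by rewrite -tnth_nth !tnth_mktuple.
rewrite lt_neqAle; apply/andP; split.
  by apply/eqP => /v_inj/perm_inj e; rewrite e ltnn in ij.
have := sorted_leq_nth (@le_trans _ R) (@lexx _ R) 0 srt.
move=> /(_ i j); rewrite !inE !size_sort !size_tuple !ltn_ord => /(_ isT isT (ltnW ij)).
by rewrite !nthE.
Qed.

(** For [n > 0] the space is connected. On the line a permutation brings every configuration into
    increasing order, and the increasing ones are joined by paths. *)
Lemma deg0_const (c : complex 0) : dif c = 0 -> ginv c -> exists a : F, forall t, (c : CX 0) t = a.
Proof.
move=> dc ic; have [n00|n0] := posnP n; last exact: conf_const.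
have D0 (a b : Delta R 0) : a = b.
  apply/val_inj/rowP => i; rewrite (ord1 i).
  by have [_] := set_mem (valP a); have [_] := set_mem (valP b); rewrite !big_ord1 => -> ->.
have ibase : increasing basePoint by move=> i j ij; rewrite /confVal /= !mxE ltr_nat.
exists ((c : CX 0) (cst basePoint)) => t; pose x : X := (t : continuousType _ X) (vert R ord0).
have tE : t = cst x by apply/continuousEP => a; rewrite (D0 a (vert R ord0)).
have [s sx] := increasing_exists x n00; rewrite tE.
have <- := congr1 (fun h : CX 0 => h (cst x)) (ic s).
rewrite /= /actCochain -(increasing_path dc sx ibase); congr ((c : CX 0) _).
exact/continuousEP.
Qed.

Definition D : nat := (n * p.-1)%N.

Lemma E_acyclic k (x : univC k.+1) : dif x = 0 -> exists y, x = dif y.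
Proof. exact: univ_acyclic. Qed.

Lemma vertC_inj0 (x : univC 0) : dif x = 0 -> vertC x = 0 -> x = 0.
Proof.
move=> dx vx; apply/funext => e.
transitivity ((x : cochain F (univ G) 0) (smap (vertices R p n) (cst basePoint : sing R X 0))).
  exact: (univ_const dx).
exact: (congr1 (fun h : CX 0 => h (cst basePoint)) vx).
Qed.

Lemma group_vanishing k : (exists v, [/\ v%:R != 0 :> F, forall i, (v%:R ^+ i == 1 :> F) = (p.-1 %| i)%N
    & ~~ (p.-1 %| uphalf k.+1)%N]) -> forall e : univC k.+1, ginv e -> dif e = 0 -> gcobd e.
Proof.
move=> [v [v0 vp nv]] e ie de.
have cop : coprime v p by rewrite coprime_sym prime_coprime // (dvdn_pcharf (pchar_Fp p_prime)).
apply: (normaliser_vanishing E_acyclic (@univ_const_ginv F G) (dilation_normal p_prime cop) v0 index_unit) => //.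
by rewrite exprVn invr_eq1 vp.
Qed.

Lemma top_vanishing k : odd n -> (k.+1 = D \/ k = D) -> forall e : univC k.+1, ginv e -> dif e = 0 -> gcobd e.
Proof.
move=> on kD; apply: group_vanishing; have [v [v0 vp]] := primitive_exists p_prime.
exists v; split=> //; pose h := (p.-1)./2.
have hp : (p.-1 = h.*2)%N.
  have op : odd p.-1 = false by apply/negbTE; have := p_odd; rewrite -{1}(prednK p0).
  by rewrite -[LHS]odd_double_half op.
have h2 : (1 < h)%N by rewrite -ltn_double -hp; have := p_gt3; lia.
have nh : uphalf D = (n * h)%N.
  by rewrite /D hp -doubleMr uphalf_double.
case: kD => ->.
  rewrite nh hp -muln2 mulnC dvdn_pmul2r; last by rewrite ltnW.
  by rewrite dvdn2 on.
have -> : uphalf D.+1 = (n * h).+1 by rewrite /= /D hp -doubleMr doubleK.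
(* Divisibility by [p - 1] would make [h] a divisor of [1]. *)
rewrite hp; apply/negP => d; have : (h %| (n * h).+1)%N by apply: dvdn_trans d; rewrite -muln2 dvdn_mulr.
by rewrite -addn1 dvdn_addr ?dvdn_mull // dvdn1 => /eqP e; rewrite e in h2.
Qed.

Section Positive.
Hypothesis n0 : (0 < n)%N.

Lemma D_gt0 : (0 < D)%N.
Proof. by rewrite /D muln_gt0 n0 andTb -subn1 subn_gt0 prime_gt1 //. Qed.

Lemma C_ac j : (0 < j < D)%N -> acTau complex g j /\ acNrm complex g j.
Proof. by move=> jD; have [v [v0 vp]] := primitive_exists p_prime; exact (@conf_acyclic R p n p_prime v j n0 v0 vp jD). Qed.

Lemma vertC_surj0 (c : complex 0) : dif c = 0 -> exists2 x : univC 0, dif x = 0 & c = vertC x.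
Proof.
move=> dc; have [a ca] := conf_const p0 n0 dc; exists ((fun=> a) : cochain F (univ G) 0).
  apply/funext => e; rewrite /= /codiff !big_ord_recl big_ord0 expr0 mul1r expr1 addr0 mulN1r.
  exact: subrr.
by apply/funext => t; rewrite ca.
Qed.

Definition splitNorm := split_norm vertC_linear vertC_dif vertC_act E_acyclic vertC_inj0 vertC_surj0 C_ac index_unit.
Definition splitCobd := split_cobd vertC_linear vertC_dif vertC_act E_acyclic vertC_inj0 vertC_surj0 C_ac index_unit.
Definition vertC_gcobd := gcobd_inj vertC_linear vertC_dif vertC_act E_acyclic vertC_inj0 vertC_surj0 C_ac index_unit.
Definition classTop := class_top vertC_linear vertC_dif vertC_act E_acyclic vertC_inj0 vertC_surj0 D_gt0 C_ac index_unit.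
End Positive.

Lemma above_exact k (z : CB k) : (D < k)%N -> codiff z = 0 -> cls z = 0.
Proof.
case: k z => // k z kD dz; apply: prC_cls0 => //.
have dc : dif (prC k.+1 z) = 0 by rewrite prC_dif dz.
have ic := prC_ginv z.
have [y [ty yE]] := quotient_exact (kD : (n * p.-1 <= k)%N) (ginv_tau g ic) dc.
exact: (gcobd_avg index_unit ic ty yE).
Qed.

Lemma conf_above k (x : complex k) : (D < k)%N -> dif x = 0 -> cobd x.
Proof.
move=> kD; apply: conf_exact => // c cp kE; move: kD; rewrite kE /D ltnNge.
by rewrite mulnC leq_mul2l (_ : c <= p.-1)%N ?orbT //; lia.
Qed.

End Unordered.

(** * The fibre product decomposition *)
Section Decomposition.
Variables (R : realType) (p n : nat).
Hypotheses (p_prime : prime p) (p_gt3 : (3 < p)%N).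
Notation F := ('F_p : fieldType).
Notation G := ('S_p).
Notation X := (Conf R p n.+1).
Notation B := (Bconf R p n.+1).
Notation CX k := (cochain F (sing R X) k).
Notation CB k := (cochain F (sing R B) k).
Notation CN k := (cochain F (nerve G) k).
Notation complex := (confComplex R p n F).
Notation univC := (univComplex F G).
Notation g := (rotation p_prime).
Notation pr := (@pr R p n).
Notation nu := (@nu R p n).
Notation D := (D p n).
Notation prC := (fun k (z : CB k) => (cochain_pull pr z : complex k)).
Notation edgeC := (fun k (z : CN k) => (cochain_pull (edges G) z : univC k)).
Notation nuC := (fun k (z : CN k) => (cochain_pull nu z : CB k)).
Notation AB := (singularCohomology R F B).
Notation AX := (singularCohomology R F X).
Notation AG := (groupCohomology F G).
Notation J := (confInvariants R p n.+1 F).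
Notation Jsub := (invariants_sub (fun s : G => pullback F (sing_map R (conf_perm s)) : gradedMorphism AX AX)).

Let p0 : (0 < p)%N. Proof. exact: prime_gt0. Qed.

Definition fromGroup : gradedMorphism AG AB := pullback F nu.

Lemma pullback_inv k (a : AB k) : gmap (pullback F pr) a \in submod_pred (Jsub k).
Proof.
have [z [dz ->]] := cls_surj a; apply/forallP => s.
have dpz : codiff (cochain_pull pr z : CX k) = 0 by rewrite codiff_pull dz.
apply/eqP; rewrite (cls_pull pr dz) (cls_pull (sing_map R (conf_perm s)) dpz).
congr cls; exact: (prC_ginv z s).
Qed.

Definition toInvariants : gradedMorphism AB J := subMorphism pullback_inv.

Lemma toInvariants_cls k (z : CB k) : codiff z = 0 ->
  gsub_incl (gmap toInvariants (cls z) : gsub Jsub k) = cls (prC k z : CX k).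
Proof. by move=> dz; rewrite -(cls_pull pr dz). Qed.

Lemma toInvariants_eq0 k (z : CB k) : codiff z = 0 ->
  gmap toInvariants (cls z) = 0 -> cobd (prC k z).
Proof.
move=> dz q0; apply/cobdE; apply/cls_eq0; first by rewrite codiff_pull dz.
by rewrite -(toInvariants_cls dz) q0.
Qed.

Lemma invariants_class k (j : J k) : exists c : CX k, [/\ codiff c = 0,
  gsub_incl (j : gsub Jsub k) = cls c & forall s, cobd (actc s (c : complex k) - c)].
Proof.
have [c [dc jc]] := cls_surj (gsub_incl (j : gsub Jsub k)); exists c; split=> // s.
have dsc : codiff (cochain_pull (sing_map R (conf_perm s)) c : CX k) = 0 by rewrite codiff_pull dc.
apply/cobdE; apply/(cls_eq0 (S := sing R X)).
  by rewrite codiffB dc subr0; exact: dsc.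
rewrite clsB //; apply/eqP; rewrite subr_eq0 -jc.
have /forallP/(_ s) := valP (j : submod (Jsub k)); rewrite -[val _]/(gsub_incl (j : gsub Jsub k)) jc.
by rewrite (cls_pull (sing_map R (conf_perm s)) dc).
Qed.

Lemma J_inj k (j j' : J k) : gsub_incl (j : gsub Jsub k) = gsub_incl (j' : gsub Jsub k) -> j = j'.
Proof. exact: val_inj. Qed.

Definition normClass k (a : AB k) : Prop := exists (z : CB k) (y : complex k),
  [/\ codiff z = 0, dif y = 0, a = cls z & prC k z = gnrm y].

(** For odd [n] all of degree [D] is included, because there the group has no cohomology and
    acyclicity no longer provides norms. *)
Definition W k (a : AB k) : Prop :=
  a = 0 \/ [/\ odd n, (0 < k)%N & (D <= k)%N \/ normClass a].

Lemma normClass_lin k c (a b : AB k) : normClass a -> normClass b -> normClass (c *: a + b).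
Proof.
move=> [z [y [dz dy -> zy]]] [z' [y' [dz' dy' -> zy']]].
exists (c *: z + z'), (c *: y + y'); split.
- by rewrite codiff_linear dz dz' scaler0 addr0.
- by rewrite [LHS](@dif_linear F G complex k c y y') dy dy' scaler0 addr0.
- by rewrite cls_lin.
transitivity (c *: gnrm y + gnrm y'); first by rewrite -zy -zy'.
by rewrite /gnrm scaler_sumr -big_split; apply: eq_bigr => s _; rewrite linearP.
Qed.

Lemma W_lin k c (a b : AB k) : W a -> W b -> W (c *: a + b).
Proof.
move=> [->|[on k0 Wa]]; first by rewrite scaler0 add0r.
move=> [->|[_ _ Wb]].
  right; split=> //; case: Wa => [kD|Na]; first by left.
  right; apply: normClass_lin => //; exists 0, 0; split; rewrite ?codiff0 ?linear0 ?cls0 //.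
  by rewrite /gnrm big1 // => s _; rewrite linear0.
right; split=> //; case: Wa => [kD|Na]; first by left.
by case: Wb => [kD|Nb]; [left | right; exact: normClass_lin].
Qed.

Lemma gmul0l i j (y : AB j) : gmul (0 : AB i) y = 0.
Proof. by rewrite -(subrr 0) gmulBl subrr. Qed.
Lemma gmul0r i j (x : AB i) : gmul x (0 : AB j) = 0.
Proof. by rewrite -(subrr 0) gmulBr subrr. Qed.

Lemma prC_cup i j (z : CB i) (w : CB j) :
  prC (i + j)%N (cup z w) = cup (prC i z : CX i) (prC j w : CX j) :> CX (i + j)%N.
Proof. exact: (cochain_pull_mul pr). Qed.

(** The projection formula: cochains from the quotient are invariant, so their product with a norm
    is the norm of a product. *)
Lemma W_mull i j (x : AB i) (y : AB j) : W y -> W (gmul x y).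
Proof.
move=> [->|[on j0 Wy]]; first by left; exact: gmul0r.
right; split; rewrite ?addn_gt0 ?j0 ?orbT //; case: Wy => [jD|[z [w [dz dw -> zw]]]].
  by left; rewrite (leq_trans jD) // leq_addl.
right; have [u [du ->]] := cls_surj x; rewrite cls_mul //.
exists (cup u z), (cup (prC i u : CX i) (w : CX j)); split=> //; first exact: cup_coc.
  by apply: cup_coc; [rewrite codiff_pull du | exact: dw].
rewrite [LHS]prC_cup zw /gnrm; apply/funext => t.
rewrite [RHS]cochain_sumE /cup /cupm [X in _ * X]cochain_sumE big_distrr /=.
apply: eq_bigr => s _; have := congr1 (fun h : CX (i + j)%N => h t) (actc_cup s (prC i u) w).
by rewrite (prC_ginv u s) => E; exact: (esym E).
Qed.

Lemma W_mulr i j (x : AB i) (y : AB j) : W x -> W (gmul x y).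
Proof.
move=> [->|[on i0 Wx]]; first by left; exact: gmul0l.
right; split; rewrite ?addn_gt0 ?i0 //; case: Wx => [iD|[z [w [dz dw -> zw]]]].
  by left; rewrite (leq_trans iD) // leq_addr.
right; have [u [du ->]] := cls_surj y; rewrite cls_mul //.
exists (cup z u), (cup (w : CX i) (prC j u : CX j)); split=> //; first exact: cup_coc.
  by apply: cup_coc; [exact: dw | rewrite codiff_pull du].
rewrite [LHS]prC_cup zw /gnrm; apply/funext => t.
rewrite [RHS]cochain_sumE /cup /cupm [X in X * _]cochain_sumE big_distrl /=.
apply: eq_bigr => s _; have := congr1 (fun h : CX (i + j)%N => h t) (actc_cup s w (prC j u)).
by rewrite (prC_ginv u s) => E; exact: (esym E).
Qed.

Lemma fromGroup_sub k (z : CB k) (b : CN k) : codiff z = 0 -> codiff b = 0 ->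
  cls z - gmap fromGroup (cls b) = cls (z - nuC k b).
Proof. by move=> dz db; rewrite (cls_pull nu db) clsB //; exact: nuC_coc. Qed.

Lemma W_dec k (x : AB k) : (k <= D)%N -> exists b : AG k, W (x - gmap fromGroup b).
Proof.
move=> kD; have [z [dz ->]] := cls_surj x.
have dc : dif (prC k z) = 0 by rewrite prC_dif dz.
have ic := prC_ginv z.
case: (posnP k) => [k0|k0].
  subst k.
  have [a ca] := deg0_const p_prime dc ic.
  pose b : CN 0 := fun=> a; have db : codiff b = 0.
    apply/funext => s; rewrite /codiff !big_ord_recl big_ord0 expr0 mul1r expr1 addr0 mulN1r.
    exact: subrr.
  exists (cls b); left; rewrite fromGroup_sub //.
  have -> : z - nuC 0%N b = 0; last exact: cls0.
  apply/funext => s; apply/eqP; rewrite subr_eq0; apply/eqP.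
  by have := ca (liftS s); rewrite /cochain_pull /= -[sing_fun _ _]/(smap pr (liftS s)) liftSK.
(* For [n = 0] also [D = 0], which leaves no positive degree. *)
have n0 : (0 < n)%N by move: kD; rewrite /D; case: (n) => // kD; move: k0; rewrite ltnNge kD.
have [on|en] := boolP (odd n).
  move: kD; rewrite leq_eqVlt => /predU1P[kE|kD].
    by exists 0; right; split=> //; left; rewrite kE.
  have kkD : (0 < k < D)%N by rewrite k0.
  have [e [ie de [y [dy by_]]]] := splitNorm p_prime n0 kkD ic dc.
  have [b [db bE]] := edgeC_lift ie de; exists (cls b); rewrite fromGroup_sub //.
  have [w wE] := prC_surj (@gnrm_ginv _ _ complex k y).
  have dw : codiff w = 0 by apply: prC_coc; rewrite wE dif_gnrm dy /gnrm big1 // => s _; rewrite linear0.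
  have dzb : codiff (z - nuC k b) = 0 by rewrite codiffB dz nuC_coc // subr0.
  right; split=> //; right; exists w, y; split=> //; apply: cls_eq => //.
  apply: prC_gcobd.
  have E : prC k (z - nuC k b - w) = prC k z - @vertC R p n k e - gnrm y by rewrite -wE -bE -prC_nu.
  by move: by_; rewrite -[X in gcobd X]E.
have kkD : (0 < k <= D)%N by rewrite k0.
(* For even [n] an invariant cocycle of positive degree is exact upstairs, so only the part from the
   group remains. *)
have bc : cobd (prC k z).
  apply: conf_invariant_exact => //; first exact: two_unit.
  by move=> s; rewrite ic subrr; exact: cobd0.
have [e [ie de be]] := splitCobd p_prime n0 kkD ic bc.
have [b [db bE]] := edgeC_lift ie de; exists (cls b); rewrite fromGroup_sub //; left.
apply: prC_cls0; first by rewrite codiffB dz nuC_coc // subr0.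
have E : prC k (z - nuC k b) = prC k z - @vertC R p n k e by rewrite -bE -prC_nu.
by move: be; rewrite -[X in gcobd X]E.
Qed.

Lemma fromGroup_inj k (b : AG k) : (k <= D)%N -> gmap fromGroup b = 0 -> b = 0.
Proof.
move=> kD; have [c [dc ->]] := cls_surj b; rewrite (cls_pull nu dc) => /(cls_eq0 (nuC_coc R n dc)) bc.
have bp : gcobd (@vertC R p n _ (edgeC k c)).
  rewrite -prC_nu; move: (cochain_pull nu c : CB k) bc => z; case: (k) z => [|k'] z /=.
    by move=> ->.
  by move=> [y ->]; exists (prC k' y); split; [exact: prC_ginv | exact/esym/prC_dif].
apply/(cls_eq0 dc)/edges_gcobd.
case: (posnP k) => [k0|k0].
  subst k.
  have de : dif (edgeC 0%N c) = 0 by exact (etrans (codiff_pull (edges G) c) (congr1 _ dc)).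
  exact (vertC_inj0 de bp).
have n0 : (0 < n)%N by move: kD; rewrite /D; case: (n) => // kD; move: k0; rewrite ltnNge kD.
apply: (vertC_gcobd p_prime n0 kD) bp; first exact: edges_pull_ginv.
exact: (etrans (codiff_pull (edges G) c) (congr1 _ dc)).
Qed.

Lemma W_top k (x : AB k) : (D < k)%N -> W x.
Proof. by move=> kD; have [z [dz ->]] := cls_surj x; left; exact: (above_exact p_prime kD dz). Qed.

Lemma toInvariants_surj k (j : J k) : (0 < k)%N -> exists2 w : AB k, W w & gmap toInvariants w = j.
Proof.
move=> k0; have [c [dc jc ic]] := invariants_class j.
have trivial_class : cobd (c : complex k) -> exists2 w : AB k, W w & gmap toInvariants w = j.
  move=> b; have bc := (@cobdE R p n F k c).1 b; exists 0; first by left.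
  by rewrite gmap0; apply: J_inj; rewrite jc; apply/esym; apply/(cls_eq0 dc).
have from_cochain (z : CB k) : codiff z = 0 -> cobd (prC k z - c) -> W (cls z) ->
    exists2 w : AB k, W w & gmap toInvariants w = j.
  move=> dz bz Wz; exists (cls z) => //; apply: J_inj; rewrite toInvariants_cls // jc.
  apply: cls_eq => //; first by rewrite codiff_pull dz.
case: (ltnP D k) => [kD|kD]; first by apply: trivial_class; exact: conf_above.
have n0 : (0 < n)%N by move: kD; rewrite /D; case: (n) => // kD; move: k0; rewrite ltnNge kD.
have [on|en] := boolP (odd n); last first.
  apply: trivial_class; apply: conf_invariant_exact => //; exact: two_unit.
(* In degree [D] the invariant representative rests on the vanishing of the group cohomology in
   degree [D + 1]; below, a norm serves. *)
move: kD; rewrite leq_eqVlt => /predU1P[kE|kD].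
  subst k.
  have et (e : univC D.+1) : ginv e -> dif e = 0 -> gcobd e.
    by apply: (top_vanishing (n := n) p_prime p_gt3 on); right.
  have [c' [ic' dc' bc']] := classTop p_prime n0 et dc ic.
  have [z zE] := prC_surj ic'.
  apply: (from_cochain z); [by apply: prC_coc; rewrite zE | by rewrite zE |].
  by right; split=> //; left.
have kkD : (0 < k < D)%N by rewrite k0.
have [y [dy by_]] := class_gnrm (@C_ac R p n p_prime n0) (rotation_index_unit p_prime) kkD dc ic.
have [z zE] := prC_surj (@gnrm_ginv _ _ complex k y).
have dz : codiff z = 0 by apply: prC_coc; rewrite zE dif_gnrm dy /gnrm big1 // => s _; rewrite linear0.
apply: (from_cochain z) => //; first by rewrite zE.
by right; split=> //; right; exists z, y.
Qed.

Lemma gcobdD (C : gcomplex F G) k (x y : C k) : gcobd x -> gcobd y -> gcobd (x + y).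
Proof.
case: k x y => [|k] x y /=; first by move=> -> ->; rewrite addr0.
move=> [u [iu ->]] [v [iv ->]]; exists (u + v); split; last by rewrite linearD.
by move=> s; rewrite -[in RHS](iu s) -[in RHS](iv s); exact: linearD.
Qed.

Lemma toInvariants_inj k (w : AB k) : (0 < k)%N -> W w -> gmap toInvariants w = 0 -> w = 0.
Proof.
move=> k0 [//|[on _ Ww]]; case: (ltnP D k) => [kD|kD].
  by move=> _; have [z [dz ->]] := cls_surj w; exact: (above_exact p_prime kD dz).
have n0 : (0 < n)%N by move: kD; rewrite /D; case: (n) => // kD; move: k0; rewrite ltnNge kD.
move: kD; rewrite leq_eqVlt => /predU1P[kE|kD]; last first.
  case: Ww => [|[z [y [dz dy -> zy]]]]; first by rewrite leqNgt kD.
  move=> /(toInvariants_eq0 dz); rewrite zy => bn; apply: prC_cls0 => //.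
  have kkD : (0 < k < D)%N by rewrite k0.
  by rewrite zy; exact (gnrm_inj (@C_ac R p n p_prime n0) (rotation_index_unit p_prime) kkD dy bn).
(* In degree [D] a class that is exact upstairs comes from the group, whose cohomology vanishes
   there. *)
have [z [dz ->]] := cls_surj w => /(toInvariants_eq0 dz) bz; apply: prC_cls0 => //.
have kkD : (0 < k <= D)%N by rewrite k0 kE leqnn.
have [e [ie de be]] := splitCobd p_prime n0 kkD (prC_ginv z) bz.
have ge : gcobd e.
  case: k k0 kE {w Ww kkD z dz bz be} e ie de => // k _ kE e ie de.
  by apply: (top_vanishing (n := n) p_prime p_gt3 on) => //; left.
have gfe : gcobd (@vertC R p n _ e).
  case: (k) e ge {ie de be} => [|k'] e /=; first by move=> ->; apply/funext.
  by move=> [y [iy ->]]; exists (@vertC R p n _ y); split; [move=> s; rewrite -vertC_act iy | rewrite vertC_dif].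
have -> : prC k z = (prC k z - @vertC R p n _ e) + @vertC R p n _ e by rewrite subrK.
exact: gcobdD.
Qed.

(** The composite factors through the cochains of [univ], which are acyclic in positive degrees. *)
Lemma toInvariants_fromGroup k (b : AG k) : (0 < k)%N -> gmap toInvariants (gmap fromGroup b) = 0.
Proof.
move=> k0; have [c [dc ->]] := cls_surj b; rewrite (cls_pull nu dc).
have dn := nuC_coc R n dc; apply: J_inj; rewrite toInvariants_cls //.
apply/cls_eq0; first by rewrite codiff_pull dn.
apply/(@cobdE R p n); rewrite [cochain_pull pr _]prC_nu.
case: k k0 c dc {b dn} => // k _ c dc.
have de : dif (edgeC k.+1 c) = 0 by exact: (etrans (codiff_pull (edges G) c) (congr1 _ dc)).
by have [e ->] := E_acyclic de; exists (@vertC R p n _ e); rewrite vertC_dif.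
Qed.

Lemma nerve0 (a b : nerve G 0) : a = b.
Proof. by apply/ffunP => -[]. Qed.

Notation eJ := (confInvariants_aug R p F (ltn0Sn n)).
Notation eG := (groupCohomology_aug F G).

Lemma invariants_augE (j : J 0) (c : CX 0) : codiff c = 0 -> gsub_incl (j : gsub Jsub 0) = cls c ->
  aug eJ j = c (sing_vertex R (conf_base R p (ltn0Sn n))).
Proof. by move=> dc jc; rewrite -cls_aug // -jc. Qed.

Lemma aug_fromGroup (b : AG 0) : aug eJ (gmap toInvariants (gmap fromGroup b)) = aug eG b.
Proof.
have [c [dc ->]] := cls_surj b; rewrite (cls_pull nu dc).
have dn := nuC_coc R n dc.
rewrite (invariants_augE _ (toInvariants_cls dn)); last by rewrite codiff_pull dn.
by rewrite [RHS]cls_aug // /cochain_pull /=; congr (c _); exact: nerve0.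
Qed.

Lemma aug_invariants_inj (j : J 0) : aug eJ j = 0 -> j = 0.
Proof.
have [c [dc jc ic]] := invariants_class j; rewrite (invariants_augE dc jc) => c0.
have gc : ginv (c : complex 0) by move=> s; apply/eqP; rewrite -subr_eq0; apply/eqP; exact: (ic s).
have [a ca] := deg0_const p_prime dc gc; apply: J_inj; rewrite jc.
have -> : c = 0; last exact: cls0.
by apply/funext => t; rewrite ca -(ca (sing_vertex R (conf_base R p (ltn0Sn n)))) c0.
Qed.

Lemma W_deg0 (x : AB 0) : W x -> x = 0.
Proof. by case=> // -[]. Qed.

Theorem unordered_decomposition :
  gradedIsomorphic AB (fibreProduct eJ (truncation_aug D eG)).
Proof.
apply: (@fibre_isomorphic F AB AG J fromGroup toInvariants eJ eG D W).
- exact (@W_lin).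
- by left.
- exact (@W_deg0).
- exact (@W_mull).
- exact (@W_mulr).
- exact (@W_dec).
- exact (@fromGroup_inj).
- exact (@W_top).
- exact (@toInvariants_surj).
- exact (@toInvariants_inj).
- exact (@toInvariants_fromGroup).
- exact (@aug_fromGroup).
- exact (@aug_invariants_inj).
Qed.

End Decomposition.

Theorem theorem8p1p4 (R : realType) (p n : nat)
    (p_prime : prime p) (p_gt3 : (3 < p)%N) (n_gt0 : (0 < n)%N) :
  gradedIsomorphic
    (singularCohomology R 'F_p (Bconf R p n))
    (fibreProduct
       (A := confInvariants R p n 'F_p)
       (B := truncation ((n - 1) * (p - 1))%N (groupCohomology 'F_p {perm 'I_p}))
       (confInvariants_aug R p 'F_p n_gt0)
       (truncation_aug ((n - 1) * (p - 1))%N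
          (groupCohomology_aug 'F_p {perm 'I_p}))).
Proof.
(* The dimension becomes [n.+1], with [n] the dimension of the spheres. *)
case: n n_gt0 => // n n_gt0; have -> : n_gt0 = ltn0Sn n by exact: bool_irrelevance.
by rewrite !subn1; exact: unordered_decomposition.
Qed.
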